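(* Let $H\in(0,1)$ and $K\in(0,1]$ with $2HK\geq 1$, let $T>0$, and let $(B^{H,K}_t)_{t\in[0,T]}$ be a one-dimensional bifractional Brownian motion with parameters $H,K$. Then for each $t\in[0,T]$ and $x\in\mathbb{R}$, almost surely, $$\left|B^{H,K}_t-x\right|=|x|+\int_0^t\mathrm{sign}\left(B^{H,K}_s-x\right)\delta B^{H,K}_s+L_t^x,$$ where the stochastic integral is the divergence (Skorohod) integral and $L_t^x$ is the weighted local time of $B^{H,K}$ at $x$ up to time $t$.
   Context: Bifractional Brownian motion: for $H\in(0,1)$, $K\in(0,1]$, $B^{H,K}$ is the centered Gaussian process with continuous paths, starting from $0$, with covariance $R(t,s)=2^{-K}\left((t^{2H}+s^{2H})^K-|t-s|^{2HK}\right)$. Divergence integral: let $\mathcal{H}$ be the completion of the linear span of the indicators $1_{[0,t]}$, $t\in[0,T]$, under the inner product $\langle 1_{[0,t]},1_{[0,s]}\rangle_{\mathcal{H}}=R(t,s)$. The map $1_{[0,t]}\mapsto B^{H,K}_t$ extends to an isometry $\varphi\mapsto B(\varphi)$ from $\mathcal{H}$ into the Gaussian space of $B^{H,K}$. When $2HK\ge 1$, $L^2([0,T])\subset\mathcal{H}$, so square-integrable functions on $[0,T]$ are regarded as elements of $\mathcal{H}$. For $F=g(B(\varphi_1),\dots,B(\varphi_n))$ with $g\in C_b^\infty(\mathbb{R}^n)$, $\varphi_i\in\mathcal{H}$ (the class $\mathcal{S}$ of smooth functionals), the Malliavin derivative is $DF=\sum_i\partial_i g(B(\varphi_1),\dots,B(\varphi_n))\varphi_i$.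 The divergence $\delta$ is the adjoint of $D$: $u\in L^2(\Omega;\mathcal{H})$ is in $\mathrm{Dom}(\delta)$ if $|E\langle DF,u\rangle_{\mathcal{H}}|\le c\|F\|_{L^2(\Omega)}$ for all $F\in\mathcal{S}$, and then $\delta(u)$ is characterized by $E(F\delta(u))=E\langle DF,u\rangle_{\mathcal{H}}$. One writes $\int_0^t u_s\,\delta B^{H,K}_s=\delta(u1_{(0,t]})$. Weighted local time: $x\mapsto L_t^x$ is the density (with respect to Lebesgue measure) of the occupation measure $A\in\mathcal{B}(\mathbb{R})\mapsto 2HK\int_0^t 1_A(B^{H,K}_s)s^{2HK-1}\,ds$. For fixed $t,x$ the version used is $L_t^x=\lim_{\varepsilon\to0}2HK\int_0^t p_\varepsilon(B^{H,K}_s-x)s^{2HK-1}\,ds$ in $L^2(\Omega)$, where $p_\varepsilon(y)=(2\pi\varepsilon)^{-1/2}e^{-y^2/(2\varepsilon)}$. *)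

(* Defs.v *)
(* MathComp-Analysis *)
From HB Require Import structures.
From mathcomp Require Import all_boot all_order all_algebra.
From mathcomp Require Import all_classical all_reals all_analysis.
From mathcomp Require Import sesquilinear.

Set Implicit Arguments.
Unset Strict Implicit.
Unset Printing Implicit Defensive.

Import Order.TTheory GRing.Theory Num.Theory.
Import numFieldNormedType.Exports.

Local Open Scope classical_set_scope.
Local Open Scope ring_scope.

Section bifractional_brownian_motion.
Context {d : measure_display} {Omega : measurableType d} {R : realType}.
Variable P : probability Omega R.
Implicit Types (Hu K T t s x : R) (c : seq (R * R)).

(* Since [0 `^ a = 0] for [a != 0], the powers below take the value 0 at 0. *)
Definition bif_cov Hu K t s : R :=
  2 `^ (- K) *
  ((t `^ (2 * Hu) + s `^ (2 * Hu)) `^ K - `|t - s| `^ (2 * Hu * K)).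

(* A list [(a_1, t_1), ..., (a_n, t_n)] with all t_i in [0, T] encodes the
   element a_1 1_[0,t_1] + ... + a_n 1_[0,t_n] of the linear span of the
   indicators. *)
Definition times_in T c := forall p, p \in c -> p.2 \in `[0, T].

Definition step_fun c (s : R) : R :=
  \sum_(p <- c) p.1 * \1_`[0, p.2]%classic s.

Definition step_rv (B : R -> Omega -> R) c (w : Omega) : R :=
  \sum_(p <- c) p.1 * B p.2 w.

(* The degenerate case is separate because [normal_prob m 0] is not a Dirac
   mass. *)
Definition gaussian_law (m sd : R) (A : set R) : \bar R :=
  if sd == 0 then (\d_ m A)%E else normal_prob m sd A.

Definition is_gaussian (X : Omega -> R) :=
  exists m sd, forall A, measurable A -> P (X @^-1` A) = gaussian_law m sd A.

(* Only the restriction of B to [0, T] is constrained. *)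
Record is_bifBm Hu K T (B : R -> {RV P >-> R}) : Prop := {
  bifBm_gaussian : forall c, times_in T c -> is_gaussian (step_rv B c) ;
  bifBm_centered : forall t, t \in `[0, T] -> ('E_P[B t] = 0)%E ;
  bifBm_cov : forall t s, t \in `[0, T] -> s \in `[0, T] ->
    covariance P (B t) (B s) = (bif_cov Hu K t s)%:E ;
  bifBm_0 : forall w, B 0 w = 0 ;
  bifBm_continuous : forall w, {within `[0, T], continuous (fun t => B t w)} }.

Definition step_vec (V : completeNormedModType R) (e : R -> V) c : V :=
  \sum_(p <- c) p.1 *: e p.2.

(* V, with inner product ip, is the completion of the span of the indicators
   1_[0,t], t in [0, T], for <1_[0,t], 1_[0,s]> = bif_cov Hu K t s; the vector
   e t is the image of 1_[0,t].  This determines (V, ip, e on [0, T]) up to a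
   unique isometric isomorphism. *)
Record is_completion Hu K T (V : completeNormedModType R)
    (ip : {dot V for idfun}) (e : R -> V) : Prop := {
  completion_norm : forall h : V, `|h| = Num.sqrt (ip h h) ;
  completion_ip : forall t s, t \in `[0, T] -> s \in `[0, T] ->
    ip (e t) (e s) = bif_cov Hu K t s ;
  completion_dense : dense [set step_vec e c | c in [set c | times_in T c]] }.

(* f in L^2([0, T]) regarded as the element h of V: the inclusion of
   L^2([0, T]) is the continuous extension of the one of step functions, so h
   is the limit of the images of step functions converging to f in
   L^2([0, T]). *)
Definition L2_element T (V : completeNormedModType R) (e : R -> V)
    (f : R -> R) (h : V) :=
  [/\ measurable_fun `[0, T] f,
      (\int[lebesgue_measure]_(s in `[0%R, T]) (f s ^+ 2)%:E < +oo)%E &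
      exists c : nat -> seq (R * R),
      [/\ forall n, times_in T (c n),
          (\int[lebesgue_measure]_(s in `[0%R, T])
             (((step_fun (c n) s - f s) ^+ 2)%R)%:E)%E @[n --> \oo] --> 0%E &
          step_vec e (c n) @[n --> \oo] --> h]].

Definition L2_dist (X Y : Omega -> R) : \bar R :=
  ('N[P]_2%:E[EFin \o (X \- Y)%R])%E.

(* X is a version of B(h), where h |-> B(h) is the isometric extension of
   1_[0,t] |-> B_t to V. *)
Definition wiener_integral T (B : R -> {RV P >-> R})
    (V : completeNormedModType R) (e : R -> V) (h : V) (X : {RV P >-> R}) :=
  exists c : nat -> seq (R * R),
  [/\ forall n, times_in T (c n),
      step_vec e (c n) @[n --> \oo] --> h &
      L2_dist (step_rv B (c n)) X @[n --> \oo] --> 0%E].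

Definition partial n (i : 'I_n) (g : 'rV[R]_n -> R) (y : 'rV[R]_n) : R :=
  'D_(delta_mx 0 i) g y.

(* C_b^oo(R^n): all iterated partial derivatives (including g itself, for
   l = [::]) exist and are continuous and bounded. *)
Definition smooth_bounded n (g : 'rV[R]_n -> R) :=
  forall l : seq 'I_n, let f := foldr (@partial n) g l in
  [/\ continuous f, forall y i, derivable f y (delta_mx 0 i) &
      exists M, forall y, `|f y| <= M].

Record smooth_functional T (B : R -> {RV P >-> R})
    (V : completeNormedModType R) (e : R -> V) := SmoothFunctional {
  sf_dim : nat ;
  sf_fun : 'rV[R]_sf_dim -> R ;
  sf_dir : 'I_sf_dim -> V ;
  sf_rv : 'I_sf_dim -> {RV P >-> R} ;
  sf_smooth : smooth_bounded sf_fun ;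
  sf_wiener : forall i, wiener_integral T B e (sf_dir i) (sf_rv i) }.

Arguments sf_fun {T B V e} s y.
Arguments sf_dir {T B V e} s i.
Arguments sf_rv {T B V e} s i.

Section malliavin.
Context {T : R} {B : R -> {RV P >-> R}} {V : completeNormedModType R}
  {e : R -> V}.
Implicit Type F : smooth_functional T B e.

Definition sf_arg F (w : Omega) : 'rV[R]_(sf_dim F) := \row_i sf_rv F i w.

Definition sf_val F (w : Omega) : R := sf_fun F (sf_arg F w).

Definition malliavin F (w : Omega) : V :=
  \sum_(i < sf_dim F) partial i (sf_fun F) (sf_arg F w) *: sf_dir F i.

End malliavin.

(* Borel measurability; it coincides with strong measurability because the
   completion V is separable. *)
Definition in_L2_vec (V : completeNormedModType R) (u : Omega -> V) :=
  (forall O : set V, open O -> measurable (u @^-1` O)) /\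
  (\int[P]_w (`|u w| ^+ 2)%:E < +oo)%E.

Definition process_sigma T (B : R -> {RV P >-> R}) : set (set Omega) :=
  <<s [set E | exists2 s, s \in `[0, T] &
       exists2 A : set R, measurable A & E = B s @^-1` A] >>.

Definition dom_divergence T (B : R -> {RV P >-> R})
    (V : completeNormedModType R) (ip : {dot V for idfun}) (e : R -> V)
    (u : Omega -> V) :=
  in_L2_vec u /\
  exists C : R, forall F : smooth_functional T B e,
    (`| 'E_P[fun w => ip (malliavin F w) (u w)] |
       <= C%:E * 'N[P]_2%:E[EFin \o sf_val F])%E.

(* delta is a version of the divergence of u.  Smooth functionals are dense
   only in L^2 of the sigma-algebra generated by B, so the duality relation
   determines delta almost surely once delta is measurable with respect to that
   sigma-algebra; the measurable structure of Omega may be larger. *)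
Record is_divergence T (B : R -> {RV P >-> R}) (V : completeNormedModType R)
    (ip : {dot V for idfun}) (e : R -> V) (u : Omega -> V)
    (delta : Omega -> R) : Prop := {
  divergence_dom : dom_divergence T B ip e u ;
  divergence_meas : forall A : set R, measurable A ->
    process_sigma T B (delta @^-1` A) ;
  divergence_L2 : delta \in Lfun P 2%:E ;
  divergence_dual : forall F : smooth_functional T B e,
    ('E_P[fun w => (sf_val F w * delta w)%R] =
    'E_P[fun w => ip (malliavin F w) (u w)])%E }.

(* delta is a version of the integral of v over [0, t] against
   delta B, i.e. of the divergence of v 1_(0,t]. *)
Definition skorohod_integral T (B : R -> {RV P >-> R})
    (V : completeNormedModType R) (ip : {dot V for idfun}) (e : R -> V)
    t (v : R -> Omega -> R) (delta : Omega -> R) :=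
  exists2 u : Omega -> V,
    forall w, L2_element T e (fun s => v s w * \1_`]0, t]%classic s) (u w) &
    is_divergence T B ip e u delta.

Definition gauss_kernel (eps y : R) : R :=
  (Num.sqrt (2 * pi * eps))^-1 * expR (- y ^+ 2 / (2 * eps)).

Definition approx_local_time Hu K (B : R -> {RV P >-> R}) t x (eps : R)
    (w : Omega) : R :=
  2 * Hu * K * \int[lebesgue_measure]_(s in `[0, t])
    (gauss_kernel eps (B s w - x) * s `^ (2 * Hu * K - 1)).

Definition is_local_time Hu K (B : R -> {RV P >-> R}) t x (L : Omega -> R) :=
  L \in Lfun P 2%:E /\
  L2_dist (approx_local_time Hu K B t x eps) L @[eps --> 0^'+] --> 0%E.

End bifractional_brownian_motion.

(* Main.v *)
(* Let f_m be smooth approximations of the absolute value with f_m'' = 2 p_eps,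
   eps = 1 / (2 (m + 1)).  For a smooth functional F, the increments of
   E[F f_m(B_s - x)] over a fine grid of [0, t] are expanded by the trapezoidal
   rule, whose error is cubic in the increment of B.  Gaussian integration by
   parts turns the first-order terms into E<DF, sum of f_m'(B - x) over the
   grid intervals> plus a trace term, and since
   <1_[0,a] + 1_[0,b], 1_]a,b]> = b^(2HK) - a^(2HK), the trace terms add up to
   E[F L_eps].  In the limit, first of the grid and then of m,
   E[F (|B_t - x| - |x| - L)] = E<DF, sign(B - x) 1_]0,t]>,
   so that |B_t - x| - |x| - L is the divergence.

   The grid sums converge in H because
   |sum phi_k 1_]t_k,t_(k+1)]|^2 <= C sum phi_k^2 (t_(k+1) - t_k), a consequence
   of the sign of the mixed increments of the two parts of the covariance.  The
   L_eps converge in L^2 because Fourier inversion bounds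
   E[(L_eps - L_eps')^2], for eps, eps' <= eta, by the integral over [0, t]^2 of
   (D^(-1/2) - (D + eta r^(2HK))^(-1/2)) / (2 pi) against the weights, where
   D(s, r) is the determinant of the covariance of (B_s, B_r), and a lower bound
   on D gives an integrable majorant. *)
Require Import Defs.
From HB Require Import structures.
From mathcomp Require Import all_boot all_order all_algebra.
From mathcomp Require Import all_classical all_reals all_analysis.
From mathcomp Require Import measurable_realfun sesquilinear ring lra.

Set Implicit Arguments.
Unset Strict Implicit.
Unset Printing Implicit Defensive.

Import Order.TTheory GRing.Theory Num.Theory.
Import numFieldNormedType.Exports.
Local Open Scope classical_set_scope.
Local Open Scope ring_scope.

(** * Integrals of real-valued functions *)

(** The integrand is treated path by path: for each continuous path the trapezoidal sums, and then
    the mollified signs, converge in the completion, with a norm bound that does not depend on the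
    path. Dominated convergence over Omega then needs nothing more. The candidate |B_t - x| - |x| -
    L is square-integrable, so once the duality relation is known, Cauchy-Schwarz puts the sign
    process in the domain of the divergence.

    The trapezoidal rule is forced by the case 2HK = 1: the second moment of an increment is only
    bounded by a multiple of its length, so quadratic errors need not add up to something small,
    while cubic ones do.

    Integration by parts is needed for functionals of arbitrary, possibly linearly dependent, Wiener
    integrals, which need not have a joint density; hence the route through characteristic
    functions. The process is constrained on [0, T] only, hence the clamped paths; the divergence
    must be measurable for the sigma-algebra of the process, hence the local time is built as an
    explicit upper limit. *)

Notation integrableR mu f := (integrable mu setT (EFin \o f)).

Section integration.
Context {R : realType} d (T : measurableType d) (mu : {measure set T -> \bar R}).
Implicit Types f g : T -> R.

Lemma integrableR_dominated f g : measurable_fun setT f ->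
  integrableR mu g -> (forall x, `|f x| <= g x) -> integrableR mu f.
Proof.
move=> mf ig fg; apply: (le_integrable measurableT _ _ ig) => //.
  exact/measurable_EFinP.
by move=> x _ /=; rewrite lee_fin (le_trans (fg x))// ler_norm.
Qed.

Lemma integrableRD f g : integrableR mu f -> integrableR mu g ->
  integrableR mu (fun x => f x + g x).
Proof. by move=> fi gi; exact: (integrableD measurableT fi gi). Qed.

Lemma integrableRZ k f : integrableR mu f -> integrableR mu (fun x => k * f x).
Proof. by move=> fi; exact: (integrableZl measurableT k fi). Qed.

Lemma integrableRB f g : integrableR mu f -> integrableR mu g ->
  integrableR mu (fun x => f x - g x).
Proof. by move=> fi gi; exact: (integrableB measurableT fi gi). Qed.

Lemma integrableR_measurable f : integrableR mu f -> measurable_fun setT f.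
Proof. by move=> /measurable_int/measurable_EFinP. Qed.

Lemma integrableR_norm f : integrableR mu f -> integrableR mu (fun x => `|f x|).
Proof.
move=> fi; apply: (le_integrable measurableT _ _ fi) => //.
  apply/measurable_EFinP; apply: measurableT_comp => //.
  exact: integrableR_measurable.
by move=> x _ /=; rewrite normr_id.
Qed.

Lemma integrableR_sum I (s : seq I) (F : I -> T -> R) :
  (forall i, integrableR mu (F i)) -> integrableR mu (fun x => \sum_(i <- s) F i x).
Proof.
move=> Fi; elim: s => [|i s IH].
  by under [X in EFin \o X]eq_fun do rewrite big_nil; exact: integrable0.
by under [X in EFin \o X]eq_fun do rewrite big_cons; exact: integrableRD.
Qed.

Lemma Rintegral_sum I (s : seq I) (F : I -> T -> R) :
  (forall i, integrableR mu (F i)) ->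
  \int[mu]_x (\sum_(i <- s) F i x) = \sum_(i <- s) \int[mu]_x F i x.
Proof.
move=> Fi; elim: s => [|i s IH].
  under eq_Rintegral do rewrite big_nil.
  by rewrite big_nil Rintegral_cst// mul0r.
under eq_Rintegral do rewrite big_cons.
by rewrite RintegralD ?IH ?big_cons//; exact: integrableR_sum.
Qed.

Lemma Rintegral_bound f g : measurable_fun setT f -> integrableR mu g ->
  (forall x, `|f x| <= g x) -> `|\int[mu]_x f x| <= \int[mu]_x g x.
Proof.
move=> mf ig fg; have fi := integrableR_dominated mf ig fg.
apply: (le_trans (le_normr_Rintegral measurableT fi)).
by apply: le_Rintegral => //; exact: integrableR_norm.
Qed.

Lemma Rintegral_dominated_cvg (f_ : nat -> T -> R) f g :
  (forall n, measurable_fun setT (f_ n)) ->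
  (forall x, f_ n x @[n --> \oo] --> f x) -> integrableR mu g ->
  (forall n x, `|f_ n x| <= g x) ->
  \int[mu]_x f_ n x @[n --> \oo] --> \int[mu]_x f x.
Proof.
move=> mf_ f_f ig f_g.
have cf x : (f_ n x)%:E @[n --> \oo] --> (f x)%:E.
  by apply: cvg_EFin; [exact: nearW|exact: f_f].
have mf : measurable_fun setT f by exact: (measurable_fun_cvg mf_).
have fg x : `|f x| <= g x.
  apply: (cvgr_to_le (cvg_norm (f_f x))); exact: nearW.
have fi := integrableR_dominated mf ig fg.
apply: fine_cvg; rewrite fineK; last exact: integrable_fin_num.
apply: (@dominated_cvg _ _ _ mu setT measurableT _ _ (EFin \o g)) => //=.
- by move=> n; exact/measurable_EFinP.
- by move=> n x _; rewrite lee_fin.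
Qed.

Lemma EFin_Rintegral f : integrableR mu f ->
  (\int[mu]_x f x)%:E = (\int[mu]_x (f x)%:E)%E.
Proof. by move=> fi; rewrite fineK//; exact: integrable_fin_num. Qed.

End integration.

Lemma integrableR_bounded {R : realType} d (T : measurableType d)
    (P : probability T R) (f : T -> R) (M : R) :
  measurable_fun setT f -> (forall x, `|f x| <= M) -> integrableR P f.
Proof.
move=> mf fM; apply: (integrableR_dominated mf _ fM).
by apply: finite_measure_integrable_cst.
Qed.

(** * Fubini for real-valued integrals *)

Section product.
Context {R : realType} d1 d2 (T1 : measurableType d1) (T2 : measurableType d2)
  (m1 : {sigma_finite_measure set T1 -> \bar R})
  (m2 : {sigma_finite_measure set T2 -> \bar R}).

Lemma integrableR_prod (a : T1 -> R) (b : T2 -> R) :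
  integrableR m1 a -> integrableR m2 b ->
  integrableR (m1 \x m2)%E (fun p => a p.1 * b p.2).
Proof.
move=> ia ib.
have ma := integrableR_measurable ia; have mb := integrableR_measurable ib.
have mab : measurable_fun setT (EFin \o (fun p : T1 * T2 => a p.1 * b p.2)).
  apply/measurable_EFinP; apply: measurable_funM.
    exact: measurableT_comp measurable_fst.
  exact: measurableT_comp measurable_snd.
apply/(integrable12ltyP m1 m2 mab) => /=.
rewrite (_ : (fun x => _) = fun x => (`|a x|%:E * (\int[m2]_y `|b y|)%:E)%E).
  rewrite ge0_integralZr//.
  - apply: lte_mul_pinfty => //; [exact: integral_ge0| |by rewrite ltry].
    by have := integrable_fin_num measurableT (integrableR_norm ia).
  - by apply/measurable_EFinP; apply: measurableT_comp.
  - by rewrite lee_fin Rintegral_ge0.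
apply/funext => x.
rewrite EFin_Rintegral; last exact: integrableR_norm.
rewrite -ge0_integralZl//; last by apply/measurable_EFinP; apply: measurableT_comp.
by apply: eq_integral => y _; rewrite -EFinM normrM.
Qed.

(** Domination by a product makes every section of [F] integrable, not only almost every one, so the
    inner real-valued integrals are genuine at every point. *)
Lemma Rintegral_fubini (F : T1 * T2 -> R) (a : T1 -> R) (b : T2 -> R) :
  measurable_fun setT F -> integrableR m1 a -> integrableR m2 b ->
  (forall x y, `|F (x, y)| <= a x * b y) ->
  \int[m1]_x \int[m2]_y F (x, y) = \int[m2]_y \int[m1]_x F (x, y).
Proof.
move=> mF ia ib Fab.
have mF' : measurable_fun setT (EFin \o F) by exact/measurable_EFinP.
have iF : integrableR (m1 \x m2)%E F.
  by apply: (integrableR_dominated mF (integrableR_prod ia ib)) => -[].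
have ma := integrableR_measurable ia; have mb := integrableR_measurable ib.
have i1 x : integrableR m2 (fun y => F (x, y)).
  apply: (integrableR_dominated _ (integrableRZ (a x) ib)) => //.
  exact: measurableT_comp (measurable_pair1 x).
have i2 y : integrableR m1 (fun x => F (x, y)).
  apply: (integrableR_dominated _ (integrableRZ (b y) ia)).
    exact: measurableT_comp (measurable_pair2 y).
  by move=> x; rewrite mulrC.
rewrite {1}/Rintegral [RHS]/Rintegral; congr fine.
under eq_integral do rewrite EFin_Rintegral//.
under [RHS]eq_integral do rewrite EFin_Rintegral//.
exact: (Fubini iF).
Qed.

Lemma Rintegral_prod (F : T1 * T2 -> R) (a : T1 -> R) (b : T2 -> R) :
  measurable_fun setT F -> integrableR m1 a -> integrableR m2 b ->
  (forall x y, `|F (x, y)| <= a x * b y) ->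
  \int[(m1 \x m2)%E]_p F p = \int[m1]_x \int[m2]_y F (x, y).
Proof.
move=> mF ia ib Fab.
have iF : integrableR (m1 \x m2)%E F.
  by apply: (integrableR_dominated mF (integrableR_prod ia ib)) => -[].
have i1 x : integrableR m2 (fun y => F (x, y)).
  apply: (integrableR_dominated _ (integrableRZ (a x) ib)) => //.
  exact: measurableT_comp (measurable_pair1 x).
rewrite {1}/Rintegral [RHS]/Rintegral; congr fine.
under [RHS]eq_integral do rewrite EFin_Rintegral//.
by rewrite -(fubini1 iF).
Qed.

Lemma measurable_Rintegral1 (F : T1 * T2 -> R) (a : T1 -> R) (b : T2 -> R) :
  measurable_fun setT F -> integrableR m1 a -> integrableR m2 b ->
  (forall x y, `|F (x, y)| <= a x * b y) ->
  measurable_fun setT (fun x => \int[m2]_y F (x, y)).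
Proof.
move=> mF ia ib Fab.
have iF : integrableR (m1 \x m2)%E F.
  by apply: (integrableR_dominated mF (integrableR_prod ia ib)) => -[].
have := measurable_fubini_F iF => mm.
exact: measurableT_comp mm.
Qed.

End product.

(** * Measurability by rounding to a grid *)

Lemma continuous_cvg_seq (U V : topologicalType) (h : U -> V) (u : nat -> U)
    (l : U) : {for l, continuous h} ->
  u n @[n --> \oo] --> l -> h (u n) @[n --> \oo] --> h l.
Proof. by move=> ch ul; exact: continuous_cvg. Qed.

(** Gluing along a countable measurable partition; combined with rounding to a grid it gives the
    measurability of maps that are continuous in some of their arguments. *)
Lemma measurable_fun_countable_case d (T : measurableType d) d'
    (T' : measurableType d') (I : countType) (F : I -> T -> T') (q : T -> I) :
  (forall i, measurable (q @^-1` [set i])) ->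
  (forall i, measurable_fun setT (F i)) ->
  measurable_fun setT (fun x => F (q x) x).
Proof.
move=> mq mF _ Y mY; rewrite setTI.
rewrite (_ : _ @^-1` _ = \bigcup_n (if unpickle n is Some i then
    q @^-1` [set i] `&` F i @^-1` Y else set0)).
  apply: bigcupT_measurable => n; case: unpickle => // i.
  by apply: measurableI => //; rewrite -[X in measurable X]setTI; exact: mF.
apply/seteqP; split => [x /= Yx|x [n _]].
  by exists (pickle (q x)) => //; rewrite pickleK.
by case: unpickle => [i|//] [/= ->].
Qed.

Lemma floor_grid_cvg {R : realType} (x : R) :
  (Num.floor (n.+1%:R * x))%:~R / n.+1%:R @[n --> \oo] --> x.
Proof.
have h : (x - n.+1%:R^-1) @[n --> \oo] --> x.
  rewrite -[X in _ --> X]subr0; apply: cvgB; first exact: cvg_cst.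
  exact: cvg_harmonic.
apply: (squeeze_cvgr _ h (cvg_cst x)); apply: nearW => n.
have n0 : 0 < n.+1%:R :> R by [].
rewrite ler_pdivrMr// [x * _]mulrC floor_le_tmp andbT.
rewrite ler_pdivlMr// mulrBl mulVf ?gt_eqF// lerBlDr [x * _]mulrC.
by apply: ltW; rewrite -[X in _ + X]/(1%:~R) -intrD floorD1_gt.
Qed.

Lemma measurable_floor_grid {R : realType} d (T : measurableType d)
    (f : T -> R) n : measurable_fun setT f ->
  forall k : int, measurable ((fun x => Num.floor (n.+1%:R * f x)) @^-1` [set k]).
Proof.
move=> mf k.
rewrite (_ : _ @^-1` _ = f @^-1` `[k%:~R / n.+1%:R, (k + 1)%:~R / n.+1%:R[).
  by rewrite -[X in measurable X]setTI; exact: mf.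
have n0 : 0 < n.+1%:R :> R by [].
apply/seteqP; split => x /=; rewrite in_itv/= ler_pdivrMr// ltr_pdivlMr// [_ * n.+1%:R]mulrC.
  by move=> <-; rewrite floor_le_tmp floorD1_gt.
by move=> h; apply: floor_def.
Qed.

Lemma measurable_fst_comp d1 d2 d3 (T1 : measurableType d1)
    (T2 : measurableType d2) (T3 : measurableType d3) (f : T1 -> T3) :
  measurable_fun setT f -> measurable_fun setT (fun p : T1 * T2 => f p.1).
Proof. by move=> mf; exact: measurableT_comp mf measurable_fst. Qed.

Lemma measurable_snd_comp d1 d2 d3 (T1 : measurableType d1)
    (T2 : measurableType d2) (T3 : measurableType d3) (f : T2 -> T3) :
  measurable_fun setT f -> measurable_fun setT (fun p : T1 * T2 => f p.2).
Proof. by move=> mf; exact: measurableT_comp mf measurable_snd. Qed.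

(** Rounding the time down to a grid leaves countably many times, hence a measurable gluing;
    continuity in time removes the rounding in the limit. *)
Lemma measurable_fun_joint {R : realType} d (T : measurableType d)
    (f : R -> T -> R) :
  (forall s, measurable_fun setT (f s)) ->
  (forall w, continuous (f^~ w)) ->
  measurable_fun setT (fun p : R * T => f p.1 p.2).
Proof.
move=> mf cf.
apply: (@measurable_fun_cvg _ _ _ _ (fun n (p : R * T) =>
  f ((Num.floor (n.+1%:R * p.1))%:~R / n.+1%:R) p.2)) => [n|p _]; last first.
  apply: (continuous_cvg_seq (h := f^~ p.2)); first exact: cf.
  exact: floor_grid_cvg.
have H := @measurable_fun_countable_case _ (measurableTypeR R * T)%type _ R int
    (fun k p => f (k%:~R / n.+1%:R) p.2)
    (fun p => Num.floor (n.+1%:R * p.1)).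
apply: H => k.
  exact: (measurable_floor_grid (f := fst) n measurable_fst k).
exact: measurableT_comp (mf _) measurable_snd.
Qed.

Lemma cvg_row {R : realType} n (X : nat -> 'I_n -> R) (Y : 'I_n -> R) :
  (forall i, X m i @[m --> \oo] --> Y i) ->
  \row_i X m i @[m --> \oo] --> \row_i Y i.
Proof.
move=> XY; apply/cvgrPdist_lt => e e0.
have : \forall m \near \oo, forall i, `|Y i - X m i| < e.
  apply: filter_forall => i.
  by move/cvgrPdist_lt : (XY i) => /(_ _ e0).
apply: filterS => m h.
rewrite /Num.Def.normr/= mx_normrE; apply: bigmax_lt => // -[i j] _.
by rewrite !mxE; exact: h.
Qed.

(** All coordinates are rounded to a grid, which leaves countably many rows; in this way no
    sigma-algebra on row vectors is needed. *)
Lemma measurable_continuous_row {R : realType} d (T : measurableType d) n (g : 'rV[R]_n -> R)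
    (X : 'I_n -> T -> R) :
  continuous g -> (forall i, measurable_fun setT (X i)) ->
  measurable_fun setT (fun w => g (\row_i X i w)).
Proof.
move=> cg mX.
apply: (@measurable_fun_cvg _ _ _ _ (fun m w =>
  g (\row_i ((Num.floor (m.+1%:R * X i w))%:~R / m.+1%:R)))) => [m|w _]; last first.
  apply: (continuous_cvg_seq (h := g)); first exact: cg.
  by apply: cvg_row => i; exact: floor_grid_cvg.
have H := @measurable_fun_countable_case _ T _ R {ffun 'I_n -> int}
    (fun k w => g (\row_i ((k i)%:~R / m.+1%:R)))
    (fun w => [ffun i => Num.floor (m.+1%:R * X i w)]).
rewrite (_ : (fun w => _) = (fun w => g (\row_i
  (([ffun i => Num.floor (m.+1%:R * X i w)] i)%:~R / m.+1%:R)))).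
  apply: H => // k.
  rewrite (_ : _ @^-1` _ = \bigcap_i
      ((fun w => Num.floor (m.+1%:R * X i w)) @^-1` [set k i])).
    rewrite -[X in measurable X]setCK setC_bigcap; apply: measurableC.
    apply: countable_bigcupT_measurable => [|i]; first exact: countableP.
    by apply: measurableC; exact: measurable_floor_grid.
  apply/seteqP; split => w /=.
    by move=> <- i _ /=; rewrite ffunE.
  by move=> h; apply/ffunP => i; rewrite ffunE; exact: h.
apply/funext => w; congr g; apply/rowP => i; by rewrite !mxE ffunE.
Qed.

(** * Gaussian integrals *)

Section gauss.
Context {R : realType}.
Notation leb := (@lebesgue_measure R).

(** The fundamental theorem on growing symmetric intervals leaves boundary values that vanish in the
    limit. This is the form in which integration by parts against Gaussian weights is used below. *)
Lemma integral_deriv_eq0 (F f : R -> R) :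
  (forall x : R, is_derive x 1 F (f x)) -> continuous f -> integrableR leb f ->
  F n%:R @[n --> \oo] --> 0 -> F (- n%:R) @[n --> \oo] --> 0 ->
  \int[leb]_x f x = 0.
Proof.
move=> dF cf fi F0 FN0.
have mf := integrableR_measurable fi.
pose f_ n x := f x * \1_(`[- n.+1%:R, n.+1%:R]) x.
have h1 : \int[leb]_x f_ n x @[n --> \oo] --> \int[leb]_x f x.
  apply: (Rintegral_dominated_cvg (g := fun x : measurableTypeR R => `|f x|)).
  - move=> n; apply: measurable_funM => //; exact: measurable_indic.
  - move=> x; apply: cvg_near_cst.
    near=> n; rewrite /f_ indicE mem_set ?mulr1//= in_itv/= -ler_norml.
    rewrite (@le_trans _ _ n%:R)//; last by rewrite ler_nat.
    by near: n; exact: nbhs_infty_ger.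
  - exact: integrableR_norm.
  - by move=> n x; rewrite normrM ler_piMr// indicE; case: (_ \in _); rewrite ?normr1 ?normr0.
have h2 n : \int[leb]_x f_ n x = F n.+1%:R - F (- n.+1%:R).
  rewrite /f_.
  transitivity (\int[leb]_(x in `[- n.+1%:R, n.+1%:R]) f x).
    rewrite [RHS]Rintegral_mkcond; apply: eq_Rintegral => x _.
    by rewrite patchE indicE; case: (_ \in _); rewrite ?mulr1 ?mulr0.
  have cF : continuous F.
    by move=> y; apply/differentiable_continuous/derivable1_diffP; have [] := dF y.
  rewrite /Rintegral (@continuous_FTC2 _ f F)//.
  - by rewrite ltrNl (lt_trans _ (ltr0Sn _ _))// oppr_lt0.
  - exact: continuous_subspaceT.
  - split.
    + by move=> x _; have [] := dF x.
    + by apply: cvg_at_right_filter; exact: cF.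
    + by apply: cvg_at_left_filter; exact: cF.
  - by move=> x _; rewrite derive1E; exact: derive_val.
have h3 : \int[leb]_x f_ n x @[n --> \oo] --> 0.
  rewrite [X in X @ _](_ : _ = fun n => F n.+1%:R - F (- n.+1%:R)); last exact/funext.
  rewrite -[X in _ --> X]subr0; apply: cvgB.
    by rewrite (cvg_shiftS (fun n => F n%:R)).
  by rewrite (cvg_shiftS (fun n => F (- n%:R))).
exact: (cvg_unique _ h1 h3).
Unshelve. all: end_near. Qed.

Definition gaussf (a x : R) := expR (- (a * x ^+ 2)).

Lemma gaussf_gt0 (a x : R) : 0 < gaussf a x. Proof. exact: expR_gt0. Qed.

Lemma gaussf_le1 (a x : R) : 0 <= a -> gaussf a x <= 1.
Proof. by move=> a0; rewrite -expR0 ler_expR oppr_le0 mulr_ge0// sqr_ge0. Qed.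

Lemma is_derive_gaussf a (x : R) : is_derive x 1 (gaussf a) (- (2 * a * x) * gaussf a x).
Proof.
rewrite /gaussf; apply: is_derive_eq.
rewrite /GRing.scale/=; ring.
Qed.

Lemma continuous_gaussf (a : R) : continuous (gaussf a).
Proof.
move=> x; apply/differentiable_continuous/derivable1_diffP.
by have [] := is_derive_gaussf a x.
Qed.

Lemma measurable_gaussf (a : R) : measurable_fun setT (gaussf a).
Proof. by apply: continuous_measurable_fun; exact: continuous_gaussf. Qed.

Lemma gaussf_normal (a : R) : 0 < a ->
  gaussf a = fun x => Num.sqrt (pi / a) * normal_pdf 0 (Num.sqrt (2 * a))^-1 x.
Proof.
move=> a0; apply/funext => x.
have s0 : (Num.sqrt (2 * a))^-1 != 0 by rewrite invr_neq0// gt_eqF// sqrtr_gt0 mulr_gt0.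
have s2 : (Num.sqrt (2 * a))^-1 ^+ 2 = (2 * a)^-1 :> R.
  by rewrite exprVn sqr_sqrtr// mulr_ge0// ltW.
rewrite normal_pdfE// /normal_peak /normal_fun s2 subr0.
rewrite (_ : (2 * a)^-1 * pi *+ 2 = pi / a); last by field; rewrite gt_eqF.
rewrite mulrA divff ?mul1r; last by rewrite gt_eqF// sqrtr_gt0 divr_gt0// pi_gt0.
by congr expR; field; rewrite gt_eqF.
Qed.

Lemma integrable_gaussf (a : R) : 0 < a -> integrableR leb (gaussf a).
Proof.
move=> a0; rewrite gaussf_normal//; apply: integrableRZ; exact: integrable_normal_pdf.
Qed.

Lemma integral_gaussf (a : R) : 0 < a -> \int[leb]_x gaussf a x = Num.sqrt (pi / a).
Proof.
move=> a0; rewrite gaussf_normal// RintegralZl//; last exact: integrable_normal_pdf.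
by rewrite /Rintegral integral_normal_pdf mulr1.
Qed.

(** The linear factor is paid for with half of the exponent: |x| <= 1 + x^2, and 1 + a x^2 / 2 <=
    exp(a x^2 / 2). *)
Lemma mulr_gaussf_le (a x : R) : 0 < a -> `|x| * gaussf a x <= (1 + 2 / a) * gaussf (a / 2) x.
Proof.
move=> a0.
have -> : gaussf (a / 2) x = expR (a / 2 * x ^+ 2) * gaussf a x.
  by rewrite /gaussf -expRD; congr expR; field.
rewrite mulrA ler_pM2r ?gaussf_gt0//.
apply: (@le_trans _ _ ((1 + 2 / a) * (1 + a / 2 * x ^+ 2))); last first.
  by rewrite ler_pM2l ?expR_ge1Dx// addr_gt0// divr_gt0.
have -> : (1 + 2 / a) * (1 + a / 2 * x ^+ 2) = 1 + x ^+ 2 + (2 / a + a / 2 * x ^+ 2).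
  by field; rewrite gt_eqF.
apply: (@le_trans _ _ (1 + x ^+ 2)).
  by rewrite -real_normK ?num_real//; have := normr_ge0 x; nra.
have h1 : 0 < 2 / a by rewrite divr_gt0.
have h2 : 0 <= a / 2 * x ^+ 2 by rewrite mulr_ge0 ?sqr_ge0// divr_ge0// ltW.
by lra.
Qed.

Lemma integrable_mulr_gaussf (a : R) : 0 < a -> integrableR leb (fun x => x * gaussf a x).
Proof.
move=> a0; apply: (integrableR_dominated (g := fun x : measurableTypeR R => (1 + 2 / a) * gaussf (a / 2) x)).
- by apply: measurable_funM => //; exact: measurable_gaussf.
- by apply: integrableRZ; apply: integrable_gaussf; rewrite divr_gt0.
- by move=> x; rewrite normrM [X in _ * X]ger0_norm ?mulr_gaussf_le// ltW ?gaussf_gt0.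
Qed.

Lemma gaussf_cvg0 (a : R) (u : nat -> R) : 0 < a -> (forall n, u n ^+ 2 = n%:R ^+ 2) ->
  gaussf a (u n) @[n --> \oo] --> 0.
Proof.
move=> a0 un.
apply: (@squeeze_cvgr _ _ _ _ (fun=> 0) (fun n => a^-1 / n%:R)).
- near=> n.
  have n0 : 0 < n%:R :> R by near: n; exact: nbhs_infty_gtr.
  rewrite ltW ?gaussf_gt0//= /gaussf un expRN -[leRHS]invfM lef_pV2 ?posrE ?expR_gt0 ?mulr_gt0//.
  apply: le_trans (expR_ge1Dx _); rewrite (@le_trans _ _ (a * n%:R ^+ 2))//; last by rewrite lerDr.
  rewrite ler_pM2l// expr2 ler_peMl ?ltW//.
  by rewrite -[1]/(1%:R) ltr_nat; near: n; exact: nbhs_infty_gt.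
- exact: cvg_cst.
- rewrite -(mulr0 a^-1); rewrite -(cvg_shiftS (fun n => a^-1 / n%:R)).
  by apply: cvgMr; exact: cvg_harmonic.
Unshelve. all: end_near. Qed.

Variable th : R.

Let J (a v : R) := \int[leb]_x (gaussf a x * cos (v * x + th)).

Let Jd (a v : R) := \int[leb]_x (- (x * gaussf a x) * sin (v * x + th)).

Let mcos (v : R) : measurable_fun setT (fun x : R => cos (v * x + th)).
Proof.
apply: (measurableT_comp (f := cos)); last first.
  by apply: measurable_funD => //; exact: measurable_funM.
by apply: continuous_measurable_fun; exact: continuous_cos.
Qed.

Let msin (v : R) : measurable_fun setT (fun x : R => sin (v * x + th)).
Proof.
apply: (measurableT_comp (f := sin)); last first.
  by apply: measurable_funD => //; exact: measurable_funM.
by apply: continuous_measurable_fun; exact: continuous_sin.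
Qed.

Lemma integrable_gaussf_cos (a v : R) : 0 < a ->
  integrableR leb (fun x => gaussf a x * cos (v * x + th)).
Proof.
move=> a0; apply: (integrableR_dominated _ (integrable_gaussf a0)).
  by apply: measurable_funM; [exact: measurable_gaussf|exact: mcos].
move=> x; rewrite normrM (ger0_norm (ltW (gaussf_gt0 _ _))).
by rewrite ler_piMr ?cos_max// ltW// gaussf_gt0.
Qed.

Let intJd (a v : R) : 0 < a -> integrableR leb (fun x => x * gaussf a x * sin (v * x + th)).
Proof.
move=> a0.
apply: (integrableR_dominated _ (integrableR_norm (integrable_mulr_gaussf a0))).
  apply: measurable_funM; [|exact: msin].
  by apply: measurable_funM => //; exact: measurable_gaussf.
by move=> x; rewrite normrM ler_piMr ?sin_max.
Qed.

Let derJ (a v : R) : 0 < a -> is_derive v 1 (J a) (Jd a v).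
Proof.
move=> a0.
have der (w x : R) : is_derive w 1 (fun w => gaussf a x * cos (w * x + th))
    (- (x * gaussf a x) * sin (w * x + th)).
  apply: is_derive_eq; rewrite /GRing.scale/=; ring.
have d1E (w x : R) : partial1of2 (fun w x => gaussf a x * cos (w * x + th)) w x =
    - (x * gaussf a x) * sin (w * x + th).
  by rewrite partial1of2E; exact: derive_val.
have cvgJ := @cvg_differentiation_under_integral R _ _ leb
  (fun w x => gaussf a x * cos (w * x + th)) setT measurableT v (v - 1) (v + 1) _ _ _
  (fun x => `|x * gaussf a x|) _ _ _.
have {}cvgJ : h^-1 *: (J a (h + v) - J a v) @[h --> 0^'] --> Jd a v.
  rewrite /Jd; under eq_Rintegral do rewrite -d1E; apply: cvgJ.
  - by rewrite /= in_itv/=; lra.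
  - by move=> w _; exact: integrable_gaussf_cos.
  - by move=> w x _ _; have [] := der w x.
  - by [].
  - exact/integrableR_norm/integrable_mulr_gaussf.
  - by move=> w x _ _; rewrite d1E normrM normrN ler_piMr ?sin_max.
have e : (fun h : R => h^-1 *: ((J a \o shift v) (h *: 1) - J a v)) =
   (fun h => h^-1 *: (J a (h + v) - J a v)).
  by apply/funext => h; rewrite /= /GRing.scale/= mulr1.
split.
  by apply/cvg_ex; exists (Jd a v); rewrite e.
by rewrite /derive e; exact/cvg_lim.
Qed.

Let JdE (a v : R) : 0 < a -> Jd a v = - (v / (2 * a)) * J a v.
Proof.
move=> a0.
have gsin0 (u : nat -> R) : (forall n, u n ^+ 2 = n%:R ^+ 2) ->
    gaussf a (u n) * sin (v * u n + th) @[n --> \oo] --> 0.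
  move=> un; apply: norm_cvg0.
  apply: (@squeeze_cvgr _ _ _ _ (fun=> 0) (fun n => gaussf a (u n))).
  - apply: nearW => n; rewrite normr_ge0 normrM (ger0_norm (ltW (gaussf_gt0 _ _))).
    by rewrite ler_piMr ?sin_max// ltW// gaussf_gt0.
  - exact: cvg_cst.
  - exact: gaussf_cvg0.
have h : \int[leb]_x (- (2 * a) * (x * gaussf a x * sin (v * x + th)) + v * (gaussf a x * cos (v * x + th))) = 0.
  apply: (integral_deriv_eq0 (F := fun x => gaussf a x * sin (v * x + th))).
  - move=> x; have := is_derive_gaussf a x => dg.
    apply: is_derive_eq; rewrite /GRing.scale/=; ring.
  - have cs : continuous (fun x : R => sin (v * x + th)).
      move=> x; apply: continuous_comp; last exact: continuous_sin.
      by apply: cvgD; [apply: cvgM; [exact: cvg_cst|exact: cvg_id]|exact: cvg_cst].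
    have cc : continuous (fun x : R => cos (v * x + th)).
      move=> x; apply: continuous_comp; last exact: continuous_cos.
      by apply: cvgD; [apply: cvgM; [exact: cvg_cst|exact: cvg_id]|exact: cvg_cst].
    move=> x; apply: cvgD; apply: cvgM; try exact: cvg_cst.
      apply: cvgM; last exact: cs.
      by apply: cvgM; [exact: cvg_id|exact: continuous_gaussf].
    by apply: cvgM; [exact: continuous_gaussf|exact: cc].
  - apply: integrableRD; apply: integrableRZ; [exact: intJd|exact: integrable_gaussf_cos].
  - exact: gsin0.
  - by apply: gsin0 => n; rewrite sqrrN.
move: h; rewrite RintegralD//; last 2 first.
  by apply: integrableRZ; exact: intJd.
  by apply: integrableRZ; exact: integrable_gaussf_cos.
rewrite (RintegralZl _ measurableT (intJd v a0)) (RintegralZl _ measurableT (integrable_gaussf_cos v a0)).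
move=> h; rewrite /Jd.
under eq_Rintegral do rewrite mulNr -mulN1r.
rewrite RintegralZl//; last exact: intJd.
rewrite -/(J a v) in h *.
have -> : \int[leb]_x (x * gaussf a x * sin (v * x + th)) = v / (2 * a) * J a v.
  by apply: (@mulfI _ (2 * a)); [rewrite mulf_neq0// gt_eqF|
    rewrite mulrA mulrCA divff ?mulr1; [lra|rewrite mulf_neq0// gt_eqF]].
lra.
Qed.

(** The parameter integral solves J' = - v / (2 a) J, so its product with the integrating factor
    exp(v^2 / (4 a)) is constant. The free phase [th] lets real cosines play the part of complex
    exponentials. *)
Lemma integral_gaussf_cos (a v : R) : 0 < a ->
  \int[leb]_x (gaussf a x * cos (v * x + th)) = cos th * Num.sqrt (pi / a) * gaussf (4 * a)^-1 v.
Proof.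
move=> a0.
pose G w := J a w * expR (w ^+ 2 / (4 * a)).
have dG (w : R) : is_derive w 1 G 0.
  rewrite /G; have := derJ w a0; rewrite JdE// => dJ.
  apply: is_derive_eq; rewrite /GRing.scale/=.
  by field; rewrite gt_eqF.
have := is_derive_0_is_cst v 0 dG.
rewrite /G /J expr0n/= mul0r expR0 mulr1 => h.
rewrite [RHS](_ : _ = \int[leb]_x (gaussf a x * cos (0 * x + th)) * gaussf (4 * a)^-1 v); last first.
  rewrite -integral_gaussf// -(RintegralZl _ measurableT (integrable_gaussf a0)).
  congr (_ * _); apply: eq_Rintegral => x _.
  by rewrite mul0r add0r mulrC.
rewrite -h -mulrA /gaussf -expRD.
by rewrite [X in expR X](_ : _ = 0) ?expR0 ?mulr1// mulrC subrr.
Qed.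

End gauss.

(** * Moments and expectations under a Gaussian law *)

Section gaussian_moments.
Context {R : realType}.
Notation leb := (@lebesgue_measure R).

Lemma gaussf_normal_shift (a m : R) : 0 < a ->
  (fun x => gaussf a (x - m)) =
  fun x => Num.sqrt (pi / a) * normal_pdf m (Num.sqrt (2 * a))^-1 x.
Proof.
move=> a0; apply/funext => x.
have s0 : (Num.sqrt (2 * a))^-1 != 0 by rewrite invr_neq0// gt_eqF// sqrtr_gt0 mulr_gt0.
have := congr1 (fun f => f (x - m)) (gaussf_normal a0) => /= ->.
by rewrite !normal_pdfE// /normal_fun subr0.
Qed.

(** By induction, each further power of x costs half of the rate in the exponent. *)
Lemma exprn_gaussf_le k (a : R) : 0 < a ->
  exists C, exists2 b, 0 < b & forall x, `|x ^+ k * gaussf a x| <= C * gaussf b x.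
Proof.
elim: k a => [|k IH] a a0.
  exists 1, a => // x; rewrite expr0 !mul1r ger0_norm// ltW// gaussf_gt0//.
have a20 : 0 < a / 2 by rewrite divr_gt0.
have [C [b b0 Cb]] := IH _ a20.
exists ((1 + 2 / a) * C), b => // x.
rewrite exprSr -mulrA normrM normrM (ger0_norm (ltW (gaussf_gt0 a x))).
apply: (le_trans (ler_wpM2l (normr_ge0 _) (mulr_gaussf_le x a0))).
rewrite mulrCA -mulrA ler_wpM2l ?addr_ge0 ?divr_ge0// ?(ltW a0)//.
by apply: le_trans (Cb x); rewrite normrM (ger0_norm (ltW (gaussf_gt0 _ x))).
Qed.

Lemma measurable_exprn_gaussf k (a : R) :
  measurable_fun setT (fun x : R => x ^+ k * gaussf a x).
Proof.
by apply: measurable_funM; [exact: measurable_funX|exact: measurable_gaussf].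
Qed.

Lemma integrable_exprn_gaussf k (a : R) : 0 < a ->
  integrableR leb (fun x => x ^+ k * gaussf a x).
Proof.
move=> a0; have [C [b b0 Cb]] := exprn_gaussf_le k a0.
apply: (integrableR_dominated _ (integrableRZ C (integrable_gaussf b0))) => //.
exact: measurable_exprn_gaussf.
Qed.

Lemma continuous_exprn_gaussf k (a : R) :
  continuous (fun x : R => x ^+ k * gaussf a x).
Proof.
by move=> x; apply: cvgM; [exact: exprn_continuous|exact: continuous_gaussf].
Qed.

Lemma integral_exprn_gaussf k (a : R) : 0 < a ->
  \int[leb]_x (x ^+ k.+2 * gaussf a x) =
  k.+1%:R / (2 * a) * \int[leb]_x (x ^+ k * gaussf a x).
Proof.
move=> a0.
have ik := integrable_exprn_gaussf k a0.
have ik2 := integrable_exprn_gaussf k.+2 a0.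
have h : \int[leb]_x (k.+1%:R * (x ^+ k * gaussf a x) -
    2 * a * (x ^+ k.+2 * gaussf a x)) = 0.
  have [C [b b0 Cb]] := exprn_gaussf_le k.+1 a0.
  have F0 (u : nat -> R) : (forall n, u n ^+ 2 = n%:R ^+ 2) ->
      u n ^+ k.+1 * gaussf a (u n) @[n --> \oo] --> 0.
    move=> un; apply: norm_cvg0.
    apply: (@squeeze_cvgr _ _ _ _ (fun=> 0) (fun n => C * gaussf b (u n))).
    - by apply: nearW => n; rewrite normr_ge0 Cb.
    - exact: cvg_cst.
    - by rewrite -(mulr0 C); apply: cvgMr; exact: gaussf_cvg0.
  apply: (integral_deriv_eq0 (F := fun x => x ^+ k.+1 * gaussf a x)).
  - move=> x; have := is_derive_gaussf a x => dg.
    have dX : is_derive x 1 (fun x : R => x ^+ k.+1) (k.+1%:R * x ^+ k).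
      rewrite (_ : (fun x => _) = (@id R) ^+ k.+1); last by rewrite exprfctE.
      by apply: is_derive_eq; rewrite /GRing.scale/= mulr1.
    apply: is_derive_eq; rewrite /GRing.scale/= !exprS; ring.
  - by move=> x; apply: cvgB; apply: cvgM; try exact: cvg_cst;
      exact: continuous_exprn_gaussf.
  - by apply: integrableRB; apply: integrableRZ.
  - exact: F0.
  - by apply: F0 => n; rewrite sqrrN.
move: h; rewrite RintegralB//; [|exact: integrableRZ|exact: integrableRZ].
rewrite (RintegralZl _ measurableT ik) (RintegralZl _ measurableT ik2) => /subr0_eq h.
rewrite mulrAC h; field; exact: lt0r_neq0.
Qed.

Lemma integral_shift_gaussf (a m : R) : 0 < a ->
  integrableR leb (fun x => (x - m) * gaussf a (x - m)) /\
  \int[leb]_x ((x - m) * gaussf a (x - m)) = 0.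
Proof.
move=> a0.
have ishift (b : R) : 0 < b -> integrableR leb (fun x => gaussf b (x - m)).
  by move=> b0; rewrite gaussf_normal_shift//; apply: integrableRZ; exact: integrable_normal_pdf.
have a20 : 0 < a / 2 by rewrite divr_gt0.
have mg : measurable_fun setT (fun x : R => gaussf a (x - m)).
  by apply: measurableT_comp; [exact: measurable_gaussf|exact: measurable_funB].
have i1 : integrableR leb (fun x => (x - m) * gaussf a (x - m)).
  apply: (integrableR_dominated _ (integrableRZ (1 + 2 / a) (ishift _ a20))).
    by apply: measurable_funM => //; exact: measurable_funB.
  by move=> x; rewrite normrM [X in _ * X]ger0_norm ?mulr_gaussf_le// ltW ?gaussf_gt0.
split => //.
have h : \int[leb]_x (- (2 * a) * ((x - m) * gaussf a (x - m))) = 0.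
  have dg (x : R) : is_derive x 1 (fun x : R => gaussf a (x - m)) (- (2 * a) * ((x - m) * gaussf a (x - m))).
    rewrite /gaussf; apply: is_derive_eq; rewrite /GRing.scale/=; ring.
  have g0 (u : nat -> R) : (forall n, `|u n| = n%:R) ->
      gaussf a (u n - m) @[n --> \oo] --> 0.
    move=> un.
    (* From (x - 2 m)^2 >= 0 follows (x - m)^2 >= x^2 / 2 - m^2, hence the rate a / 2 and the
       constant exp(a m^2). *)
    have [C [b b0 Cb]] : exists C, exists2 b, 0 < b & forall x, gaussf a (x - m) <= C * gaussf b x.
      exists (expR (a * m ^+ 2)), (a / 2) => //.
      move=> x; rewrite /gaussf -expRD ler_expR.
      have := sqr_ge0 (x - 2 * m); rewrite -subr_ge0 => h.
      by rewrite subr0 in h; nra.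
    apply: (@squeeze_cvgr _ _ _ _ (fun=> 0) (fun n => C * gaussf b (u n))).
    - by apply: nearW => n; rewrite Cb ltW// gaussf_gt0.
    - exact: cvg_cst.
    - rewrite -(mulr0 C); apply: cvgMr; apply: gaussf_cvg0 => // n.
      by rewrite -real_normK ?num_real// un.
  apply: (integral_deriv_eq0 dg).
  - have cs : continuous (fun x : R => x - m).
      by move=> x; apply: cvgB; [exact: cvg_id|exact: cvg_cst].
    move=> x; apply: cvgM; first exact: cvg_cst.
    apply: cvgM; first exact: cs.
    by apply: (continuous_comp (cs x)); exact: continuous_gaussf.
  - exact: integrableRZ.
  - by apply: g0 => n; rewrite normr_nat.
  - by apply: g0 => n; rewrite normrN normr_nat.
move: h; rewrite (RintegralZl _ measurableT i1) => /eqP; rewrite mulf_eq0 => /orP[|/eqP//].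
by rewrite oppr_eq0 mulf_eq0 (gt_eqF a0) orbF pnatr_eq0.
Qed.

(** The Radon-Nikodym derivative of [normal_prob] and the function [normal_pdf] have the same
    integral over every measurable set, hence agree almost everywhere. *)
Lemma ge0_integral_normal_prob (m s : R) (f : R -> R) :
  measurable_fun setT f -> (forall x, 0 <= f x) ->
  (\int[normal_prob m s]_x (f x)%:E = \int[leb]_x (f x * normal_pdf m s x)%:E)%E.
Proof.
move=> mf f0.
have dom := normal_prob_dominates m s.
have mpdf := measurable_normal_pdf m s.
rewrite -(Radon_Nikodym_SigmaFinite.change_of_variables dom)//; last exact/measurable_EFinP.
have iRN := Radon_Nikodym_SigmaFinite.f_integrable dom.
under [RHS]eq_integral do rewrite EFinM.
apply: ae_eq_integral => //.
- apply: emeasurable_funM; first exact/measurable_EFinP.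
  exact: measurable_int iRN.
- by apply: emeasurable_funM; exact/measurable_EFinP.
- apply: ae_eqe_mul2l; apply: integral_ae_eq => //.
  + exact/measurable_EFinP.
  + by move=> E _ mE; rewrite -Radon_Nikodym_SigmaFinite.f_integral.
Qed.

End gaussian_moments.

Section gaussian_law_integral.
Context {R : realType} d (Omega : measurableType d) (P : probability Omega R).
Variables (X : Omega -> R) (m s : R).
Hypothesis mX : measurable_fun setT X.
Hypothesis lawX : forall A, measurable A -> P (X @^-1` A) = gaussian_law m s A.
Notation leb := (@lebesgue_measure R).

Let mX' : measurable_fun [set: Omega] (X : Omega -> measurableTypeR R).
Proof. exact: mX. Qed.

Let XM : {mfun Omega >-> measurableTypeR R} :=
  HB.pack X (isMeasurableFun.Build _ _ _ _ _ mX').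

Let ge0_int (f : R -> R) : measurable_fun setT f -> (forall x, 0 <= f x) ->
  (\int[P]_w (f (X w))%:E = if (s == 0)%R then (f m)%:E else
    \int[leb]_x (f x * normal_pdf m s x)%:E)%E.
Proof.
move=> mf f0.
rewrite -[LHS](@ge0_integral_distribution _ _ _ _ _ P XM (EFin \o f))//; last exact/measurable_EFinP.
case: (eqVneq s 0) => s0.
  rewrite (@eq_measure_integral _ (measurableTypeR R) _ _ \d_(m : measurableTypeR R)) => [|A mA _]; last first.
    by have := lawX mA; rewrite /gaussian_law s0 eqxx; exact.
  by rewrite integral_dirac//= ?diracT ?mul1e//; exact/measurable_EFinP.
have h := @eq_measure_integral _ (measurableTypeR R) R setT
  (normal_prob m s) (distribution P XM) (EFin \o f).
rewrite h => [|A mA _]; first by rewrite ge0_integral_normal_prob.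
by have := lawX mA; rewrite /gaussian_law (negbTE s0); exact.
Qed.

Lemma gaussian_law_integral_degenerate (f : R -> R) : s = 0 -> measurable_fun setT f ->
  integrableR P (fun w => f (X w)) /\ \int[P]_w f (X w) = f m.
Proof.
move=> s0 mf.
have h (g : R -> R) : measurable_fun setT g -> (forall x, 0 <= g x) ->
    (\int[P]_w (g (X w))%:E = (g m)%:E)%E.
  by move=> mg g0; rewrite ge0_int// s0 eqxx.
have mfX : measurable_fun setT (fun w => f (X w)) by exact: measurableT_comp.
have mfn : measurable_fun setT (fun x => `|f x|) by exact: measurableT_comp.
have i1 : integrableR P (fun w => f (X w)).
  apply/integrableP; split; first exact/measurable_EFinP.
  rewrite /=.
  by rewrite (h (fun x => `|f x|)) ?ltry//; exact: measurableT_comp.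
split => //.
have i2 := integrableR_norm i1.
(* The transfer formula is known for nonnegative functions; f is the difference of the nonnegative
   functions f + |f| and |f|. *)
have -> : \int[P]_w f (X w) = \int[P]_w ((f (X w) + `|f (X w)|) - `|f (X w)|).
  by apply: eq_Rintegral => w _; rewrite addrK.
rewrite RintegralB//; last exact: integrableRD.
rewrite /Rintegral (h (fun x => `|f x|))// (h (fun x => f x + `|f x|))/= ?addrK//.
  exact: measurable_funD.
by move=> x; rewrite addrC -lerBlDr sub0r -normrN ler_norm.
Qed.

Lemma gaussian_law_integral (f : R -> R) : s != 0 -> measurable_fun setT f ->
  integrableR leb (fun x => f x * normal_pdf m s x) ->
  integrableR P (fun w => f (X w)) /\
  \int[P]_w f (X w) = \int[leb]_x (f x * normal_pdf m s x).
Proof.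
move=> s0 mf fi.
have h (g : R -> R) : measurable_fun setT g -> (forall x, 0 <= g x) ->
    (\int[P]_w (g (X w))%:E = \int[leb]_x (g x * normal_pdf m s x)%:E)%E.
  by move=> mg g0; rewrite ge0_int// (negbTE s0).
have mfX : measurable_fun setT (fun w => f (X w)) by exact: measurableT_comp.
have mfn : measurable_fun setT (fun x => `|f x|) by exact: measurableT_comp.
have pdf0 x : 0 <= normal_pdf m s x by exact: normal_pdf_ge0.
have i1 : integrableR P (fun w => f (X w)).
  apply/integrableP; split; first exact/measurable_EFinP.
  rewrite /= (h (fun x => `|f x|))//.
  case/integrableP : fi => _; apply: le_lt_trans.
  by under [leRHS]eq_integral do rewrite /= normrM (ger0_norm (pdf0 _)).
split => //.
have i2 := integrableR_norm i1.
have fi2 : integrableR leb (fun x => `|f x| * normal_pdf m s x).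
  by have := integrableR_norm fi; under eq_fun do rewrite /= normrM (ger0_norm (pdf0 _)).
have -> : \int[P]_w f (X w) = \int[P]_w ((f (X w) + `|f (X w)|) - `|f (X w)|).
  by apply: eq_Rintegral => w _; rewrite addrK.
rewrite RintegralB//; last exact: integrableRD.
rewrite {1}/Rintegral (h (fun x => f x + `|f x|)); last 2 first.
  exact: measurable_funD.
  by move=> x; rewrite addrC -lerBlDr sub0r -normrN ler_norm.
rewrite {1}/Rintegral (h (fun x => `|f x|))// -/(Rintegral _ _ _) -/(Rintegral _ _ _).
under eq_Rintegral do rewrite mulrDl.
by rewrite RintegralD// addrK.
Qed.

Let a := (2 * s ^+ 2)^-1.
Let a0 : s != 0 -> 0 < a.
Proof. by move=> s0; rewrite invr_gt0 mulr_gt0// exprn_even_gt0. Qed.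

Let pdfE x : s != 0 -> normal_pdf m s x = normal_peak s * gaussf a (x - m).
Proof.
move=> s0; rewrite normal_pdfE// /normal_fun /gaussf; congr (_ * expR _).
by rewrite /a; field.
Qed.

Lemma gaussian_law_mean : integrableR P X /\ \int[P]_w X w = m.
Proof.
have [s0|s0] := eqVneq s 0.
  exact: (gaussian_law_integral_degenerate (f := id)).
have [i1 i2] := integral_shift_gaussf m (a0 s0).
have e : (fun x => x * normal_pdf m s x) = (fun x => normal_peak s * ((x - m) * gaussf a (x - m)) + m * normal_pdf m s x).
  by apply/funext => x; rewrite pdfE//; ring.
have ipdf : integrableR leb (normal_pdf m s) by exact: integrable_normal_pdf.
have i3 := integrableRZ (normal_peak s) i1.
have i4 := integrableRZ m ipdf.
have [] := @gaussian_law_integral id s0; first by [].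
  by rewrite /= e; exact: integrableRD.
move=> iX EX; split => //; rewrite EX e RintegralD//.
rewrite (RintegralZl _ measurableT i1) (RintegralZl _ measurableT ipdf) i2 mulr0 add0r.
by rewrite /Rintegral integral_normal_pdf mulr1.
Qed.

Hypothesis m0 : m = 0.

Let peak_int : s != 0 -> normal_peak s * \int[leb]_x gaussf a x = 1.
Proof.
move=> s0.
have : \int[leb]_x normal_pdf m s x = 1 by rewrite /Rintegral integral_normal_pdf.
rewrite (_ : normal_pdf m s = fun x => normal_peak s * gaussf a x); last first.
  by apply/funext => x; rewrite pdfE// m0 subr0.
by rewrite (RintegralZl _ measurableT (integrable_gaussf (a0 s0))).
Qed.

Lemma gaussian_law_moment k :
  integrableR P (fun w => X w ^+ k) /\
  (s != 0 -> \int[P]_w X w ^+ k = normal_peak s * \int[leb]_x (x ^+ k * gaussf a x)).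
Proof.
have mXk : measurable_fun setT (fun x : R => x ^+ k) by exact: measurable_funX.
have [s0|s0] := eqVneq s 0.
  by have [] := gaussian_law_integral_degenerate s0 mXk.
have e : (fun x => x ^+ k * normal_pdf m s x) = (fun x => normal_peak s * (x ^+ k * gaussf a x)).
  by apply/funext => x; rewrite pdfE// m0 subr0 mulrCA.
have ik := integrable_exprn_gaussf k (a0 s0).
have [] := @gaussian_law_integral (fun x => x ^+ k) s0 mXk.
  by rewrite e; exact: integrableRZ.
by move=> iX EX; split => // _; rewrite EX e (RintegralZl _ measurableT ik).
Qed.

Lemma gaussian_law_var : \int[P]_w X w ^+ 2 = s ^+ 2.
Proof.
have [s0|s0] := eqVneq s 0.
  have [//|_ ->] := @gaussian_law_integral_degenerate (fun x => x ^+ 2) s0.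
  by rewrite m0 s0.
have [_ ->//] := gaussian_law_moment 2; rewrite integral_exprn_gaussf ?a0//.
under eq_Rintegral do rewrite expr0 mul1r.
by rewrite mulrCA peak_int// /a; field.
Qed.

(** Serves to bound the third absolute moment of an increment, on which the trapezoidal error
    depends. *)
Lemma gaussian_law_moment4 : \int[P]_w X w ^+ 4 = 3 * s ^+ 4.
Proof.
have [s0|s0] := eqVneq s 0.
  have [//|_ ->] := @gaussian_law_integral_degenerate (fun x => x ^+ 4) s0.
  by rewrite m0 s0 !expr0n/= mulr0.
have [_ ->//] := gaussian_law_moment 4; rewrite integral_exprn_gaussf ?a0//.
rewrite integral_exprn_gaussf ?a0//.
under eq_Rintegral do rewrite expr0 mul1r.
by rewrite mulrCA [X in _ * X]mulrCA peak_int// /a; field.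
Qed.

Lemma gaussian_law_cos (theta : R) :
  \int[P]_w cos (X w + theta) = cos theta * expR (- (s ^+ 2 / 2)).
Proof.
have mcos (c : R) : measurable_fun setT (fun x : R => cos (x + c)).
  apply: (measurableT_comp (f := cos)); last exact: measurable_funD.
  by apply: continuous_measurable_fun; exact: continuous_cos.
have [s0|s0] := eqVneq s 0.
  have [//|_ ->] := @gaussian_law_integral_degenerate (fun x => cos (x + theta)) s0.
  by rewrite m0 s0 add0r expr0n/= mul0r oppr0 expR0 mulr1.
have ic := integrable_gaussf_cos theta (1 : R) (a0 s0).
have e : (fun x => cos (x + theta) * normal_pdf m s x) = (fun x =>
    normal_peak s * (gaussf a x * cos (1 * x + theta))).
  by apply/funext => x; rewrite pdfE// m0 subr0 mul1r; ring.
have [] := @gaussian_law_integral (fun x => cos (x + theta)) s0 (mcos _).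
  by rewrite e; exact: integrableRZ.
move=> _ ->; rewrite e (RintegralZl _ measurableT ic) integral_gaussf_cos ?a0//.
have := peak_int s0; rewrite integral_gaussf ?a0// => h.
rewrite [LHS](_ : _ = cos theta * gaussf (4 * a)^-1 1 *
    (normal_peak s * Num.sqrt (pi / a))); last by ring.
rewrite h mulr1.
rewrite /gaussf; congr (_ * expR _); rewrite /a; field.
by [].
Qed.

End gaussian_law_integral.

(** * The isometry into the Gaussian space *)

Section inner_product.
Context {R : realType} (V : completeNormedModType R) (ip : {dot V for idfun}).
Hypothesis normE : forall h : V, `|h| = Num.sqrt (ip h h).

Lemma ipC (u v : V) : ip u v = ip v u.
Proof. by rewrite hermC expr0 mul1r. Qed.

Lemma ipDl (u v w : V) : ip (u + v) w = ip u w + ip v w.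
Proof. exact: linearDl. Qed.

Lemma ipZl a (u w : V) : ip (a *: u) w = a * ip u w.
Proof. exact: linearZl_LR. Qed.

Lemma ipDr (u v w : V) : ip w (u + v) = ip w u + ip w v.
Proof. by rewrite ![ip w _]ipC ipDl. Qed.

Lemma ipZr a (u w : V) : ip w (a *: u) = a * ip w u.
Proof. by rewrite ![ip w _]ipC ipZl. Qed.

Lemma ipNl (u w : V) : ip (- u) w = - ip u w.
Proof. by rewrite -scaleN1r ipZl mulN1r. Qed.

Lemma ipBl (u v w : V) : ip (u - v) w = ip u w - ip v w.
Proof. by rewrite ipDl ipNl. Qed.

Lemma ipBr (u v w : V) : ip w (u - v) = ip w u - ip w v.
Proof. by rewrite ![ip w _]ipC ipBl. Qed.

Lemma ip0l (w : V) : ip 0 w = 0.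
Proof. by rewrite -(scale0r 0) ipZl mul0r. Qed.

Lemma ip_suml I (s : seq I) (F : I -> V) w :
  ip (\sum_(i <- s) F i) w = \sum_(i <- s) ip (F i) w.
Proof.
by elim: s => [|i s IH]; rewrite ?big_nil ?ip0l// !big_cons ipDl IH.
Qed.

Lemma ip_sumr I (s : seq I) (F : I -> V) w :
  ip w (\sum_(i <- s) F i) = \sum_(i <- s) ip w (F i).
Proof. by rewrite ipC ip_suml; apply: eq_bigr => i _; rewrite ipC. Qed.

(** [Num.sqrt] is 0 on negative numbers, so a negative value would give u the norm 0. *)
Lemma ip_ge0 (u : V) : 0 <= ip u u.
Proof.
have [->|u0] := eqVneq u 0; first by rewrite ip0l.
have : `|u| != 0 by rewrite normr_eq0.
by move=> n0; rewrite leNgt; apply: contra_neqN n0 => /ltW/ler0_sqrtr; rewrite -normE.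
Qed.

Lemma norm_sqr (u : V) : `|u| ^+ 2 = ip u u.
Proof. by rewrite normE sqr_sqrtr// ip_ge0. Qed.

Lemma ip_norm_le (u v : V) : `|ip u v| <= `|u| * `|v|.
Proof.
have [->|u0] := eqVneq u 0; first by rewrite ip0l !normr0 mul0r.
have [->|v0] := eqVneq v 0; first by rewrite ipC ip0l !normr0 mulr0.
have h (x : V) : x != 0 -> ip u x <= `|u| * `|x|.
  move=> x0; have := ip_ge0 (`|x| *: u - `|u| *: x).
  rewrite !(ipBl, ipBr, ipZl, ipZr) -!norm_sqr [ip x u]ipC => h.
  have : 0 < `|u| * `|x| by rewrite mulr_gt0 ?normr_gt0.
  by move: h; set a := `|u|; set b := `|x|; set c := ip u x; nra.
rewrite ler_norml h// andbT lerNl.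
by have := h (- v); rewrite oppr_eq0 normrN [ip _ (- v)]ipC ipNl ipC; apply.
Qed.

Lemma cvg_ipl (u : nat -> V) (l w : V) :
  u n @[n --> \oo] --> l -> ip (u n) w @[n --> \oo] --> ip l w.
Proof.
move=> ul; apply/cvgrPdist_le => e e0.
have w0 : 0 < `|w| + 1 by rewrite ltr_wpDl.
move/cvgrPdist_le : ul => /(_ (e / (`|w| + 1)) (divr_gt0 e0 w0)).
apply: filterS => i h; rewrite -ipBl.
apply: (le_trans (ip_norm_le _ _)).
apply: (@le_trans _ _ (e / (`|w| + 1) * (`|w| + 1))); last by rewrite divfK// gt_eqF.
by apply: ler_pM => //; rewrite lerDl.
Qed.

Lemma cvg_ip_sqr (u : nat -> V) (l : V) :
  u n @[n --> \oo] --> l -> ip (u n) (u n) @[n --> \oo] --> ip l l.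
Proof.
move=> ul; rewrite -norm_sqr; under eq_fun do rewrite -norm_sqr.
by rewrite !expr2; under eq_fun do rewrite expr2; apply: cvgM; exact: cvg_norm.
Qed.

End inner_product.

(** * Square-integrable functions and Cauchy-Schwarz *)

Section square_integrable.
Context {R : realType} d (T : measurableType d) (mu : {measure set T -> \bar R}).

Definition sqint (X : T -> R) :=
  measurable_fun setT X /\ integrableR mu (fun w => X w ^+ 2).

Lemma sqint_mul X Y : sqint X -> sqint Y -> integrableR mu (fun w => X w * Y w).
Proof.
move=> [mX iX] [mY iY].
apply: (integrableR_dominated _ (integrableRD iX iY)).
  exact: measurable_funM.
move=> w; rewrite normrM -[X w ^+ 2]real_normK ?num_real// -[Y w ^+ 2]real_normK ?num_real//.
by have := sqr_ge0 (`|X w| - `|Y w|); have := normr_ge0 (X w); have := normr_ge0 (Y w); nra.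
Qed.

Lemma sqintD X Y : sqint X -> sqint Y -> sqint (fun w => X w + Y w).
Proof.
move=> [mX iX] [mY iY]; split; first exact: measurable_funD.
have iXY := sqint_mul (conj mX iX) (conj mY iY).
rewrite (_ : (fun w => _) = (fun w => X w ^+ 2 + Y w ^+ 2 + 2 * (X w * Y w))).
  by apply: integrableRD; [exact: integrableRD|exact: integrableRZ].
by apply/funext => w; ring.
Qed.

Lemma sqintZ k X : sqint X -> sqint (fun w => k * X w).
Proof.
move=> [mX iX]; split; first exact: measurable_funM.
by under eq_fun do rewrite exprMn; exact: integrableRZ.
Qed.

Lemma sqintB X Y : sqint X -> sqint Y -> sqint (fun w => X w - Y w).
Proof.
move=> sX sY; have := sqintD sX (sqintZ (-1) sY).
by under eq_fun do rewrite mulN1r.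
Qed.

Lemma Rintegral_cauchy X Y : sqint X -> sqint Y ->
  `|\int[mu]_w (X w * Y w)| <=
  Num.sqrt (\int[mu]_w X w ^+ 2) * Num.sqrt (\int[mu]_w Y w ^+ 2).
Proof.
move=> sX sY; have iXY := sqint_mul sX sY; have [[mX iX] [mY iY]] := (sX, sY).
set x := \int[mu]_w X w ^+ 2; set y := \int[mu]_w Y w ^+ 2.
set z := \int[mu]_w (X w * Y w).
have x0 : 0 <= x by apply: Rintegral_ge0 => w _; exact: sqr_ge0.
have y0 : 0 <= y by apply: Rintegral_ge0 => w _; exact: sqr_ge0.
have h (l : R) : 0 <= x + l * l * y + 2 * l * z.
  have : 0 <= \int[mu]_w (X w + l * Y w) ^+ 2.
    by apply: Rintegral_ge0 => w _; exact: sqr_ge0.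
  have -> : \int[mu]_w (X w + l * Y w) ^+ 2 =
     \int[mu]_w (X w ^+ 2 + l * l * Y w ^+ 2 + 2 * l * (X w * Y w)).
    by apply: eq_Rintegral => w _; ring.
  rewrite RintegralD//; [|by apply: integrableRD => //; exact: integrableRZ|exact: integrableRZ].
  rewrite RintegralD//; last exact: integrableRZ.
  by rewrite (RintegralZl _ measurableT iY) (RintegralZl _ measurableT iXY).
rewrite -sqrtrM// -sqrtr_sqr ler_wsqrtr//.
(* The quadratic in l is affine when y = 0, and the chosen l gives it the value -1; otherwise l = -
   z / y is its minimizer. *)
have [y00|yn0] := eqVneq y 0.
  rewrite y00 mulr0; have [->|z0] := eqVneq z 0; first by rewrite expr0n.
  have := h (- (x + 1) / (2 * z)); rewrite y00 mulr0 addr0.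
  rewrite (_ : 2 * _ * z = - (x + 1)); last by field.
  lra.
have := h (- z / y); have yp : 0 < y by rewrite lt_def yn0.
rewrite (_ : x + _ + _ = (x * y - z ^+ 2) / y); last by field.
by rewrite pmulr_lge0 ?invr_gt0// subr_ge0.
Qed.

Lemma Lnorm2_ltP X (r : R) : measurable_fun setT X -> 0 < r ->
  ('N[mu]_2%:E[EFin \o X] < r%:E)%E ->
  sqint X /\ \int[mu]_w X w ^+ 2 < r ^+ 2.
Proof.
move=> mX r0 h.
have l2 : X \in Lfun mu 2%:E.
  rewrite inE; apply/andP; split; rewrite inE//=.
  by rewrite /finite_norm (lt_trans h)// ltry.
have i2 := Lfun2_integrable_sqr l2.
split => //; rewrite -lte_fin EFin_Rintegral//.
have -> : (\int[mu]_w (X w ^+ 2)%:E = 'N[mu]_2%:E[EFin \o X] `^ 2)%E.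
  rewrite poweR_Lnorm//; apply: eq_integral => w _.
  by rewrite /= -[in LHS](@real_normK _ (X w)) ?num_real// -powR_mulrn.
move: h; have := Lnorm_ge0 mu 2%:E (EFin \o X).
case: ('N[mu]_2%:E[EFin \o X])%E => [n| |]//.
rewrite lee_fin lte_fin => n0 nr.
rewrite poweR_EFin lte_fin powR_mulrn//.
by rewrite ltrXn2r ?nnegrE// ltW.
Qed.

Lemma Lnorm2E X : sqint X ->
  ('N[mu]_2%:E[EFin \o X] = (Num.sqrt (\int[mu]_w X w ^+ 2))%:E)%E.
Proof.
move=> [mX iX]; rewrite unlock.
rewrite (_ : (\int[mu]_x _)%E = (\int[mu]_w X w ^+ 2)%:E).
  by rewrite poweR_EFin powR12_sqrt// Rintegral_ge0// => w _; exact: sqr_ge0.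
rewrite EFin_Rintegral//; apply: eq_integral => w _.
by rewrite /= -[in RHS](@real_normK _ (X w)) ?num_real// -powR_mulrn.
Qed.

Lemma sqint_Lfun X : sqint X -> X \in Lfun mu 2%:E.
Proof.
move=> sX; have [mX iX] := sX.
rewrite inE; apply/andP; split; rewrite inE//=.
by rewrite /finite_norm Lnorm2E// ltry.
Qed.

End square_integrable.

Lemma sqint_bounded {R : realType} d (T : measurableType d) (P : probability T R)
  (X : T -> R) (M : R) : measurable_fun setT X -> (forall w, `|X w| <= M) -> sqint P X.
Proof.
move=> mX XM; split => //.
apply: (@integrableR_bounded _ _ _ _ _ (M ^+ 2)); first exact: measurable_funX.
by move=> w; rewrite normrX lerXn2r ?nnegrE// (le_trans _ (XM w)).
Qed.

Lemma sqint_integrable {R : realType} d (T : measurableType d) (P : probability T R)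
  (X : T -> R) : sqint P X -> integrableR P X.
Proof.
move=> sX.
have s1 : sqint P (fun=> 1 : R) by apply: (@sqint_bounded _ _ _ _ _ 1) => // w; rewrite normr1.
by have := sqint_mul sX s1; under eq_fun do rewrite /= mulr1.
Qed.

Lemma Rintegral_norm_le_sqrt {R : realType} d (T : measurableType d) (P : probability T R)
  (X : T -> R) : sqint P X ->
  \int[P]_w `|X w| <= Num.sqrt (\int[P]_w X w ^+ 2).
Proof.
move=> sX; have [mX iX] := sX.
have s1 : sqint P (fun=> 1 : R) by apply: (@sqint_bounded _ _ _ _ _ 1) => // w; rewrite normr1.
have sn : sqint P (fun w => `|X w|).
  split; first exact: measurableT_comp.
  by under eq_fun do rewrite real_normK ?num_real//.
have := Rintegral_cauchy sn s1.
under eq_Rintegral do rewrite mulr1.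
under [X in Num.sqrt X * _]eq_Rintegral do rewrite real_normK ?num_real//.
rewrite [X in _ * Num.sqrt X](_ : _ = 1).
  by rewrite sqrtr1 mulr1; apply: le_trans; exact: ler_norm.
by rewrite Rintegral_cst//= expr1n probability_setT mulr1.
Qed.

Section isonormal.
Context {R : realType} {d : measure_display} {Omega : measurableType d}
  (P : probability Omega R) (Hu K T : R) (B : R -> {RV P >-> R})
  (hB : is_bifBm Hu K T B) (V : completeNormedModType R)
  (ip : {dot V for idfun}) (e : R -> V) (hV : is_completion Hu K T ip e).

Let normE := completion_norm hV.

Lemma measurable_step_rv c : measurable_fun setT (step_rv B c).
Proof.
rewrite /step_rv; elim: c => [|p c IH].
  by under eq_fun do rewrite big_nil; exact: measurable_cst.
under eq_fun do rewrite big_cons; apply: measurable_funD => //.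
by apply: measurable_funM => //; exact: measurable_funPT.
Qed.

Lemma bifBm_sqint t : t \in `[0, T] -> sqint P (B t) /\ \int[P]_w B t w = 0.
Proof.
move=> tT.
have tc : times_in T [:: (1, t)] by move=> p; rewrite inE => /eqP ->.
have BE : step_rv B [:: (1, t)] = B t.
  by apply/funext => w; rewrite /step_rv big_seq1 mul1r.
have [m [s]] := bifBm_gaussian hB tc; rewrite BE => law.
have mB : measurable_fun setT (B t) by exact: measurable_funPT.
have [iB EB] := gaussian_law_mean mB law.
have m0 : m = 0.
  have := bifBm_centered hB tT; rewrite unlock -EFin_Rintegral// EB.
  by case.
split; last by rewrite EB.
by split => //; have [] := gaussian_law_moment mB law m0 2.
Qed.

Lemma bifBm_cov_int t s : t \in `[0, T] -> s \in `[0, T] ->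
  \int[P]_w (B t w * B s w) = bif_cov Hu K t s.
Proof.
move=> tT sT; have [Bt Bt0] := bifBm_sqint tT; have [Bs Bs0] := bifBm_sqint sT.
have := bifBm_cov hB tT sT; rewrite unlock.
rewrite !(bifBm_centered hB)// unlock => h.
have {}h : (\int[P]_w (B t w * B s w)%:E = (bif_cov Hu K t s)%:E)%E.
  by rewrite -h; apply: eq_integral => w _; congr EFin; rewrite mulrfctE /= !subr0.
by rewrite /Rintegral h.
Qed.

Lemma step_rv_sqr c : times_in T c -> sqint P (step_rv B c) /\
  \int[P]_w step_rv B c w ^+ 2 = ip (step_vec e c) (step_vec e c).
Proof.
move=> cT.
have sB p : p \in c -> sqint P (B p.2) by move=> /cT pT; have [] := bifBm_sqint pT.
have iBB p q : p \in c -> q \in c -> integrableR P (fun w => B p.2 w * B q.2 w).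
  by move=> pc qc; apply: sqint_mul; exact: sB.
have [m [s law]] := bifBm_gaussian hB cT.
(* The isometry is polarized to two sublists of c so that induction can run on each of them while
   all times stay among those of c. *)
have EE (c1 c2 : seq (R * R)) : {subset c1 <= c} -> {subset c2 <= c} ->
    integrableR P (fun w => step_rv B c1 w * step_rv B c2 w) /\
    \int[P]_w (step_rv B c1 w * step_rv B c2 w) = ip (step_vec e c1) (step_vec e c2).
  have iE p (c' : seq (R * R)) : p \in c -> {subset c' <= c} ->
     integrableR P (fun w => B p.2 w * step_rv B c' w) /\
     \int[P]_w (B p.2 w * step_rv B c' w) = ip (e p.2) (step_vec e c').
    move=> pc; elim: c' => [|q c' IH] sub.
      rewrite /step_rv /step_vec; under [X in EFin \o X]eq_fun do rewrite big_nil mulr0.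
      under eq_Rintegral do rewrite big_nil mulr0.
      rewrite Rintegral_cst// mul0r big_nil ipC ip0l; split => //.
      exact: integrable0.
    have qc : q \in c by apply: sub; rewrite mem_head.
    have [i1 E1] := IH (fun x xc => sub x (mem_behead (s := q :: c') xc)).
    have eqf w : B p.2 w * step_rv B (q :: c') w =
        q.1 * (B p.2 w * B q.2 w) + B p.2 w * step_rv B c' w.
      by rewrite /step_rv big_cons; ring.
    have i2 := iBB _ _ pc qc; have i3 := integrableRZ q.1 i2.
    under [X in EFin \o X]eq_fun do rewrite eqf.
    under eq_Rintegral do rewrite eqf.
    split; first exact: integrableRD.
    rewrite RintegralD// (RintegralZl _ measurableT i2) E1.
    rewrite bifBm_cov_int ?cT// /step_vec big_cons ipDr ipZr.
    by rewrite (completion_ip hV) ?cT.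
  elim: c1 => [|q c1 IH] sub1 sub2.
    rewrite /step_rv /step_vec; under [X in EFin \o X]eq_fun do rewrite big_nil mul0r.
    under eq_Rintegral do rewrite big_nil mul0r.
    rewrite Rintegral_cst// mul0r big_nil ip0l; split => //.
    exact: integrable0.
  have qc : q \in c by apply: sub1; rewrite mem_head.
  have [i1 E1] := IH (fun x xc => sub1 x (mem_behead (s := q :: c1) xc)) sub2.
  have [i2 E2] := iE q c2 qc sub2.
  have eqf w : step_rv B (q :: c1) w * step_rv B c2 w =
      q.1 * (B q.2 w * step_rv B c2 w) + step_rv B c1 w * step_rv B c2 w.
    by rewrite /step_rv big_cons; ring.
  have i3 := integrableRZ q.1 i2.
  under [X in EFin \o X]eq_fun do rewrite eqf.
  under eq_Rintegral do rewrite eqf.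
  split; first exact: integrableRD.
  by rewrite RintegralD// (RintegralZl _ measurableT i2) E1 E2 /step_vec big_cons ipDl ipZl.
have [iS ES] := EE c c (fun _ => id) (fun _ => id).
by split; [split => //; exact: measurable_step_rv|rewrite -ES].
Qed.

Lemma step_rv_law c : times_in T c -> exists2 s : R,
  (forall A, measurable A -> P (step_rv B c @^-1` A) = gaussian_law 0 s A) &
  s ^+ 2 = ip (step_vec e c) (step_vec e c).
Proof.
move=> cT; have [m [s law]] := bifBm_gaussian hB cT.
have [sS ES] := step_rv_sqr cT.
have mS := measurable_step_rv c.
have [iS mE] := gaussian_law_mean mS law.
have m0 : m = 0.
  rewrite -mE /step_rv.
  have h : {in c, forall p, integrableR P (B p.2) /\ \int[P]_w B p.2 w = 0}.
    move=> p pc; have [sB B0] := bifBm_sqint (cT _ pc).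
    by split => //; exact: sqint_integrable.
  suff key (c' : seq (R * R)) :
      {in c', forall p, integrableR P (B p.2) /\ \int[P]_w B p.2 w = 0} ->
      integrableR P (fun w => \sum_(p <- c') p.1 * B p.2 w) /\
      \int[P]_w (\sum_(p <- c') p.1 * B p.2 w) = 0 by case: (key c h).
  elim: c' => [|p c' IH] {}h.
    under [X in EFin \o X]eq_fun do rewrite big_nil.
    under eq_Rintegral do rewrite big_nil.
    by rewrite Rintegral_cst// mul0r; split => //; exact: integrable0.
  have [i1 E1] := IH (fun x xc => h x (mem_behead (s := p :: c') xc)).
  have [i2 E2] := h p (mem_head _ _).
  under [X in EFin \o X]eq_fun do rewrite big_cons.
  under eq_Rintegral do rewrite big_cons.
  have i3 := integrableRZ p.1 i2.
  split; first exact: integrableRD.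
  by rewrite RintegralD// (RintegralZl _ measurableT i2) E1 E2 mulr0 addr0.
exists s; first by rewrite -m0.
by rewrite -ES -(gaussian_law_var mS law m0).
Qed.

(* [X] is a version of the Wiener integral of [h]. *)
Definition isonormal (h : V) (X : Omega -> R) :=
  measurable_fun setT X /\ exists c : nat -> seq (R * R),
  [/\ forall n, times_in T (c n), step_vec e (c n) @[n --> \oo] --> h,
   forall n, sqint P (fun w => step_rv B (c n) w - X w) &
   \int[P]_w (step_rv B (c n) w - X w) ^+ 2 @[n --> \oo] --> 0].

(** Convergence of the distances makes them finite only eventually; dropping the first N
    approximations makes every difference square-integrable. *)
Lemma wiener_integral_isonormal h (X : {RV P >-> R}) :
  wiener_integral T B e h X -> isonormal h X.
Proof.
move=> [c [cT ch cX]]; have mX : measurable_fun setT X by exact: measurable_funPT.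
split => //.
have mSX n : measurable_fun setT (fun w => step_rv B (c n) w - X w).
  by apply: measurable_funB => //; exact: measurable_step_rv.
have small (r : R) : 0 < r -> \forall n \near \oo,
    (L2_dist P (step_rv B (c n)) X < r%:E)%E.
  move=> r0; have h0 : nbhs (0%:E : \bar R) [set y | (y < r%:E)%E].
    exact: (nbhs_open_ereal_lt (f := fun=> r)).
  exact: cX h0.
have [N _ hN] := small 1 ltr01.
have sSX n : sqint P (fun w => step_rv B (c (n + N)%N) w - X w).
  by have [] := Lnorm2_ltP (mSX _) ltr01 (hN (n + N)%N (leq_addl _ _)).
exists (fun n => c (n + N)%N); split => //.
- by rewrite (cvg_shiftn N (fun n => step_vec e (c n))).
- apply/cvgrPdist_lt => r r0; have r20 : 0 < Num.sqrt r by rewrite sqrtr_gt0.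
  have [M _ hM] := small _ r20; exists M => // n /= Mn.
  rewrite sub0r normrN ger0_norm; last by apply: Rintegral_ge0 => w _; exact: sqr_ge0.
  have [_] := Lnorm2_ltP (mSX _) r20 (hM (n + N)%N (leq_trans Mn (leq_addr _ _))).
  by rewrite sqr_sqrtr// ltW.
Qed.

Lemma isonormal_bifBm t : t \in `[0, T] -> isonormal (e t) (B t).
Proof.
move=> tT; split; first exact: measurable_funPT.
have SB w : step_rv B [:: (1, t)] w - B t w = 0.
  by rewrite /step_rv big_seq1 mul1r subrr.
exists (fun=> [:: (1, t)]); split.
- by move=> n p; rewrite inE => /eqP ->.
- by rewrite /step_vec; under eq_fun do rewrite big_seq1 scale1r; exact: cvg_cst.
- move=> n; apply: (@sqint_bounded _ _ _ _ _ 0); last by move=> w; rewrite SB normr0.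
  by apply: measurable_funB; [exact: measurable_step_rv|exact: measurable_funPT].
- under eq_fun do under eq_Rintegral do rewrite SB expr0n/=.
  by under eq_fun do rewrite Rintegral_cst// mul0r; exact: cvg_cst.
Qed.

(** The approximating lists are rescaled and concatenated; the errors add up by (p + q)^2 <= 2 p^2 +
    2 q^2. *)
Lemma isonormal_linear a b h k X Y : isonormal h X -> isonormal k Y ->
  isonormal (a *: h + b *: k) (fun w => a * X w + b * Y w).
Proof.
move=> [mX [c [cT ch sc cX]]] [mY [c' [cT' ch' sc' cY]]].
split; first by apply: measurable_funD; exact: measurable_funM.
pose sc_ (r : R) := map (fun p : R * R => (r * p.1, p.2)).
have sT r cc : times_in T cc -> times_in T (sc_ r cc).
  by move=> ccT p /mapP[q qc ->]; exact: (ccT q qc).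
have vE r cc : step_vec e (sc_ r cc) = r *: step_vec e cc.
  by rewrite /step_vec big_map scaler_sumr; apply: eq_bigr => p _; rewrite scalerA.
have rE r cc w : step_rv B (sc_ r cc) w = r * step_rv B cc w.
  by rewrite /step_rv big_map mulr_sumr; apply: eq_bigr => p _; rewrite mulrA.
have rcat c1 c2 w : step_rv B (c1 ++ c2) w = step_rv B c1 w + step_rv B c2 w.
  by rewrite /step_rv big_cat.
have vcat c1 c2 : step_vec e (c1 ++ c2) = step_vec e c1 + step_vec e c2.
  by rewrite /step_vec big_cat.
have rE' n w : step_rv B (sc_ a (c n) ++ sc_ b (c' n)) w - (a * X w + b * Y w) =
    a * (step_rv B (c n) w - X w) + b * (step_rv B (c' n) w - Y w).
  rewrite rcat !rE; ring.
have sq n : sqint P (fun w => a * (step_rv B (c n) w - X w) + b * (step_rv B (c' n) w - Y w)).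
  by apply: sqintD; exact: sqintZ.
exists (fun n => sc_ a (c n) ++ sc_ b (c' n)); split.
- by move=> n p; rewrite mem_cat => /orP[]; exact: sT.
- rewrite (_ : (fun n => _) = (fun n => a *: step_vec e (c n) + b *: step_vec e (c' n))).
    by apply: cvgD; apply: cvgZr.
  by apply/funext => n; rewrite vcat !vE.
- by move=> n; under eq_fun do rewrite rE'.
- under eq_fun do under eq_Rintegral do rewrite rE'.
  apply: (@squeeze_cvgr _ _ _ _ (fun=> 0) (fun n =>
    2 * a ^+ 2 * \int[P]_w (step_rv B (c n) w - X w) ^+ 2 +
    2 * b ^+ 2 * \int[P]_w (step_rv B (c' n) w - Y w) ^+ 2)).
  + apply: nearW => n; rewrite Rintegral_ge0/=; last by move=> w _; exact: sqr_ge0.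
    have [_ i1] := sc n; have [_ i2] := sc' n.
    rewrite -(RintegralZl _ measurableT i1) -(RintegralZl _ measurableT i2).
    rewrite -RintegralD//; [|exact: integrableRZ|exact: integrableRZ].
    apply: le_Rintegral => //; first by case: (sq n).
      by apply: integrableRD; exact: integrableRZ.
    move=> w _; set p := _ - X w; set q := _ - Y w.
    by have := sqr_ge0 (a * p - b * q); nra.
  + exact: cvg_cst.
  + rewrite (_ : 0 = 2 * a ^+ 2 * 0 + 2 * b ^+ 2 * 0); last by rewrite !mulr0 addr0.
    by apply: cvgD; apply: cvgMr.
Qed.

Lemma isonormal_sqint h X : isonormal h X -> sqint P X.
Proof.
move=> [mX [c [cT ch sc cX]]].
have [sS _] := step_rv_sqr (cT 0%N).
have := sqintB sS (sc 0%N).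
by under eq_fun do rewrite opprB addrC subrK.
Qed.

(** Both sides are limits of the isometry on step elements; the cross term between the error and X
    vanishes by Cauchy-Schwarz. *)
Lemma isonormal_sqr h X : isonormal h X -> \int[P]_w X w ^+ 2 = ip h h.
Proof.
move=> GX; have sX := isonormal_sqint GX; have [mX [c [cT ch sc cX]]] := GX.
have h1 := cvg_ip_sqr normE ch.
have h2 : ip (step_vec e (c n)) (step_vec e (c n)) @[n --> \oo] --> \int[P]_w X w ^+ 2.
  have E n : ip (step_vec e (c n)) (step_vec e (c n)) = \int[P]_w (step_rv B (c n) w - X w) ^+ 2 +
     2 * \int[P]_w ((step_rv B (c n) w - X w) * X w) + \int[P]_w X w ^+ 2.
    have [sS <-] := step_rv_sqr (cT n).
    have [_ i1] := sc n; have [_ i2] := sX; have i3 := sqint_mul (sc n) sX.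
    rewrite -(RintegralZl _ measurableT i3) -RintegralD//; last exact: integrableRZ.
    rewrite -RintegralD//; last by apply: integrableRD => //; exact: integrableRZ.
    by apply: eq_Rintegral => w _; ring.
  rewrite (_ : (fun n => ip _ _) = (fun n => \int[P]_w (step_rv B (c n) w - X w) ^+ 2 +
     2 * \int[P]_w ((step_rv B (c n) w - X w) * X w) + \int[P]_w X w ^+ 2)).
    2: exact/funext.
  rewrite -[X in _ --> X]add0r; apply: cvgD; last exact: cvg_cst.
  rewrite -[X in _ --> X](addr0 0); apply: cvgD => //.
  rewrite -(mulr0 2); apply: cvgMr; apply: norm_cvg0.
  apply: (@squeeze_cvgr _ _ _ _ (fun=> 0) (fun n =>
    Num.sqrt (\int[P]_w (step_rv B (c n) w - X w) ^+ 2) * Num.sqrt (\int[P]_w X w ^+ 2))).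
  - by apply: nearW => n; rewrite normr_ge0; exact: Rintegral_cauchy.
  - exact: cvg_cst.
  - rewrite -(mul0r (Num.sqrt (\int[P]_w X w ^+ 2))) -{1}sqrtr0; apply: cvgMl.
    exact: (continuous_cvg_seq (@sqrt_continuous R 0) cX).
exact: (cvg_unique _ h2 h1).
Qed.

Lemma normr_cosB (x y : R) : `|cos x - cos y| <= `|x - y|.
Proof.
wlog xy : x y / x <= y.
  move=> H; have [/H//|/ltW/H] := leP x y.
  by rewrite distrC [in leRHS]distrC.
have [] := @MVT_segment R cos (fun x => - sin x) x y xy.
- by apply: continuous_subspaceT => z; exact: continuous_cos.
- move=> z _; rewrite distrC => ->; rewrite normrM normrN [in leRHS]distrC.
  by rewrite ler_piMl// sin_max.
Qed.

(** The cosine is 1-Lipschitz, so the formula for step elements survives the L^2 limit. With its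
    free phase it is the characteristic function, the only form in which Gaussianity enters the
    integration by parts. *)
Lemma isonormal_cos h X theta : isonormal h X ->
  \int[P]_w cos (X w + theta) = cos theta * expR (- (ip h h / 2)).
Proof.
move=> GX; have [mX [c [cT ch sc cX]]] := GX.
have mcos (Y : Omega -> R) : measurable_fun setT Y -> measurable_fun setT (fun w => cos (Y w + theta)).
  move=> mY; apply: (measurableT_comp (f := cos)).
    by apply: continuous_measurable_fun; exact: continuous_cos.
  exact: measurable_funD.
have icos (Y : Omega -> R) : measurable_fun setT Y -> integrableR P (fun w => cos (Y w + theta)).
  by move=> mY; apply: (@integrableR_bounded _ _ _ _ _ 1); [exact: mcos|move=> w; exact: cos_max].
have mS n := measurable_step_rv (c n).
have h1 : \int[P]_w cos (step_rv B (c n) w + theta) @[n --> \oo] --> cos theta * expR (- (ip h h / 2)).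
  have E n : \int[P]_w cos (step_rv B (c n) w + theta) =
      cos theta * expR (- (ip (step_vec e (c n)) (step_vec e (c n)) / 2)).
    by have [s law <-] := step_rv_law (cT n); exact: gaussian_law_cos (mS n) law erefl _.
  under eq_fun do rewrite E.
  apply: cvgMr; apply: (continuous_cvg_seq (h := expR)); first exact: continuous_expR.
  by apply: cvgN; apply: cvgMl; exact: (cvg_ip_sqr normE ch).
have h2 : \int[P]_w cos (step_rv B (c n) w + theta) @[n --> \oo] --> \int[P]_w cos (X w + theta).
  apply/subr_cvg0; apply: norm_cvg0.
  apply: (@squeeze_cvgr _ _ _ _ (fun=> 0) (fun n =>
    Num.sqrt (\int[P]_w (step_rv B (c n) w - X w) ^+ 2))).
  - apply: nearW => n; rewrite normr_ge0/= -RintegralB ?icos//.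
    apply: le_trans (Rintegral_norm_le_sqrt (sc n)).
    apply: Rintegral_bound; first by apply: measurable_funB; exact: mcos.
      by apply: integrableR_norm; apply: sqint_integrable; exact: sc.
    by move=> w; apply: (le_trans (normr_cosB _ _)); rewrite opprD addrACA subrr addr0.
  - exact: cvg_cst.
  - by have := continuous_cvg_seq (@sqrt_continuous R 0) cX; rewrite sqrtr0.
exact: (cvg_unique _ h2 h1).
Qed.

End isonormal.

(** * Uniqueness of characteristic functions *)

Section approximate_identity.
Context {R : realType}.
Notation leb := (@lebesgue_measure R).

Lemma integral_shift_ge0 (G : R -> R) (m : R) : continuous G ->
  (forall x, 0 <= G x) ->
  (\int[leb]_x (G (x - m))%:E = \int[leb]_x (G x)%:E)%E.
Proof.
move=> cG G0.
pose F (x : R) := x - m.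
have dF (x : R) : is_derive x 1 F 1 by apply: is_derive_eq; rewrite subr0.
have F'E : F^`()%classic = cst 1 by apply/funext => x; rewrite derive1E; exact: derive_val.
rewrite [RHS](@increasing_ge0_integration_by_substitutionT R F G)//.
- by apply: eq_integral => x _; rewrite F'E mulrfctE /= mulr1.
- by move=> x y xy; rewrite /F ltrD2r.
- by rewrite F'E => x; exact: cvg_cst.
- by rewrite F'E; exact: is_cvg_cst.
- by rewrite F'E; exact: is_cvg_cst.
- exact: cvg_addrr_Ny.
- exact: cvg_addrr.
Qed.

Lemma Rintegral_shift_ge0 (G : R -> R) (m : R) : continuous G ->
  (forall x, 0 <= G x) -> integrableR leb G ->
  integrableR leb (fun x => G (x - m)) /\
  \int[leb]_x G (x - m) = \int[leb]_x G x.
Proof.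
move=> cG G0 iG; have h := integral_shift_ge0 m cG G0.
split; last by rewrite /Rintegral h.
have mG : measurable_fun setT (fun x : R => G (x - m)).
  apply: measurableT_comp; last exact: measurable_funB.
  exact: continuous_measurable_fun.
apply/integrableP; split; first exact/measurable_EFinP.
rewrite /=; under eq_integral do rewrite ger0_norm//.
rewrite h; case/integrableP : iG => _; apply: le_lt_trans.
by under [leRHS]eq_integral do rewrite /= ger0_norm//.
Qed.

Lemma integral_gaussf_center (a y : R) : 0 < a ->
  integrableR leb (fun z => gaussf a (z - y)) /\
  \int[leb]_z gaussf a (z - y) = Num.sqrt (pi / a).
Proof.
move=> a0; rewrite -integral_gaussf//; apply: Rintegral_shift_ge0.
- exact: continuous_gaussf.
- by move=> x; rewrite ltW// gaussf_gt0.
- exact: integrable_gaussf.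
Qed.

Lemma sqrt_pi_inv n : Num.sqrt (n.+1%:R / pi) * Num.sqrt (pi / n.+1%:R) = 1 :> R.
Proof.
have pi0 : 0 < pi :> R := pi_gt0 R.
rewrite -sqrtrM ?divr_ge0 ?(ltW pi0)//.
by rewrite (_ : _ * _ = 1) ?sqrtr1// -[X in _ * X]invf_div mulfV// mulf_neq0 ?invr_neq0// gt_eqF.
Qed.

Lemma gaussf_approx_bound (F : R -> R) (M y : R) n : measurable_fun setT F ->
  (forall x, `|F x| <= M) ->
  `|Num.sqrt (n.+1%:R / pi) * \int[leb]_z (F z * gaussf n.+1%:R (z - y))| <= M.
Proof.
move=> mF FM; have [j0 J0] := @integral_gaussf_center n.+1%:R y (ltr0Sn _ _).
rewrite normrM ger0_norm ?sqrtr_ge0//.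
have -> : M = Num.sqrt (n.+1%:R / pi) * \int[leb]_z (M * gaussf n.+1%:R (z - y)).
  by rewrite (RintegralZl _ measurableT j0) J0 mulrCA sqrt_pi_inv mulr1.
rewrite ler_wpM2l ?sqrtr_ge0//; apply: Rintegral_bound.
- by apply: measurable_funM => //; exact: integrableR_measurable j0.
- exact: integrableRZ.
- by move=> z; rewrite normrM (ger0_norm (ltW (gaussf_gt0 _ _))) ler_wpM2r// ltW// gaussf_gt0.
Qed.

Lemma gaussf_approx_id (F : R -> R) (M y : R) : measurable_fun setT F ->
  (forall x, `|F x| <= M) -> {for y, continuous F} ->
  Num.sqrt (n.+1%:R / pi) * \int[leb]_z (F z * gaussf n.+1%:R (z - y))
    @[n --> \oo] --> F y.
Proof.
move=> mF FM cF.
have pi0 : 0 < pi :> R := pi_gt0 R.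
have i0 n := @integral_gaussf_center n.+1%:R y (ltr0Sn _ _).
have i2 n : integrableR leb (fun z => (z - y) ^+ 2 * gaussf n.+1%:R (z - y)) /\
    \int[leb]_z ((z - y) ^+ 2 * gaussf n.+1%:R (z - y)) =
      (2 * n.+1%:R)^-1 * Num.sqrt (pi / n.+1%:R).
  have <- : \int[leb]_z (z ^+ 2 * gaussf n.+1%:R z) = (2 * n.+1%:R)^-1 * Num.sqrt (pi / n.+1%:R).
    rewrite integral_exprn_gaussf// div1r; congr (_ * _).
    by under eq_Rintegral do rewrite expr0 mul1r; exact: integral_gaussf.
  apply: (Rintegral_shift_ge0 (G := fun z => z ^+ 2 * gaussf n.+1%:R z)).
  - exact: continuous_exprn_gaussf.
  - by move=> x; rewrite mulr_ge0 ?sqr_ge0// ltW// gaussf_gt0.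
  - exact: integrable_exprn_gaussf.
have peak n : Num.sqrt (n.+1%:R / pi) * Num.sqrt (pi / n.+1%:R) = 1 :> R := @sqrt_pi_inv n.
have M0 : 0 <= M := le_trans (normr_ge0 _) (FM 0).
apply/cvgrPdist_le => eps eps0.
have eps20 : 0 < eps / 2 by rewrite divr_gt0.
move/cvgrPdist_le : cF => /(_ _ eps20)/nbhs_ballP[r /= r0 hr].
(* Near y continuity gives eps / 2. At distance at least r from y the bound 2 M is paid for by (z -
   y)^2 / r^2, whose average under the kernel is of order 1 / n. *)
have key z : `|F y - F z| <= eps / 2 + 2 * M / r ^+ 2 * (z - y) ^+ 2.
  have [zr|zr] := ltP `|y - z| r.
    have := hr z zr; move=> h; apply: (le_trans h).
    by rewrite lerDl mulr_ge0 ?sqr_ge0// divr_ge0 ?sqr_ge0// mulr_ge0.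
  apply: (@le_trans _ _ (2 * M)).
    by apply: (le_trans (ler_normB _ _)); rewrite mulr_natl mulr2n lerD.
  rewrite -[leLHS]add0r lerD ?(ltW eps20)// mulrAC ler_pdivlMr ?exprn_gt0//.
  rewrite ler_wpM2l ?mulr_ge0// -[leRHS]real_normK ?num_real// distrC.
  by rewrite lerXn2r ?nnegrE// ltW.
have bound n : `|F y - Num.sqrt (n.+1%:R / pi) * \int[leb]_z (F z * gaussf n.+1%:R (z - y))|
    <= eps / 2 + M / r ^+ 2 / n.+1%:R.
  have [j0 J0] := i0 n; have [j2 J2] := i2 n.
  have g0 z : 0 <= gaussf n.+1%:R (z - y) by rewrite ltW// gaussf_gt0.
  have mg : measurable_fun setT (fun z : R => gaussf n.+1%:R (z - y)) := integrableR_measurable j0.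
  have jF : integrableR leb (fun z => F z * gaussf n.+1%:R (z - y)).
    apply: (integrableR_dominated _ (integrableRZ M j0)); first exact: measurable_funM.
    by move=> z; rewrite normrM (ger0_norm (g0 z)) ler_wpM2r.
  have -> : F y = Num.sqrt (n.+1%:R / pi) * \int[leb]_z (F y * gaussf n.+1%:R (z - y)).
    by rewrite (RintegralZl _ measurableT j0) J0 mulrCA peak mulr1.
  have jy := integrableRZ (F y) j0.
  rewrite -mulrBr -RintegralB// normrM ger0_norm ?sqrtr_ge0//.
  have -> : eps / 2 + M / r ^+ 2 / n.+1%:R = Num.sqrt (n.+1%:R / pi) *
      \int[leb]_z (eps / 2 * gaussf n.+1%:R (z - y) +
        2 * M / r ^+ 2 * ((z - y) ^+ 2 * gaussf n.+1%:R (z - y))).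
    rewrite RintegralD//; [|exact: integrableRZ|exact: integrableRZ].
    rewrite (RintegralZl _ measurableT j0) (RintegralZl _ measurableT j2) J0 J2.
    rewrite mulrDr mulrCA peak mulr1; congr (_ + _).
    rewrite [RHS](_ : _ = 2 * M / r ^+ 2 * (2 * n.+1%:R)^-1 *
      (Num.sqrt (n.+1%:R / pi) * Num.sqrt (pi / n.+1%:R))); last by ring.
    by rewrite peak mulr1; field; rewrite !gt_eqF ?andbT.
  rewrite ler_wpM2l ?sqrtr_ge0//; apply: Rintegral_bound.
  - by apply: measurable_funB; apply: measurable_funM.
  - by apply: integrableRD; exact: integrableRZ.
  - by move=> z; rewrite -mulrBl normrM (ger0_norm (g0 z)) mulrA -mulrDl ler_wpM2r// key.
have c0 : M / r ^+ 2 / n.+1%:R @[n --> \oo] --> 0.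
  by rewrite -(mulr0 (M / r ^+ 2)); apply: cvgMr; exact: cvg_harmonic.
move/cvgrPdist_le : c0 => /(_ _ eps20); apply: filterS => n hn.
apply: (le_trans (bound n)); rewrite [leRHS]splitr lerD2l.
by apply: le_trans hn; rewrite sub0r normrN ler_norm.
Qed.

End approximate_identity.

Lemma cosM_sum {R : realType} (x y : R) : cos x * cos y = (cos (x + y) + cos (x - y)) / 2.
Proof. by rewrite cosD cosB; field. Qed.

Section trig_uniqueness.
Context {R : realType} d (S : measurableType d)
  (mu : {sigma_finite_measure set S -> \bar R}) (n : nat).
Variable Y : 'I_n -> S -> R.
Hypothesis mY : forall i, measurable_fun setT (Y i).
Notation leb := (@lebesgue_measure R).

Let trunc k (y : 'rV[R]_n) : 'rV[R]_n := \row_i (if (i < k)%N then y 0 i else 0).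

Let upd (i0 : 'I_n) (y : 'rV[R]_n) (z : R) : 'rV[R]_n :=
  \row_i (if i == i0 then z else y 0 i).

Let continuous_upd1 i0 z : continuous (fun y : 'rV[R]_n => upd i0 y z).
Proof.
move=> y; apply/(cvgrPdist_lt (FF := nbhs_filter y)) => eps eps0.
apply/nbhs_ballP; exists eps => //= y' hy.
rewrite /Num.Def.normr/= mx_normrE; apply: bigmax_lt => // -[i j] _ /=.
rewrite !mxE; case: eqP => _; first by rewrite subrr normr0.
move: hy; rewrite mx_norm_ball /ball_/=; apply: le_lt_trans.
rewrite /Num.Def.normr/= mx_normrE.
by apply: le_trans (le_bigmax _ _ (ord0, j)); rewrite !mxE.
Qed.

Let continuous_upd2 i0 (y : 'rV[R]_n) : continuous (upd i0 y).
Proof.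
move=> z; apply/cvgrPdist_lt => eps eps0; apply/nbhs_ballP; exists eps => //= z' hz.
rewrite /Num.Def.normr/= mx_normrE; apply: bigmax_lt => // -[i j] _ /=.
by rewrite !mxE; case: eqP => _; [exact: hz|rewrite subrr normr0].
Qed.

Let measurable_cos_comp (X : S -> R) : measurable_fun setT X ->
  measurable_fun setT (fun s => cos (X s)).
Proof.
move=> mX; apply: (measurableT_comp (f := cos)) => //.
by apply: continuous_measurable_fun; exact: continuous_cos.
Qed.

(** By the product-to-sum formula, multiplying [Phi] by a cosine of one coordinate preserves the
    trigonometric hypothesis; this is what feeds the induction on the coordinates. *)
Let trig_step (Phi : S -> R) i0 (xi0 th0 : R) : integrableR mu Phi ->
  (forall (xi : 'I_n -> R) th,
    \int[mu]_s (Phi s * cos (\sum_i xi i * Y i s + th)) = 0) ->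
  forall (xi : 'I_n -> R) th,
    \int[mu]_s (Phi s * cos (xi0 * Y i0 s + th0) * cos (\sum_i xi i * Y i s + th)) = 0.
Proof.
move=> iPhi h xi th.
have mlin (xi' : 'I_n -> R) th' : measurable_fun setT (fun s => \sum_i xi' i * Y i s + th').
  apply: measurable_funD => //; apply: measurable_sum => i.
  exact: measurable_funM.
have ic (xi' : 'I_n -> R) th' : integrableR mu (fun s => Phi s * cos (\sum_i xi' i * Y i s + th')).
  apply: (integrableR_dominated _ (integrableR_norm iPhi)).
    apply: measurable_funM; first exact: integrableR_measurable iPhi.
    by apply: measurable_cos_comp; exact: mlin.
  by move=> s; rewrite normrM ler_piMr// cos_max.
pose xp i := xi i + (if i == i0 then xi0 else 0).
pose xm i := xi i - (if i == i0 then xi0 else 0).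
have sE (sg : R) s : \sum_i (xi i + sg * (if i == i0 then xi0 else 0)) * Y i s =
    \sum_i xi i * Y i s + sg * (xi0 * Y i0 s).
  under eq_bigr do rewrite mulrDl.
  rewrite big_split/=; congr (_ + _).
  rewrite (bigD1 i0)//= eqxx big1 ?addr0 ?mulrA// => i /negbTE ->.
  by rewrite mulr0 mul0r.
have E s : Phi s * cos (xi0 * Y i0 s + th0) * cos (\sum_i xi i * Y i s + th) =
   2^-1 * (Phi s * cos (\sum_i (xi i + 1 * (if i == i0 then xi0 else 0)) * Y i s + (th + th0))) +
   2^-1 * (Phi s * cos (\sum_i (xi i + -1 * (if i == i0 then xi0 else 0)) * Y i s + (th - th0))).
  rewrite !sE -mulrA [cos (_ + th0) * _]mulrC cosM_sum.
  rewrite (_ : _ + (xi0 * Y i0 s + th0) = \sum_i xi i * Y i s + 1 * (xi0 * Y i0 s) + (th + th0)); last by ring.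
  rewrite (_ : _ - (xi0 * Y i0 s + th0) = \sum_i xi i * Y i s + -1 * (xi0 * Y i0 s) + (th - th0)); last by ring.
  by field.
under eq_Rintegral do rewrite E.
have i1 := ic (fun i => xi i + 1 * (if i == i0 then xi0 else 0)) (th + th0).
have i2 := ic (fun i => xi i + -1 * (if i == i0 then xi0 else 0)) (th - th0).
rewrite RintegralD//; [|exact: integrableRZ|exact: integrableRZ].
by rewrite (RintegralZl _ measurableT i1) (RintegralZl _ measurableT i2) !h !mulr0 addr0.
Qed.

(** Induction on the number of coordinates on which g depends. The induction hypothesis is used with
    the last coordinate frozen at z and with [Phi] multiplied by a cosine of that coordinate;
    Gaussian averages, first over the frequency and then over z, unfreeze it. *)
Let trig_unique_trunc k (Phi : S -> R) : integrableR mu Phi ->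
  (forall (xi : 'I_n -> R) th,
    \int[mu]_s (Phi s * cos (\sum_i xi i * Y i s + th)) = 0) ->
  forall (g : 'rV[R]_n -> R) (M : R), continuous g -> (forall y, `|g y| <= M) ->
    (forall y, g y = g (trunc k y)) ->
    \int[mu]_s (Phi s * g (\row_i Y i s)) = 0.
Proof.
elim: k Phi => [|k IH] Phi iPhi h g M cg gM gk.
  have g0 s : g (\row_i Y i s) = g 0.
    by rewrite gk; congr g; apply/rowP => i; rewrite !mxE.
  under eq_Rintegral do rewrite g0 mulrC.
  rewrite (RintegralZl _ measurableT iPhi).
  have := h (fun=> 0) 0.
  rewrite [X in X = 0 -> _](_ : _ = \int[mu]_s Phi s) => [->|]; first by rewrite mulr0.
  apply: eq_Rintegral => s _; rewrite big1 ?addr0 ?cos0 ?mulr1// => i _.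
  by rewrite mul0r.
have [kn|nk] := ltnP k n; last first.
  apply: (IH _ iPhi h g M) => // y; rewrite gk; congr g; apply/rowP => i; rewrite !mxE.
  by rewrite (leq_trans (ltn_ord i) nk) (leq_trans (ltn_ord i) (leqW nk)).
pose i0 := Ordinal kn.
have M0 : 0 <= M := le_trans (normr_ge0 _) (gM 0).
have cupd z : continuous (fun y : 'rV[R]_n => g (upd i0 y z)).
  by move=> y; apply: (continuous_comp (@continuous_upd1 i0 z y)); exact: cg.
have IHz (z xi0 th0 : R) :
    \int[mu]_s (Phi s * cos (xi0 * Y i0 s + th0) * g (upd i0 (\row_i Y i s) z)) = 0.
  apply: (IH _ _ (trig_step i0 xi0 th0 iPhi h) (fun y => g (upd i0 y z)) M) => //.
    apply: (integrableR_dominated _ (integrableR_norm iPhi)).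
      apply: measurable_funM; first exact: integrableR_measurable iPhi.
      by apply: measurable_cos_comp; apply: measurable_funD => //; exact: measurable_funM.
    by move=> s; rewrite normrM ler_piMr// cos_max.
  move=> y; rewrite gk [RHS]gk; congr g; apply/rowP => i; rewrite !mxE.
  case: eqP => [//|/eqP ii0]; case: ifP => //; rewrite ltnS leq_eqVlt => /orP[|->//].
  by move=> /eqP ik; move: ii0; rewrite -val_eqE/= ik eqxx.
have mPhi := integrableR_measurable iPhi.
have mgz (z : R) : measurable_fun setT (fun s => g (upd i0 (\row_i Y i s) z)).
  exact: (measurable_continuous_row (cupd z)).
(* Averaging the cosine over its frequency with a Gaussian weight produces a Gaussian bump that
   localizes [Y i0] near z. *)
have mixz a z : 0 < a ->
    \int[mu]_s (Phi s * g (upd i0 (\row_i Y i s) z) * gaussf (4 * a)^-1 (Y i0 s - z)) = 0.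
  move=> a0.
  have : \int[leb]_x \int[mu]_s (Phi s * g (upd i0 (\row_i Y i s) z) * (gaussf a x * cos ((Y i0 s - z) * x + 0))) = 0.
    rewrite (_ : (fun x => _) = fun=> 0); first by rewrite Rintegral_cst// mul0r.
    apply/funext => x.
    transitivity (\int[mu]_s (gaussf a x * (Phi s * cos (x * Y i0 s + - (z * x)) * g (upd i0 (\row_i Y i s) z)))).
      apply: eq_Rintegral => s _.
      rewrite (_ : (Y i0 s - z) * x + 0 = x * Y i0 s + - (z * x)); last by ring.
      ring.
    rewrite RintegralZl ?IHz ?mulr0//.
    apply: (integrableR_dominated _ (integrableRZ M (integrableR_norm iPhi))).
      apply: measurable_funM => //; apply: measurable_funM => //.
      by apply: measurable_cos_comp; apply: measurable_funD => //; exact: measurable_funM.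
    move=> s; rewrite !normrM mulrC ler_pM ?mulr_ge0//.
    by rewrite ler_piMr// cos_max.
  have mF : measurable_fun setT (fun p : R * S => Phi p.2 * g (upd i0 (\row_i Y i p.2) z) *
      (gaussf a p.1 * cos ((Y i0 p.2 - z) * p.1 + 0))).
    apply: measurable_funM.
      apply: measurable_funM; first exact: measurable_snd_comp.
      exact: (measurable_snd_comp (mgz z)).
    apply: measurable_funM.
      exact: (measurable_fst_comp (measurable_gaussf a)).
    apply: (measurableT_comp (f := cos)).
      by apply: continuous_measurable_fun; exact: continuous_cos.
    apply: measurable_funD => //; apply: measurable_funM => //.
    by apply: measurable_funB => //; exact: measurable_snd_comp.
  have -> := @Rintegral_fubini _ _ _ _ _ leb mu _ (gaussf a) (fun s => M * `|Phi s|) mF.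
  - move=> h0.
    have {h0} : \int[mu]_s (Num.sqrt (pi / a) * (Phi s * g (upd i0 (\row_i Y i s) z) * gaussf (4 * a)^-1 (Y i0 s - z))) = 0.
      rewrite -[RHS]h0; apply: eq_Rintegral => s _ /=.
      rewrite RintegralZl//; last exact: integrable_gaussf_cos.
      by rewrite integral_gaussf_cos// cos0 mul1r mulrCA.
    rewrite RintegralZl//.
      move/eqP; rewrite mulf_eq0 => /orP[|/eqP//].
      by rewrite sqrtr_eq0 leNgt divr_gt0// pi_gt0.
    apply: (integrableR_dominated _ (integrableRZ M (integrableR_norm iPhi))).
      apply: measurable_funM => //; first exact: measurable_funM.
      by apply: (measurableT_comp (measurable_gaussf _)); exact: measurable_funB.
    move=> s; rewrite !normrM mulrAC mulrC ler_pM ?mulr_ge0//.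
    rewrite ler_piMr// ger0_norm ?gaussf_le1 ?invr_ge0 ?mulr_ge0 ?(ltW a0)//.
    by rewrite ltW// gaussf_gt0.
  - exact: integrable_gaussf.
  - by apply: integrableRZ; exact: integrableR_norm.
  - move=> x s /=; rewrite !normrM (ger0_norm (ltW (gaussf_gt0 a x))).
    rewrite mulrC ler_pM ?mulr_ge0//; [exact: ltW (gaussf_gt0 _ _)| |].
      by rewrite ler_piMr ?cos_max// ltW// gaussf_gt0.
    by rewrite mulrC ler_wpM2r.
have mgz2 : measurable_fun setT (fun p : S * R => g (upd i0 (\row_i Y i p.1) p.2)).
  have := @measurable_continuous_row R _ (S * R)%type n g
    (fun i p => if i == i0 then p.2 else Y i p.1) cg.
  rewrite (_ : (fun p : S * R => g (upd i0 _ _)) =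
    (fun p : S * R => g (\row_i (if i == i0 then p.2 else Y i p.1)))).
    apply => i; case: eqP => _; first exact: measurable_snd.
    exact: (measurable_fst_comp (mY i)).
  by apply/funext => p; congr g; apply/rowP => i; rewrite !mxE.
(* The factor [gaussf kap z] supplies the integrability in z that Fubini requires; it disappears at
   the end, when kap tends to 0. *)
have mixed kap b : 0 < kap -> 0 < b ->
    \int[mu]_s (Phi s * \int[leb]_z (gaussf kap z * g (upd i0 (\row_i Y i s) z) * gaussf b (z - Y i0 s))) = 0.
  move=> kap0 b0.
  have a0 : 0 < (4 * b)^-1 by rewrite invr_gt0 mulr_gt0.
  have : \int[leb]_z \int[mu]_s (Phi s * (gaussf kap z * g (upd i0 (\row_i Y i s) z) * gaussf b (z - Y i0 s))) = 0.
    rewrite (_ : (fun z => _) = fun=> 0); first by rewrite Rintegral_cst// mul0r.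
    apply/funext => z.
    transitivity (\int[mu]_s (gaussf kap z * (Phi s * g (upd i0 (\row_i Y i s) z) * gaussf (4 * (4 * b)^-1)^-1 (Y i0 s - z)))).
      apply: eq_Rintegral => s _.
      rewrite (_ : (4 * (4 * b)^-1)^-1 = b); last by field; rewrite gt_eqF.
      rewrite (_ : gaussf b (Y i0 s - z) = gaussf b (z - Y i0 s)); first by ring.
      by rewrite /gaussf -[Y i0 s - z]opprB sqrrN.
    rewrite RintegralZl ?mixz ?mulr0//.
    apply: (integrableR_dominated _ (integrableRZ M (integrableR_norm iPhi))).
      apply: measurable_funM => //; first exact: measurable_funM.
      by apply: (measurableT_comp (measurable_gaussf _)); exact: measurable_funB.
    move=> s; rewrite !normrM mulrAC mulrC ler_pM ?mulr_ge0//.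
    rewrite ler_piMr// ger0_norm ?gaussf_le1 ?invr_ge0 ?mulr_ge0 ?(ltW a0)//.
    by rewrite ltW// gaussf_gt0.
  have mF : measurable_fun setT (fun p : S * R => Phi p.1 * (gaussf kap p.2 * g (upd i0 (\row_i Y i p.1) p.2) * gaussf b (p.2 - Y i0 p.1))).
    apply: measurable_funM; first exact: measurable_fst_comp.
    apply: measurable_funM.
      apply: measurable_funM => //.
      exact: (measurable_snd_comp (measurable_gaussf kap)).
    apply: (measurableT_comp (measurable_gaussf b)); apply: measurable_funB => //.
    exact: measurable_fst_comp.
  have <- := @Rintegral_fubini _ _ _ _ _ mu leb _ (fun s => `|Phi s|) (fun z => M * gaussf kap z) mF.
  - move=> h0; rewrite -[RHS]h0; apply: eq_Rintegral => s _ /=.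
    rewrite RintegralZl//.
    apply: (integrableR_dominated _ (integrableRZ M (integrable_gaussf kap0))).
      apply: measurable_funM.
        apply: measurable_funM; first exact: measurable_gaussf.
        exact: measurableT_comp mgz2 (measurable_pair1 s).
      by apply: (measurableT_comp (measurable_gaussf b)); exact: measurable_funB.
    move=> z; rewrite !normrM (ger0_norm (ltW (gaussf_gt0 _ _))) (ger0_norm (ltW (gaussf_gt0 _ _))).
    rewrite [M * _]mulrC -[leRHS]mulr1 ler_pM ?mulr_ge0// ?(ltW (gaussf_gt0 _ _))//.
      by rewrite ler_wpM2l// ltW// gaussf_gt0.
    by rewrite gaussf_le1// ltW.
  - exact: integrableR_norm.
  - by apply: integrableRZ; exact: integrable_gaussf.
  - move=> s z /=; rewrite !normrM (ger0_norm (ltW (gaussf_gt0 _ _))) (ger0_norm (ltW (gaussf_gt0 _ _))).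
    rewrite ler_wpM2l// [M * _]mulrC -[leRHS]mulr1 ler_pM ?mulr_ge0// ?(ltW (gaussf_gt0 _ _))//.
      by rewrite ler_wpM2l// ltW// gaussf_gt0.
    by rewrite gaussf_le1// ltW.
have Yupd s : upd i0 (\row_i Y i s) (Y i0 s) = \row_i Y i s.
  by apply/rowP => i; rewrite !mxE; case: eqP => // ->.
have cz s : continuous (fun z => g (upd i0 (\row_i Y i s) z)).
  by move=> z; apply: (continuous_comp (@continuous_upd2 i0 _ z)); exact: cg.
have mYs : measurable_fun setT (fun s => g (\row_i Y i s)).
  exact: measurable_continuous_row.
have lim1 kap : 0 < kap ->
    \int[mu]_s (Phi s * (gaussf kap (Y i0 s) * g (\row_i Y i s))) = 0.
  move=> kap0.
  pose H m s := Num.sqrt (m.+1%:R / pi) * \int[leb]_z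
    (gaussf kap z * g (upd i0 (\row_i Y i s) z) * gaussf m.+1%:R (z - Y i0 s)).
  have gpi m : 0 <= Num.sqrt (m.+1%:R / pi) :> R by exact: sqrtr_ge0.
  have mFz s : measurable_fun setT (fun z => gaussf kap z * g (upd i0 (\row_i Y i s) z)).
    by apply: measurable_funM; [exact: measurable_gaussf|exact: continuous_measurable_fun].
  have FzM s z : `|gaussf kap z * g (upd i0 (\row_i Y i s) z)| <= M.
    rewrite normrM -[leRHS]mul1r ler_pM// ger0_norm ?gaussf_le1 ?(ltW kap0)//.
    by rewrite ltW// gaussf_gt0.
  have HM m s : `|H m s| <= M by exact: gaussf_approx_bound.
  have mPH m : measurable_fun setT (fun s => Phi s * H m s).
    have mF : measurable_fun setT (fun p : S * R => Phi p.1 * (Num.sqrt (m.+1%:R / pi) *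
        (gaussf kap p.2 * g (upd i0 (\row_i Y i p.1) p.2) * gaussf m.+1%:R (p.2 - Y i0 p.1)))).
      apply: measurable_funM; first exact: measurable_fst_comp.
      apply: measurable_funM => //; apply: measurable_funM.
        apply: measurable_funM => //.
        exact: (measurable_snd_comp (measurable_gaussf kap)).
      apply: (measurableT_comp (measurable_gaussf _)); apply: measurable_funB => //.
      exact: measurable_fst_comp.
    have igk := integrableRZ (Num.sqrt (m.+1%:R / pi) * M) (integrable_gaussf kap0).
    have iz s : integrableR leb (fun z => gaussf kap z * g (upd i0 (\row_i Y i s) z) * gaussf m.+1%:R (z - Y i0 s)).
      have [j0 _] := @integral_gaussf_center R m.+1%:R (Y i0 s) (ltr0Sn _ _).
      apply: (integrableR_dominated _ (integrableRZ M j0)).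
        by apply: measurable_funM; [exact: mFz|exact: integrableR_measurable j0].
      move=> z; rewrite normrM (ger0_norm (ltW (gaussf_gt0 m.+1%:R _))) ler_wpM2r ?FzM//.
      by rewrite ltW// gaussf_gt0.
    have := @measurable_Rintegral1 _ _ _ _ _ mu leb _ _ _ mF (integrableR_norm iPhi) igk.
    rewrite (_ : (fun s => Phi s * H m s) = (fun s => \int[leb]_z (Phi s * (Num.sqrt (m.+1%:R / pi) *
        (gaussf kap z * g (upd i0 (\row_i Y i s) z) * gaussf m.+1%:R (z - Y i0 s)))))); last first.
      apply/funext => s; rewrite RintegralZl//; last exact: integrableRZ.
      by rewrite RintegralZl.
    apply => s z /=; rewrite !normrM (ger0_norm (sqrtr_ge0 _)) ler_wpM2l// -!mulrA ler_wpM2l//.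
    rewrite (ger0_norm (ltW (gaussf_gt0 kap z))) (ger0_norm (ltW (gaussf_gt0 m.+1%:R _))).
    rewrite [leRHS]mulrC ler_wpM2l ?(ltW (gaussf_gt0 _ _))//.
    by rewrite -[leRHS]mulr1 ler_pM ?(ltW (gaussf_gt0 _ _))// gaussf_le1.
  have cH s : H m s @[m --> \oo] --> gaussf kap (Y i0 s) * g (\row_i Y i s).
    rewrite -[X in _ --> _ * g X]Yupd.
    apply: (@gaussf_approx_id _ (fun z => gaussf kap z * g (upd i0 (\row_i Y i s) z)) M).
    - exact: mFz.
    - exact: FzM.
    - by apply: cvgM; [exact: continuous_gaussf|exact: cz].
  have h1 : \int[mu]_s (Phi s * H m s) @[m --> \oo] -->
      \int[mu]_s (Phi s * (gaussf kap (Y i0 s) * g (\row_i Y i s))).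
    apply: (Rintegral_dominated_cvg _ _ (integrableRZ M (integrableR_norm iPhi))).
    - exact: mPH.
    - by move=> s; apply: cvgMr; exact: cH.
    - by move=> m s; rewrite normrM mulrC ler_wpM2r.
  have h2 m : \int[mu]_s (Phi s * H m s) = 0.
    transitivity (\int[mu]_s (Num.sqrt (m.+1%:R / pi) * (Phi s * \int[leb]_z
    (gaussf kap z * g (upd i0 (\row_i Y i s) z) * gaussf m.+1%:R (z - Y i0 s))))).
      by apply: eq_Rintegral => s _; rewrite /H mulrCA.
    have c0 : Num.sqrt (m.+1%:R / pi) != 0 :> R.
      by rewrite sqrtr_eq0 -ltNge divr_gt0// pi_gt0.
    rewrite RintegralZl ?mixed ?mulr0//.
    have := integrableRZ (Num.sqrt (m.+1%:R / pi))^-1 (integrableR_dominated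
      (mPH m) (integrableRZ M (integrableR_norm iPhi)) _).
    under eq_fun do rewrite /= /H mulrCA mulKf//.
    by apply => s; rewrite normrM mulrC ler_wpM2r.
  move: h1; under eq_fun do rewrite h2.
  by move=> h1; apply/esym; exact: (cvg_unique _ (cvg_cst 0) h1).
have h1 : \int[mu]_s (Phi s * (gaussf m.+1%:R^-1 (Y i0 s) * g (\row_i Y i s))) @[m --> \oo] -->
    \int[mu]_s (Phi s * g (\row_i Y i s)).
  apply: (Rintegral_dominated_cvg _ _ (integrableRZ M (integrableR_norm iPhi))).
  - move=> m; apply: measurable_funM => //; apply: measurable_funM => //.
    exact: (measurableT_comp (measurable_gaussf _)).
  - move=> s; apply: cvgMr.
    have c1 : gaussf m.+1%:R^-1 (Y i0 s) @[m --> \oo] --> gaussf 0 (Y i0 s).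
      apply: (continuous_cvg_seq (h := expR)); first exact: continuous_expR.
      by apply: cvgN; apply: cvgMl; exact: cvg_harmonic.
    rewrite [X in _ --> X](_ : _ = gaussf 0 (Y i0 s) * g (\row_i Y i s)).
      by apply: cvgM => //; exact: cvg_cst.
    by rewrite /gaussf mul0r oppr0 expR0 mul1r.
  - move=> m s; rewrite normrM mulrC ler_wpM2r// normrM -[leRHS]mul1r ler_pM//.
    by rewrite ger0_norm ?gaussf_le1// ltW// gaussf_gt0.
move: h1; under eq_fun do rewrite lim1 ?invr_gt0//.
by move=> h1; apply/esym; exact: (cvg_unique _ (cvg_cst 0) h1).
Qed.

Lemma trig_unique (Phi : S -> R) : integrableR mu Phi ->
  (forall (xi : 'I_n -> R) th,
    \int[mu]_s (Phi s * cos (\sum_i xi i * Y i s + th)) = 0) ->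
  forall (g : 'rV[R]_n -> R) (M : R), continuous g -> (forall y, `|g y| <= M) ->
    \int[mu]_s (Phi s * g (\row_i Y i s)) = 0.
Proof.
move=> iPhi h g M cg gM; apply: (@trig_unique_trunc n _ iPhi h g M) => // y.
by congr g; apply/rowP => i; rewrite mxE ltn_ord.
Qed.

End trig_uniqueness.

(** * Gaussian integration by parts *)

(** Difference quotients along 1 / (n + 1), the form that dominated convergence for sequences
    accepts. *)
Lemma is_derive_seq {R : realType} (f : R -> R) (x df : R) : is_derive x 1 f df ->
  n.+1%:R * (f (x + n.+1%:R^-1) - f x) @[n --> \oo] --> df.
Proof.
move=> [dfx dfE].
have h : h^-1 *: (f (h *: 1 + x) - f x) @[h --> 0^'] --> df.
  by rewrite -dfE; exact: dfx.
have {}h := cvg_dnbhs_at_right h.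
move/cvg_at_rightP : h => /(_ (fun n => n.+1%:R^-1)) h.
have : (n.+1%:R^-1)^-1 *: (f (n.+1%:R^-1 *: 1 + x) - f x) @[n --> \oo] --> df.
  apply: h; split => [n|]; last exact: cvg_harmonic.
  by rewrite invr_gt0.
rewrite (_ : (fun n => _) = (fun n => n.+1%:R * (f (x + n.+1%:R^-1) - f x)))//.
by apply/funext => n; rewrite invrK [_%:A]mulr1 [_ + x]addrC.
Qed.

Lemma normr_row_le {R : realType} (n : nat) (v z : 'rV[R]_n) :
  (forall i, `|z 0 i| <= `|v 0 i|) -> `|z| <= `|v|.
Proof.
move=> zv; rewrite /Num.norm/= !mx_normrE; apply: bigmax_le => [|[i j] _].
  exact: bigmax_ge_id.
rewrite (ord1 i) (le_trans (zv j))//.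
exact: (le_bigmax _ (fun ij : 'I_1 * 'I_n => `|v ij.1 ij.2|) (0, j)).
Qed.

Lemma continuous_col' {R : realType} (n : nat) :
  continuous (fun y : 'rV[R]_n.+1 => col' ord0 y : 'rV[R]_n).
Proof.
move=> y; apply/(cvgrPdist_lt (FF := nbhs_filter y)) => eps eps0.
have : \forall z \near y, `|y - z| < eps.
  by apply/nbhs_ballP; exists eps => // z; rewrite -ball_normE.
apply: filterS => z; apply: le_lt_trans.
rewrite /Num.norm/= !mx_normrE; apply: bigmax_le => [|[i j] _]; first exact: bigmax_ge_id.
rewrite !mxE.
have := le_bigmax 0 (fun ij : 'I_1 * 'I_n.+1 => `|(y - z) ij.1 ij.2|) (i, lift ord0 j).
by rewrite /= !mxE.
Qed.

Lemma continuousR_sum {R : realType} (T : topologicalType) (I : Type) (r : seq I)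
    (f : I -> T -> R) : (forall i, continuous (f i)) ->
  continuous (fun y => \sum_(i <- r) f i y).
Proof.
move=> cf y; elim: r => [|i r IH].
  under eq_fun do rewrite big_nil.
  exact: cst_continuous.
under eq_fun do rewrite big_cons.
exact: (cvgD (cf i y) IH).
Qed.

(** * Chain rule from continuous partial derivatives *)

Section partial_derivatives.
Context {R : realType} (n : nat) (g : 'rV[R]_n -> R).
Hypothesis dg : forall y i, derivable g y (delta_mx 0 i).
Hypothesis cg : forall i, continuous (partial i g).

Let is_derive_coord (p : 'rV[R]_n) i (s : R) :
  is_derive s 1 (fun s : R => g (p + s *: delta_mx 0 i)) (partial i g (p + s *: delta_mx 0 i)).
Proof.
have E : (fun h : R => h^-1 *: (((fun s : R => g (p + s *: delta_mx 0 i)) \o shift s) (h *: 1) -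
     g (p + s *: delta_mx 0 i))) =
   (fun h : R => h^-1 *: ((g \o shift (p + s *: delta_mx 0 i)) (h *: delta_mx 0 i) -
     g (p + s *: delta_mx 0 i))).
  apply/funext => h /=; congr (_ *: (g _ - _)).
  by rewrite [h%:A]mulr1 scalerDl addrCA.
split; first by rewrite /derivable E; exact: dg.
by rewrite /derive E.
Qed.

Let trunc k (v : 'rV[R]_n) : 'rV[R]_n := \row_i (if (i < k)%N then v 0 i else 0).

(** The coordinates are moved one at a time. The mean value theorem turns each move into a partial
    derivative at a point y + h z with |z| <= |v|, and continuity of the partials gives the
    limit. *)
Let chain_trunc k (y v : 'rV[R]_n) :
  h^-1 * (g (y + h *: trunc k v) - g y) @[h --> (0:R)^'] -->
  \sum_(i < n | (i < k)%N) v 0 i * partial i g y.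
Proof.
elim: k => [|k IH].
  rewrite big_pred0//; apply: cvg_near_cst; apply: nearW => h.
  rewrite (_ : trunc 0 v = 0); last by apply/rowP => i; rewrite !mxE.
  by rewrite scaler0 addr0 subrr mulr0.
have [kn|nk] := ltnP k n; last first.
  rewrite (_ : trunc k.+1 v = trunc k v).
    rewrite (eq_bigl (fun i : 'I_n => (i < k)%N))// => i.
    by rewrite (leq_trans (ltn_ord i) nk) (leq_trans (ltn_ord i) (leqW nk)).
  by apply/rowP => i; rewrite !mxE (leq_trans (ltn_ord i) nk) (leq_trans (ltn_ord i) (leqW nk)).
pose i0 := Ordinal kn.
have tE : trunc k.+1 v = trunc k v + v 0 i0 *: delta_mx 0 i0.
  apply/rowP => i; rewrite !mxE/= ltnS leq_eqVlt -val_eqE/=.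
  case: (ltngtP i k) => //= ik; rewrite ?mulr0 ?addr0 ?mulr1 ?add0r//.
  by congr (v 0 _); apply/val_inj.
have sE : \sum_(i < n | (i < k.+1)%N) v 0 i * partial i g y =
    \sum_(i < n | (i < k)%N) v 0 i * partial i g y + v 0 i0 * partial i0 g y.
  rewrite (bigD1 i0)//= addrC; congr (_ + _); apply: eq_bigl => i.
  by rewrite -val_eqE/= ltnS ltn_neqAle andbC.
rewrite sE.
have c2 : h^-1 * (g (y + h *: trunc k.+1 v) - g (y + h *: trunc k v)) @[h --> (0:R)^'] -->
    v 0 i0 * partial i0 g y.
  have key (h : R) : exists2 z : 'rV[R]_n, `|z| <= `|v| &
      g (y + h *: trunc k.+1 v) - g (y + h *: trunc k v) = h * v 0 i0 * partial i0 g (y + h *: z).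
    have [] := @MVT_segment R (fun t => g (y + h *: trunc k v + (t * (h * v 0 i0)) *: delta_mx 0 i0))
       (fun t => h * v 0 i0 * partial i0 g (y + h *: trunc k v + (t * (h * v 0 i0)) *: delta_mx 0 i0)) 0 1 ler01.
    - move=> t _.
      have d1 := is_derive_coord (y + h *: trunc k v) i0 (t * (h * v 0 i0)).
      have d2 : is_derive t 1 (fun t => t * (h * v 0 i0)) (h * v 0 i0).
        by apply: is_derive_eq; rewrite /GRing.scale/= mulr1 mulr0 add0r.
      have := @is_derive1_comp R (fun s : R => g (y + h *: trunc k v + s *: delta_mx 0 i0))
        (fun t => t * (h * v 0 i0)) t _ _ d1 d2.
      by rewrite [X in is_derive _ _ _ X -> _]mulrC.
    - apply: derivable_within_continuous => t _.
      have d1 := is_derive_coord (y + h *: trunc k v) i0 (t * (h * v 0 i0)).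
      have d2 : is_derive t 1 (fun t => t * (h * v 0 i0)) (h * v 0 i0).
        by apply: is_derive_eq; rewrite /GRing.scale/= mulr1 mulr0 add0r.
      by have [] := @is_derive1_comp R (fun s : R => g (y + h *: trunc k v + s *: delta_mx 0 i0))
        (fun t => t * (h * v 0 i0)) t _ _ d1 d2.
    - move=> t; rewrite in_itv/= => /andP[t0 t1].
      rewrite mul0r mul1r subr0 mulr1 scale0r addr0 => E.
      exists (trunc k v + (t * v 0 i0) *: delta_mx 0 i0).
        apply: normr_row_le => i; rewrite !mxE/= -val_eqE/=.
        case: (ltngtP i k) => ik; rewrite ?mulr0 ?addr0//.
          by rewrite normr0.
        rewrite mulr1 add0r (_ : i = i0); last exact/val_inj.
        by rewrite normrM ger0_norm// ler_piMl.
      rewrite -addrA -scalerA -scalerDr -tE in E. rewrite E.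
      by rewrite scalerDr addrA scalerA mulrCA.
  apply/cvgrPdist_lt => eps eps0.
  have e1 : 0 < eps / (`|v 0 i0| + 1) by rewrite divr_gt0// ltr_wpDl.
  have /(cvgrPdist_lt (FF := nbhs_filter y)) /(_ _ e1) := @cg i0 y.
  move=> /nbhs_ballP[del /= del0 hdel].
  have d1 : 0 < del / (`|v| + 1) by rewrite divr_gt0// ltr_wpDl.
  near=> h.
  have h0 : h != 0 by near: h; exact: nbhs_dnbhs_neq.
  have hd : `|h| < del / (`|v| + 1).
    near: h; apply: dnbhs0_lt; exact: d1.
  have [z zv ->] := key h.
  rewrite !mulrA mulVf// mul1r -mulrBr normrM.
  rewrite ltr_pdivlMr in hd; last by rewrite ltr_wpDl.
  have : `|partial i0 g y - partial i0 g (y + h *: z)| < eps / (`|v 0 i0| + 1).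
    apply: hdel; rewrite -ball_normE/= opprD addrA subrr sub0r normrN normrZ.
    apply: le_lt_trans hd; rewrite ler_wpM2l//.
    by rewrite (le_trans zv)// lerDl.
  rewrite ltr_pdivlMr ?ltr_wpDl// => ltE.
  apply: le_lt_trans ltE; rewrite mulrC ler_wpM2l//.
  by rewrite lerDl.
rewrite (_ : (fun h => _) = (fun h => h^-1 * (g (y + h *: trunc k v) - g y) +
   h^-1 * (g (y + h *: trunc k.+1 v) - g (y + h *: trunc k v)))).
  exact: cvgD.
by apply/funext => h; ring.
Unshelve. all: by end_near.
Qed.

Lemma is_derive_line (y v : 'rV[R]_n) (s : R) :
  is_derive s 1 (fun s => g (y + s *: v)) (\sum_i v 0 i * partial i g (y + s *: v)).
Proof.
have h := @chain_trunc n (y + s *: v) v.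
have tE : trunc n v = v by apply/rowP => i; rewrite !mxE ltn_ord.
rewrite tE (eq_bigl predT) in h; last by move=> i; rewrite ltn_ord.
have E : (fun h : R => h^-1 *: (((fun s : R => g (y + s *: v)) \o shift s) (h *: 1) - g (y + s *: v))) =
   (fun h => h^-1 * (g (y + s *: v + h *: v) - g (y + s *: v))).
  apply/funext => r; rewrite /GRing.scale/= mulr1; congr (_ * (g _ - _)).
  by rewrite -addrA -!/(_ *: _) -scalerDl [s + r]addrC.
split; first by rewrite /derivable E; apply/cvg_ex; eexists; exact: h.
by rewrite /derive E; exact/cvg_lim.
Qed.

End partial_derivatives.

Section sigma_finite_product.
Context {d1 d2 : measure_display} {T1 : measurableType d1} {T2 : measurableType d2}
  {R : realType} (m1 : {sigma_finite_measure set T1 -> \bar R})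
  (m2 : {sigma_finite_measure set T2 -> \bar R}).

(* The library's canonical sigma-finite structure on [m1 \x m2] is only found
   for subprobability measures. *)
Definition sigma_finite_prod : set (T1 * T2) -> \bar R := (m1 \x m2)%E.

HB.instance Definition _ := Measure.on sigma_finite_prod.

Let sigma_finite_prodT : sigma_finite setT sigma_finite_prod.
Proof.
have /sigma_finiteP[F [FT Fnd Foo]] := sigma_finiteT m1.
have /sigma_finiteP[G [GT Gnd Goo]] := sigma_finiteT m2.
exists (fun n => F n `*` G n) => [|n]; last first.
  have [mF Ffin] := Foo n; have [mG Gfin] := Goo n.
  split; first exact: measurableX.
  by rewrite /sigma_finite_prod product_measure1E// lte_mul_pinfty// ge0_fin_numE.
apply/seteqP; split => // -[x y] _.
have [i _ Fx] : (\bigcup_n F n) x by rewrite -FT.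
have [j _ Gy] : (\bigcup_n G n) y by rewrite -GT.
exists (i + j)%N => //; split => /=.
- by have /subsetPset := Fnd _ _ (leq_addr j i); exact.
- by have /subsetPset := Gnd _ _ (leq_addl i j); exact.
Qed.

HB.instance Definition _ := Measure_isSigmaFinite.Build _ _ _ sigma_finite_prod
  sigma_finite_prodT.

End sigma_finite_product.
Section isonormal_ibp.
Context {R : realType} {d : measure_display} {Omega : measurableType d}
  {P : probability Omega R} {Hu K T : R} {B : R -> {RV P >-> R}}.
Hypothesis hB : is_bifBm Hu K T B.
Context {V : completeNormedModType R} {ip : {dot V for idfun}} {e : R -> V}.
Hypothesis hV : is_completion Hu K T ip e.

(** The derivative of E cos(X + s Z + th) at s = 0 is computed twice: from the closed form of the
    characteristic function, and under the expectation with dominating function |Z|. *)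
Lemma isonormal_sin (h k : V) (X Z : Omega -> R) (th : R) :
  isonormal T B e h X -> isonormal T B e k Z ->
  \int[P]_w (sin (X w + th) * Z w) = ip h k * cos th * expR (- (ip h h / 2)).
Proof.
move=> hX hZ.
have [mX _] := isonormal_sqint hB hV hX; have [mZ _] := isonormal_sqint hB hV hZ.
pose phi (s : R) := cos th * expR (- ((ip h h + 2 * s * ip h k + s ^+ 2 * ip k k) / 2)).
have phiE s : \int[P]_w cos (X w + s * Z w + th) = phi s.
  have := isonormal_cos hB hV th (isonormal_linear 1 s hX hZ).
  under eq_Rintegral do rewrite mul1r.
  move=> ->; rewrite /phi; congr (_ * expR (- (_ / 2))).
  rewrite ipDl !ipDr !ipZl !ipZr (ipC ip k h); ring.
have dphi : is_derive (0:R) 1 phi (- (ip h k * cos th * expR (- (ip h h / 2)))).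
  rewrite /phi; apply: is_derive_eq; rewrite /GRing.scale/=.
  rewrite !(mulr0, mul0r, addr0, expr0n)/=; by field.
have h1 := is_derive_seq dphi.
have mc th' : measurable_fun setT (fun w => cos (X w + th' * Z w + th)).
  apply: measurableT_comp; first exact: continuous_measurable_fun (@continuous_cos R).
  by apply: measurable_funD => //; apply: measurable_funD => //; exact: measurable_funM.
have ic th' : integrableR P (fun w => cos (X w + th' * Z w + th)).
  by apply: (@integrableR_bounded _ _ _ _ _ 1) => // w; exact: cos_max.
have h2 : n.+1%:R * (phi (0 + n.+1%:R^-1) - phi 0) @[n --> \oo] --> \int[P]_w (- (sin (X w + th) * Z w)).
  rewrite (_ : (fun n => _) = (fun n => \int[P]_w (n.+1%:R * (cos (X w + n.+1%:R^-1 * Z w + th) - cos (X w + 0 * Z w + th))))); last first.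
    apply/funext => n; rewrite RintegralZl//; last exact: integrableRB.
    by rewrite RintegralB// !phiE add0r.
  apply: (@Rintegral_dominated_cvg _ _ _ _ _ _ (fun w => `|Z w|)).
  - move=> n; apply: measurable_funM => //; exact: measurable_funB.
  - move=> w.
    have dc : is_derive (0:R) 1 (fun s : R => cos (X w + s * Z w + th)) (- (sin (X w + th) * Z w)).
      apply: is_derive_eq; rewrite /GRing.scale/= mul0r addr0; ring.
    by have := is_derive_seq dc; under eq_fun do rewrite add0r.
  - exact/integrableR_norm/sqint_integrable/(isonormal_sqint hB hV hZ).
  - move=> n w; rewrite normrM normr_nat.
    rewrite -ler_pdivlMl// (le_trans (normr_cosB _ _))//.
    rewrite (_ : _ - _ = n.+1%:R^-1 * Z w); last by ring.
    by rewrite normrM ger0_norm.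
have := cvg_unique _ h1 h2.
rewrite (_ : (fun w => _) = fun w => -1 * (sin (X w + th) * Z w)); last by apply/funext => w; rewrite mulN1r.
rewrite RintegralZl//.
  by rewrite mulN1r => /(_ (@Rhausdorff R) _)/oppr_inj => ->.
apply: sqint_mul; last exact: (isonormal_sqint hB hV hZ).
apply: (@sqint_bounded _ _ _ _ _ 1) => [|w]; last exact: sin_max.
apply: measurableT_comp; first exact: continuous_measurable_fun (@continuous_sin R).
exact: measurable_funD.
Qed.

Lemma isonormal0 : isonormal T B e 0 (fun=> 0).
Proof.
split; first exact: measurable_cst.
exists (fun=> [::]); split.
- by move=> n p; rewrite in_nil.
- by rewrite /step_vec big_nil; exact: cvg_cst.
- move=> n; apply: (@sqint_bounded _ _ _ _ _ 0).
    by rewrite /step_rv; under eq_fun do rewrite big_nil subrr; exact: measurable_cst.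
  by move=> w; rewrite /step_rv big_nil subrr normr0.
- rewrite (_ : (fun n => _) = fun=> 0); first exact: cvg_cst.
  apply/funext => n; rewrite /step_rv; under eq_Rintegral do rewrite big_nil subrr expr0n/=.
  by rewrite Rintegral_cst// mul0r.
Qed.

Lemma isonormal_sum n (h : 'I_n -> V) (X : 'I_n -> Omega -> R) (a : 'I_n -> R) :
  (forall i, isonormal T B e (h i) (X i)) ->
  isonormal T B e (\sum_i a i *: h i) (fun w => \sum_i a i * X i w).
Proof.
elim: n h X a => [|n IH] h X a hX.
  rewrite big_ord0 (_ : (fun _ => _) = fun=> 0); first exact: isonormal0.
  by apply/funext => w; rewrite big_ord0.
have h1 := IH _ _ (fun i => a (widen_ord (leqnSn _) i)) (fun i => hX (widen_ord (leqnSn _) i)).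
have := isonormal_linear 1 (a ord_max) h1 (hX ord_max).
rewrite scale1r -(big_ord_recr n (fun i => a i *: h i)).
rewrite (_ : (fun w => _) = (fun w => \sum_i a i * X i w))//.
by apply/funext => w; rewrite mul1r [RHS]big_ord_recr.
Qed.

Local Notation leb := (@lebesgue_measure R).

(* Adding to X an independent Gaussian multiple of c and letting its variance
   tend to 0 reduces the claim to trigonometric functions, by uniqueness of
   characteristic functions. *)
Lemma isonormal_ibp_dir n (h : 'I_n -> V) (X : 'I_n -> Omega -> R) (k : V) (Z : Omega -> R)
    (G DG : 'rV[R]_n -> R) (M L : R) :
  (forall i, isonormal T B e (h i) (X i)) -> isonormal T B e k Z ->
  continuous G -> continuous DG -> (forall y, `|G y| <= M) -> (forall y, `|DG y| <= L) ->
  (forall y (s : R), is_derive s 1 (fun s : R => G (y + s *: \row_i ip (h i) k))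
     (DG (y + s *: \row_i ip (h i) k))) ->
  \int[P]_w (G (\row_i X i w) * Z w) = \int[P]_w DG (\row_i X i w).
Proof.
move=> hX hZ cG cDG GM DGL dG.
pose c i := ip (h i) k.
have [mZ _] := isonormal_sqint hB hV hZ.
have mX i : measurable_fun setT (X i) by have [] := isonormal_sqint hB hV (hX i).
have iZ : integrableR P Z by exact/sqint_integrable/(isonormal_sqint hB hV hZ).
pose Y i (p : Omega * measurableTypeR R) := X i p.1 + p.2 * c i.
have mY i : measurable_fun setT (Y i).
  apply: measurable_funD; first exact: measurable_fst_comp.
  by apply: measurable_funM => //; exact: measurable_snd_comp.
(* By parts in u, integrating [Phi] times G(Y) amounts to integrating Z G(Y) - DG(Y) against the
   Gaussian weight ([parts]). The derivative has moved from G to the weight, so the identity to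
   prove is linear in G alone and [trig_unique] applies. *)
pose Phi a (p : Omega * measurableTypeR R) := (Z p.1 - 2 * a * p.2) * gaussf a p.2.
have mPhi a : measurable_fun setT (Phi a).
  apply: measurable_funM; last by apply: measurable_snd_comp; exact: measurable_gaussf.
  apply: measurable_funB; first exact: measurable_fst_comp.
  by apply: measurable_funM => //; exact: measurable_snd_comp.
have gsn (a : R) : 0 < a -> integrableR leb (fun u : R => (1 + 2 * a * `|u|) * gaussf a u).
  move=> a0.
  have i1 := integrable_gaussf a0.
  have i2 := integrableRZ (2 * a) (integrableR_norm (integrable_exprn_gaussf 1 a0)).
  apply: (integrableR_dominated _ (integrableRD i1 i2)).
    apply: measurable_funM; last exact: measurable_gaussf.
    apply: measurable_funD => //; apply: measurable_funM => //; exact: measurable_normr.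
  move=> u; rewrite ger0_norm.
    by rewrite normrM expr1 (ger0_norm (ltW (gaussf_gt0 _ _))) mulrDl mul1r mulrA.
  by rewrite mulr_ge0 ?addr_ge0 ?mulr_ge0 ?(ltW a0) ?(ltW (gaussf_gt0 _ _)).
have bPhi (a : R) (w : Omega) (u : R) : 0 < a ->
    `|Phi a (w, u)| <= (`|Z w| + 1) * ((1 + 2 * a * `|u|) * gaussf a u).
  move=> a0; rewrite /Phi/= normrM (ger0_norm (ltW (gaussf_gt0 _ _))) mulrA.
  rewrite ler_wpM2r ?(ltW (gaussf_gt0 _ _))// (le_trans (ler_normB _ _))//.
  rewrite !normrM (ger0_norm (ltW a0)) (@ger0_norm _ 2)//.
  have := normr_ge0 (Z w); have : 0 <= a * `|u| by rewrite mulr_ge0 ?(ltW a0).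
  by nra.
have iZ1 : integrableR P (fun w => `|Z w| + 1).
  apply: integrableRD; first exact: integrableR_norm.
  by apply: (@integrableR_bounded _ _ _ _ _ 1) => // w; rewrite normr1.
have iPhi (a : R) : 0 < a -> integrableR (P \x leb)%E (Phi a).
  move=> a0; apply: (integrableR_dominated (mPhi a) (integrableR_prod iZ1 (gsn a a0))).
  by move=> [w u]; exact: bPhi.
have trig (a : R) : 0 < a -> forall (xi : 'I_n -> R) (th : R),
    \int[(P \x leb)%E]_p (Phi a p * cos (\sum_i xi i * Y i p + th)) = 0.
  move=> a0 xi th.
  pose W w := \sum_i xi i * X i w.
  pose hW := \sum_i xi i *: h i.
  have hWi : isonormal T B e hW W by exact: isonormal_sum.
  have YE w u : \sum_i xi i * Y i (w, u) + th = W w + (u * ip hW k + th).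
    rewrite /Y/W/hW/= ip_suml mulr_sumr addrA; congr (_ + _).
    by rewrite -big_split/=; apply: eq_bigr => i _; rewrite ipZl /c; ring.
  have mW : measurable_fun setT W by have [] := isonormal_sqint hB hV hWi.
  have mF : measurable_fun (@setT (Omega * measurableTypeR R)) (fun p => Phi a p * cos (\sum_i xi i * Y i p + th)).
    apply: measurable_funM => //; apply: measurableT_comp.
      by apply: continuous_measurable_fun; exact: continuous_cos.
    by apply: measurable_funD => //; apply: measurable_sum => i; exact: measurable_funM.
  have bF (w : Omega) (u : R) : `|Phi a (w, u) * cos (\sum_i xi i * Y i (w, u) + th)| <=
      (`|Z w| + 1) * ((1 + 2 * a * `|u|) * gaussf a u).
    rewrite normrM; apply: le_trans (bPhi a w u a0).
    by rewrite ler_piMr// cos_max.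
  rewrite (Rintegral_prod mF iZ1 (gsn a a0) bF) (Rintegral_fubini mF iZ1 (gsn a a0) bF).
  pose E := expR (- (ip hW hW / 2)).
  (* Once the expectation over Omega is taken, the integrand in u is the derivative of this
     function, so its integral over the line is 0. *)
  pose F (u : R) := E * (gaussf a u * cos (u * ip hW k + th)).
  pose f0 (u : R) := - (2 * a * u) * gaussf a u * cos (u * ip hW k + th) -
     gaussf a u * (ip hW k * sin (u * ip hW k + th)).
  have imsq := isonormal_sqint hB hV hZ.
  have mcos (tau : R) : measurable_fun setT (fun w => cos (W w + tau)).
    apply: measurableT_comp; last exact: measurable_funD.
    by apply: continuous_measurable_fun; exact: continuous_cos.
  have sqcos (tau : R) : sqint P (fun w => cos (W w + tau)).
    by apply: (@sqint_bounded _ _ _ _ _ 1) => // w; exact: cos_max.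
  have fE (u : R) : \int[P]_w (Phi a (w, u) * cos (\sum_i xi i * Y i (w, u) + th)) = E * f0 u.
    under eq_Rintegral do rewrite YE.
    set tau := u * ip hW k + th.
    rewrite (_ : (fun w => _) = (fun w => gaussf a u * (cos (W w + tau) * Z w) -
        (2 * a * u * gaussf a u) * cos (W w + tau))); last first.
      by apply/funext => w; rewrite /Phi/=; ring.
    rewrite RintegralB//; last 2 first.
    - by apply: integrableRZ; exact: sqint_mul.
    - by apply: integrableRZ; exact: sqint_integrable.
    rewrite RintegralZl//; last exact: sqint_mul.
    rewrite RintegralZl//; last exact: sqint_integrable.
    rewrite (isonormal_cos hB hV tau hWi) -/E.
    have := isonormal_sin (tau + pi / 2) hWi hZ.
    under eq_Rintegral do rewrite addrA sinDpihalf.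
    by rewrite cosDpihalf -/E => ->; rewrite /f0 -/tau; ring.
  have dF (u : R) : is_derive u 1 F (E * f0 u).
    have dg := is_derive_gaussf a u.
    by apply: is_derive_eq; rewrite /f0 /GRing.scale/=; ring.
  have cf0 : continuous f0.
    move=> u; have cg := @continuous_gaussf R a u.
    have cl : {for u, continuous (fun u : R => u * ip hW k + th)}.
      by apply: cvgD; [apply: cvgMl; exact: cvg_id|exact: cvg_cst].
    apply: cvgB; apply: cvgM => //.
    - apply: cvgM => //; apply: cvgN; apply: cvgMr; exact: cvg_id.
    - by apply: continuous_cvg; [exact: continuous_cos|exact: cl].
    - apply: cvgMr.
      by apply: continuous_cvg; [exact: continuous_sin|exact: cl].
  have F0 (u : nat -> R) : (forall m, u m ^+ 2 = m%:R ^+ 2) -> F (u m) @[m --> \oo] --> 0.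
    move=> um; rewrite [X in _ --> X](_ : _ = E * 0); last by rewrite mulr0.
    apply: cvgMr; apply/cvgr0Pnorm_le => eps eps0.
    have /cvgr0Pnorm_le /(_ _ eps0) := gaussf_cvg0 a0 um.
    apply: filterS => m; apply: le_trans.
    by rewrite normrM ler_piMr// cos_max.
  under eq_Rintegral do rewrite fE.
  apply: (@integral_deriv_eq0 _ F) => //.
  - by move=> u; apply: cvgMr; exact: cf0.
  - apply: integrableRZ.
    apply: (integrableR_dominated _ (integrableRZ (1 + `|ip hW k|) (gsn a a0))).
      exact: continuous_measurable_fun.
    move=> u; rewrite /f0 -mulrA (mulrCA _ (gaussf a u)) -mulrBr normrM.
    rewrite (ger0_norm (ltW (gaussf_gt0 _ _))) [in leRHS]mulrA mulrC.
    rewrite ler_wpM2r ?(ltW (gaussf_gt0 _ _))// (le_trans (ler_normB _ _))//.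
    rewrite !normrM normrN !normrM (ger0_norm (ltW a0)) (@ger0_norm _ 2)//.
    rewrite -[2 * a * _]mulrA.
    have := cos_max (u * ip hW k + th); have := sin_max (u * ip hW k + th).
    have := normr_ge0 (ip hW k); have : 0 <= a * `|u| by rewrite mulr_ge0 ?(ltW a0).
    set p := `|cos _|; set q := `|sin _|; set r := `|ip _ _|; move: (a * `|u|) => v v0 r0 q1 p1.
    have : 2 * v * p <= 2 * v by rewrite ler_piMr// mulr_ge0.
    have : r * q <= r by rewrite ler_piMr.
    by nra.
  - by apply: F0.
  - by apply: F0 => m; rewrite sqrrN.
have cline (w : Omega) : continuous (fun u : R => \row_i Y i (w, u)).
  rewrite (_ : (fun u : R => _) = (fun u : R => \row_i X i w + u *: \row_i c i)).
    move=> u; apply: cvgD; first exact: cvg_cst.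
    by apply: cvgZl; exact: cvg_id.
  by apply/funext => u; apply/rowP => i; rewrite !mxE.
have cGl w : continuous (fun u : R => G (\row_i Y i (w, u))).
  by move=> u; exact: (continuous_comp (cline w u) (cG _)).
have cDGl w : continuous (fun u : R => DG (\row_i Y i (w, u))).
  by move=> u; exact: (continuous_comp (cline w u) (cDG _)).
have mG : measurable_fun (@setT (Omega * measurableTypeR R)) (fun p => G (\row_i Y i p)).
  exact: measurable_continuous_row.
have mDG : measurable_fun (@setT (Omega * measurableTypeR R)) (fun p => DG (\row_i Y i p)).
  exact: measurable_continuous_row.
have M0 : 0 <= M := le_trans (normr_ge0 _) (GM 0).
have L0 : 0 <= L := le_trans (normr_ge0 _) (DGL 0).
pose F w (u : R) := Z w * G (\row_i Y i (w, u)) - DG (\row_i Y i (w, u)).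
have bF w u : `|F w u| <= `|Z w| * M + L.
  rewrite /F (le_trans (ler_normB _ _))// lerD// normrM ler_wpM2l//; exact: GM.
have iF w (a : R) : 0 < a -> integrableR leb (fun u : R => F w u * gaussf a u).
  move=> a0; apply: (integrableR_dominated _ (integrableRZ (`|Z w| * M + L) (integrable_gaussf a0))).
    apply: measurable_funM; last exact: measurable_gaussf.
    apply: measurable_funB; last by apply: continuous_measurable_fun; exact: cDGl.
    by apply: measurable_funM => //; apply: continuous_measurable_fun; exact: cGl.
  move=> u; rewrite normrM (ger0_norm (ltW (gaussf_gt0 _ _))).
  by rewrite ler_wpM2r ?(ltW (gaussf_gt0 _ _)).
have parts w (a : R) : 0 < a -> \int[leb]_u (F w u * gaussf a u) =
    \int[leb]_u (Phi a (w, u) * G (\row_i Y i (w, u))).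
  move=> a0.
  pose D (u : R) := gaussf a u * DG (\row_i Y i (w, u)) - 2 * a * u * gaussf a u * G (\row_i Y i (w, u)).
  have dH (u : R) : is_derive u 1 (fun u => gaussf a u * G (\row_i Y i (w, u))) (D u).
    have dg := is_derive_gaussf a u.
    have dG' : is_derive u 1 (fun u : R => G (\row_i Y i (w, u))) (DG (\row_i Y i (w, u))).
      have E v : \row_i Y i (w, v) = \row_i X i w + v *: \row_i c i by apply/rowP => i; rewrite !mxE.
      rewrite E (_ : (fun v : R => _) = (fun v : R => G (\row_i X i w + v *: \row_i c i))).
        exact: dG.
      by apply/funext => v; rewrite E.
    by apply: is_derive_eq; rewrite /D /GRing.scale/=; ring.
  have cD : continuous D.
    move=> u; have cg := @continuous_gaussf R a u.
    apply: cvgB; apply: cvgM => //; [exact: cDGl| |exact: cGl].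
    by apply: cvgM => //; apply: cvgMr; exact: cvg_id.
  have iD : integrableR leb D.
    apply: (integrableR_dominated _ (integrableRZ (M + L) (gsn a a0))).
      exact: continuous_measurable_fun.
    move=> u; rewrite /D (le_trans (ler_normB _ _))// !normrM (ger0_norm (ltW (gaussf_gt0 _ _))).
    rewrite (ger0_norm (ltW a0)) (@ger0_norm _ 2)//.
    have := GM (\row_i Y i (w, u)); have := DGL (\row_i Y i (w, u)).
    have := gaussf_gt0 a u; set p := `|G _|; set q := `|DG _|; move: (gaussf a u) => r r0 qL pM.
    have x0 : 0 <= a * `|u| by rewrite mulr_ge0 ?(ltW a0).
    have e1 : r * q <= r * L by rewrite ler_wpM2l// ltW.
    have e2 : (a * `|u|) * r * p <= (a * `|u|) * r * M by rewrite ler_wpM2l// mulr_ge0// ltW.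
    have e3 : 0 <= (a * `|u|) * r * L by rewrite mulr_ge0// mulr_ge0// ltW.
    have e4 : 0 <= r * M by rewrite mulr_ge0// ltW.
    by nra.
  have H0 : \int[leb]_u D u = 0.
    have F0 (u : nat -> R) : (forall m, u m ^+ 2 = m%:R ^+ 2) ->
        (gaussf a (u m) * G (\row_i Y i (w, u m))) @[m --> \oo] --> 0.
      move=> um.
      have b0 : M * gaussf a (u m) @[m --> \oo] --> 0.
        by rewrite [X in _ --> X](_ : _ = M * 0); [apply: cvgMr; exact: gaussf_cvg0|rewrite mulr0].
      apply/cvgr0Pnorm_le => eps eps0.
      have /cvgr0Pnorm_le /(_ _ eps0) := b0.
      apply: filterS => m; apply: le_trans; rewrite mulrC !normrM.
      by rewrite ler_wpM2r// (ger0_norm M0).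
    by apply: (integral_deriv_eq0 dH) => //; apply: F0 => // m; rewrite sqrrN.
  rewrite (_ : (fun u => Phi a (w, u) * _) = (fun u : measurableTypeR R => F w u * gaussf a u + D u)).
    by rewrite RintegralD//; [rewrite H0 addr0|exact: iF].
  by apply/funext => u; rewrite /F /D /Phi/=; ring.
have bPG (a : R) w (u : R) : 0 < a -> `|Phi a (w, u) * G (\row_i Y i (w, u))| <=
    (`|Z w| + 1) * (M * ((1 + 2 * a * `|u|) * gaussf a u)).
  by move=> a0; rewrite normrM mulrCA mulrC; apply: ler_pM => //; exact: bPhi.
have iMg (a : R) : 0 < a -> integrableR leb (fun u : R => M * ((1 + 2 * a * `|u|) * gaussf a u)).
  by move=> a0; apply: integrableRZ; exact: gsn.
have mPG a : measurable_fun (@setT (Omega * measurableTypeR R)) (fun p => Phi a p * G (\row_i Y i p)).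
  exact: measurable_funM.
have approx m : \int[P]_w (Num.sqrt (m.+1%:R / pi) * \int[leb]_u (F w u * gaussf m.+1%:R (u - 0))) = 0.
  under eq_Rintegral.
    move=> w _; under eq_Rintegral do rewrite subr0.
    rewrite parts//; over.
  have bPGm := fun w u => bPG m.+1%:R w u (ltr0Sn R _).
  have iMgm := iMg m.+1%:R (ltr0Sn R _).
  rewrite RintegralZl//; last first.
    apply: (integrableR_dominated _ (integrableRZ (\int[leb]_u (M * ((1 + 2 * m.+1%:R * `|u|) * gaussf m.+1%:R u))) iZ1)).
      exact: (@measurable_Rintegral1 _ _ _ _ _ P leb _ _ _ (mPG _) iZ1 iMgm bPGm).
    move=> w; rewrite [leRHS]mulrC -RintegralZl//.
    apply: Rintegral_bound; last exact: bPGm.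
    + apply: measurable_funM; last by apply: continuous_measurable_fun; exact: cGl.
      apply: measurable_funM; last exact: measurable_gaussf.
      by apply: measurable_funB => //=; apply: measurable_funM => //; exact: measurable_id.
    + exact: integrableRZ.
  rewrite -(@Rintegral_prod _ _ _ _ _ P leb _ _ _ (mPG _) iZ1 iMgm bPGm).
  have := @trig_unique _ _ _ (sigma_finite_prod P leb) _ Y mY (Phi m.+1%:R) (iPhi _ (ltr0Sn R m)) (trig _ (ltr0Sn R m)) G M cG GM.
  by move=> ->; rewrite mulr0.
have cF w : continuous (F w).
  by move=> u; apply: cvgB; [apply: cvgMr; exact: cGl|exact: cDGl].
have mF w : measurable_fun setT (F w) by exact: continuous_measurable_fun.
have lim : \int[P]_w (Num.sqrt (m.+1%:R / pi) * \int[leb]_u (F w u * gaussf m.+1%:R (u - 0))) @[m --> \oo]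
   --> \int[P]_w F w 0.
  apply: (@Rintegral_dominated_cvg _ _ _ _ _ _ (fun w => `|Z w| * M + L)).
  - move=> m; apply: measurable_funM => //.
    rewrite (_ : (fun w => _) = (fun w => \int[leb]_u (Phi m.+1%:R (w, u) * G (\row_i Y i (w, u))))).
      exact: (@measurable_Rintegral1 _ _ _ _ _ P leb _ _ _ (mPG _) iZ1 (iMg _ (ltr0Sn R _)) (fun w u => bPG _ w u (ltr0Sn R _))).
    by apply/funext => w; under eq_Rintegral do rewrite subr0; exact: parts.
  - by move=> w; apply: (gaussf_approx_id (mF w) (bF w)); exact: cF.
  - apply: integrableRD.
      by under eq_fun do rewrite mulrC; apply: integrableRZ; exact: integrableR_norm.
    by apply: (@integrableR_bounded _ _ _ _ _ L) => // w; rewrite ger0_norm.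
  - by move=> m w; apply: gaussf_approx_bound.
have : \int[P]_w F w 0 = 0.
  have l0 := lim; rewrite (funext approx) in l0.
  by apply: (cvg_unique _ l0); [exact: Rhausdorff|exact: cvg_cst].
have Y0 w : \row_i Y i (w, 0) = \row_i X i w by apply/rowP => i; rewrite !mxE /Y/= mul0r addr0.
under eq_Rintegral do rewrite /F Y0 mulrC.
rewrite RintegralB//.
- by move/eqP; rewrite subr_eq0 => /eqP.
- apply: (integrableR_dominated _ (integrableRZ M (integrableR_norm iZ))).
    by apply: measurable_funM => //; exact: measurable_continuous_row.
  by move=> w; rewrite normrM ler_wpM2r.
- by apply: (@integrableR_bounded _ _ _ _ _ L) => //; exact: measurable_continuous_row.
Qed.


(** The directional formula is applied to the row with Y prepended as coordinate 0 and to the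
    product of g and f; the product rule along the row of inner products with k gives the two
    terms. *)
Lemma isonormal_ibp n (h : 'I_n -> V) (X : 'I_n -> Omega -> R) (l : V) (Y : Omega -> R)
    (k : V) (Z : Omega -> R) (g : 'rV[R]_n -> R) (f f' : R -> R) (M M' L L' : R) :
  (forall i, isonormal T B e (h i) (X i)) -> isonormal T B e l Y -> isonormal T B e k Z ->
  continuous g -> (forall y i, derivable g y (delta_mx 0 i)) ->
  (forall i, continuous (partial i g)) ->
  (forall y, `|g y| <= M) -> (forall i y, `|partial i g y| <= M') ->
  (forall x : R, is_derive x 1 f (f' x)) -> continuous f' ->
  (forall x, `|f x| <= L) -> (forall x, `|f' x| <= L') ->
  \int[P]_w (g (\row_i X i w) * f (Y w) * Z w) =
    \sum_i ip (h i) k * \int[P]_w (partial i g (\row_i X i w) * f (Y w)) +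
    ip l k * \int[P]_w (g (\row_i X i w) * f' (Y w)).
Proof.
move=> hX hY hZ cg dg cdg gM dgM df cf' fL f'L.
have cf : continuous f by move=> x; exact/differentiable_continuous/derivable1_diffP.
have mX i : measurable_fun setT (X i) by have [] := isonormal_sqint hB hV (hX i).
have mY : measurable_fun setT Y by have [] := isonormal_sqint hB hV hY.
pose h' i := oapp h l (unlift ord0 i).
pose X' i := oapp X Y (unlift (ord0 : 'I_n.+1) i).
have hX' i : isonormal T B e (h' i) (X' i).
  by rewrite /h'/X'; case: unliftP => [j|] _ /=; [exact: hX|exact: hY].
pose G (y : 'rV[R]_n.+1) := g (col' ord0 y) * f (y 0 ord0).
pose DG (y : 'rV[R]_n.+1) := \sum_i ip (h i) k * (partial i g (col' ord0 y) * f (y 0 ord0)) +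
   ip l k * (g (col' ord0 y) * f' (y 0 ord0)).
have cc (q : 'rV[R]_n -> R) : continuous q -> continuous (fun y : 'rV[R]_n.+1 => q (col' ord0 y)).
  by move=> cq y; exact: (continuous_comp (@continuous_col' R n y) (cq _)).
have c0 (q : R -> R) : continuous q -> continuous (fun y : 'rV[R]_n.+1 => q (y 0 ord0)).
  by move=> cq y; exact: (continuous_comp (@coord_continuous _ _ _ 0 ord0 y) (cq _)).
have cG : continuous G by move=> y; exact: (cvgM (cc g cg y) (c0 f cf y)).
have cDG : continuous DG.
  have cP i : continuous (fun y : 'rV[R]_n.+1 => ip (h i) k * (partial i g (col' ord0 y) * f (y 0 ord0))).
    move=> y; exact: (cvgM (cvg_cst (ip (h i) k)) (cvgM (cc _ (cdg i) y) (c0 f cf y))).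
  move=> y.
  have c1 : continuous (fun y : 'rV[R]_n.+1 => \sum_i ip (h i) k * (partial i g (col' ord0 y) * f (y 0 ord0))).
    exact: continuousR_sum.
  have c2 : continuous (fun y : 'rV[R]_n.+1 => ip l k * (g (col' ord0 y) * f' (y 0 ord0))).
    by move=> z; exact: (cvgM (cvg_cst (ip l k)) (cvgM (cc g cg z) (c0 f' cf' z))).
  exact: (cvgD (c1 y) (c2 y)).
have := @isonormal_ibp_dir _ h' X' k Z G DG (M * L)
  (\sum_i `|ip (h i) k| * (M' * L) + `|ip l k| * (M * L')) hX' hZ cG cDG.
have colE w : col' ord0 (\row_i X' i w) = \row_i X i w.
  by apply/rowP => i; rewrite !mxE /X' liftK.
have X0 w : (\row_i X' i w) 0 ord0 = Y w by rewrite mxE /X' unlift_none.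
have colh : col' ord0 (\row_i ip (h' i) k) = \row_i ip (h i) k.
  by apply/rowP => i; rewrite !mxE /h' liftK.
have h0 : (\row_i ip (h' i) k) 0 ord0 = ip l k by rewrite mxE /h' unlift_none.
under eq_Rintegral do rewrite /G colE X0.
under [in RHS]eq_Rintegral do rewrite /DG colE X0.
move=> HE; etransitivity; first apply: HE; last 1 first.
- have mf w' (q : 'rV[R]_n -> R) (f0 : R -> R) (a b : R) : continuous q -> continuous f0 ->
      (forall y, `|q y| <= a) -> (forall x, `|f0 x| <= b) ->
      integrableR P (fun w => w' * (q (\row_i X i w) * f0 (Y w))).
    move=> cq cf0 qa f0b; apply: integrableRZ.
    apply: (@integrableR_bounded _ _ _ _ _ (a * b)) => [|w]; last by rewrite normrM ler_pM.
    apply: measurable_funM; first exact: measurable_continuous_row.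
    by apply: measurableT_comp => //; exact: continuous_measurable_fun.
  have i1 i : integrableR P (fun w => partial i g (\row_i X i w) * f (Y w)).
    by have := mf 1 _ _ _ _ (cdg i) cf (dgM i) fL; under eq_fun do rewrite mul1r.
  have i2 : integrableR P (fun w => g (\row_i X i w) * f' (Y w)).
    by have := mf 1 _ _ _ _ cg cf' gM f'L; under eq_fun do rewrite mul1r.
  rewrite RintegralD//; last 2 first.
  + apply: integrableR_sum => i; exact: (mf _ _ _ _ _ (cdg i) cf (dgM i) fL).
  + exact: (mf _ _ _ _ _ cg cf' gM f'L).
  rewrite Rintegral_sum; last by move=> i; exact: (mf _ _ _ _ _ (cdg i) cf (dgM i) fL).
  congr (_ + _); last by rewrite RintegralZl.
  apply: eq_bigr => i _.
  by rewrite RintegralZl.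
- by move=> y; rewrite normrM ler_pM.
- move=> y; rewrite (le_trans (ler_normD _ _))//; apply: lerD.
    rewrite (le_trans (ler_norm_sum _ _ _))//; apply: ler_sum => i _.
    by rewrite !normrM ler_wpM2l// ler_pM.
  by rewrite !normrM ler_wpM2l// ler_pM.
- move=> y s; rewrite /G /DG -/h'.
  set v := \row_i ip (h' i) k.
  have E1 (t : R) : col' ord0 (y + t *: v) = col' ord0 y + t *: \row_i ip (h i) k.
    by rewrite -colh; apply/rowP => i; rewrite !mxE.
  have E2 (t : R) : (y + t *: v) 0 ord0 = y 0 ord0 + t * ip l k by rewrite -h0 !mxE.
  under [X in is_derive _ _ X]eq_fun do rewrite E1 E2.
  rewrite E1 E2.
  have d1 := @is_derive_line _ _ g dg cdg (col' ord0 y) (\row_i ip (h i) k) s.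
  have d0 (a c : R) : is_derive s 1 (fun t : R => a + t * c) c.
    by apply: is_derive_eq; rewrite /GRing.scale/=; ring.
  have d2 := d0 (y 0 ord0) (ip l k).
  have d3 := is_derive1_comp (df _) d2.
  have d4 := is_deriveM d1 d3.
  apply: (is_derive_eq d4).
  rewrite /GRing.scale/= addrC mulr_sumr; congr (_ + _).
    apply: eq_bigr => i _; rewrite !mxE; ring.
  ring.
Qed.

End isonormal_ibp.

(** * The bifractional covariance *)

Ltac generalize_powR :=
  repeat match goal with |- context [?x `^ ?y] => move: (x `^ y) => ? end.

Section powR_inequalities.
Context {R : realType}.
Implicit Types p q K a b c d l x y : R.

Lemma powR_convex p l x y : 1 <= p -> 0 <= l <= 1 -> 0 <= x -> 0 <= y ->
  (l * x + (1 - l) * y) `^ p <= l * x `^ p + (1 - l) * y `^ p.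
Proof.
move=> p1 /andP[l0 l1] x0 y0.
have := @convex_powR R p p1 (Itv01 l0 l1) x y.
rewrite !inE/= !in_itv/= !andbT => /(_ x0 y0).
by rewrite !convRE.
Qed.

(** Apply the convexity of the power 1 / K to the points x^K and y^K, then raise to the power K. *)
Lemma powR_concave K l x y : 0 < K <= 1 -> 0 <= l <= 1 -> 0 <= x -> 0 <= y ->
  l * x `^ K + (1 - l) * y `^ K <= (l * x + (1 - l) * y) `^ K.
Proof.
move=> /andP[K0 K1] l01 x0 y0; have /andP[l0 l1] := l01.
have l1' : 0 <= 1 - l by rewrite subr_ge0.
have K1' : 1 <= K^-1 by rewrite invf_ge1.
have := powR_convex K1' l01 (powR_ge0 x K) (powR_ge0 y K).
rewrite -!powRrM mulfV ?gt_eqF// !powRr1// => h.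
have z0 : 0 <= l * x `^ K + (1 - l) * y `^ K by rewrite addr_ge0// mulr_ge0// powR_ge0.
rewrite -[leLHS](powRr1 z0) -[X in _ `^ X <= _](mulVf (lt0r_neq0 K0)) powRrM.
by rewrite ge0_ler_powR ?nnegrE ?powR_ge0 ?(ltW K0)// addr_ge0// mulr_ge0.
Qed.

(** Two inner points with the same sum as the outer ones are mirrored convex combinations of them.
    Both signs of mixed increments below come from this. *)
Lemma convex_mid (f : R -> R) a b c d : a <= c <= b -> c + d = a + b ->
  (forall l, 0 <= l <= 1 -> f (l * a + (1 - l) * b) <= l * f a + (1 - l) * f b) ->
  f c + f d <= f a + f b.
Proof.
move=> /andP[ac cb] cd cf.
have [ab|ab] := eqVneq a b.
  have ca : c = a by apply/eqP; rewrite eq_le ac andbT ab.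
  have -> : d = b by move: cd; rewrite ca => /addrI.
  by rewrite ca.
have ba : 0 < b - a by rewrite subr_gt0 lt_neqAle ab (le_trans ac cb).
pose l := (b - c) / (b - a).
have l01 : 0 <= l <= 1.
  rewrite divr_ge0 ?subr_ge0//=; last by rewrite -subr_ge0 ltW.
  by rewrite ler_pdivrMr// mul1r lerB.
have cE : c = l * a + (1 - l) * b by rewrite /l; field; rewrite gt_eqF.
have dE : d = (1 - l) * a + (1 - (1 - l)) * b.
  have -> : d = a + b - c by rewrite -cd; ring.
  by rewrite cE; ring.
have l01' : 0 <= 1 - l <= 1 by case/andP: l01 => ? ?; rewrite subr_ge0 gerBl; apply/andP.
have := cf l l01; have := cf _ l01'; rewrite -cE -dE => h1 h2.
by apply: le_trans (lerD h2 h1) _; rewrite le_eqVlt; apply/orP; left; apply/eqP; ring.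
Qed.

Lemma powR_mixed_le0 K a b c d : 0 < K <= 1 -> 0 <= a <= b -> 0 <= c <= d ->
  (b + d) `^ K + (a + c) `^ K <= (b + c) `^ K + (a + d) `^ K.
Proof.
move=> K01 /andP[a0 ab] /andP[c0 cd].
have h : - (b + c) `^ K + - (a + d) `^ K <= - (a + c) `^ K + - (b + d) `^ K.
  apply: (@convex_mid (fun x => - x `^ K)).
  - by rewrite lerD2r ab lerD2l cd.
  - ring.
  - move=> l l01; rewrite !mulrN -opprD lerN2 powR_concave//.
    + by rewrite addr_ge0.
    + by rewrite addr_ge0// ?(le_trans a0 ab)// (le_trans c0 cd).
by lra.
Qed.

Lemma powR_norm_mixed_ge0 p a b c d : 1 <= p -> a <= b -> c <= d ->
  `|b - d| `^ p + `|a - c| `^ p <= `|b - c| `^ p + `|a - d| `^ p.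
Proof.
move=> p1 ab cd.
have h : `|a - c| `^ p + `|b - d| `^ p <= `|a - d| `^ p + `|b - c| `^ p.
  apply: (@convex_mid (fun x => `|x| `^ p)).
  - by rewrite lerD2l lerN2 cd lerD2r ab.
  - ring.
  - move=> l l01; have /andP[l0 l1] := l01.
    apply: le_trans (powR_convex p1 l01 (normr_ge0 _) (normr_ge0 _)).
    rewrite ge0_ler_powR ?nnegrE ?(le_trans ler01 p1)//.
      by rewrite addr_ge0// mulr_ge0// subr_ge0.
    rewrite (le_trans (ler_normD _ _))// !normrM (ger0_norm l0) (@ger0_norm _ (1 - l))// subr_ge0//.
by lra.
Qed.

(** Write x^p = x^(p - 1) x. Since p - 1 <= 1, the ratio x^(p - 1) / x is nonincreasing, which
    bounds the cross term; the two remaining terms contribute T^(p - 1) each, whence the factor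
    2. *)
Lemma powR_lip (T : R) p x y : 1 <= p <= 2 -> 0 <= y <= x -> x <= T ->
  x `^ p - y `^ p <= 2 * T `^ (p - 1) * (x - y).
Proof.
move=> /andP[p1 p2] /andP[y0 yx] xT.
have q0 : 0 <= p - 1 by rewrite subr_ge0.
have q1 : p - 1 <= 1 by rewrite lerBlDr.
have x0 := le_trans y0 yx; have T0 := le_trans x0 xT.
have pE z : 0 <= z -> z `^ p = z `^ (p - 1) * z.
  move=> z0; rewrite (_ : z `^ p = z `^ (p - 1 + 1)); last by rewrite subrK.
  by rewrite (powRD (r := p - 1)) ?powRr1// subrK gt_eqF// (lt_le_trans ltr01 p1).
rewrite !pE//.
have h1 : x `^ (p - 1) <= T `^ (p - 1) by rewrite ge0_ler_powR.
have h2 : y `^ (p - 1) <= T `^ (p - 1) by rewrite ge0_ler_powR ?nnegrE// (le_trans yx).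
have h3 : y * x `^ (p - 1) <= y `^ (p - 1) * x.
  have [->|yN0] := eqVneq y 0; first by rewrite mul0r mulr_ge0// powR_ge0.
  have {}y0 : 0 < y by rewrite lt_neqAle eq_sym yN0.
  have xy1 : 1 <= x / y by rewrite ler_pdivlMr// mul1r.
  have := ler1_powR xy1 q1.
  have -> : x `^ (p - 1) = (x / y) `^ (p - 1) * y `^ (p - 1).
    by rewrite -powRM ?divr_ge0 ?(ltW y0)// divfK// gt_eqF.
  rewrite ler_pdivlMr// => h.
  by rewrite mulrA (mulrC y) [leRHS]mulrC ler_wpM2r// powR_ge0.
have := powR_ge0 x (p-1); have := powR_ge0 y (p-1).
move: h1 h2 h3; set A := x `^ _; set C := y `^ _; set D := T `^ _ => h1 h2 h3 A0 C0.
by nra.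
Qed.

End powR_inequalities.

Section covariance.
Context {R : realType} {Hu K T : R}.
Hypotheses (hH : 0 < Hu < 1) (hK : 0 < K <= 1) (hHK : 1 <= 2 * Hu * K).
Implicit Types a b c d r s t x y : R.

Local Notation cov := (bif_cov Hu K).
Local Notation p := (2 * Hu * K).

Let p1 : 1 <= p <= 2.
Proof.
rewrite hHK/=; case/andP: hH => H0 H1; case/andP: hK => K0 K1.
rewrite -[leRHS]mulr1; apply: ler_pM => //; last by rewrite -[leRHS]mulr1 ler_wpM2l ?ltW.
by rewrite mulr_ge0 ?ltW.
by rewrite ltW.
Qed.

Let p0 : 2 * Hu * K != 0.
Proof. by rewrite gt_eqF// (lt_le_trans ltr01). Qed.

Let a0 : 2 * Hu != 0.
Proof. by case/andP: hH => H0 _; rewrite mulf_neq0 ?gt_eqF. Qed.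

Lemma bif_covC t s : cov t s = cov s t.
Proof. by rewrite /bif_cov distrC [_ `^ (2 * Hu) + _]addrC. Qed.

Lemma bif_cov_diag s : 0 <= s -> cov s s = s `^ p.
Proof.
case/andP: hK => K0 K1 s0.
rewrite /bif_cov subrr normr0 powR0// subr0.
rewrite (_ : s `^ (2 * Hu) + s `^ (2 * Hu) = 2 * s `^ (2 * Hu)); last by generalize_powR; ring.
rewrite (powRM _ (ler0n _ 2)) ?powR_ge0// -(powRrM s (2 * Hu) K) mulrA -powRD.
  by rewrite addNr powRr0 mul1r.
by rewrite pnatr_eq0 implybT.
Qed.

Lemma bif_cov0 t : 0 <= t -> cov t 0 = 0.
Proof.
by move=> t0; rewrite /bif_cov powR0// addr0 subr0 ger0_norm// -powRrM subrr mulr0.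
Qed.

Definition cov_rect a b c d := cov b d - cov b c - cov a d + cov a c.

(** The factor 2^(-K) normalizes the covariance, and 6 = 2 + 4 adds the bounds [conc_le] and
    [conv_le] for its two sign-definite parts. *)
Definition cov_const := 2 `^ (- K) * (6 * T `^ (p - 1)).

Let conc a b c d := (b `^ (2 * Hu) + c `^ (2 * Hu)) `^ K + (a `^ (2 * Hu) + d `^ (2 * Hu)) `^ K
  - (b `^ (2 * Hu) + d `^ (2 * Hu)) `^ K - (a `^ (2 * Hu) + c `^ (2 * Hu)) `^ K.

Let conv a b c d := `|b - c| `^ p + `|a - d| `^ p - `|b - d| `^ p - `|a - c| `^ p.

Let powa_le a b : 0 <= a -> a <= b -> a `^ (2 * Hu) <= b `^ (2 * Hu).
Proof.
move=> a1 ab; case/andP: hH => H0 _.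
by rewrite ge0_ler_powR ?nnegrE ?mulr_ge0 ?(ltW H0)// (le_trans a1).
Qed.

Let conc_ge0 a b c d : 0 <= a -> a <= b -> 0 <= c -> c <= d -> 0 <= conc a b c d.
Proof.
move=> a1 ab c1 cd.
have := @powR_mixed_le0 _ K (a `^ (2 * Hu)) (b `^ (2 * Hu)) (c `^ (2 * Hu)) (d `^ (2 * Hu)) hK.
rewrite !powR_ge0 !powa_le//= => /(_ isT isT); rewrite /conc.
by generalize_powR; lra.
Qed.

Let conv_ge0 a b c d : a <= b -> c <= d -> 0 <= conv a b c d.
Proof.
by move=> ab cd; have := @powR_norm_mixed_ge0 _ p a b c d hHK ab cd; rewrite /conv; generalize_powR; lra.
Qed.

Let cov_rectE a b c d : cov_rect a b c d = 2 `^ (- K) * (conv a b c d - conc a b c d).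
Proof. by rewrite /cov_rect /bif_cov /conv /conc; generalize_powR; ring. Qed.

Let conc_le a b c d : 0 <= a -> a <= b -> b <= T -> 0 <= c -> c <= d ->
  conc a b c d <= 2 * T `^ (p - 1) * (b - a).
Proof.
move=> a1 ab bT c1 cd; case/andP: hK => K0 K1.
have b1 := le_trans a1 ab; have d1 := le_trans c1 cd.
apply: le_trans (powR_lip p1 _ bT); last by rewrite a1 ab.
have h1 : (a `^ (2 * Hu) + d `^ (2 * Hu)) `^ K <= (b `^ (2 * Hu) + d `^ (2 * Hu)) `^ K.
  by rewrite ge0_ler_powR ?nnegrE ?addr_ge0 ?powR_ge0 ?(ltW K0)// lerD2r powa_le.
have h2 := @powR_mixed_le0 _ K (a `^ (2 * Hu)) (b `^ (2 * Hu)) 0 (c `^ (2 * Hu)) hK.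
move: h2; rewrite !powR_ge0 powa_le// lexx/= !addr0 -!powRrM => /(_ isT isT).
by move: h1; rewrite /conc; generalize_powR; lra.
Qed.

Let norm_powR_lip x y : `|x| <= T -> `|y| <= T ->
  `|x| `^ p - `|y| `^ p <= 2 * T `^ (p - 1) * `|x - y|.
Proof.
move=> xT yT.
have [xy|/ltW yx] := leP `|x| `|y|.
  apply: (@le_trans _ _ 0); last by rewrite mulr_ge0// mulr_ge0// powR_ge0.
  by rewrite subr_le0 ge0_ler_powR// (le_trans ler01 hHK).
apply: le_trans (powR_lip p1 _ xT) _; first by rewrite normr_ge0.
by rewrite ler_wpM2l ?mulr_ge0 ?powR_ge0// lerB_dist.
Qed.

Let conv_le a b c d : 0 <= a -> a <= b -> b <= T -> 0 <= c -> c <= d -> d <= T ->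
  conv a b c d <= 4 * T `^ (p - 1) * (b - a).
Proof.
move=> a1 ab bT c1 cd dT.
have nT x y : 0 <= x -> x <= T -> 0 <= y -> y <= T -> `|x - y| <= T.
  by move=> *; rewrite ler_norml; apply/andP; split; lra.
have b1 := le_trans a1 ab; have d1 := le_trans c1 cd.
have aT := le_trans ab bT; have cT := le_trans cd dT.
have := norm_powR_lip (nT b c b1 bT c1 cT) (nT a c a1 aT c1 cT).
have := norm_powR_lip (nT a d a1 aT d1 dT) (nT b d b1 bT d1 dT).
rewrite (_ : b - c - (a - c) = b - a); last by ring.
rewrite (_ : a - d - (b - d) = - (b - a)); last by ring.
have E : `|b - a| = b - a by rewrite ger0_norm ?subr_ge0.
by rewrite normrN E /conv; generalize_powR; lra.
Qed.

Let rect_const (a b u v : R) : u <= 2 * T `^ (p - 1) * (b - a) -> v <= 4 * T `^ (p - 1) * (b - a) ->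
  2 `^ (- K) * (u + v) <= cov_const * (b - a).
Proof.
by move=> h1 h2; rewrite /cov_const -mulrA ler_wpM2l ?powR_ge0//; move: h1 h2; generalize_powR; lra.
Qed.

(** Since [conc] and [conv] are nonnegative, the absolute value is at most 2^(-K) times their sum,
    and that sum is additive in the second interval: the rectangles merge into a single one. *)
Lemma cov_rect_sum a b (u : nat -> R) n : 0 <= a -> a <= b -> b <= T ->
  0 <= u 0%N -> (forall k, u k <= u k.+1) -> u n <= T ->
  \sum_(k < n) `|cov_rect a b (u k) (u k.+1)| <= cov_const * (b - a).
Proof.
move=> a1 ab bT u0 um unT.
have u_ge0 k : 0 <= u k by elim: k => // k IH; exact: le_trans (um k).
have u0n : u 0%N <= u n.
  by elim: n {unT} => // n IH; exact: le_trans (um n).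
apply: le_trans (rect_const (conc_le a1 ab bT u0 u0n) (conv_le a1 ab bT u0 u0n unT)).
elim: n {unT u0n} => [|n IH].
  rewrite big_ord0 mulr_ge0 ?powR_ge0// addr_ge0//; [exact: conc_ge0|exact: conv_ge0].
rewrite big_ord_recr/=; apply: le_trans (lerD IH (_ : _ <= 2 `^ (- K) * (conc a b (u n) (u n.+1) + conv a b (u n) (u n.+1)))) _.
  rewrite cov_rectE normrM (ger0_norm (powR_ge0 _ _)) ler_wpM2l ?powR_ge0//.
  have h1 := conc_ge0 a1 ab (u_ge0 n) (um n); have h2 := conv_ge0 ab (um n).
  move: h1 h2; move: (conv a b _ _) (conc a b _ _) => x y y0 x0.
  by rewrite ler_norml; apply/andP; split; lra.
by rewrite -mulrDr ler_wpM2l ?powR_ge0// /conc /conv; generalize_powR; lra.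
Qed.

Lemma cov_rect_le a b c d : 0 <= a -> a <= b -> b <= T -> 0 <= c -> c <= d -> d <= T ->
  `|cov_rect a b c d| <= cov_const * (b - a).
Proof.
move=> a1 ab bT c1 cd dT.
have := @cov_rect_sum a b (fun k => if k == 0%N then c else d) 1 a1 ab bT c1.
rewrite big_ord1/=; apply => // -[|k]//.
Qed.

Lemma cov_const_ge0 : 0 <= cov_const.
Proof. by rewrite /cov_const !mulr_ge0// powR_ge0. Qed.

Lemma bif_cov_ge0 r s : 0 <= r -> 0 <= s -> 0 <= cov r s.
Proof.
wlog rs : r s / r <= s.
  move=> h r0 s0; have [rs|/ltW sr] := leP r s; first exact: h.
  by rewrite bif_covC; exact: h.
move=> r0 s0; case/andP: hK => K0 _; case/andP: hH => H0 _.
rewrite mulr_ge0 ?powR_ge0// subr_ge0 powRrM ge0_ler_powR ?nnegrE ?(ltW K0) ?addr_ge0 ?powR_ge0//.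
apply: (@le_trans _ _ (s `^ (2 * Hu))); last by rewrite lerDr powR_ge0.
rewrite ge0_ler_powR ?nnegrE ?mulr_ge0 ?(ltW H0)//.
by rewrite distrC ger0_norm ?subr_ge0// gerBl.
Qed.

Definition det_const := 2 `^ (- K) * (2 * K * (1 - Hu) / (1 + 2 * K * (1 - Hu))).

Lemma det_const_gt0 : 0 < det_const.
Proof.
case/andP: hK => K0 K1; case/andP: hH => H0 H1.
have k0 : 0 < 2 * K * (1 - Hu) by rewrite !mulr_gt0// subr_gt0.
by rewrite /det_const mulr_gt0 ?powR_gt0// divr_gt0// addr_gt0.
Qed.

Lemma powR_subadd q x y : 0 < q <= 1 -> 0 <= x -> 0 <= y -> (x + y) `^ q <= x `^ q + y `^ q.
Proof.
move=> q01 x0 y0; have := @powR_mixed_le0 _ q 0 x 0 y q01.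
rewrite !lexx x0 y0 !addr0 !add0r => /(_ isT isT).
by case/andP: q01 => q0 _; rewrite powR0 ?gt_eqF// addr0.
Qed.

(* With rho = r / s this reduces to 1 - (1 - rho)^k >= k rho / (1 + k). *)
Lemma bif_cov_det r s : 0 < r -> r < s ->
  det_const * (r * s) `^ (Hu * K) * (s - r) `^ p * (r / s) <=
  r `^ p * s `^ p - cov r s ^+ 2.
Proof.
move=> r0 rs; have s0 := lt_trans r0 rs; have sr0 : 0 < s - r by rewrite subr_gt0.
case/andP: hK => K0 K1; case/andP: hH => H0 H1.
set k := 2 * K * (1 - Hu).
have k0 : 0 < k by rewrite !mulr_gt0// subr_gt0.
pose M := (r * s) `^ (Hu * K).
have M0 : 0 <= M by exact: powR_ge0.
have ME : r `^ p * s `^ p = M ^+ 2.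
  rewrite -powRM ?ltW// -powR_mulrn// -powRrM; congr (_ `^ _); ring.
pose A := r `^ Hu; pose B := s `^ Hu.
have AB : A <= B by rewrite ge0_ler_powR ?nnegrE ?ltW.
have A0 : 0 <= A by exact: powR_ge0.
have B0 : 0 < B by exact: powR_gt0.
have sq x : x `^ (2 * Hu) = (x `^ Hu) ^+ 2.
  by rewrite mulrC powRrM powR_mulrn// powR_ge0.
(* [M] is the geometric mean of the two variances. As A^2 + B^2 = 2 A B + (B - A)^2, subadditivity
   of the power K bounds the concave part of the covariance by 2^K M + (B - A)^(2 K). *)
have lower : (s - r) `^ p - (B - A) `^ (2 * K) <= 2 `^ K * (M - cov r s).
  rewrite /bif_cov mulrBr (mulrA (2 `^ K)) -powRD ?subrr ?powRr0 ?mul1r ?eqxx//; last first.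
    by rewrite pnatr_eq0 implybT.
  rewrite distrC (gtr0_norm sr0) !sq -/A -/B.
  have h := @powR_subadd K (2 * (A * B)) ((B - A) ^+ 2) hK.
  rewrite (_ : A ^+ 2 + B ^+ 2 = 2 * (A * B) + (B - A) ^+ 2); last by ring.
  have ABE : (2 * (A * B)) `^ K = 2 `^ K * M.
    by rewrite (powRM K) ?mulr_ge0 ?(ltW B0)// /M (powRrM (r * s)) (powRM Hu (ltW r0) (ltW s0)).
  have sqE : ((B - A) ^+ 2) `^ K = (B - A) `^ (2 * K).
    by rewrite powRrM powR_mulrn// subr_ge0.
  have AB0 : 0 <= 2 * (A * B) by rewrite mulr_ge0// mulr_ge0// ltW.
  have := h AB0 (sqr_ge0 _); rewrite ABE sqE.
  by generalize_powR; lra.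
have rho : 0 < r / s < 1 by rewrite divr_gt0//= ltr_pdivrMr// mul1r.
set rh := r / s in rho *; case/andP: rho => rh0 rh1.
have srE : s - r = s * (1 - rh) by rewrite /rh; field; rewrite gt_eqF.
(* Since rh^Hu >= rh, B - A is at most B (1 - rh); the exponent is split as 2 K = p + k in order to
   extract (s - r)^p. *)
have h1 : (B - A) `^ (2 * K) <= (s - r) `^ p * (1 - rh) `^ k.
  have -> : B - A = B * (1 - rh `^ Hu).
    rewrite /rh powRM ?invr_ge0 ?ltW// mulrBr mulr1; congr (_ - _).
    rewrite mulrCA -/A [B * _](_ : _ = 1) ?mulr1//.
    by rewrite /B -powRM ?invr_ge0 ?ltW// mulfV ?powR1// gt_eqF.
  have rH1 : rh `^ Hu <= 1.
    have : rh `^ Hu <= 1 `^ Hu by rewrite ge0_ler_powR ?nnegrE ?ltW.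
    by rewrite powR1.
  have rH : rh <= rh `^ Hu.
    by rewrite -[leLHS]powRr1 ?(ltW rh0)// ger_powR// ?(ltW H1)// rh0 ltW.
  rewrite srE (powRM (2 * K)) ?(ltW B0) ?subr_ge0// (powRM p) ?(ltW s0) ?subr_ge0 ?(ltW rh1)//.
  rewrite -mulrA -powRD; last by rewrite subr_eq0 (gt_eqF rh1) implybT.
  have -> : p + k = 2 * K by rewrite /k; ring.
  have -> : B `^ (2 * K) = s `^ p by rewrite /B -powRrM; congr (_ `^ _); ring.
  rewrite ler_wpM2l ?powR_ge0// ge0_ler_powR ?nnegrE ?subr_ge0 ?(ltW rh1) ?mulr_ge0 ?(ltW K0)//.
  by rewrite lerB.
(* (1 - rh)^k <= exp(- k rh) <= 1 / (1 + k rh), and this convex function of rh lies below its chord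
   over [0, 1]. *)
have h2 : (1 - rh) `^ k <= 1 - k * rh / (1 + k).
  have q0 : 0 < 1 - rh by rewrite subr_gt0.
  rewrite /powR gt_eqF//.
  have lnle : ln (1 - rh) <= - rh by apply: le_ln1Dx; rewrite ltrN2.
  have kr : 0 <= k * rh by rewrite mulr_ge0 ?ltW.
  apply: (@le_trans _ _ (1 + k * rh)^-1).
    rewrite -[leLHS]invrK lef_pV2 ?posrE ?invr_gt0 ?expR_gt0 ?ltr_wpDr// -expRN.
    apply: le_trans (expR_ge1Dx _) _; rewrite ler_expR -mulrN ler_wpM2l ?(ltW k0)//.
    by rewrite lerNr.
  have e1 : 1 - k * rh / (1 + k) - (1 + k * rh)^-1 = k * rh * (k * (1 - rh)) / ((1 + k) * (1 + k * rh)).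
    by field; rewrite !gt_eqF// ltr_wpDr// ltW.
  have n0 : 0 <= k * rh * (k * (1 - rh)) by rewrite mulr_ge0// mulr_ge0// ltW.
  have dn0 : 0 <= (1 + k) * (1 + k * rh) by rewrite mulr_ge0// addr_ge0// ltW.
  by rewrite -subr_ge0 e1 divr_ge0.
have s1 := powR_ge0 (s - r) p.
have c0 : 0 < 2 `^ K :> R by rewrite powR_gt0.
have h3 : 2 `^ (- K) * (k / (1 + k)) * (s - r) `^ p * rh <= M - cov r s.
  have hX : k / (1 + k) * (s - r) `^ p * rh <= (s - r) `^ p - (B - A) `^ (2 * K).
    have := ler_wpM2l s1 h2; move: h1.
    rewrite (_ : k * rh / (1 + k) = k / (1 + k) * rh); last by ring.
    move: (k / (1 + k)) ((s - r) `^ p) ((B - A) `^ (2 * K)) ((1 - rh) `^ k) => x y z v; nra.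
  have {}hX := le_trans hX lower.
  rewrite powRN (_ : _ * rh = (2 `^ K)^-1 * (k / (1 + k) * (s - r) `^ p * rh)); last by rewrite !mulrA.
  by rewrite ler_pdivrMl.
have cv0 := bif_cov_ge0 (ltW r0) (ltW s0).
have d0 : 0 <= M - cov r s.
  have kk0 : 0 <= k / (1 + k) by rewrite divr_ge0// ?addr_ge0// ltW.
  apply: le_trans h3; apply: mulr_ge0 (ltW rh0); apply: mulr_ge0 s1.
  by apply: mulr_ge0 kk0; exact: powR_ge0.
rewrite ME /det_const -/k -/M.
(* The first factor carries the smallness; the second is at least M because the covariance is
   nonnegative. *)
have -> : M ^+ 2 - cov r s ^+ 2 = (M - cov r s) * (M + cov r s) by ring.
apply: (@le_trans _ _ ((M - cov r s) * M)); last by rewrite ler_wpM2l// lerDl.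
by have := ler_wpM2r M0 h3; lra.
Qed.

Section increments.
Context {V : completeNormedModType R} {ip : {dot V for idfun}} {e : R -> V}.
Hypothesis hV : is_completion Hu K T ip e.

Lemma ip_incr a b c d : a \in `[0, T] -> b \in `[0, T] -> c \in `[0, T] -> d \in `[0, T] ->
  ip (e b - e a) (e d - e c) = cov_rect a b c d.
Proof.
move=> aT bT cT dT; rewrite ipBl !ipBr !(completion_ip hV)// /cov_rect; ring.
Qed.

(** A Schur test on the Gram matrix of the increments: each entry is weighted by the mean of the two
    squared coefficients, and [cov_rect_sum] bounds every row sum by the length of the interval of
    that row. *)
Lemma norm_sum_incr_le (u : nat -> R) n (phi : nat -> R) :
  0 <= u 0%N -> (forall k, u k <= u k.+1) -> u n <= T ->
  `|\sum_(k < n) phi k *: (e (u k.+1) - e (u k))| ^+ 2 <=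
  cov_const * \sum_(k < n) phi k ^+ 2 * (u k.+1 - u k).
Proof.
move=> u0 um unT.
have u_ge0 k : 0 <= u k by elim: k => // k IH; exact: le_trans (um k).
have uT k : (k <= n)%N -> u k <= T.
  move=> kn; apply: le_trans unT; rewrite -(subnK kn).
  by elim: (n - k)%N => // j IH; rewrite addSn; exact: le_trans (um _).
have uI k : (k <= n)%N -> u k \in `[0, T] by move=> kn; rewrite in_itv/= u_ge0 uT.
pose m (k l : 'I_n) := cov_rect (u k) (u k.+1) (u l) (u l.+1).
have mC k l : `|m k l| = `|m l k|.
  by rewrite /m /cov_rect ![cov (u l.+1) _]bif_covC ![cov (u l) _]bif_covC; congr (`|_|); ring.
have mE (k l : 'I_n) : ip (phi k *: (e (u k.+1) - e (u k))) (phi l *: (e (u l.+1) - e (u l))) =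
    phi k * phi l * m k l.
  have /ltnW kn := ltn_ord k; have /ltnW ln := ltn_ord l.
  by rewrite ipZl ipZr ip_incr ?uI// mulrA.
rewrite (norm_sqr (completion_norm hV)) ip_suml.
under eq_bigr do rewrite ip_sumr.
under eq_bigr do under eq_bigr do rewrite mE.
have h (k l : 'I_n) : phi k * phi l * m k l <= 2^-1 * (phi k ^+ 2 * `|m k l|) + 2^-1 * (phi l ^+ 2 * `|m l k|).
  rewrite (mC l k); have := ler_norm (m k l); have := ler_norm (- m k l); rewrite normrN.
  have := sqr_ge0 (phi k - phi l); have := sqr_ge0 (phi k + phi l).
  set M := `|_|; move: (phi k) (phi l) (m k l) => x y z h1 h2 h3 h4.
  have h5 : 0 <= (x - y) ^+ 2 * (M + z) by rewrite mulr_ge0//; lra.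
  have h6 : 0 <= (x + y) ^+ 2 * (M - z) by rewrite mulr_ge0//; lra.
  by nra.
apply: (@le_trans _ _ (\sum_(k < n) phi k ^+ 2 * \sum_(l < n) `|m k l|)).
  apply: (@le_trans _ _ (\sum_(k < n) \sum_(l < n)
      (2^-1 * (phi k ^+ 2 * `|m k l|) + 2^-1 * (phi l ^+ 2 * `|m l k|)))).
    by apply: ler_sum => k _; apply: ler_sum => l _; exact: h.
  under eq_bigr do rewrite big_split/=.
  rewrite big_split/= [X in _ + X]exchange_big/= -big_split/=.
  apply: ler_sum => k _; rewrite mulr_sumr -big_split/=.
  by apply: ler_sum => l _; lra.
rewrite mulr_sumr; apply: ler_sum => k _; rewrite mulrCA ler_wpM2l ?sqr_ge0//.
by apply: cov_rect_sum => //; exact: uT.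
Qed.

End increments.
End covariance.

(** * Mollified sign and absolute value *)

Lemma derive_bound_lip {R : realType} (f f' : R -> R) (C : R) :
  (forall x : R, is_derive x 1 f (f' x)) -> (forall x, `|f' x| <= C) ->
  forall x y, `|f x - f y| <= C * `|x - y|.
Proof.
move=> df f'C x y.
wlog xy : x y / y <= x.
  move=> h; have [xy|/ltW yx] := leP y x; first exact: h.
  by rewrite distrC (distrC x); exact: h.
have cf z : z \in `[y, x] -> derivable f z 1 by move=> _; case: (df z).
have [|c _ ->] := MVT_segment xy (fun z _ => df z).
  exact: derivable_within_continuous.
by rewrite normrM ler_wpM2r.
Qed.

Section mollified_sign.
Context {R : realType}.
Local Notation leb := (@lebesgue_measure R).
Implicit Types (n : nat) (x y z : R).

(** The centred Gaussian density of variance 1 / (2 (n + 1)), a special case of the kernel that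
    defines the local time. *)
Definition mollifier n y : R := Num.sqrt (n.+1%:R / pi) * gaussf n.+1%:R y.

Lemma gauss_kernelE n y : gauss_kernel (2 * n.+1%:R)^-1 y = mollifier n y.
Proof.
have p0 := pi_gt0 R.
rewrite /gauss_kernel /mollifier /gaussf; congr (_ * expR _); last first.
  by rewrite invfM invrK; field.
rewrite -sqrtrV; last by rewrite divr_ge0 ?mulr_ge0 ?(ltW p0).
congr (Num.sqrt _).
by rewrite -mulf_div divff// mul1r invf_div.
Qed.

Lemma mollifier_ge0 n y : 0 <= mollifier n y.
Proof. by rewrite mulr_ge0 ?sqrtr_ge0// ltW// gaussf_gt0. Qed.

Lemma mollifier_le n y : mollifier n y <= Num.sqrt (n.+1%:R / pi).
Proof. by rewrite ler_piMr ?sqrtr_ge0// gaussf_le1. Qed.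

Lemma continuous_mollifier n : continuous (mollifier n).
Proof. by move=> y; apply: cvgMr; exact: continuous_gaussf. Qed.

Lemma is_derive_mollifier n y :
  is_derive y 1 (mollifier n) (- (2 * n.+1%:R * y) * mollifier n y).
Proof.
have dg := is_derive_gaussf n.+1%:R y.
by apply: is_derive_eq; rewrite /mollifier /GRing.scale/=; ring.
Qed.

Lemma integrable_mollifier n : integrableR leb (mollifier n).
Proof. by apply: integrableRZ; exact: integrable_gaussf. Qed.

Lemma integral_mollifier n : \int[leb]_y mollifier n y = 1.
Proof.
rewrite RintegralZl//; last exact: integrable_gaussf.
by rewrite integral_gaussf// sqrt_pi_inv.
Qed.

Lemma mollifier_deriv_le n : exists C, forall y, `|- (2 * n.+1%:R * y) * mollifier n y| <= C.
Proof.
exists (2 * n.+1%:R * (Num.sqrt (n.+1%:R / pi) * (1 + 2 / n.+1%:R))) => y.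
rewrite normrM normrN normrM (ger0_norm (mollifier_ge0 n y)) (@ger0_norm _ (2 * _)) ?mulr_ge0//.
rewrite -mulrA ler_wpM2l ?mulr_ge0// /mollifier mulrCA ler_wpM2l ?sqrtr_ge0//.
apply: le_trans (mulr_gaussf_le _ _) _ => //.
by rewrite ler_piMr ?addr_ge0 ?divr_ge0// gaussf_le1// divr_ge0.
Qed.

Definition mollifier_cdf n y : R := \int[leb]_(z in `]-oo, y]) mollifier n z.

Lemma mollifier_cdfE n y : mollifier_cdf n y = \int[leb]_z (mollifier n \_ `]-oo, y]) z.
Proof. by rewrite /mollifier_cdf Rintegral_mkcond. Qed.

Lemma mollifier_patch n y z : 0 <= (mollifier n \_ `]-oo, y]) z <= mollifier n z.
Proof. by rewrite patchE; case: ifP => _; rewrite ?lexx mollifier_ge0. Qed.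

Lemma measurable_mollifier_patch n y : measurable_fun setT (mollifier n \_ `]-oo, y]).
Proof.
apply/measurable_restrict => //; apply: measurable_funTS.
exact: continuous_measurable_fun (@continuous_mollifier n).
Qed.

Lemma integrable_mollifier_patch n y : integrableR leb (mollifier n \_ `]-oo, y]).
Proof.
apply: (integrableR_dominated _ (integrable_mollifier n)); first exact: measurable_mollifier_patch.
by move=> z; case/andP: (mollifier_patch n y z) => h1 h2; rewrite ger0_norm.
Qed.

Lemma mollifier_cdf_itv n y : 0 <= mollifier_cdf n y <= 1.
Proof.
rewrite mollifier_cdfE -(integral_mollifier n); apply/andP; split.
  by apply: Rintegral_ge0 => z _; case/andP: (mollifier_patch n y z).
apply: le_Rintegral => //; first exact: integrable_mollifier_patch.
  exact: integrable_mollifier.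
by move=> z _; case/andP: (mollifier_patch n y z).
Qed.

Lemma is_derive_mollifier_cdf n y : is_derive y 1 (mollifier_cdf n) (mollifier n y).
Proof.
have [] := @continuous_FTC1 R (mollifier n) -oo%O y (y + 1).
- by rewrite ltrDl.
- apply: integrableS (integrable_mollifier n) => //.
- by rewrite ltNyr.
- exact: continuous_mollifier.
move=> d1 d2; split; first exact: d1.
by rewrite -derive1E.
Qed.

Let chebyshev n y (D : set R) : y != 0 -> (forall z, D z -> y ^+ 2 <= z ^+ 2) ->
  measurable_fun setT (mollifier n \_ D) ->
  \int[leb]_z (mollifier n \_ D) z <= (y ^+ 2)^-1 * (2 * n.+1%:R)^-1.
Proof.
move=> y0 Dy mD.
have y2 : 0 < y ^+ 2 by rewrite exprn_even_gt0.
have i2 : integrableR leb (fun z => (y ^+ 2)^-1 * Num.sqrt (n.+1%:R / pi) * (z ^+ 2 * gaussf n.+1%:R z)).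
  by apply: integrableRZ; exact: integrable_exprn_gaussf.
have b z : `|(mollifier n \_ D) z| <= (y ^+ 2)^-1 * Num.sqrt (n.+1%:R / pi) * (z ^+ 2 * gaussf n.+1%:R z).
  rewrite patchE; case: ifPn => [/set_mem Dz|_]; last first.
    have g0 := ltW (gaussf_gt0 n.+1%:R z); rewrite -[`|_|]/(`|0 : R|) normr0.
    by apply: mulr_ge0; apply: mulr_ge0 => //; rewrite ?invr_ge0 sqr_ge0.
  rewrite ger0_norm ?mollifier_ge0// mulrACA -/(mollifier n z) ler_peMl ?mollifier_ge0//.
  by rewrite mulrC ler_pdivlMr// mul1r Dy.
apply: (le_trans (ler_norm _)).
apply: (le_trans (@Rintegral_bound _ _ (measurableTypeR R) leb _ _ mD i2 b)).
rewrite RintegralZl//; last exact: integrable_exprn_gaussf.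
rewrite integral_exprn_gaussf//.
under eq_Rintegral do rewrite expr0 mul1r.
rewrite integral_gaussf// div1r -mulrA ler_wpM2l ?invr_ge0 ?(ltW y2)//.
by rewrite mulrCA sqrt_pi_inv mulr1.
Qed.

(** The centred distribution function scaled to [-1, 1], in a form that is odd by construction; its
    value at 0 is 0, in agreement with [Num.sg]. *)
Definition mollified_sg n y : R := mollifier_cdf n y - mollifier_cdf n (- y).

Lemma mollified_sg_norm_le1 n y : `|mollified_sg n y| <= 1.
Proof.
case/andP: (mollifier_cdf_itv n y) => ? ?; case/andP: (mollifier_cdf_itv n (- y)) => ? ?.
by rewrite ler_norml /mollified_sg; apply/andP; split; lra.
Qed.

Lemma is_derive_mollified_sg n y : is_derive y 1 (mollified_sg n) (2 * mollifier n y).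
Proof.
have d1 := is_derive_mollifier_cdf n y; have d2 := is_derive_mollifier_cdf n (- y).
have d3 : is_derive y 1 (fun y : R => - y) (- 1 : R) by apply: is_derive_eq.
have d4 := is_derive1_comp d2 d3.
apply: is_derive_eq.
rewrite (_ : mollifier n (- y) = mollifier n y); last by rewrite /mollifier /gaussf sqrrN.
by rewrite /GRing.scale/=; ring.
Qed.

Lemma mollified_sg0 n : mollified_sg n 0 = 0.
Proof. by rewrite /mollified_sg oppr0 subrr. Qed.

Let mollified_sg_gt0 n y : 0 < y -> `|mollified_sg n y - 1| <= (y ^+ 2)^-1 * n.+1%:R^-1.
Proof.
move=> y0.
have mC : measurable_fun setT (mollifier n \_ (~` `]-oo, y])).
  apply/measurable_restrict => //; first exact: measurableC.
  by apply: measurable_funTS; exact: continuous_measurable_fun (@continuous_mollifier n).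
have h1 : 1 - mollifier_cdf n y = \int[leb]_z (mollifier n \_ (~` `]-oo, y])) z.
  rewrite -(integral_mollifier n) mollifier_cdfE -RintegralB//.
  - apply: eq_Rintegral => z _; rewrite !patchE in_setC.
    by case: (_ \in _); rewrite /= ?subrr ?subr0.
  - exact: integrable_mollifier.
  - exact: integrable_mollifier_patch.
have b1 := @chebyshev n y _ (lt0r_neq0 y0) _ mC.
have b2 := @chebyshev n y _ (lt0r_neq0 y0) _ (measurable_mollifier_patch n (- y)).
have c1 : \int[leb]_z (mollifier n \_ (~` `]-oo, y])) z <= (y ^+ 2)^-1 * (2 * n.+1%:R)^-1.
  apply: b1 => z /=; rewrite in_itv/= => /negP; rewrite -ltNge => yz.
  by rewrite ler_sqr ?nnegrE ?ltW// (lt_trans y0).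
have c2 : mollifier_cdf n (- y) <= (y ^+ 2)^-1 * (2 * n.+1%:R)^-1.
  rewrite mollifier_cdfE; apply: b2 => z /=; rewrite in_itv/= => yz.
  have yz' : y <= - z by rewrite lerNr.
  by rewrite -(sqrrN z) ler_sqr ?nnegrE ?(ltW y0) ?(le_trans (ltW y0) yz').
case/andP: (mollifier_cdf_itv n y) => g0 g1; case/andP: (mollifier_cdf_itv n (- y)) => g2 g3.
have e2 : (y ^+ 2)^-1 * n.+1%:R^-1 = (y ^+ 2)^-1 * (2 * n.+1%:R)^-1 + (y ^+ 2)^-1 * (2 * n.+1%:R)^-1.
  by rewrite [(2 * _)^-1]invfM; move: (y ^- 2) (n.+1%:R^-1) => a b; field.
rewrite e2 /mollified_sg ler_norml; rewrite -h1 in c1.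
move: c1 c2; move: (y ^- 2 / (2 * n.+1%:R)) => b c1 c2.
by apply/andP; split; lra.
Qed.

Let mollified_sgN n y : mollified_sg n (- y) = - mollified_sg n y.
Proof. by rewrite /mollified_sg opprK opprB. Qed.

Lemma mollified_sg_cvg y : mollified_sg n y @[n --> \oo] --> Num.sg y.
Proof.
have pos z : 0 < z -> mollified_sg n z @[n --> \oo] --> (1 : R).
  move=> z0; apply: cvg_sub0; last exact: cvg_cst.
  apply: norm_cvg0; apply: (@squeeze_cvgr _ _ _ _ (fun=> 0) (fun n => (z ^+ 2)^-1 * n.+1%:R^-1)).
  - by apply: nearW => n; rewrite normr_ge0 mollified_sg_gt0.
  - exact: cvg_cst.
  - rewrite [X in _ --> X](_ : _ = (z ^+ 2)^-1 * 0); last by rewrite mulr0.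
    by apply: cvgMr; exact: cvg_harmonic.
have [y0|y0|<-] := ltgtP 0 y.
- by rewrite gtr0_sg//; exact: pos.
- rewrite ltr0_sg//.
  rewrite (_ : (fun n => _) = (fun n => - mollified_sg n (- y))).
    by apply: cvgN; apply: pos; rewrite oppr_gt0.
  by apply/funext => n; rewrite mollified_sgN opprK.
- by rewrite sgr0; under eq_fun do rewrite mollified_sg0; exact: cvg_cst.
Qed.

(** An antiderivative of [mollified_sg n] in closed form: differentiating the second term cancels y
    times the derivative of [mollified_sg n]. *)
Definition mollified_norm n y : R := y * mollified_sg n y + n.+1%:R^-1 * mollifier n y.

Lemma is_derive_mollified_norm n y : is_derive y 1 (mollified_norm n) (mollified_sg n y).
Proof.
have d1 := is_derive_mollified_sg n y; have d2 := is_derive_mollifier n y.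
apply: is_derive_eq; rewrite /GRing.scale/=; field; by rewrite addrC natr1 pnatr_eq0.
Qed.

Let mollifier_small n y : 0 <= n.+1%:R^-1 * mollifier n y <= Num.sqrt n.+1%:R^-1.
Proof.
rewrite mulr_ge0 ?invr_ge0 ?mollifier_ge0//=.
apply: (@le_trans _ _ (n.+1%:R^-1 * Num.sqrt n.+1%:R)).
  rewrite ler_wpM2l ?invr_ge0// (le_trans (mollifier_le n y))//.
  by rewrite ler_sqrt// ler_piMr// invf_le1 ?pi_gt0// (le_trans _ (pi_ge2 R))// ler1n.
rewrite -{1}[n.+1%:R^-1](@sqr_sqrtr _ n.+1%:R^-1) ?invr_ge0// expr2 -mulrA -sqrtrM ?invr_ge0//.
by rewrite mulVf// sqrtr1 mulr1.
Qed.

Lemma mollified_norm_le n y : `|mollified_norm n y| <= `|y| + 1.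
Proof.
rewrite /mollified_norm (le_trans (ler_normD _ _))// lerD//.
  by rewrite normrM ler_piMr// mollified_sg_norm_le1.
case/andP: (mollifier_small n y) => h0 h1; rewrite ger0_norm// (le_trans h1)//.
by rewrite -[leRHS]sqrtr1 ler_sqrt// invf_le1 ?ler1n.
Qed.

Lemma mollified_norm_cvg y : mollified_norm n y @[n --> \oo] --> `|y|.
Proof.
rewrite /mollified_norm [X in _ --> X](_ : _ = y * Num.sg y + 0); last first.
  by rewrite addr0 mulrC normrEsg.
apply: cvgD; first by apply: cvgMr; exact: mollified_sg_cvg.
apply: (@squeeze_cvgr _ _ _ _ (fun=> 0) (fun n => Num.sqrt n.+1%:R^-1)).
- by apply: nearW => n; exact: mollifier_small.
- exact: cvg_cst.
- rewrite -[X in _ --> X](@sqrtr0 R).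
  by apply: (continuous_cvg_seq (h := Num.sqrt)); [exact: sqrt_continuous|exact: cvg_harmonic].
Qed.

End mollified_sign.

(** * Square-integrable functions as elements of the completion *)

Section refinement.
Context {R : realType} {T : R}.
Implicit Types (c : seq (R * R)) (p : nat -> R).

Let telescope_le {W : zmodType} (E : R -> W) p n j : (forall k, p k <= p k.+1) -> (j <= n)%N ->
  \sum_(k < n) (if p k.+1 <= p j then E (p k.+1) - E (p k) else 0) = E (p j) - E (p 0%N).
Proof.
move=> pm; have pm2 i k : (i <= k)%N -> p i <= p k.
  by move=> ik; rewrite -(subnK ik); elim: (k - i)%N => // l IH; rewrite addSn (le_trans IH).
elim: n => [|n IH]; first by rewrite leqn0 => /eqP ->; rewrite big_ord0 subrr.
rewrite leq_eqVlt => /predU1P[->|jn].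
  rewrite (eq_bigr (fun k : 'I_n.+1 => E (p k.+1) - E (p k))) => [|k _]; last by rewrite pm2.
  by rewrite -(big_mkord xpredT (fun k => E (p k.+1) - E (p k))) telescope_sumr.
rewrite big_ord_recr/= IH//; case: ifP => [h|_]; last by rewrite addr0.
have -> : p n.+1 = p n by apply: le_anti; rewrite pm (le_trans h)// pm2.
by rewrite subrr addr0.
Qed.

(* All indicators in c are constant on the intervals ]p k, p k.+1]. *)
Lemma step_refinement c : times_in T c ->
  exists p (phi : nat -> R) n, [/\ p 0%N = 0, forall k, p k <= p k.+1, 0 <= T -> p n <= T &
    forall (W : lmodType R) (E : R -> W), \sum_(q <- c) q.1 *: E q.2 =
      \sum_(k < n) phi k *: (E (p k.+1) - E (p k)) + (\sum_(q <- c) q.1) *: E 0].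
Proof.
move=> cT; pose s := sort <=%R (0 :: map snd c); pose n := size c.
have sn : size s = n.+1 by rewrite size_sort/= size_map.
(* Freezing the index at n makes p monotone over all natural numbers. *)
pose p k := nth 0 s (minn k n).
have ss : sorted <=%R s by apply: sort_sorted; exact: le_total.
have minS k : (minn k n < size s)%N by rewrite sn ltnS geq_minr.
have pm k : p k <= p k.+1.
  apply: (sorted_leq_nth le_trans) => //; rewrite ?inE ?minS//.
  by rewrite leq_min geq_minr andbT (leq_trans (geq_minl _ _)).
have ps k : p k \in 0 :: map snd c by rewrite -(mem_sort <=%R) mem_nth.
have c0 q : q \in c -> 0 <= q.2 <= T by move=> /cT; rewrite in_itv.
have p_itv k : 0 <= p k /\ (0 <= T -> p k <= T).
  have := ps k; rewrite in_cons => /predU1P[->//|/mapP[q qc ->]].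
  by have /andP[] := c0 _ qc.
have sp x : x \in 0 :: map snd c -> exists2 j, (j <= n)%N & x = p j.
  rewrite -(mem_sort <=%R) => xs; exists (index x s).
    by rewrite -ltnS -sn index_mem.
  by rewrite /p (minn_idPl _) ?nth_index// -ltnS -sn index_mem.
have p0 : p 0%N = 0.
  have [j jn pj] := sp 0 (mem_head _ _).
  apply: le_anti; rewrite (p_itv 0%N).1 andbT pj.
  by elim: j {jn pj} => // j IH; exact: le_trans (pm j).
exists p, (fun k => \sum_(q <- c | p k.+1 <= q.2) q.1), n; split=> //.
  by move=> T0; exact: (p_itv n).2.
(* [E] is arbitrary so that one refinement serves both the vectors of the completion and, at a given
   point, the values of the indicators. *)
move=> W E.
rewrite scaler_suml -[X in _ = X + _](_ : \sum_(q <- c) q.1 *: (E q.2 - E 0) = _).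
  by rewrite -big_split/=; apply: eq_bigr => q _; rewrite -scalerDr subrK.
transitivity (\sum_(q <- c) \sum_(k < n) (if p k.+1 <= q.2 then q.1 *: (E (p k.+1) - E (p k)) else 0)).
  apply: eq_big_seq => q qc.
  have [j jn pj] : exists2 j, (j <= n)%N & q.2 = p j.
    by apply: sp; rewrite in_cons map_f ?orbT.
  rewrite {1}pj -p0 -(telescope_le E pm jn) scaler_sumr.
  by apply: eq_bigr => k _; rewrite pj; case: ifP; rewrite ?scaler0.
rewrite exchange_big/=; apply: eq_bigr => k _.
by rewrite -big_mkcond/= scaler_suml.
Qed.

End refinement.

(* The packed structure lets lemmas on probability measures apply. *)
Definition uniform_law {R : realType} {T : R} (hT : 0 < T) : probability (measurableTypeR R) R :=
  uniform_prob hT.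

Lemma cauchy_seq_cvg {R : realType} {V : completeNormedModType R} (u : nat -> V) :
  (forall eps, 0 < eps -> exists N, forall n, (N <= n)%N -> `|u N - u n| <= eps) ->
  exists l : V, u n @[n --> \oo] --> l.
Proof.
move=> h; suff /cvg_ex : cvg (u n @[n --> \oo]) by [].
apply/cauchy_cvgP/cauchy_exP => eps eps0.
have e2 : 0 < eps / 2 by rewrite divr_gt0.
have [N hN] := h _ e2; exists (u N).
exists N => // n /= Nn; rewrite -ball_normE/=.
by rewrite (le_lt_trans (hN n Nn))// ltr_pdivrMr// ltr_pMr// ltr1n.
Qed.

Lemma sqr_norm_add3_le {R : realType} {V : normedModType R} (x y z : V) :
  `|x + y + z| ^+ 2 <= 3 * (`|x| ^+ 2 + `|y| ^+ 2 + `|z| ^+ 2).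
Proof.
have h : `|x + y + z| <= `|x| + `|y| + `|z|.
  by rewrite (le_trans (ler_normD _ _))// lerD2r ler_normD.
have : `|x + y + z| ^+ 2 <= (`|x| + `|y| + `|z|) ^+ 2.
  by rewrite ler_sqr ?nnegrE ?addr_ge0.
move: `|x| `|y| `|z| => a b c; have := sqr_ge0 (a - b); have := sqr_ge0 (b - c).
have := sqr_ge0 (a - c); nra.
Qed.

Lemma ler_add_eps {R : realType} (a b k : R) : 0 <= k ->
  (forall eps, 0 < eps -> a <= b + k * eps) -> a <= b.
Proof.
move=> k0 h; apply/ler_addgt0Pr => eps eps0.
have k1 : 0 < k + 1 by rewrite ltr_wpDl.
have := h (eps / (k + 1)); rewrite divr_gt0// => /(_ isT) /le_trans; apply.
by rewrite lerD2l mulrA ler_pdivrMr// mulrC ler_wpM2l ?(ltW eps0)// lerDl.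
Qed.

Section L2_vectors.
Context {R : realType} {Hu K T : R}.
Hypotheses (hH : 0 < Hu < 1) (hK : 0 < K <= 1) (hHK : 1 <= 2 * Hu * K) (hT : 0 < T).
Local Notation U := (uniform_law hT).
Local Notation C := (@cov_const R Hu K T).
Implicit Types (c : seq (R * R)) (f g : R -> R).

Lemma integral_uniform_itv (p q : R) : 0 <= p -> p <= q -> q <= T ->
  \int[U]_s \1_`]p, q] s = (q - p) / T.
Proof.
move=> p0 pq qT.
rewrite /Rintegral integral_uniform//=; last exact/measurable_EFinP/measurable_indic.
rewrite subr0 integral_indic//= (setIidl _); last first.
  by move=> x /=; rewrite !in_itv/= => /andP[px xq]; rewrite (le_trans p0 (ltW px)) (le_trans xq qT).
rewrite lebesgue_measure_itv/= lte_fin.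
case: ltP => [_|qp]; first by rewrite -EFinD -EFinM/= mulrC.
by rewrite mule0/= (_ : q - p = 0) ?mul0r//; apply/eqP; rewrite subr_eq0 eq_le qp pq.
Qed.

Lemma measurable_step_fun c : measurable_fun setT (step_fun c).
Proof.
rewrite /step_fun; apply: measurable_sum => q.
by apply: measurable_funM => //; exact: measurable_indic.
Qed.

Lemma step_fun_bounded c : exists M, forall s, `|step_fun c s| <= M.
Proof.
exists (\sum_(q <- c) `|q.1|) => s; rewrite (le_trans (ler_norm_sum _ _ _))//.
by apply: ler_sum => q _; rewrite normrM ler_piMr// indicE; case: (_ \in _); rewrite ?normr0 ?normr1.
Qed.

Lemma sqint_step_fun c : sqint U (step_fun c).
Proof. by have [M cM] := step_fun_bounded c; apply: (@sqint_bounded _ _ _ U _ M) => //; exact: measurable_step_fun. Qed.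

Section vectors.
Context {V : completeNormedModType R} {ip : {dot V for idfun}} {e : R -> V}.
Hypothesis hV : is_completion Hu K T ip e.

Lemma completion0 : e 0 = 0.
Proof.
have T0 : 0 \in `[0, T] by rewrite in_itv/= lexx ltW.
apply/eqP; rewrite -normr_eq0 -sqrf_eq0 (norm_sqr (completion_norm hV)).
by rewrite (completion_ip hV)// bif_cov0.
Qed.

(** On the disjoint intervals of a refinement, the bound [norm_sum_incr_le] is C times the integral
    of the squared step function; the factor T undoes the normalization of the uniform law. This is
    the continuity of the inclusion of L^2 on step functions. *)
Lemma step_vec_le c : times_in T c ->
  `|step_vec e c| ^+ 2 <= C * T * \int[U]_s step_fun c s ^+ 2.
Proof.
move=> cT; have [p [phi [n [p0 pm pT cE]]]] := step_refinement cT.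
have {}pT := pT (ltW hT).
rewrite /step_vec cE completion0 scaler0 addr0.
have p00 : 0 <= p 0%N by rewrite p0.
apply: (le_trans (norm_sum_incr_le hH hK hHK hV phi p00 pm pT)).
rewrite -mulrA ler_wpM2l ?cov_const_ge0//.
have p_ge0 k : 0 <= p k by elim: k => [|k IH]; [rewrite p0|exact: le_trans (pm k)].
have pm2 i k : (i <= k)%N -> p i <= p k.
  by move=> ik; rewrite -(subnK ik); elim: (k - i)%N => // l IH; rewrite addSn (le_trans IH).
pose I k : R -> R := \1_`]p k, p k.+1]%classic.
have iI k : integrableR U (I k).
  apply: (@integrableR_bounded _ _ _ _ _ 1); first exact: measurable_indic.
  by move=> s; rewrite /I indicE; case: (_ \in _); rewrite ?normr0 ?normr1.
have -> : \sum_(k < n) phi k ^+ 2 * (p k.+1 - p k) = T * \int[U]_s \sum_(k < n) phi k ^+ 2 * I k s.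
  rewrite Rintegral_sum; last by move=> k; exact: integrableRZ.
  rewrite mulr_sumr; apply: eq_bigr => k _.
  rewrite RintegralZl//.
  rewrite integral_uniform_itv//; last by rewrite (le_trans _ pT)// pm2.
  by field; rewrite gt_eqF.
rewrite ler_wpM2l ?(ltW hT)//; apply: le_Rintegral => //.
- by apply: (@integrableR_sum _ _ _ U) => k; exact: integrableRZ.
- by have [] := sqint_step_fun c.
move=> s _.
have II (k l : 'I_n) : k != l -> I k s * I l s = 0.
  wlog kl : k l / (k < l)%N.
    move=> h kNl; have [kl|lk|/val_inj kl] := ltngtP k l; [exact: h| |by rewrite kl eqxx in kNl].
    by rewrite mulrC; apply: h => //; rewrite eq_sym.
  move=> _; rewrite /I !indicE !mem_setE !in_itv/=.
  case: (ltP (p k) s) => _ /=; last by rewrite mul0r.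
  case: (leP s (p k.+1)) => sk /=; last by rewrite mul0r.
  by rewrite ltNge (le_trans sk (pm2 _ _ kl))/= mulr0.
have sqE : \sum_(k < n) phi k ^+ 2 * I k s = (\sum_(k < n) phi k * I k s) ^+ 2.
  rewrite expr2 mulr_suml; apply: eq_bigr => k _.
  rewrite mulr_sumr (bigD1 k)//= big1 ?addr0.
    by rewrite mulrACA -expr2 /I indicE; case: (_ \in _); rewrite ?mulr1 ?mulr0.
  by move=> l lk; rewrite mulrACA II ?mulr0// eq_sym.
rewrite sqE.
have IE k : I k s = \1_`]0, p k.+1]%classic s - \1_`]0, p k]%classic s :> R.
  rewrite /I !indicE !mem_setE !in_itv/=.
  have [s0|s0] := ltP 0 s; last first.
    by rewrite /= subrr ltNge (le_trans s0 (p_ge0 k)).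
  rewrite /=; have [sk|ks] := leP s (p k); first by rewrite (le_trans sk (pm k))/= subrr.
  by rewrite subr0.
under eq_bigr do rewrite IE.
have := cE R^o (fun tau : R => \1_`]0, tau]%classic s : R^o).
rewrite (_ : \1_`]0, 0]%classic s = 0 :> R); last first.
  rewrite indicE mem_setE in_itv/=.
  by case: (ltP 0 s) => //= s0; rewrite leNgt s0.
rewrite scaler0 addr0 => <-.
(* For s > 0 the half-open indicators agree with those of [step_fun]; for s <= 0 the refined sum is
   0 and the inequality is trivial. *)
have [s0|s0] := ltP 0 s; last first.
  rewrite big1 ?expr0n ?sqr_ge0// => q _.
  by rewrite indicE mem_setE in_itv/= ltNge s0/= scaler0.
rewrite le_eqVlt; apply/orP; left; apply/eqP; congr (_ ^+ 2).
by apply: eq_bigr => q _; rewrite !indicE !mem_setE !in_itv/= s0 (ltW s0).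
Qed.

(** The relation behind [L2_element] in epsilon form, which passes to limits without diagonal
    sequences. *)
Definition L2_approx f (h : V) := forall eps, 0 < eps -> exists c,
  [/\ times_in T c, \int[U]_s (step_fun c s - f s) ^+ 2 <= eps &
      `|step_vec e c - h| ^+ 2 <= eps].

Lemma L2_approx_step c : times_in T c -> L2_approx (step_fun c) (step_vec e c).
Proof.
move=> cT eps eps0; exists c; split=> //.
  under eq_Rintegral do rewrite subrr expr0n/=.
  by rewrite Rintegral_cst// mul0r ltW.
by rewrite subrr normr0 expr0n ltW.
Qed.

Let int3 f1 f2 f3 : sqint U f1 -> sqint U f2 -> sqint U f3 ->
  \int[U]_s (f1 s + f2 s + f3 s) ^+ 2 <=
  3 * (\int[U]_s f1 s ^+ 2 + \int[U]_s f2 s ^+ 2 + \int[U]_s f3 s ^+ 2).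
Proof.
move=> h1 h2 h3; have [_ i1] := h1; have [_ i2] := h2; have [_ i3] := h3.
rewrite -RintegralD// -RintegralD//; last exact: integrableRD.
rewrite -RintegralZl//; last by apply: integrableRD => //; exact: integrableRD.
apply: le_Rintegral => //.
- by have [_] := sqintD (sqintD h1 h2) h3.
- by apply: integrableRZ; apply: integrableRD => //; exact: integrableRD.
move=> s _; have := @sqr_norm_add3_le _ R^o (f1 s) (f2 s) (f3 s).
by rewrite !real_normK ?num_real.
Qed.

(** Two three-term splittings, one in the completion and one in L^2, give the factor 9 = 3 . 3; the
    approximation errors are absorbed by [ler_add_eps]. The element attached to f thus depends
    continuously on f. *)
Lemma L2_approx_dist f g (h k : V) : sqint U f -> sqint U g ->
  L2_approx f h -> L2_approx g k ->
  `|h - k| ^+ 2 <= 9 * (C * T) * \int[U]_s (f s - g s) ^+ 2.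
Proof.
move=> sf sg hf hg.
have CT0 : 0 <= C * T by rewrite mulr_ge0 ?cov_const_ge0// ltW.
apply: (@ler_add_eps _ _ _ (6 + 18 * (C * T))) => [|eps eps0].
  by rewrite addr_ge0// mulr_ge0.
have [c [cT cf ch]] := hf _ eps0; have [c' [cT' cg ck]] := hg _ eps0.
pose c2 := c ++ [seq (- q.1, q.2) | q <- c'].
have c2T : times_in T c2.
  by move=> q; rewrite mem_cat => /orP[/cT//|/mapP[q' /cT' q'T ->]].
have c2v : step_vec e c2 = step_vec e c - step_vec e c'.
  rewrite /step_vec big_cat big_map/=; congr (_ + _).
  by rewrite -sumrN; apply: eq_bigr => q _; rewrite scaleNr.
have c2f s : step_fun c2 s = step_fun c s - step_fun c' s.
  rewrite /step_fun big_cat big_map/=; congr (_ + _).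
  by rewrite -sumrN; apply: eq_bigr => q _; rewrite mulNr.
have v2 := step_vec_le c2T; rewrite c2v in v2.
have v2E : \int[U]_s step_fun c2 s ^+ 2 = \int[U]_s (step_fun c s - step_fun c' s) ^+ 2.
  by apply: eq_Rintegral => s _; rewrite c2f.
rewrite v2E in v2.
have sc := sqint_step_fun c; have sc' := sqint_step_fun c'.
have i3 := int3 (sqintB sc sf) (sqintB sf sg) (sqintB sg sc').
have E : \int[U]_s (step_fun c s - step_fun c' s) ^+ 2 =
    \int[U]_s (step_fun c s - f s + (f s - g s) + (g s - step_fun c' s)) ^+ 2.
  by apply: eq_Rintegral => s _; congr (_ ^+ 2); ring.
have cg' : \int[U]_s (g s - step_fun c' s) ^+ 2 <= eps.
  by under eq_Rintegral do rewrite -sqrrN opprB.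
have n3 := sqr_norm_add3_le (h - step_vec e c) (step_vec e c - step_vec e c') (step_vec e c' - k).
have vE : h - step_vec e c + (step_vec e c - step_vec e c') + (step_vec e c' - k) = h - k.
  by rewrite [h - _ + _]addrA subrK [LHS]addrA subrK.
rewrite vE (distrC h (step_vec e c)) in n3; rewrite E in v2.
have v3 := le_trans v2 (ler_wpM2l CT0 i3).
move: n3 v3 cf cg' ch ck CT0.
move: (`|h - k| ^+ 2) (`|step_vec e c - h| ^+ 2) (`|step_vec e c - step_vec e c'| ^+ 2)
  (`|step_vec e c' - k| ^+ 2) (Rintegral _ _ _) (Rintegral _ _ _) (Rintegral _ _ _) (C * T).
move=> x y z w a b d' k' n3 v3 h1 h2 h3 h4 h5.
have : k' * a <= k' * eps by rewrite ler_wpM2l.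
have : k' * d' <= k' * eps by rewrite ler_wpM2l.
lra.
Qed.

(** The distance estimate makes [h_] a Cauchy sequence, and its limit inherits the approximations of
    a late term. *)
Lemma L2_approx_closed (f_ : nat -> R -> R) f (h_ : nat -> V) :
  (forall n, sqint U (f_ n)) -> sqint U f -> (forall n, L2_approx (f_ n) (h_ n)) ->
  \int[U]_s (f_ n s - f s) ^+ 2 @[n --> \oo] --> 0 ->
  exists2 h, L2_approx f h & h_ n @[n --> \oo] --> h.
Proof.
move=> sf_ sf hf fn0.
have CT0 : 0 <= C * T by rewrite mulr_ge0 ?cov_const_ge0// ltW.
have small eps : 0 < eps -> exists N, forall n, (N <= n)%N -> \int[U]_s (f_ n s - f s) ^+ 2 <= eps.
  move=> eps0; have /cvgr0Pnorm_le /(_ _ eps0) [N _ hN] := fn0.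
  by exists N => n Nn; apply: le_trans (hN n Nn); exact: ler_norm.
have [h hh] : exists h : V, h_ n @[n --> \oo] --> h.
  apply: cauchy_seq_cvg => eps eps0.
  have d0 : 0 < eps ^+ 2 / (9 * (C * T) * 6 + 1).
    by rewrite divr_gt0 ?exprn_gt0// ltr_wpDl// mulr_ge0// mulr_ge0.
  have [N hN] := small _ d0; exists N => n Nn.
  rewrite -ler_sqr ?nnegrE ?(ltW eps0)//.
  apply: (le_trans (L2_approx_dist (sf_ N) (sf_ n) (hf N) (hf n))).
  have i3 := int3 (sqintB (sf_ N) sf) (sqintB sf (sf_ n)) (sqint_step_fun [::]).
  have E : \int[U]_s (f_ N s - f_ n s) ^+ 2 =
      \int[U]_s (f_ N s - f s + (f s - f_ n s) + step_fun [::] s) ^+ 2.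
    by apply: eq_Rintegral => s _; congr (_ ^+ 2); rewrite /step_fun big_nil; ring.
  have h1 := hN N (leqnn _); have h2 := hN n Nn.
  have E2 : \int[U]_s (f s - f_ n s) ^+ 2 = \int[U]_s (f_ n s - f s) ^+ 2.
    by apply: eq_Rintegral => s _; rewrite -sqrrN opprB.
  have E3 : \int[U]_s step_fun [::] s ^+ 2 = 0.
    under eq_Rintegral do rewrite /step_fun big_nil expr0n/=.
    by rewrite Rintegral_cst// mul0r.
  rewrite -E E2 E3 addr0 in i3.
  apply: (@le_trans _ _ (9 * (C * T) * (6 * (eps ^+ 2 / (9 * (C * T) * 6 + 1))))).
    apply: ler_wpM2l; [exact: mulr_ge0|move: h1 h2 i3].
    by move: (eps ^+ 2 / _) (Rintegral _ _ _) (Rintegral _ _ _) (Rintegral _ _ _) => x1 x2 x3 x4; lra.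
  have q0 : 0 <= 9 * (C * T) * 6 by apply: mulr_ge0 => //; exact: mulr_ge0.
  rewrite (mulrA (9 * (C * T))) [X in X <= _]mulrA ler_pdivrMr ?ltr_wpDl//.
  by rewrite mulrC ler_wpM2l ?sqr_ge0// lerDl.
exists h => // eps eps0.
have e4 : 0 < eps / 6 by rewrite divr_gt0.
have [N hN] := small _ e4.
have : \forall n \near \oo, `|h - h_ n| < Num.sqrt (eps / 6).
  by move/cvgrPdist_lt : hh; apply; rewrite sqrtr_gt0.
move=> [N' _ hN'].
pose n := maxn N N'.
have h1 := hN n (leq_maxl _ _); have h2 := hN' n (leq_maxr _ _).
have [c [cT cf ch]] := hf n _ e4.
have {}h2 : `|h_ n - h| ^+ 2 <= eps / 6.
  by rewrite distrC -[leRHS]sqr_sqrtr ?(ltW e4)// ler_sqr ?nnegrE ?sqrtr_ge0// ltW.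
exists c; split => //.
  have i3 := int3 (sqintB (sqint_step_fun c) (sf_ n)) (sqintB (sf_ n) sf) (sqint_step_fun [::]).
  have E : \int[U]_s (step_fun c s - f s) ^+ 2 =
      \int[U]_s (step_fun c s - f_ n s + (f_ n s - f s) + step_fun [::] s) ^+ 2.
    by apply: eq_Rintegral => s _; congr (_ ^+ 2); rewrite /step_fun big_nil; ring.
  have E3 : \int[U]_s step_fun [::] s ^+ 2 = 0.
    under eq_Rintegral do rewrite /step_fun big_nil expr0n/=.
    by rewrite Rintegral_cst// mul0r.
  by rewrite E3 addr0 in i3; rewrite E; lra.
have := sqr_norm_add3_le (step_vec e c - h_ n) (h_ n - h) 0.
rewrite addr0 normr0 expr0n/= addr0 addrA subrK => h3.
lra.
Qed.

Lemma L2_approx_element f (h : V) M : measurable_fun setT f -> (forall s, `|f s| <= M) ->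
  L2_approx f h -> L2_element T e f h.
Proof.
move=> mf fM hf.
have sf : sqint U f by apply: (@sqint_bounded _ _ _ U _ M).
have intE g : sqint U g ->
    (\int[lebesgue_measure]_(s in `[0%R, T]) (g s ^+ 2)%:E)%E = (T * \int[U]_s g s ^+ 2)%:E.
  move=> [mg ig]; rewrite EFinM EFin_Rintegral// integral_uniform//; last first.
  - by move=> s; rewrite lee_fin sqr_ge0.
  - by apply/measurable_EFinP; exact: measurable_funX.
  by rewrite subr0 muleA -EFinM mulfV ?gt_eqF// mul1e.
split.
- exact: measurable_funTS.
- by rewrite intE// ltry.
- have cn n : exists c, [/\ times_in T c, \int[U]_s (step_fun c s - f s) ^+ 2 <= n.+1%:R^-1 &
      `|step_vec e c - h| ^+ 2 <= n.+1%:R^-1].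
    by apply: hf; rewrite invr_gt0.
  pose c n := sval (cid (cn n)).
  have cP n : [/\ times_in T (c n), \int[U]_s (step_fun (c n) s - f s) ^+ 2 <= n.+1%:R^-1 &
      `|step_vec e (c n) - h| ^+ 2 <= n.+1%:R^-1] := svalP (cid (cn n)).
  exists c; split.
  + by move=> n; have [] := cP n.
  + rewrite (_ : (fun n => _) =
        (fun n => (T * \int[U]_s (step_fun (c n) s - f s) ^+ 2)%:E)); last first.
      by apply/funext => n; rewrite intE//; exact: sqintB (sqint_step_fun _) sf.
    apply: cvg_EFin; first exact: nearW.
    apply: (@squeeze_cvgr _ _ _ _ (fun=> 0) (fun n => T * n.+1%:R^-1)).
    * apply: nearW => n /=; rewrite mulr_ge0 ?(ltW hT)//=; last first.
        by apply: Rintegral_ge0 => s _; exact: sqr_ge0.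
      by rewrite ler_wpM2l ?(ltW hT)//; have [] := cP n.
    * exact: cvg_cst.
    * rewrite [X in _ --> X](_ : _ = T * 0); last by rewrite mulr0.
      by apply: cvgMr; exact: cvg_harmonic.
  + apply/cvgrPdist_le => eps eps0.
    have e2 : 0 < eps ^+ 2 by rewrite exprn_gt0.
    have /cvgr0Pnorm_le /(_ _ e2) := @cvg_harmonic R.
    apply: filterS => n hn; rewrite distrC -ler_sqr ?nnegrE ?(ltW eps0)//.
    have [_ _ h2] := cP n; apply: (le_trans h2); apply: le_trans hn.
    exact: ler_norm.
Qed.

End vectors.
End L2_vectors.

(** * Step elements on uniform grids *)

Section uniform_grid.
Context {R : realType}.
Implicit Types (t s : R) (N k : nat).

Definition grid t N k : R := k%:R * (t / N.+1%:R).

Lemma grid0 t N : grid t N 0 = 0. Proof. by rewrite /grid mul0r. Qed.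

Lemma grid_last t N : grid t N N.+1 = t.
Proof. by rewrite /grid mulrCA divff ?mulr1. Qed.

Lemma gridS t N k : grid t N k.+1 - grid t N k = t / N.+1%:R.
Proof. by rewrite /grid -natr1; ring. Qed.

Lemma grid_le t N k : 0 <= t -> grid t N k <= grid t N k.+1.
Proof. by move=> t0; rewrite -subr_ge0 gridS divr_ge0. Qed.

Lemma grid_itv t N k : 0 <= t -> (k <= N.+1)%N -> 0 <= grid t N k <= t.
Proof.
move=> t0 kN; rewrite mulr_ge0 ?divr_ge0//=.
by rewrite /grid mulrA ler_pdivrMr// mulrC ler_wpM2l// ler_nat.
Qed.

Definition grid_sum {W : lmodType R} (E : R -> W) t N (phi : nat -> R) : W :=
  \sum_(k < N.+1) phi k *: (E (grid t N k.+1) - E (grid t N k)).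

(** Each increment is split into its two endpoints because the encoding of step elements only knows
    the indicators of [0, t]. *)
Definition grid_list t N (phi : nat -> R) : seq (R * R) :=
  [seq (phi k, grid t N k.+1) | k <- iota 0 N.+1] ++ [seq (- phi k, grid t N k) | k <- iota 0 N.+1].

Lemma grid_list_sum {W : lmodType R} (E : R -> W) t N (phi : nat -> R) :
  \sum_(q <- grid_list t N phi) q.1 *: E q.2 = grid_sum E t N phi.
Proof.
have E0 (F : nat -> W) : \sum_(k <- iota 0 N.+1) F k = \sum_(k < N.+1) F k.
  by rewrite -(big_mkord xpredT F) /index_iota subn0.
rewrite /grid_list big_cat !big_map !E0 /grid_sum.
by rewrite /= -big_split/=; apply: eq_bigr => k _; rewrite scaleNr scalerBr.
Qed.

Lemma grid_list_in T t N (phi : nat -> R) : 0 <= t <= T -> times_in T (grid_list t N phi).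
Proof.
move=> /andP[t0 tT] q; rewrite /grid_list mem_cat => /orP[] /mapP[k];
  rewrite mem_iota add0n => /andP[_ kN] -> /=; rewrite in_itv/=.
- by have /andP[-> h] := grid_itv t0 kN; rewrite (le_trans h).
- by have /andP[-> h] := grid_itv t0 (ltnW kN); rewrite (le_trans h).
Qed.

(* On the interval of the grid containing s the step function takes the value
   phi k, and the indicators of these intervals add up to that of ]0, t]. *)
Lemma grid_step_close t N (phi : nat -> R) (v s d : R) : 0 <= t -> 0 <= d ->
  (forall k, (k < N.+1)%N -> grid t N k < s -> s <= grid t N k.+1 -> `|phi k - v| <= d) ->
  `|step_fun (grid_list t N phi) s - v * \1_`]0, t]%classic s| <= d.
Proof.
move=> t0 d0 hd; pose E (tau : R) : R^o := \1_`[0, tau]%classic s.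
have EE tau : E tau = (0 <= s <= tau)%R%:R :> R by rewrite /E indicE mem_setE in_itv.
have -> : step_fun (grid_list t N phi) s = grid_sum E t N phi.
  by rewrite -grid_list_sum; apply: eq_bigr.
have -> : \1_`]0, t]%classic s = \sum_(k < N.+1) (E (grid t N k.+1) - E (grid t N k)) :> R.
  rewrite -(big_mkord xpredT (fun k => E (grid t N k.+1) - E (grid t N k))) telescope_sumr//.
  rewrite grid0 grid_last !EE indicE mem_setE in_itv/=.
  have [s0|s0|<-] := ltgtP 0 s => /=; rewrite ?subrr ?subr0//.
  by rewrite t0 subrr.
rewrite /grid_sum mulr_sumr -sumrB.
have inc k : 0 <= E (grid t N k.+1) - E (grid t N k).
  rewrite subr_ge0 !EE ler_nat; case: (0 <= s) => //=.
  by case: leP => // h; rewrite (le_trans h (grid_le _ _ t0)).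
have b (k : 'I_N.+1) : `|phi k *: (E (grid t N k.+1) - E (grid t N k)) - v * (E (grid t N k.+1) - E (grid t N k))| <=
    d * (E (grid t N k.+1) - E (grid t N k)).
  rewrite -mulrBl normrM (ger0_norm (inc k)).
  have [E0|] := eqVneq (E (grid t N k.+1) - E (grid t N k)) 0; first by rewrite E0 !mulr0.
  rewrite !EE => h; rewrite ler_wpM2r//; first by rewrite -!EE.
  apply: hd => //; move: h; case: (0 <= s) => /=; rewrite ?subrr ?eqxx//.
    by case: (ltP (grid t N k) s) => // h; rewrite (le_trans h (grid_le _ _ t0)) subrr eqxx.
  by case: (leP s (grid t N k.+1)) => // h; rewrite leNgt (le_lt_trans (grid_le _ _ t0) h) subrr eqxx.
apply: (le_trans (ler_norm_sum _ _ _)); apply: (@le_trans _ _ (\sum_(k < N.+1) d * (E (grid t N k.+1) - E (grid t N k)))).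
  by apply: ler_sum => k _; exact: b.
rewrite -mulr_sumr -[leRHS]mulr1 ler_wpM2l//.
rewrite -(big_mkord xpredT (fun k => E (grid t N k.+1) - E (grid t N k))) telescope_sumr// !EE.
case: (0 <= s <= grid t N N.+1); case: (0 <= s <= grid t N 0);
  by rewrite /= ?subrr ?subr0 ?sub0r ?lexx ?ler01 ?lerN10.
Qed.

End uniform_grid.

Section path_integrals.
Context {R : realType} {Hu K T : R}.
Hypotheses (hH : 0 < Hu < 1) (hK : 0 < K <= 1) (hHK : 1 <= 2 * Hu * K) (hT : 0 < T).
Local Notation U := (uniform_law hT).
Local Notation C := (@cov_const R Hu K T).
Context {V : completeNormedModType R} {ip : {dot V for idfun}} {e : R -> V}.
Hypothesis hV : is_completion Hu K T ip e.
Context (t : R) (ht : 0 <= t <= T).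
Local Notation approx := (@L2_approx R T hT V e).

Let t0 : 0 <= t. Proof. by case/andP: ht. Qed.

(** Trapezoidal weights, the mean of the two endpoint values: the integrations by parts at both ends
    of an interval produce exactly this coefficient. *)
Definition path_coef (S b : R -> R) N (k : nat) : R :=
  (S (b (grid t N k)) + S (b (grid t N k.+1))) / 2.

Lemma bounded_path_sqint (S b : R -> R) M : measurable_fun setT S -> continuous b ->
  (forall x, `|S x| <= M) ->
  measurable_fun setT (fun s => S (b s) * \1_`]0, t]%classic s) /\
  (forall s, `|S (b s) * \1_`]0, t]%classic s| <= M).
Proof.
move=> mS cb SM; split.
  apply: measurable_funM; last exact: measurable_indic.
  by apply: measurableT_comp => //; exact: continuous_measurable_fun.
move=> s; rewrite normrM indicE; case: (_ \in _); rewrite ?normr1 ?mulr1//.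
by rewrite normr0 mulr0 (le_trans (normr_ge0 _) (SM 0)).
Qed.

(** The step functions converge at every point because S composed with the path is continuous, and
    they are bounded by M; so they converge in L^2 and [L2_approx_closed] applies. *)
Lemma trapezoid_cvg (S b : R -> R) M : continuous S -> continuous b -> (forall x, `|S x| <= M) ->
  exists2 h : V, approx (fun s => S (b s) * \1_`]0, t]%classic s) h &
    grid_sum e t N (path_coef S b N) @[N --> \oo] --> h.
Proof.
move=> cS cb SM.
have [mf fM] := bounded_path_sqint (continuous_measurable_fun cS) cb SM.
have M0 : 0 <= M := le_trans (normr_ge0 _) (SM 0).
have cM N k : `|path_coef S b N k| <= M.
  rewrite /path_coef normrM (@ger0_norm _ 2^-1)// ler_pdivrMr//.
  by rewrite (le_trans (ler_normD _ _))// mulr_natr mulr2n lerD.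
have svE N : step_vec e (grid_list t N (path_coef S b N)) = grid_sum e t N (path_coef S b N).
  exact: grid_list_sum.
rewrite -(funext svE).
apply: (@L2_approx_closed _ _ _ _ hH hK hHK hT _ _ _ hV
  (fun N => step_fun (grid_list t N (path_coef S b N)))).
- by move=> N; exact: sqint_step_fun.
- exact: (@sqint_bounded _ _ _ U _ M).
- by move=> N; apply: L2_approx_step; exact: grid_list_in.
have sM N s : `|step_fun (grid_list t N (path_coef S b N)) s| <= M.
  have := @grid_step_close _ t N (path_coef S b N) 0 s M t0 M0.
  by rewrite mul0r subr0; apply => k _ _ _; rewrite subr0.
rewrite [X in _ --> X](_ : _ = \int[U]_s 0); last by rewrite Rintegral_cst// mul0r.
apply: (@Rintegral_dominated_cvg _ _ _ _ _ _ (fun=> (2 * M) ^+ 2)).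
- move=> N; apply: measurable_funX; apply: measurable_funB => //; exact: measurable_step_fun.
- move=> s; rewrite [X in _ --> X](_ : _ = 0 ^+ 2); last by rewrite expr0n.
  apply: (continuous_cvg_seq (h := fun x : R => x ^+ 2)); first exact: exprn_continuous.
  apply/cvgr0Pnorm_le => eps eps0.
  have e2 : 0 < eps by [].
  have cSb : {for s, continuous (S \o b)} by apply: continuous_comp; [exact: cb|exact: cS].
  have /cvgrPdist_le /(_ _ eps0) /nbhs_ballP [r /= r0 hr] := cSb.
  have : \forall N \near \oo, t * N.+1%:R^-1 < r.
    have : t * N.+1%:R^-1 @[N --> \oo] --> t * 0 by apply: cvgMr; exact: cvg_harmonic.
    by rewrite mulr0 => /cvgr0Pnorm_lt /(_ _ r0); apply: filterS => N; apply: le_lt_trans; exact: ler_norm.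
  apply: filterS => N hN; apply: grid_step_close => //; first exact: ltW.
  move=> k kN k1 k2; have := gridS t N k; rewrite /path_coef.
  move: hN; move: (t / N.+1%:R) => q hN gk.
  have h1 : `|S (b s) - S (b (grid t N k))| <= eps.
    by apply: hr; rewrite -ball_normE/= gtr0_norm ?subr_gt0//; lra.
  have h2 : `|S (b s) - S (b (grid t N k.+1))| <= eps.
    apply: hr; rewrite -ball_normE/= ler0_norm ?subr_le0//; lra.
  move: h1 h2; rewrite !ler_norml => /andP[h1 h1'] /andP[h2 h2']; apply/andP; split; lra.
- by apply: (@integrableR_bounded _ _ _ U _ ((2 * M) ^+ 2)) => // s; rewrite ger0_norm ?sqr_ge0.
- move=> N s; rewrite ger0_norm ?sqr_ge0// -real_normK ?num_real// ler_sqr ?nnegrE ?mulr_ge0//.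
  by rewrite (le_trans (ler_normB _ _))// mulr_natl mulr2n lerD.
Qed.

(** Both limits are taken for one fixed path. The bound 9 C T is [L2_approx_dist] against the zero
    function; being the same for all paths, it later serves for dominated convergence over Omega. *)
Lemma sign_path_cvg (b : R -> R) : continuous b ->
  exists u_ : nat -> V, exists2 u : V,
    L2_element T e (fun s => Num.sg (b s) * \1_`]0, t]%classic s) u &
    [/\ forall n, grid_sum e t N (path_coef (mollified_sg n) b N) @[N --> \oo] --> u_ n,
        u_ n @[n --> \oo] --> u, forall n, `|u_ n| ^+ 2 <= 9 * (C * T) & `|u| ^+ 2 <= 9 * (C * T)].
Proof.
move=> cb.
have cS n : continuous (mollified_sg n : R -> R).
  move=> y; apply/differentiable_continuous/derivable1_diffP.
  by have [] := is_derive_mollified_sg n y.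
have hu n := trapezoid_cvg (cS n) cb (mollified_sg_norm_le1 n).
have hu' n : exists h : V, approx (fun s => mollified_sg n (b s) * \1_`]0, t]%classic s) h /\
    grid_sum e t N (path_coef (mollified_sg n) b N) @[N --> \oo] --> h.
  by have [h h1 h2] := hu n; exists h.
pose u_ n : V := sval (cid (hu' n)).
have uP n : approx (fun s => mollified_sg n (b s) * \1_`]0, t]%classic s) (u_ n) /\
    grid_sum e t N (path_coef (mollified_sg n) b N) @[N --> \oo] --> u_ n := svalP (cid (hu' n)).
have msg : measurable_fun setT (Num.sg : R -> R).
  rewrite (_ : Num.sg = (fun x : R => \1_`]0, +oo[%classic x - \1_`]-oo, 0[%classic x)).
    by apply: measurable_funB; exact: measurable_indic.
  apply/funext => x; rewrite !indicE !mem_setE !in_itv/= andbT.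
  have [x0|x0|<-] := ltgtP 0 x.
  - by rewrite gtr0_sg// subr0.
  - by rewrite ltr0_sg// sub0r.
  - by rewrite sgr0 subrr.
have sg1 x : `|Num.sg x| <= 1 :> R by rewrite normr_sg; case: eqP => _; rewrite /= ?ler01.
have [mf fM] := bounded_path_sqint msg cb sg1.
have mfn n := bounded_path_sqint (continuous_measurable_fun (cS n)) cb (mollified_sg_norm_le1 n).
have sf : sqint U (fun s => Num.sg (b s) * \1_`]0, t]%classic s) by exact: (@sqint_bounded _ _ _ U _ 1).
have sfn n : sqint U (fun s => mollified_sg n (b s) * \1_`]0, t]%classic s).
  by have [h1 h2] := mfn n; exact: (@sqint_bounded _ _ _ U _ 1).
have bnd (f : R -> R) (h : V) : measurable_fun setT f -> (forall s, `|f s| <= 1) -> approx f h -> `|h| ^+ 2 <= 9 * (C * T).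
  move=> mf' f1 fh.
  have sf' : sqint U f by exact: (@sqint_bounded _ _ _ U _ 1).
  have nilT : times_in T [::] by [].
  have := L2_approx_dist hH hK hHK hV sf' (sqint_step_fun hT [::]) fh (L2_approx_step hT nilT).
  rewrite /step_vec big_nil subr0 => /le_trans; apply.
  have CT0 : 0 <= C * T by rewrite mulr_ge0 ?cov_const_ge0// ltW.
  rewrite -[leRHS]mulr1; apply: ler_wpM2l; first exact: mulr_ge0.
  have : \int[U]_s 1 = 1.
    have h1 := @Rintegral_cst _ _ _ U setT measurableT 1.
    rewrite h1 mul1r -[RHS]/(fine 1%E); congr (fine _); exact: (@probability_setT _ _ _ U).
  move=> <-; apply: le_Rintegral => //.
  - by have [] := sqintB sf' (sqint_step_fun hT [::]).
  - by apply: (@integrableR_bounded _ _ _ U _ 1) => // s; rewrite normr1.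
  move=> s _; rewrite /step_fun big_nil subr0 -real_normK ?num_real//.
  by rewrite -[leRHS](expr1n _ 2) ler_sqr ?nnegrE.
have [u uf uu] : exists2 u, approx (fun s => Num.sg (b s) * \1_`]0, t]%classic s) u & u_ n @[n --> \oo] --> u.
  apply: (L2_approx_closed hH hK hHK hV sfn sf (fun n => (uP n).1)).
  rewrite [X in _ --> X](_ : _ = \int[U]_s 0); last by rewrite Rintegral_cst// mul0r.
  apply: (@Rintegral_dominated_cvg _ _ _ _ _ _ (fun=> 4)).
  - move=> n; apply: measurable_funX; apply: measurable_funB => //; exact: (mfn n).1.
  - move=> s; rewrite [X in _ --> X](_ : _ = (Num.sg (b s) * \1_`]0, t]%classic s - Num.sg (b s) * \1_`]0, t]%classic s) ^+ 2); last by rewrite subrr expr0n.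
    apply: (continuous_cvg_seq (h := fun x : R => x ^+ 2)); first exact: exprn_continuous.
    apply: cvgB; last exact: cvg_cst.
    by apply: cvgMl; exact: mollified_sg_cvg.
  - by apply: (@integrableR_bounded _ _ _ U _ 4) => // s; rewrite ger0_norm.
  - move=> n s; rewrite ger0_norm ?sqr_ge0// -real_normK ?num_real//.
    rewrite (_ : 4 = 2 ^+ 2 :> R); last by rewrite -natrX.
    rewrite ler_sqr ?nnegrE//.
    rewrite (le_trans (ler_normB _ _))// (_ : 2 = 1 + 1 :> R)// lerD//; exact: (mfn n).2.
exists u_, u; first exact: (L2_approx_element mf fM uf).
split=> //.
- by move=> n; exact: (uP n).2.
- by move=> n; exact: (bnd _ _ (mfn n).1 (mfn n).2 (uP n).1).
- exact: (bnd _ _ mf fM uf).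
Qed.

End path_integrals.

Section clamp.
Context {R : realType} (T : R).
Hypothesis T0 : 0 <= T.

(** Freezing the time outside [0, T] turns paths known to be continuous on [0, T] into paths
    continuous on the whole line, as the joint measurability lemma requires. *)
Definition clamp (s : R) : R := Num.max 0 (Num.min s T).

Lemma clamp_itv s : 0 <= clamp s <= T.
Proof. by rewrite /clamp le_max lexx/= ge_max T0 ge_min lexx orbT. Qed.

Lemma clamp_id s : 0 <= s <= T -> clamp s = s.
Proof. by move=> /andP[s0 sT]; rewrite /clamp (min_idPl sT) (max_idPr s0). Qed.

Lemma clamp_lip s r : `|clamp s - clamp r| <= `|s - r|.
Proof.
wlog sr : s r / s <= r.
  by move=> h; have [/h//|/ltW/h] := leP s r; rewrite distrC (distrC r).
have mono : clamp s <= clamp r by rewrite /clamp le_max2// le_min2.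
rewrite distrC (distrC s) !ger0_norm ?subr_ge0// /clamp.
by rewrite /Num.max /Num.min; do ?case: ifPn; rewrite -?leNgt => *; lra.
Qed.

Lemma continuous_clamp : continuous clamp.
Proof.
move=> s; apply/cvgrPdist_lt => eps eps0.
exists eps => // r /=.
exact: le_lt_trans (clamp_lip _ _).
Qed.

Lemma continuous_comp_clamp (f : R -> R) : {within `[0, T], continuous f} ->
  continuous (f \o clamp).
Proof.
move=> /subspace_continuousP cf s.
have h : f @ within `[0, T]%classic (nbhs (clamp s)) --> f (clamp s).
  by apply: cf; rewrite /= in_itv/= clamp_itv.
move=> A /h hA; have := @continuous_clamp s _ hA.
by apply: (@filterS _ (nbhs s)) => r; apply; rewrite /= in_itv/= clamp_itv.
Qed.

End clamp.

(** * Separability of the completion and measurable vector fields *)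

Section separability.
Context {R : realType} {Hu K T : R}.
Hypotheses (hH : 0 < Hu < 1) (hK : 0 < K <= 1) (hHK : 1 <= 2 * Hu * K) (hT : 0 < T).
Local Notation C := (@cov_const R Hu K T).
Context {V : completeNormedModType R} {ip : {dot V for idfun}} {e : R -> V}.
Hypothesis hV : is_completion Hu K T ip e.

Lemma norm_incr_sqr_le a b : 0 <= a <= T -> 0 <= b <= T -> `|e a - e b| ^+ 2 <= C * `|a - b|.
Proof.
wlog ab : a b / a <= b.
  by move=> h ha hb; have [/h->//|/ltW/h] := leP a b; rewrite distrC (distrC a); exact.
move=> /andP[a0 aT] /andP[b0 bT]; rewrite distrC (distrC a) (norm_sqr (completion_norm hV)).
rewrite (ip_incr hV) ?in_itv/= ?a0 ?aT ?b0 ?bT//.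
rewrite (@ger0_norm _ (b - a)) ?subr_ge0//.
exact: (le_trans (ler_norm _) (cov_rect_le hH hK hHK a0 ab bT a0 ab bT)).
Qed.

Let rat_vec (c : seq (rat * rat)) : V :=
  step_vec e [seq (ratr p.1, clamp T (ratr p.2)) | p <- c].

Let rat_near (x d : R) : 0 < d -> exists q : rat, `|x - ratr q| < d.
Proof.
move=> d0; have [q] := @rat_in_itvoo R (x - d) (x + d) (ltac:(by rewrite ltrBlDr -addrA ltrDl addr_gt0)).
rewrite in_itv/= => /andP[h1 h2]; exists q; rewrite ltr_norml; apply/andP; split; lra.
Qed.

Let rat_vec_dense c eps : 0 < eps -> times_in T c -> exists c', `|step_vec e c - rat_vec c'| < eps.
Proof.
have C0 : 0 <= C := @cov_const_ge0 _ _ _ _.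
elim: c eps => [|[a tau] c IH] eps eps0 cT.
  by exists [::]; rewrite /rat_vec /step_vec !big_nil subrr normr0.
have e2 : 0 < eps / 2 by rewrite divr_gt0.
have [c' hc'] := IH _ e2 (fun p pc => cT p (mem_behead (s := (a, tau) :: c) pc)).
have tauT : 0 <= tau <= T by have := cT _ (mem_head _ _); rewrite in_itv.
have d1 : 0 < Num.min 1 (eps / (4 * (`|e tau| + 1))).
  by rewrite lt_min ltr01 divr_gt0// mulr_gt0// ltr_wpDl.
have [a' ha'] := rat_near a d1; move: ha'; rewrite lt_min => /andP[ha1 ha2].
pose d2 := eps / (4 * (`|a| + 1)).
have d20 : 0 < d2 by rewrite divr_gt0// mulr_gt0// ltr_wpDl.
(* The squared norm of an increment is at most linear in time, hence the square in the tolerance for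
   the time. *)
have d3 : 0 < d2 ^+ 2 / (C + 1) by rewrite divr_gt0 ?exprn_gt0// ltr_wpDl.
have [q hq] := rat_near tau d3.
exists ((a', q) :: c').
rewrite /rat_vec/= /step_vec !big_cons/= opprD addrACA.
rewrite (le_lt_trans (ler_normD _ _))// [eps]splitr ltr_leD//; last exact: ltW hc'.
rewrite (_ : _ - _ = (a - ratr a') *: e tau + ratr a' *: (e tau - e (clamp T (ratr q)))); last first.
  by rewrite scalerBl scalerBr addrA subrK.
have h1 : `|(a - ratr a') *: e tau| <= eps / 4.
  rewrite normrZ; apply: (@le_trans _ _ (eps / (4 * (`|e tau| + 1)) * (`|e tau| + 1))).
    by rewrite ler_pM// ?(ltW ha2)// lerDl.
  by rewrite le_eqVlt; apply/orP; left; apply/eqP; field; rewrite gt_eqF// ltr_wpDl.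
have h2 : `|e tau - e (clamp T (ratr q))| < d2.
  rewrite -ltr_sqr ?nnegrE ?(ltW d20)//.
  apply: (le_lt_trans (norm_incr_sqr_le tauT (clamp_itv (ltW hT) _))).
  rewrite -{1}(clamp_id tauT).
  apply: (@le_lt_trans _ _ ((C + 1) * `|tau - ratr q|)).
    by rewrite ler_pM ?lerDl// clamp_lip.
  by rewrite mulrC -ltr_pdivlMr// ltr_wpDl.
have h3 : `|ratr a' *: (e tau - e (clamp T (ratr q)))| < eps / 4.
  have ha' : `|ratr a' : R| <= `|a| + 1.
    rewrite -[ratr a' : R](subrK a) addrC (le_trans (ler_normD _ _))// lerD2l distrC.
    exact: ltW ha1.
  rewrite normrZ; apply: (@le_lt_trans _ _ ((`|a| + 1) * `|e tau - e (clamp T (ratr q))|)).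
    by rewrite ler_wpM2r.
  apply: (@lt_le_trans _ _ ((`|a| + 1) * d2)).
    by rewrite ltr_pM2l// ltr_wpDl.
  by rewrite le_eqVlt /d2; apply/orP; left; apply/eqP; field; rewrite gt_eqF// ltr_wpDl.
by apply: (le_lt_trans (ler_normD _ _)); lra.
Qed.

(** Rational coefficients and rational times, clamped to the interval, give a countable family; it
    is dense because [e] is continuous on [0, T]. *)
Lemma completion_separable : exists q : nat -> V, forall v eps, 0 < eps ->
  exists n, `|v - q n| < eps.
Proof.
pose q n := rat_vec (odflt [::] (@unpickle (seq (rat * rat)) n)).
exists q => v eps eps0.
have e2 : 0 < eps / 2 by rewrite divr_gt0.
have [|w [/= vw [c cT cw]]] := completion_dense hV (O := ball v (eps / 2)) _ (ball_open v (eps / 2)).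
  by exists v; exact: ballxx.
have [c' hc'] := rat_vec_dense e2 cT.
exists (pickle c'); rewrite /q pickleK/=.
rewrite -cw -ball_normE/= in vw.
rewrite -(subrK (step_vec e c) v) -addrA [eps]splitr.
by rewrite (le_lt_trans (ler_normD _ _))// ltrD.
Qed.

Context {d : measure_display} {Omega : measurableType d}.

(** Measurability tested on squared distances to fixed vectors: real-valued, hence stable under
    pointwise limits and computable for finite sums through inner products. *)
Definition ball_measurable (u : Omega -> V) :=
  forall v, measurable_fun setT (fun w => `|u w - v| ^+ 2).

(** By separability an open set is the union of countably many balls, those with centre in the dense
    sequence and radius 1 / (m + 1) that it contains. *)
Lemma ball_measurable_open (u : Omega -> V) : ball_measurable u ->
  forall O : set V, open O -> measurable (u @^-1` O).
Proof.
move=> mu O oO; have [q hq] := completion_separable.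
pose G n m := [set w | (forall v, `|v - q n| < m.+1%:R^-1 -> O v) /\ `|u w - q n| ^+ 2 < m.+1%:R^-1 ^+ 2].
have mG n m : measurable (G n m).
  have [h|h] := pselect (forall v, `|v - q n| < m.+1%:R^-1 -> O v); last first.
    by rewrite (_ : G n m = set0)//; apply/seteqP; split => // w [].
  rewrite (_ : G n m = [set: Omega] `&` (fun w => `|u w - q n| ^+ 2) @^-1` `]-oo, m.+1%:R^-1 ^+ 2[%classic).
    by apply: mu => //; exact: measurable_itv.
  by rewrite setTI; apply/seteqP; split => w; rewrite /G/= in_itv/=; [case|].
rewrite (_ : _ @^-1` _ = \bigcup_n \bigcup_m G n m).
  by apply: bigcup_measurable => n _; apply: bigcup_measurable => m _; exact: mG.
apply/seteqP; split => w /=; last first.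
  move=> [n _ [m _ [h1 h2]]]; apply: h1.
  by rewrite -ltr_sqr ?nnegrE// invr_ge0.
move=> Ouw; have /nbhs_ballP [r /= r0 hr] := open_nbhs_nbhs (conj oO Ouw).
have r2 : 0 < r / 2 by rewrite divr_gt0.
have [m _ hm] : \forall m \near \oo, m.+1%:R^-1 < r / 2.
  have /cvgr0Pnorm_lt /(_ _ r2) := @cvg_harmonic R.
  by apply: filterS => m; apply: le_lt_trans; exact: ler_norm.
have {}hm := hm m (leqnn m).
have [|n hn] := hq (u w) m.+1%:R^-1; first by rewrite invr_gt0.
exists n => //; exists m => //; split; last first.
  by rewrite ltr_sqr ?nnegrE// ?invr_ge0.
move=> v hv; apply: hr; rewrite -ball_normE/=.
rewrite -(subrK (q n) (u w)) -addrA [r]splitr (le_lt_trans (ler_normD _ _))// ltrD//.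
  exact: lt_trans hm.
by rewrite distrC (lt_trans hv).
Qed.

Lemma ball_measurable_cvg (u_ : nat -> Omega -> V) (u : Omega -> V) :
  (forall n, ball_measurable (u_ n)) -> (forall w, u_ n w @[n --> \oo] --> u w) ->
  ball_measurable u.
Proof.
move=> mu uu v; apply: (@measurable_fun_cvg _ _ _ _ (fun n w => `|u_ n w - v| ^+ 2)).
- by move=> n; exact: mu.
- move=> w _; apply: (continuous_cvg_seq (h := fun x : R => x ^+ 2)); first exact: exprn_continuous.
  by apply: cvg_norm; apply: cvgB; [exact: uu|exact: cvg_cst].
Qed.

Lemma ball_measurable_sum n (a : 'I_n -> Omega -> R) (v_ : 'I_n -> V) :
  (forall i, measurable_fun setT (a i)) ->
  ball_measurable (fun w => \sum_(i < n) a i w *: v_ i).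
Proof.
move=> ma v.
rewrite (_ : (fun w => _) = (fun w => \sum_i \sum_j a i w * a j w * ip (v_ i) (v_ j) -
   2 * (\sum_i a i w * ip (v_ i) v) + ip v v)).
  apply: measurable_funD => //; apply: measurable_funB.
    apply: measurable_sum => i; apply: measurable_sum => j.
    by apply: measurable_funM => //; exact: measurable_funM.
  by apply: measurable_funM => //; apply: measurable_sum => i; exact: measurable_funM.
apply/funext => w; rewrite (norm_sqr (completion_norm hV)) ipBl !ipBr.
rewrite (ipC ip v (\sum_i _)).
have -> : ip (\sum_(i < n) a i w *: v_ i) (\sum_(i < n) a i w *: v_ i) =
    \sum_i \sum_j a i w * a j w * ip (v_ i) (v_ j).
  rewrite ip_suml; apply: eq_bigr => i _; rewrite ip_sumr; apply: eq_bigr => j _.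
  by rewrite ipZl ipZr mulrA.
have -> : ip (\sum_(i < n) a i w *: v_ i) v = \sum_i a i w * ip (v_ i) v.
  by rewrite ip_suml; apply: eq_bigr => i _; rewrite ipZl.
by ring.
Qed.

End separability.

(** * Weak form of the Itô formula *)

Lemma cvgR_sum {R : realType} (I : Type) (r : seq I) (f : I -> nat -> R) (l : I -> R) :
  (forall i, f i n @[n --> \oo] --> l i) ->
  \sum_(i <- r) f i n @[n --> \oo] --> \sum_(i <- r) l i.
Proof.
move=> fl; elim: r => [|i r IH].
  rewrite big_nil; under eq_fun do rewrite big_nil.
  exact: cvg_cst.
rewrite big_cons; under eq_fun do rewrite big_cons.
exact: (cvgD (fl i) IH).
Qed.

(** The error as a function of the right endpoint y has derivative (S y - S a) / 2 - (y - a) q y. By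
    the mean value theorem for S this is (y - a) (q d - q y), quadratic in the length by the
    Lipschitz bound on q; a second mean value step makes the error cubic. *)
Lemma trapezoid_taylor {R : realType} (f S q : R -> R) (L : R) : 0 <= L ->
  (forall x : R, is_derive x 1 f (S x)) -> (forall x : R, is_derive x 1 S (2 * q x)) ->
  (forall x y, `|q x - q y| <= L * `|x - y|) ->
  forall a b, `|f b - f a - (b - a) * ((S a + S b) / 2)| <= L * `|b - a| ^+ 3.
Proof.
move=> L0 df dS qL a b.
wlog ab : a b / a <= b.
  move=> h; have [/h//|/ltW/h] := leP a b.
  rewrite (distrC a); congr (_ <= _); rewrite -normrN; congr (`|_|).
  by rewrite (addrC (S a)); ring.
pose phi (y : R) := f y - f a - (y - a) * ((S a + S y) / 2).
have dphi (y : R) : is_derive y 1 phi ((S y - S a) / 2 - (y - a) * q y).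
  have d1 := df y; have d2 := dS y.
  by apply: is_derive_eq; rewrite /GRing.scale/=; field.
have cont (F F' : R -> R) u v : (forall y : R, is_derive y 1 F (F' y)) -> {within `[u, v], continuous F}.
  by move=> dF; apply: derivable_within_continuous => y _; have [] := dF y.
have [c] := MVT_segment ab (fun z _ => dphi z) (cont _ _ _ _ dphi).
rewrite in_itv/= => /andP[ac cb] E1.
have [d] := MVT_segment ac (fun z _ => dS z) (cont _ _ _ _ dS).
rewrite in_itv/= => /andP[ad dc] E2.
have phia : phi a = 0 by rewrite /phi !subrr mul0r subrr.
rewrite -/(phi b) -[phi b]subr0 -phia E1 E2.
rewrite (_ : 2 * q d * (c - a) / 2 - (c - a) * q c = (c - a) * (q d - q c)); last by field.
rewrite !normrM -mulrA exprS expr2.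
have b0 : 0 <= b - a by rewrite subr_ge0.
rewrite (ger0_norm b0) (@ger0_norm _ (c - a)) ?subr_ge0//.
apply: (@le_trans _ _ ((c - a) * (L * (c - a) * (b - a)))).
  rewrite ler_wpM2l ?subr_ge0// ler_wpM2r// (le_trans (qL _ _))// ler_wpM2l//.
  by rewrite distrC ger0_norm ?subr_ge0// lerD2l lerN2.
have ca : c - a <= b - a by rewrite lerD2r.
have ca0 : 0 <= c - a by rewrite subr_ge0.
rewrite (_ : (c - a) * _ = L * (b - a) * ((c - a) * (c - a))); last by ring.
rewrite [leRHS](_ : _ = L * (b - a) * ((b - a) * (b - a))); last by ring.
by rewrite ler_wpM2l ?mulr_ge0// ler_pM.
Qed.

Section increments_moments.
Context {R : realType} {d : measure_display} {Omega : measurableType d}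
  {P : probability Omega R} {Hu K T : R}.
Hypotheses (hH : 0 < Hu < 1) (hK : 0 < K <= 1) (hHK : 1 <= 2 * Hu * K) (hT : 0 < T).
Context {B : R -> {RV P >-> R}}.
Hypothesis hB : is_bifBm Hu K T B.
Context {V : completeNormedModType R} {ip : {dot V for idfun}} {e : R -> V}.
Hypothesis hV : is_completion Hu K T ip e.
Local Notation C := (@cov_const R Hu K T).
Implicit Types a b : R.

Lemma isonormal_incr a b : 0 <= a <= T -> 0 <= b <= T ->
  isonormal T B e (e b - e a) (fun w => B b w - B a w).
Proof.
move=> ha hb.
have := isonormal_linear 1 (-1) (@isonormal_bifBm _ _ _ _ T B V e b _) (@isonormal_bifBm _ _ _ _ T B V e a _).
rewrite scale1r scaleN1r (_ : (fun w => _) = (fun w => B b w - B a w)); last first.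
  by apply/funext => w; rewrite mul1r mulN1r.
by apply; rewrite in_itv.
Qed.

Lemma bifBm_incr_sqr a b : 0 <= a <= T -> 0 <= b <= T ->
  sqint P (fun w => B b w - B a w) /\ \int[P]_w (B b w - B a w) ^+ 2 <= C * `|b - a|.
Proof.
move=> ha hb; have hi := isonormal_incr ha hb.
split; first exact: (isonormal_sqint hB hV hi).
rewrite (isonormal_sqr hB hV hi) -(norm_sqr (completion_norm hV)).
exact: (norm_incr_sqr_le hH hK hHK hV).
Qed.

Lemma bifBm_incr_norm a b : 0 <= a <= T -> 0 <= b <= T ->
  \int[P]_w `|B b w - B a w| <= Num.sqrt (C * `|b - a|).
Proof.
move=> ha hb; have [h1 h2] := bifBm_incr_sqr ha hb.
apply: (le_trans (Rintegral_norm_le_sqrt h1)).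
by rewrite ler_sqrt// mulr_ge0 ?cov_const_ge0.
Qed.

(** Cauchy-Schwarz between |D| and D^2, with E D^4 = 3 s^4 for the Gaussian increment D; rounding 3
    up to 4 gives the factor 2. *)
Lemma bifBm_incr_cube a b : 0 <= a <= T -> 0 <= b <= T ->
  integrableR P (fun w => `|B b w - B a w| ^+ 3) /\
  \int[P]_w `|B b w - B a w| ^+ 3 <= 2 * (C * `|b - a|) * Num.sqrt (C * `|b - a|).
Proof.
move=> ha hb; have [h1 h2] := bifBm_incr_sqr ha hb.
have CD0 : 0 <= C * `|b - a| by rewrite mulr_ge0 ?cov_const_ge0.
pose c := [:: (1, b); (-1, a)] : seq (R * R).
have cT : times_in T c by move=> p; rewrite in_cons mem_seq1 => /orP[] /eqP -> /=; rewrite in_itv.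
have cE : step_rv B c = (fun w => B b w - B a w).
  by apply/funext => w; rewrite /step_rv !big_cons big_nil/= addr0 mul1r mulN1r.
have cV : step_vec e c = e b - e a.
  by rewrite /step_vec !big_cons big_nil/= addr0 scale1r scaleN1r.
have [s law sE] := step_rv_law hB hV cT; rewrite cE in law; rewrite cV in sE.
have mD := h1.1.
have m4 := gaussian_law_moment4 mD law erefl.
have s2 : s ^+ 2 <= C * `|b - a|.
  by rewrite sE -(isonormal_sqr hB hV (isonormal_incr ha hb)).
have s4 : s ^+ 4 <= (C * `|b - a|) ^+ 2.
  by rewrite (exprM s 2 2) ler_sqr ?nnegrE ?sqr_ge0.
have sn : sqint P (fun w => `|B b w - B a w|).
  split; first exact: measurableT_comp.
  by under eq_fun do rewrite real_normK ?num_real//; exact: h1.2.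
have sq : sqint P (fun w => (B b w - B a w) ^+ 2).
  split; first exact: measurable_funX.
  under eq_fun do rewrite -exprM.
  exact: (gaussian_law_moment mD law erefl 4).1.
have E w : `|B b w - B a w| ^+ 3 = `|B b w - B a w| * (B b w - B a w) ^+ 2.
  by rewrite exprS real_normK ?num_real.
split; first by under eq_fun do rewrite E; exact: sqint_mul.
under eq_Rintegral do rewrite E.
apply: (le_trans (ler_norm _)); apply: (le_trans (Rintegral_cauchy sn sq)).
rewrite mulrC; apply: ler_pM; rewrite ?sqrtr_ge0//; last first.
  by under eq_Rintegral do rewrite real_normK ?num_real//; rewrite ler_sqrt.
under eq_Rintegral do rewrite -exprM.
rewrite m4 (_ : 2 * (C * `|b - a|) = Num.sqrt (4 * (C * `|b - a|) ^+ 2)).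
  apply: ler_wsqrtr; have := sqr_ge0 (C * `|b - a|); move: s4.
  by move: (_ ^+ 2) (s ^+ 4) => y z; lra.
rewrite (_ : 4 = 2 ^+ 2 :> R); last by rewrite -natrX.
have D0 : 0 <= 2 * (C * `|b - a|) by exact: mulr_ge0.
by rewrite -exprMn sqrtr_sqr (ger0_norm D0).
Qed.

End increments_moments.

(** * The weight of the local time *)

Section powR_weight.
Context {R : realType} {Hu K T : R}.
Hypotheses (hH : 0 < Hu < 1) (hK : 0 < K <= 1) (hHK : 1 <= 2 * Hu * K).
Local Notation leb := (@lebesgue_measure R).

(** On [0, t] this is the derivative of the variance s^(2HK). The indicator is part of the function
    so that all integrals run over the whole line. *)
Definition weight (t s : R) : R := 2 * Hu * K * s `^ (2 * Hu * K - 1) * \1_`[0, t]%classic s.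

Let p0 : 0 < 2 * Hu * K. Proof. exact: lt_le_trans hHK. Qed.

Lemma weight_ge0 t s : 0 <= weight t s.
Proof. by rewrite /weight mulr_ge0// mulr_ge0 ?powR_ge0// ltW. Qed.

Lemma weight_le t s : weight t s <= 2 * Hu * K * `|t| `^ (2 * Hu * K - 1) * \1_`[0, t]%classic s.
Proof.
rewrite /weight indicE mem_setE in_itv/=.
case: (boolP (0 <= s <= t)) => [/andP[s0 st]|_]; last by rewrite !mulr0.
rewrite !mulr1 ler_wpM2l ?(ltW p0)// ge0_ler_powR ?subr_ge0 ?nnegrE//.
exact: le_trans st (ler_norm _).
Qed.

Lemma measurable_weight t : measurable_fun setT (weight t).
Proof.
apply: measurable_funM; last exact: measurable_indic.
by apply: measurable_funM => //; exact: measurable_powR.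
Qed.

Lemma integrable_weight t : integrableR leb (weight t).
Proof.
have i1 := integrableRZ (2 * Hu * K * `|t| `^ (2 * Hu * K - 1)) (integrable_indic_itv 0 t true false).
apply: (integrableR_dominated _ i1); first exact: measurable_weight.
by move=> s; rewrite ger0_norm ?weight_ge0// weight_le.
Qed.

Lemma integrable_weight_mul (F : R -> R) t : continuous F ->
  integrableR leb (fun s => F s * weight t s).
Proof.
move=> cF.
have mFw : measurable_fun setT (fun s => F s * weight t s).
  by apply: measurable_funM; [exact: continuous_measurable_fun|exact: measurable_weight].
have [t0|t0] := leP 0 t; last first.
  apply: (integrableR_dominated _ (integrable_weight t)); first exact: mFw.
  move=> s.
  rewrite /weight indicE mem_setE in_itv/=.
  have -> : (0 <= s <= t) = false by apply/negP => /andP[h1 h2]; lra.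
  by rewrite !mulr0 normr0.
have [|c _ hc] := @EVT_max R (fun s => `|F s|) 0 t t0.
  by apply: continuous_subspaceT => s; apply: cvg_norm; exact: cF.
apply: (integrableR_dominated _ (integrableRZ `|F c| (integrable_weight t))); first exact: mFw.
move=> s.
rewrite normrM (ger0_norm (weight_ge0 t s)).
have [st|st] := boolP (s \in `[0, t]).
  by rewrite ler_wpM2r ?weight_ge0// hc.
rewrite /weight indicE mem_setE; move/negbTE: st => ->.
by rewrite !mulr0.
Qed.

Lemma patch_weight (F : R -> R) t :
  (fun s => F s * (2 * Hu * K * s `^ (2 * Hu * K - 1))) \_ `[0, t] = (fun s => F s * weight t s).
Proof.
apply/funext => s; rewrite patchE /weight indicE.
by case: (s \in _); rewrite ?mulr1 ?mulr0.
Qed.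

Lemma integrable_itv_weight (F : R -> R) t : continuous F ->
  leb.-integrable `[0, t] (EFin \o (fun s => F s * (2 * Hu * K * s `^ (2 * Hu * K - 1)))).
Proof.
move=> cF.
have mt : measurable (`[0, t]%classic : set (measurableTypeR R)) by exact: measurable_itv.
rewrite -[X in leb.-integrable X _]setTI; apply/(integrable_restrict leb mt measurableT).
by rewrite restrict_EFin patch_weight; exact: integrable_weight_mul.
Qed.

Lemma Rintegral_weight (F : R -> R) t : continuous F ->
  2 * Hu * K * \int[leb]_(s in `[0, t]) (F s * s `^ (2 * Hu * K - 1)) = \int[leb]_s (F s * weight t s).
Proof.
move=> cF; rewrite -patch_weight -Rintegral_mkcond -RintegralZl//.
  by apply: eq_Rintegral => s _; ring.
have cF' : continuous (fun s => (2 * Hu * K)^-1 * F s) by move=> s; apply: cvgMr; exact: cF.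
have := @integrable_itv_weight _ t cF'.
rewrite (_ : EFin \o _ = EFin \o (fun s => F s * s `^ (2 * Hu * K - 1)))//.
apply/funext => s /=; congr EFin.
by rewrite mulrACA mulVf ?mul1r// gt_eqF.
Qed.

(** Mean value theorem for the weighted integral of psi minus psi a times s^(2HK). Derivatives are
    taken only inside the interval, where s > 0; this admits a = 0, where the power rule is not at
    hand. *)
Lemma weight_increment (psi : R -> R) (D a b : R) : continuous psi -> 0 <= D ->
  0 <= a -> a <= b -> b <= T -> (forall s, a <= s <= b -> `|psi s - psi a| <= D) ->
  `|\int[leb]_s (psi s * weight b s) - \int[leb]_s (psi s * weight a s)
    - psi a * (b `^ (2 * Hu * K) - a `^ (2 * Hu * K))| <=
  2 * Hu * K * T `^ (2 * Hu * K - 1) * D * (b - a).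
Proof.
move=> cpsi D0 a0 ab bT psiD.
have b0 := le_trans a0 ab.
pose F (s : R) := \int[leb]_(r in `[0, s]) (psi r * (2 * Hu * K * r `^ (2 * Hu * K - 1))).
have FE s : \int[leb]_r (psi r * weight s r) = F s.
  by rewrite -patch_weight -Rintegral_mkcond.
rewrite !FE.
have int1 u := @integrable_itv_weight psi u cpsi.
pose Phi s := F s - psi a * s `^ (2 * Hu * K).
have dPhi (s : R) : s \in `]a, b[ ->
    is_derive s 1 Phi ((psi s - psi a) * (2 * Hu * K * s `^ (2 * Hu * K - 1))).
  rewrite in_itv/= => /andP[as_ sb]; have s0 := le_lt_trans a0 as_.
  have dF : is_derive s 1 F (psi s * (2 * Hu * K * s `^ (2 * Hu * K - 1))).
    have [] := @continuous_FTC1 R (fun r => psi r * (2 * Hu * K * r `^ (2 * Hu * K - 1))) (BLeft 0) s (s + 1).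
    - by rewrite ltrDl.
    - exact: int1.
    - by rewrite lte_fin.
    - apply: cvgM; first exact: cpsi.
      apply: cvgMr.
      have d1 := is_derive1_powR (2 * Hu * K - 1) s0.
      have cw : {for s, continuous (fun r : R => r `^ (2 * Hu * K - 1))}.
        by apply/differentiable_continuous/derivable1_diffP; case: d1.
      exact: cw.
    by move=> d1 d2; split; [exact: d1|rewrite -derive1E].
  have d2 := is_derive1_powR (2 * Hu * K) s0.
  by apply: is_derive_eq; rewrite /GRing.scale/=; ring.
have cPhi : {within `[a, b], continuous Phi}.
  have sab : `[a, b] `<=` `[0, b].
    by move=> z /=; rewrite !in_itv/= => /andP[az ->]; rewrite (le_trans a0 az).
  have /(continuous_subspaceW sab) cF := parameterized_integral_continuous b0 (int1 b).
  have p1 : 1 <= 2 * Hu * K <= 2.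
    rewrite hHK/=; case/andP: hH => H0 H1; case/andP: hK => K0 K1.
    rewrite -mulrA -[leRHS]mulr1 ler_wpM2l// -[leRHS]mulr1; apply: ler_pM => //; exact: ltW.
  apply/subspace_continuousP => z zab; apply: cvgB.
    by move/subspace_continuousP : cF; exact.
  apply: cvgMr; apply/cvgrPdist_lt => eps eps0.
  pose L := 2 * b `^ (2 * Hu * K - 1) + 1.
  have L0 : 0 < L by rewrite ltr_wpDl// mulr_ge0// powR_ge0.
  exists (eps / L) => /=; first by rewrite divr_gt0.
  move=> y /=; rewrite ltr_pdivlMr// => yz yab.
  have ord u v : u \in `[a, b] -> v \in `[a, b] -> v <= u ->
      `|u `^ (2 * Hu * K) - v `^ (2 * Hu * K)| <= L * `|u - v|.
    rewrite !in_itv/= => /andP[au ub] /andP[av vb] vu.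
    have v0 := le_trans a0 av.
    have mono : v `^ (2 * Hu * K) <= u `^ (2 * Hu * K).
      by rewrite ge0_ler_powR ?nnegrE ?(ltW p0)// (le_trans v0).
    rewrite !ger0_norm ?subr_ge0//.
    apply: (le_trans (powR_lip p1 _ ub)); first by rewrite v0.
    by rewrite ler_wpM2r ?subr_ge0// lerDl.
  have {}ord : `|z `^ (2 * Hu * K) - y `^ (2 * Hu * K)| <= L * `|z - y|.
    have [h|/ltW h] := leP y z; first exact: ord.
    by rewrite distrC (distrC z); exact: ord.
  by apply: (le_lt_trans ord); rewrite mulrC.
have [c] := MVT_segment ab dPhi cPhi; rewrite in_itv/= => /andP[ac cb] E.
have -> : F b - F a - psi a * (b `^ (2 * Hu * K) - a `^ (2 * Hu * K)) = Phi b - Phi a.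
  by rewrite /Phi; ring.
rewrite E normrM (@ger0_norm _ (b - a)) ?subr_ge0// ler_wpM2r ?subr_ge0// normrM mulrC.
apply: ler_pM => //; last by apply: psiD; rewrite ac.
rewrite ger0_norm; last by rewrite mulr_ge0 ?powR_ge0// ltW.
have c0 := le_trans a0 ac; have cT := le_trans cb bT.
by rewrite ler_wpM2l ?(ltW p0)// ge0_ler_powR ?subr_ge0 ?nnegrE// (le_trans c0).
Qed.

End powR_weight.

Section weak_ito.
Context {R : realType} {d : measure_display} {Omega : measurableType d}
  {P : probability Omega R} {Hu K T : R}.
Hypotheses (hH : 0 < Hu < 1) (hK : 0 < K <= 1) (hHK : 1 <= 2 * Hu * K) (hT : 0 < T).
Context {B : R -> {RV P >-> R}}.
Hypothesis hB : is_bifBm Hu K T B.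
Context {V : completeNormedModType R} {ip : {dot V for idfun}} {e : R -> V}.
Hypothesis hV : is_completion Hu K T ip e.
Local Notation C := (@cov_const R Hu K T).
Local Notation p := (2 * Hu * K).
Local Notation weight := (@weight R Hu K).
Local Notation leb := (@lebesgue_measure R).
Context (x : R) (m : nat) (n : nat) (h : 'I_n -> V) (X : 'I_n -> Omega -> R)
  (g : 'rV[R]_n -> R) (M M' : R).
Hypothesis hX : forall i, isonormal T B e (h i) (X i).
Hypothesis cg : continuous g.
Hypothesis dg : forall y i, derivable g y (delta_mx 0 i).
Hypothesis cdg : forall i, continuous (partial i g).
Hypothesis gM : forall y, `|g y| <= M.
Hypothesis dgM : forall i y, `|partial i g y| <= M'.

Let path s w : R := B (clamp T s) w - x.
Let G w := g (\row_i X i w).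
Let dG i w := partial i g (\row_i X i w).
Let f := (@mollified_norm R m).
Let S := (@mollified_sg R m).
Let q := (@mollifier R m).
Let Q : R := Num.sqrt (m.+1%:R / pi).

Let psi (s : R) := \int[P]_w (G w * q (path s w)).

Let T0 : 0 <= T. Proof. exact: ltW. Qed.

Let mX i : measurable_fun setT (X i).
Proof. by have [] := isonormal_sqint hB hV (hX i). Qed.

Let mG : measurable_fun setT G.
Proof. exact: measurable_continuous_row. Qed.

Let mdG i : measurable_fun setT (dG i).
Proof. exact: measurable_continuous_row. Qed.

Let M0 : 0 <= M. Proof. exact: le_trans (normr_ge0 _) (gM 0). Qed.

Let mpath s : measurable_fun setT (path s).
Proof. by apply: measurable_funB. Qed.

Let cS : continuous S.
Proof.
by move=> y; apply/differentiable_continuous/derivable1_diffP; have [] := is_derive_mollified_sg m y.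
Qed.

Let cf : continuous f.
Proof.
by move=> y; apply/differentiable_continuous/derivable1_diffP; have [] := is_derive_mollified_norm m y.
Qed.

Let mSp s : measurable_fun setT (fun w => S (path s w)).
Proof. by apply: measurableT_comp; [exact: continuous_measurable_fun|exact: mpath]. Qed.

Let mqp s : measurable_fun setT (fun w => q (path s w)).
Proof.
by apply: measurableT_comp; [exact: continuous_measurable_fun (@continuous_mollifier _ m)|exact: mpath].
Qed.

Let q_norm y : `|q y| <= Q.
Proof. by rewrite ger0_norm ?mollifier_ge0// mollifier_le. Qed.

Let path_incr a b : 0 <= a <= T -> 0 <= b <= T ->
  (fun w => path b w - path a w) = (fun w => B b w - B a w).
Proof. by move=> ha hb; apply/funext => w; rewrite /path !clamp_id//; ring. Qed.

Let fpath_integrable s : integrableR P (fun w => f (path s w)).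
Proof.
have [h1 _] := bifBm_sqint hB (t := clamp T s) (clamp_itv T0 s).
have i1 : integrableR P (fun w => `|B (clamp T s) w| + (`|x| + 1)).
  apply: integrableRD; first exact/integrableR_norm/sqint_integrable.
  by apply: (@integrableR_bounded _ _ _ _ _ (`|x| + 1)) => // w; rewrite ger0_norm// addr_ge0.
apply: (integrableR_dominated _ i1).
  by apply: measurableT_comp; [exact: continuous_measurable_fun|exact: mpath].
move=> w; apply: (le_trans (mollified_norm_le _ _)).
by rewrite addrA lerD2r /path ler_normB.
Qed.

Let bounded_mul (F H : Omega -> R) (b : R) : measurable_fun setT F -> (forall w, `|F w| <= b) ->
  integrableR P H -> integrableR P (fun w => F w * H w).
Proof.
move=> mF Fb iH; apply: (integrableR_dominated _ (integrableRZ b (integrableR_norm iH))).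
  by apply: measurable_funM => //; exact: (integrableR_measurable iH).
by move=> w; rewrite normrM ler_wpM2r.
Qed.

Let integrable_Gq s : integrableR P (fun w => G w * q (path s w)).
Proof.
apply: (@bounded_mul _ _ M) => // [w|]; first exact: gM.
by apply: (@integrableR_bounded _ _ _ _ _ Q) => // w; exact: q_norm.
Qed.

(** [G] is bounded and [q] is Lipschitz, so [psi] inherits the modulus of continuity of the process
    in L^1, a square root. *)
Let psi_lip L0 : (forall y, `|- (2 * m.+1%:R * y) * q y| <= L0) -> forall s r,
  `|psi s - psi r| <= M * (L0 * Num.sqrt C) * Num.sqrt `|s - r|.
Proof.
move=> hL0 s r.
have qL := derive_bound_lip (@is_derive_mollifier R m) hL0.
have L00 : 0 <= L0 := le_trans (normr_ge0 _) (hL0 0).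
have C0 : 0 <= C := @cov_const_ge0 _ _ _ _.
have hs := clamp_itv T0 s; have hr := clamp_itv T0 r.
have iZ : integrableR P (fun w => `|B (clamp T s) w - B (clamp T r) w|).
  have hZ : isonormal T B e (e (clamp T s) - e (clamp T r)) (fun w => B (clamp T s) w - B (clamp T r) w).
    exact: isonormal_incr.
  exact/integrableR_norm/sqint_integrable/(isonormal_sqint hB hV hZ).
rewrite /psi -RintegralB//.
have bnd w : `|G w * q (path s w) - G w * q (path r w)| <=
    M * L0 * `|B (clamp T s) w - B (clamp T r) w|.
  rewrite -mulrBr normrM -mulrA; apply: ler_pM => //; first exact: gM.
  apply: (le_trans (qL _ _)); rewrite /path.
  by rewrite (_ : B (clamp T s) w - x - (B (clamp T r) w - x) = B (clamp T s) w - B (clamp T r) w)//; ring.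
apply: (le_trans (Rintegral_bound _ (integrableRZ (M * L0) iZ) bnd)).
  by apply: measurable_funB; exact: measurable_funM.
rewrite (RintegralZl _ measurableT iZ).
rewrite (_ : M * (L0 * _) * _ = M * L0 * (Num.sqrt C * Num.sqrt `|s - r|)); last by ring.
apply: ler_wpM2l; first exact: mulr_ge0.
apply: (le_trans (bifBm_incr_norm hH hK hHK hB hV hr hs)).
rewrite -sqrtrM// ler_wsqrtr// ler_wpM2l//; exact: clamp_lip.
Qed.

Let continuous_psi : continuous psi.
Proof.
have [L0 hL0] := @mollifier_deriv_le R m.
have L00 : 0 <= L0 := le_trans (normr_ge0 _) (hL0 0).
have C0 : 0 <= C := @cov_const_ge0 _ _ _ _.
move=> s; apply/cvgrPdist_lt => eps eps0.
pose c := M * (L0 * Num.sqrt C) + 1.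
have c0 : 0 < c.
  by rewrite ltr_wpDl//; apply: mulr_ge0 => //; apply: mulr_ge0 => //; exact: sqrtr_ge0.
exists ((eps / c) ^+ 2) => /=; first by rewrite exprn_gt0// divr_gt0.
move=> r /= hr; apply: (le_lt_trans (psi_lip hL0 s r)).
have h1 : Num.sqrt `|s - r| < eps / c.
  have ec : 0 < eps / c by rewrite divr_gt0.
  rewrite (_ : eps / c = Num.sqrt ((eps / c) ^+ 2)); last by rewrite sqrtr_sqr gtr0_norm.
  by rewrite ltr_sqrt// exprn_gt0.
apply: (@le_lt_trans _ _ (c * Num.sqrt `|s - r|)).
  by rewrite ler_wpM2r ?sqrtr_ge0// lerDl.
by rewrite mulrC -ltr_pdivlMr.
Qed.

(* The trapezoidal rule matches the second-order term: the two integrations by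
   parts add up to ip (e a + e b) (e b - e a) = b^p - a^p, so no quadratic
   variation appears, and the error is of order (b - a)^(3/2). *)
Lemma ito_increment : exists2 D, 0 <= D & forall a b : R, 0 <= a -> a <= b -> b <= T ->
  `| \int[P]_w (G w * (f (path b w) - f (path a w))) -
     \sum_i ip (h i) (e b - e a) * \int[P]_w (dG i w * ((S (path a w) + S (path b w)) / 2)) -
     psi a * (b `^ p - a `^ p) | <= D * ((b - a) * Num.sqrt (b - a)).
Proof.
have [L0 hL0] := @mollifier_deriv_le R m.
have qL := derive_bound_lip (@is_derive_mollifier R m) hL0.
have L00 : 0 <= L0 := le_trans (normr_ge0 _) (hL0 0).
have C0 : 0 <= C := @cov_const_ge0 _ _ _ _.
(* The first constant bounds the cubic remainder of the trapezoidal rule, the second the replacement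
   of psi b by psi a. *)
exists (M * L0 * (2 * C * Num.sqrt C) + C * (M * (L0 * Num.sqrt C))).
  apply: addr_ge0; apply: mulr_ge0 => //; try exact: mulr_ge0.
    by apply: mulr_ge0; [exact: mulr_ge0|exact: sqrtr_ge0].
  by apply: mulr_ge0 => //; apply: mulr_ge0 => //; exact: sqrtr_ge0.
move=> a b a0 ab bT; have b0 := le_trans a0 ab; have aT := le_trans ab bT.
have ha : 0 <= a <= T by rewrite a0.
have hb : 0 <= b <= T by rewrite b0.
have ba0 : 0 <= b - a by rewrite subr_ge0.
set k := e b - e a.
pose Z w := B b w - B a w.
have hZ : isonormal T B e k Z by exact: isonormal_incr.
have iZ : integrableR P Z by exact/sqint_integrable/(isonormal_sqint hB hV hZ).
have [i3 l3] := bifBm_incr_cube hH hK hHK hB hV ha hb.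
have ZE w : path b w - path a w = Z w by have := congr1 (fun F => F w) (path_incr ha hb).
have isoB s : 0 <= s <= T -> isonormal T B e (e s) (B s).
  by move=> hs; apply: isonormal_bifBm; rewrite in_itv.
have dSx (y : R) : is_derive y 1 (fun y : R => S (y - x)) (2 * q (y - x)).
  have d1 : is_derive y 1 (fun y : R => y - x) (1 : R) by apply: is_derive_eq; rewrite subr0.
  have d2 := @is_derive1_comp R S (fun y : R => y - x) y _ _ (is_derive_mollified_sg m (y - x)) d1.
  by apply: (is_derive_eq d2); rewrite /GRing.scale/= ?mul1r ?mulr1.
have ibp s : 0 <= s <= T -> \int[P]_w (G w * S (path s w) * Z w) =
    \sum_i ip (h i) k * \int[P]_w (dG i w * S (path s w)) + ip (e s) k * (2 * psi s).
  move=> hs; have -> : 2 * psi s = \int[P]_w (G w * (2 * q (path s w))).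
    rewrite /psi -RintegralZl//; by apply: eq_Rintegral => w _; ring.
  rewrite /path (clamp_id hs).
  apply: (@isonormal_ibp _ _ _ _ _ _ _ _ hB _ _ _ hV _ h X (e s) (B s) k Z g
    (fun y : R => S (y - x)) (fun y : R => 2 * q (y - x)) M M' 1 (2 * Q)) => //.
  - exact: isoB.
  - move=> y; apply: cvgMr; apply: (@continuous_comp _ _ _ (fun y : R => y - x) q).
      by apply: cvgB; [exact: cvg_id|exact: cvg_cst].
    exact: continuous_mollifier.
  - by move=> y; exact: mollified_sg_norm_le1.
  - by move=> y; rewrite normrM ger0_norm// ler_wpM2l.
have bS s w : `|S (path s w)| <= 1 by exact: mollified_sg_norm_le1.
have iGSZ s : integrableR P (fun w => G w * S (path s w) * Z w).
  apply: (@bounded_mul _ _ M) => // [|w]; first exact: measurable_funM.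
  by rewrite normrM -[leRHS]mulr1 ler_pM// gM.
have idS i s : integrableR P (fun w => dG i w * S (path s w)).
  apply: (@integrableR_bounded _ _ _ _ _ (M' * 1)) => [|w]; first exact: measurable_funM.
  by rewrite normrM ler_pM// dgM.
pose rem w := f (path b w) - f (path a w) - Z w * ((S (path a w) + S (path b w)) / 2).
have mrem : measurable_fun setT rem.
  apply: measurable_funB.
    by apply: measurable_funB; exact: (integrableR_measurable (fpath_integrable _)).
  apply: measurable_funM; first exact: (integrableR_measurable iZ).
  by apply: measurable_funM => //; exact: measurable_funD.
have remle w : `|rem w| <= L0 * `|Z w| ^+ 3.
  rewrite /rem -ZE.
  exact: (trapezoid_taylor L00 (@is_derive_mollified_norm R m) (@is_derive_mollified_sg R m) qL).
have iGf : integrableR P (fun w => G w * (f (path b w) - f (path a w))).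
  by apply: (@bounded_mul _ _ M) => // [w|]; [exact: gM|exact: integrableRB].
have E1 : \int[P]_w (G w * rem w) = \int[P]_w (G w * (f (path b w) - f (path a w))) -
    2^-1 * (\int[P]_w (G w * S (path a w) * Z w) + \int[P]_w (G w * S (path b w) * Z w)).
  rewrite -RintegralD// -RintegralZl//; last exact: integrableRD.
  rewrite -RintegralB//; last by apply: integrableRZ; exact: integrableRD.
  by apply: eq_Rintegral => w _; rewrite /rem; field.
have E2 i : \int[P]_w (dG i w * ((S (path a w) + S (path b w)) / 2)) =
    2^-1 * (\int[P]_w (dG i w * S (path a w)) + \int[P]_w (dG i w * S (path b w))).
  rewrite -RintegralD// -RintegralZl//; last exact: integrableRD.
  by apply: eq_Rintegral => w _; field.
have E3 : ip (e a) k + ip (e b) k = b `^ p - a `^ p.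
  rewrite /k !ipBr !(completion_ip hV) ?in_itv//= !(bif_cov_diag hK hHK)// (bif_covC b a).
  ring.
have E4 : \sum_i ip (h i) k * \int[P]_w (dG i w * ((S (path a w) + S (path b w)) / 2)) =
   2^-1 * (\sum_i ip (h i) k * \int[P]_w (dG i w * S (path a w)) +
          \sum_i ip (h i) k * \int[P]_w (dG i w * S (path b w))).
  by rewrite -big_split/= mulr_sumr; apply: eq_bigr => i _; rewrite E2 mulrCA -mulrDr.
(* The trace terms are ip (e a) k psi a + ip (e b) k psi b; evaluating both at a gives psi a (b^p -
   a^p) and leaves the difference psi b - psi a. *)
have Emain : \int[P]_w (G w * (f (path b w) - f (path a w))) -
     \sum_i ip (h i) k * \int[P]_w (dG i w * ((S (path a w) + S (path b w)) / 2)) -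
     psi a * (b `^ p - a `^ p) = \int[P]_w (G w * rem w) + ip (e b) k * (psi b - psi a).
  have alg (y1 y2 y3 y4 y5 y6 y7 : R) : y3 - 2^-1 * (y1 + y2) - y4 * (y6 + y7) =
    y3 - 2^-1 * (y1 + y6 * (2 * y4) + (y2 + y7 * (2 * y5))) + y7 * (y5 - y4) by field.
  by rewrite E1 E4 (ibp a ha) (ibp b hb) -E3; exact: alg.
rewrite Emain.
have r1 : `|\int[P]_w (G w * rem w)| <= M * L0 * (2 * C * Num.sqrt C) * ((b - a) * Num.sqrt (b - a)).
  have bnd w : `|G w * rem w| <= M * L0 * `|Z w| ^+ 3.
    by rewrite normrM -mulrA ler_pM// gM.
  apply: (le_trans (Rintegral_bound _ (integrableRZ (M * L0) i3) bnd)); first exact: measurable_funM.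
  rewrite (RintegralZl _ measurableT i3) -[leRHS]mulrA.
  apply: ler_wpM2l; first exact: mulr_ge0.
  apply: (le_trans l3); rewrite (ger0_norm ba0) sqrtrM//.
  have alg (y1 y2 y3 y4 : R) : 2 * (y1 * y2) * (y3 * y4) <= 2 * y1 * y3 * (y2 * y4).
    by rewrite (_ : 2 * y1 * y3 * (y2 * y4) = 2 * (y1 * y2) * (y3 * y4))//; ring.
  exact: alg.
have r2 : `|psi b - psi a| <= M * (L0 * Num.sqrt C) * Num.sqrt (b - a).
  by rewrite -(ger0_norm ba0); exact: psi_lip.
(* As e 0 = 0, this is a mixed increment over [0, b] and [a, b], hence of order b - a. *)
have r3 : `|ip (e b) k| <= C * (b - a).
  rewrite -[e b]subr0 -(completion0 hH hT hV) /k ipC (ip_incr hV) ?in_itv/= ?ha ?hb ?lexx ?T0//.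
  exact: (cov_rect_le hH hK hHK).
apply: (le_trans (ler_normD _ _)); rewrite mulrDl; apply: lerD => //.
rewrite normrM [leRHS](_ : _ = C * (b - a) * (M * (L0 * Num.sqrt C) * Num.sqrt (b - a))); last by ring.
by apply: ler_pM.
Qed.

Let DG N t w := \sum_i dG i w * ip (h i) (grid_sum e t N (path_coef t S (path^~ w) N)).

Let continuous_path w : continuous (path^~ w).
Proof.
have h1 : {within `[0, T], continuous (fun s => (B s w : R))} := @bifBm_continuous _ _ _ _ _ _ _ _ hB w.
have h2 := continuous_comp_clamp T0 h1.
by move=> s; exact: (cvgB (h2 s) (cvg_cst x)).
Qed.

Let continuous_qpath w c : continuous (fun s => c * q (path s w)).
Proof.
move=> s; apply: cvgMr; apply: (@continuous_comp _ _ _ (path^~ w) q); first exact: continuous_path.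
exact: continuous_mollifier.
Qed.

Let integral_DG N t : 0 <= t <= T -> \int[P]_w DG N t w = \sum_(k < N.+1)
  \sum_i ip (h i) (e (grid t N k.+1) - e (grid t N k)) *
    \int[P]_w (dG i w * ((S (path (grid t N k) w) + S (path (grid t N k.+1) w)) / 2)).
Proof.
move=> tT.
have int1 i a b : integrableR P (fun w => dG i w * ((S (path a w) + S (path b w)) / 2)).
  apply: (@integrableR_bounded _ _ _ _ _ (M' * 1)) => [|w].
    by apply: measurable_funM => //; apply: measurable_funM => //; exact: measurable_funD.
  rewrite normrM; apply: ler_pM => //; first exact: dgM.
  rewrite normrM (@ger0_norm _ 2^-1)// ler_pdivrMr// mul1r.
  apply: (le_trans (ler_normD _ _)); rewrite -[2%:R]/(1 + 1); apply: lerD; exact: mollified_sg_norm_le1.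
rewrite (_ : DG N t = fun w => \sum_(k < N.+1) \sum_i ip (h i) (e (grid t N k.+1) - e (grid t N k)) *
    (dG i w * ((S (path (grid t N k) w) + S (path (grid t N k.+1) w)) / 2))); last first.
  apply/funext => w; rewrite exchange_big/=; apply: eq_bigr => i _.
  rewrite /grid_sum ip_sumr mulr_sumr; apply: eq_bigr => k _.
  by rewrite ipZr /path_coef; ring.
rewrite Rintegral_sum; last by move=> k; apply: integrableR_sum => i; exact: integrableRZ.
apply: eq_bigr => k _; rewrite Rintegral_sum; last by move=> i; exact: integrableRZ.
by apply: eq_bigr => i _; rewrite RintegralZl.
Qed.

(** Over each grid interval the errors of [ito_increment] and [weight_increment] are both of order
    (t / (N + 1))^(3/2); the N + 1 intervals together leave the square root of t / (N + 1). *)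
Lemma weak_ito_grid t : 0 <= t <= T -> \int[P]_w DG N t w @[N --> \oo] -->
  \int[P]_w (G w * (f (path t w) - f (path 0 w))) - \int[leb]_s (psi s * weight t s).
Proof.
move=> /andP[t0 tT].
have [D D0 hD] := ito_increment.
have [L0 hL0] := @mollifier_deriv_le R m.
have L00 : 0 <= L0 := le_trans (normr_ge0 _) (hL0 0).
have C0 : 0 <= C := @cov_const_ge0 _ _ _ _.
pose D' := M * (L0 * Num.sqrt C).
have D'0 : 0 <= D' by apply: mulr_ge0 => //; apply: mulr_ge0 => //; exact: sqrtr_ge0.
have pT0 : 0 <= p * T `^ (p - 1) by rewrite mulr_ge0 ?powR_ge0// (le_trans ler01).
pose I (s : R) := \int[leb]_r (psi r * weight s r).
have I0 : I 0 = 0.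
  rewrite /I -(Rintegral_weight hHK) // set_itv1.
  by rewrite /Rintegral integral_set1//= ?mulr0.
pose J (s : R) := \int[P]_w (G w * f (path s w)).
have iJ s : integrableR P (fun w => G w * f (path s w)).
  by apply: (@bounded_mul _ _ M) => // w; exact: gM.
have JE a b : \int[P]_w (G w * (f (path b w) - f (path a w))) = J b - J a.
  by rewrite /J -RintegralB//; apply: eq_Rintegral => w _; rewrite mulrBr.
rewrite JE -/(I t); set l := J t - J 0 - I t.
pose E := D + p * T `^ (p - 1) * D'.
have E0 : 0 <= E by apply: addr_ge0 => //; exact: mulr_ge0.
have bound N : `|l - \int[P]_w DG N t w| <= E * t * Num.sqrt (t / N.+1%:R).
  set s := t / N.+1%:R.
  have s0 : 0 <= s by rewrite divr_ge0.
  rewrite integral_DG ?t0//.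
  have -> : l = \sum_(k < N.+1) ((J (grid t N k.+1) - J (grid t N k)) -
      (I (grid t N k.+1) - I (grid t N k))).
    rewrite sumrB -!(big_mkord xpredT (fun k => _ (grid t N k.+1) - _ (grid t N k))) !telescope_sumr//.
    by rewrite grid0 grid_last I0 subr0.
  rewrite -sumrB; apply: (le_trans (ler_norm_sum _ _ _)).
  apply: (@le_trans _ _ (\sum_(k < N.+1) E * (s * Num.sqrt s))); last first.
    rewrite sumr_const card_ord -mulr_natr /s.
    rewrite (_ : E * (t / N.+1%:R * Num.sqrt (t / N.+1%:R)) * N.+1%:R = E * t * Num.sqrt (t / N.+1%:R))//.
    by move: (Num.sqrt _) => y; field; rewrite addrC natr1 pnatr_eq0.
  apply: ler_sum => k _.
  set a := grid t N k; set b := grid t N k.+1.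
  have ba : b - a = s by exact: gridS.
  have ab : a <= b by exact: grid_le.
  have /andP[a0 _] : 0 <= a <= t by apply: grid_itv => //; exact: ltnW.
  have /andP[_ bt] : 0 <= b <= t by apply: grid_itv => //; exact: ltn_ord.
  have bT := le_trans bt tT.
  have h1 := hD a b a0 ab bT; rewrite ba JE in h1.
  have h2 : `|I b - I a - psi a * (b `^ p - a `^ p)| <= p * T `^ (p - 1) * (D' * Num.sqrt s) * (b - a).
    apply: (weight_increment hH hK hHK) => //; first by rewrite mulr_ge0 ?sqrtr_ge0.
    move=> r /andP[ar rb]; apply: (le_trans (psi_lip hL0 r a)); rewrite -/D'.
    rewrite ler_wpM2l// ler_wsqrtr// ger0_norm ?subr_ge0// -ba.
    by rewrite lerD2r.
  rewrite ba in h2.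
  set A := \sum_i _ in h1 *.
  have alg (y1 y2 y3 z1 z2 w1 w2 : R) : `|y1 - y2 - y3| <= w1 -> `|z1 - y3| <= w2 ->
      `|y1 - z1 - y2| <= w1 + w2.
    move=> g1 g2; rewrite (_ : y1 - z1 - y2 = (y1 - y2 - y3) - (z1 - y3)); last by ring.
    by apply: (le_trans (ler_normB _ _)); exact: lerD.
  apply: (le_trans (alg _ _ _ _ 0 _ _ h1 h2)).
  rewrite (mulrDl D) lerD2l.
  have alg2 (y1 y2 y3 y4 : R) : y1 * (y2 * y3) * y4 <= y1 * y2 * (y4 * y3).
    by rewrite (_ : y1 * (y2 * y3) * y4 = y1 * y2 * (y4 * y3))//; ring.
  exact: alg2.
apply/cvgrPdist_le => eps eps0.
have c0 : E * t * Num.sqrt (t / n.+1%:R) @[n --> \oo] --> (0 : R).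
  rewrite -[X in _ --> X](mulr0 (E * t)); apply: cvgMr.
  rewrite -(sqrtr0 R); apply: (@continuous_cvg_seq _ _ (@Num.sqrt R)); first exact: sqrt_continuous.
  rewrite -[X in _ --> X](mulr0 t); apply: cvgMr; exact: cvg_harmonic.
move/cvgrPdist_le : c0 => /(_ eps eps0); apply: filterS => N.
rewrite sub0r normrN ger0_norm; first exact: le_trans.
by rewrite mulr_ge0 ?sqrtr_ge0// mulr_ge0.
Qed.

(** Fubini exchanges the expectation and the time integral; the kernels match because [mollifier m]
    is [gauss_kernel] at (2 (m + 1))^-1. *)
Lemma integral_weight_local_time t : 0 <= t <= T ->
  \int[leb]_s (psi s * weight t s) =
  \int[P]_w (G w * approx_local_time Hu K B t x (2 * m.+1%:R)^-1 w).
Proof.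
move=> /andP[t0 tT].
have ->: (fun w => G w * approx_local_time Hu K B t x (2 * m.+1%:R)^-1 w) =
    (fun w => \int[leb]_s (G w * q (path s w) * weight t s)).
  apply/funext => w.
  transitivity (p * \int[leb]_(s in `[0, t]) (G w * q (path s w) * s `^ (p - 1))); last first.
    have h1 := @Rintegral_weight R Hu K hHK (fun s => G w * q (path s w)) t (@continuous_qpath w (G w)).
    exact: h1.
  rewrite /approx_local_time [LHS]mulrCA; congr (_ * _).
  rewrite -RintegralZl//.
    apply: eq_Rintegral => s; rewrite inE/= in_itv/= => /andP[s0 st].
    by rewrite gauss_kernelE /path clamp_id ?s0 ?(le_trans st)// mulrA.
  have := @integrable_itv_weight _ _ _ hHK (fun s => p^-1 * q (path s w)) t (@continuous_qpath w p^-1); apply: eq_integrable => //.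
  move=> s; rewrite inE/= in_itv/= => /andP[s0 st]; congr EFin.
  rewrite gauss_kernelE /path clamp_id ?s0 ?(le_trans st)//.
  by rewrite mulrACA mulVf ?mul1r// gt_eqF// (lt_le_trans ltr01).
rewrite -(@Rintegral_fubini _ _ _ _ _ leb P (fun pr => G pr.2 * q (path pr.1 pr.2) * weight t pr.1)
  (fun s => M * Q * weight t s) (fun=> 1)).
- by apply: eq_Rintegral => s _; rewrite /= RintegralZr.
- apply: measurable_funM; last exact: (measurable_fst_comp (@measurable_weight R Hu K t)).
  apply: measurable_funM; first exact: (measurable_snd_comp mG).
  apply: measurableT_comp; first exact: continuous_measurable_fun (@continuous_mollifier _ m).
  exact: measurable_fun_joint.
- by apply: integrableRZ; exact: integrable_weight.
- by apply: (@integrableR_bounded _ _ _ _ _ 1) => // w; rewrite normr1.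
- move=> s w /=; rewrite mulr1 normrM (ger0_norm (weight_ge0 _ _ _)) ?ler_wpM2r ?weight_ge0//.
  by rewrite normrM; apply: ler_pM => //; exact: gM.
Qed.

Lemma weak_ito t (u : Omega -> V) : 0 <= t <= T ->
  (forall w, grid_sum e t N (path_coef t S (path^~ w) N) @[N --> \oo] --> u w) ->
  \int[P]_w \sum_i dG i w * ip (h i) (u w) =
  \int[P]_w (G w * (f (path t w) - f (path 0 w))) -
  \int[P]_w (G w * approx_local_time Hu K B t x (2 * m.+1%:R)^-1 w).
Proof.
move=> tT uE; rewrite -integral_weight_local_time//.
have c1 := weak_ito_grid tT.
(* The trapezoidal coefficients are bounded by 1, so [norm_sum_incr_le] bounds all grid sums
   uniformly in N and in the path, and dominated convergence applies. *)
have bG N w : `|grid_sum e t N (path_coef t S (path^~ w) N)| <= Num.sqrt (C * T).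
  have CT0 : 0 <= C * T by rewrite mulr_ge0 ?cov_const_ge0// ltW.
  have /andP[t0 tT'] := tT.
  rewrite -[leLHS]ger0_norm// -sqrtr_sqr ler_sqrt//.
  have h1 := @norm_sum_incr_le R Hu K T hH hK hHK V ip e hV (grid t N) N.+1 (path_coef t S (path^~ w) N).
  apply: (le_trans (h1 _ _ _)) => {h1}.
  - by rewrite grid0.
  - by move=> k; exact: grid_le.
  - by rewrite grid_last.
  apply: ler_wpM2l; first exact: cov_const_ge0.
  apply: (@le_trans _ _ (\sum_(k < N.+1) (grid t N k.+1 - grid t N k))).
    apply: ler_sum => k _; rewrite -[leRHS]mul1r ler_wpM2r ?subr_ge0 ?grid_le//.
    rewrite -real_normK ?num_real// -[leRHS](expr1n _ 2) ler_sqr ?nnegrE//.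
    rewrite /path_coef normrM (@ger0_norm _ 2^-1)// ler_pdivrMr// mul1r.
    apply: (le_trans (ler_normD _ _)); rewrite -[2%:R]/(1 + 1).
    apply: lerD; exact: mollified_sg_norm_le1.
  rewrite -(big_mkord xpredT (fun k => grid t N k.+1 - grid t N k)) telescope_sumr//.
  by rewrite grid0 grid_last subr0.
have c2 : \int[P]_w DG N t w @[N --> \oo] --> \int[P]_w \sum_i dG i w * ip (h i) (u w).
  apply: (@Rintegral_dominated_cvg _ _ _ _ _ _ (fun=> \sum_i M' * (`|h i| * Num.sqrt (C * T)))).
  - move=> N; apply: measurable_sum => i; apply: measurable_funM => //.
    rewrite (_ : (fun w => _) = fun w => \sum_(k < N.+1) path_coef t S (path^~ w) N k *
      ip (h i) (e (grid t N k.+1) - e (grid t N k))); last first.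
      by apply/funext => w; rewrite /grid_sum ip_sumr; apply: eq_bigr => k _; rewrite ipZr.
    apply: measurable_sum => k; apply: measurable_funM => //.
    by apply: measurable_funM => //; exact: measurable_funD.
  - move=> w; apply: cvgR_sum => i; apply: cvgMr.
    rewrite (_ : (fun N => _) = fun N => ip (grid_sum e t N (path_coef t S (path^~ w) N)) (h i)).
      by rewrite ipC; apply: (cvg_ipl (completion_norm hV)); exact: uE.
    by apply/funext => N; rewrite ipC.
  - apply: (@integrableR_bounded _ _ _ _ _ (`|\sum_i M' * (`|h i| * Num.sqrt (C * T))|)) => //.
  - move=> N w; apply: (le_trans (ler_norm_sum _ _ _)); apply: ler_sum => i _.
    rewrite normrM; apply: ler_pM => //; first exact: dgM.
    apply: (le_trans (ip_norm_le (completion_norm hV) _ _)).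
    by rewrite ler_wpM2l.
by apply: (cvg_unique _ c2); [exact: Rhausdorff|exact: c1].
Qed.

End weak_ito.

(** * Singular integrals and the covariance determinant *)

Section singular_integrals.
Context {R : realType}.
Local Notation leb := (@lebesgue_measure R).

(** The fundamental theorem on compact intervals that avoid the singularity, followed by monotone
    convergence of the integrals. *)
Lemma ge0_integral_exhaust (f F : R -> R) (a_ b_ : nat -> R) (c : R) :
  (forall n, a_ n < b_ n) -> (forall n, a_ n.+1 <= a_ n) -> (forall n, b_ n <= b_ n.+1) ->
  (forall n s, a_ n <= s <= b_ n -> is_derive s 1 F (f s)) ->
  (forall n s, a_ n <= s <= b_ n -> {for s, continuous f}) ->
  measurable_fun setT f -> (forall s, 0 <= f s) -> (forall n, F (b_ n) - F (a_ n) <= c) ->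
  (\int[leb]_(s in \bigcup_n `[a_ n, b_ n]%classic) (f s)%:E <= c%:E)%E.
Proof.
move=> ab da ib dF cf mf f0 Fc.
pose D n : set (measurableTypeR R) := `[a_ n, b_ n]%classic.
have h := @ge0_nondecreasing_set_cvg_integral _ (measurableTypeR R) R D (EFin \o f) leb.
have {}h : (\int[leb]_(s in D n) (f s)%:E)%E @[n --> \oo] --> (\int[leb]_(s in \bigcup_n D n) (f s)%:E)%E.
  apply: h.
  - apply/nondecreasing_seqP => n; rewrite subsetEset => s.
    by rewrite /D/= !in_itv/= => /andP[h1 h2]; rewrite (le_trans (da n))// (le_trans h2).
  - by move=> n; exact: measurable_itv.
  - by move=> n; apply: measurable_funTS; exact/measurable_EFinP.
  - by move=> n s _; rewrite lee_fin.
have E n : (\int[leb]_(s in D n) (f s)%:E = (F (b_ n) - F (a_ n))%:E)%E.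
  rewrite EFinB; apply: continuous_FTC2 => //.
  - apply/subspace_continuousP => s; rewrite /= in_itv/= => /cf cs.
    by apply: cvg_within_filter; exact: cs.
  - have cF s : a_ n <= s <= b_ n -> {for s, continuous F}.
      by move=> /dF d1; apply/differentiable_continuous/derivable1_diffP; case: d1.
    have /ltW abn := ab n.
    split.
    + by move=> s; rewrite in_itv/= => /andP[/ltW h1 /ltW h2]; have [] : is_derive s 1 F (f s) by apply: (dF n); rewrite h1.
    + by apply: cvg_at_right_filter; apply: cF; rewrite lexx.
    + by apply: cvg_at_left_filter; apply: cF; rewrite lexx abn.
  - move=> s; rewrite in_itv/= => /andP[/ltW h1 /ltW h2].
    have d1 : is_derive s 1 F (f s) by apply: (dF n); rewrite h1.
    by rewrite derive1E derive_val.
apply: (cvge_to_le h).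
by apply: nearW => n; rewrite E lee_fin.
Qed.

Lemma measurable_norm_powR (r q : R) : measurable_fun setT (fun s : R => `|s - r| `^ q).
Proof.
apply: (measurableT_comp (f := fun y : R => y `^ q)); first exact: measurable_powR.
apply: measurableT_comp => //.
exact: measurable_funB.
Qed.

Lemma integral_norm_powR_right (q r T : R) : 0 <= q < 1 -> 0 < T ->
  (\int[leb]_(s in `]r, (r + T)%R]) (`|s - r| `^ (- q))%:E <= (T `^ (1 - q) / (1 - q))%:E)%E.
Proof.
move=> /andP[q0 q1] T0.
have q1' : 0 < 1 - q by rewrite subr_gt0.
pose F (s : R) := (s - r) `^ (1 - q) / (1 - q).
(* Starting the sequence at T / 2 keeps every interval nondegenerate. *)
pose a_ n := r + T * n.+2%:R^-1.
have nS n : n.+2%:R^-1 < 1 :> R by rewrite invf_lt1// ltr1n.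
have dF (s : R) : r < s -> is_derive s 1 F (`|s - r| `^ (- q)).
  move=> rs; have sr : 0 < s - r by rewrite subr_gt0.
  have d1 := is_derive1_powR (1 - q) sr.
  have d2 : is_derive s 1 (fun s : R => s - r) (1 : R) by apply: is_derive_eq; rewrite subr0.
  have d3 := @is_derive1_comp R (fun y => y `^ (1 - q)) (fun s => s - r) s _ _ d1 d2.
  rewrite /F; have d4 : is_derive s 1 ((fun y : R => y `^ (1 - q)) \o (fun s => s - r)) (((1 - q) * (s - r) `^ (1 - q - 1)) *: (1 : R)) := d3.
  rewrite (_ : (fun s => _) = (fun s => (1 - q)^-1 * ((fun y : R => y `^ (1 - q)) \o (fun s => s - r)) s)); last by apply/funext => y; rewrite mulrC.
  apply: is_derive_eq; rewrite gtr0_norm//.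
  rewrite (_ : 1 - q - 1 = - q); last by ring.
  rewrite /GRing.scale/= mulr1 mulrA mulVf ?gt_eqF//; ring.
have -> : (`]r, (r + T)%R]%classic : set (measurableTypeR R)) = \bigcup_n `[a_ n, r + T]%classic.
  apply/seteqP; split => s.
    rewrite /= in_itv/= => /andP[rs sT].
    have sr : 0 < (s - r) / T by rewrite divr_gt0// subr_gt0.
    have [n _ hn] : \forall n \near \oo, n.+1%:R^-1 < (s - r) / T.
      have /cvgr0Pnorm_lt /(_ _ sr) := @cvg_harmonic R.
      by apply: filterS => m; apply: le_lt_trans; exact: ler_norm.
    exists n => //; rewrite /= in_itv/= sT andbT /a_ -lerBrDl -ler_pdivlMl// mulrC.
    by have /ltW := hn n.+1 (leqnSn n).
  move=> [n _]; rewrite /= !in_itv/= => /andP[h1 ->]; rewrite andbT.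
  by apply: lt_le_trans h1; rewrite /a_ ltrDl mulr_gt0.
apply: (@ge0_integral_exhaust _ F) => //.
- by move=> n; rewrite /a_ ltrD2l -[ltRHS]mulr1 ltr_pM2l.
- by move=> n; rewrite /a_ lerD2l ler_pM2l// lef_pV2 ?posrE// ler_nat.
- move=> n s /andP[h _]; apply: dF; apply: lt_le_trans h.
  by rewrite /a_ ltrDl mulr_gt0.
- move=> n s /andP[h _].
  have rs : 0 < s - r by rewrite subr_gt0; apply: lt_le_trans h; rewrite /a_ ltrDl mulr_gt0.
  apply: (@continuous_comp _ _ _ (fun s : R => `|s - r|) (fun y : R => y `^ (- q))).
    by apply: cvg_norm; apply: cvgB; [exact: cvg_id|exact: cvg_cst].
  apply/differentiable_continuous/derivable1_diffP.
  rewrite gtr0_norm//.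
  by have [] := is_derive1_powR (- q) rs.
- exact: measurable_norm_powR.
- move=> n; rewrite /F (_ : r + T - r = T); last by ring.
  by rewrite gerBl divr_ge0 ?powR_ge0// ltW.
Qed.

Lemma integral_norm_powR_left (q r T : R) : 0 <= q < 1 -> 0 < T ->
  (\int[leb]_(s in `[(r - T)%R, r[) (`|s - r| `^ (- q))%:E <= (T `^ (1 - q) / (1 - q))%:E)%E.
Proof.
move=> /andP[q0 q1] T0.
have q1' : 0 < 1 - q by rewrite subr_gt0.
pose F (s : R) := - ((r - s) `^ (1 - q) / (1 - q)).
pose b_ n := r - T * n.+2%:R^-1.
have nS n : n.+2%:R^-1 < 1 :> R by rewrite invf_lt1// ltr1n.
have dF (s : R) : s < r -> is_derive s 1 F (`|s - r| `^ (- q)).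
  move=> rs; have sr : 0 < r - s by rewrite subr_gt0.
  have d1 := is_derive1_powR (1 - q) sr.
  have d2 : is_derive s 1 (fun s : R => r - s) (- 1 : R).
    by apply: (is_derive_eq (is_deriveB (is_derive_cst r s 1) (is_derive_id s 1))); rewrite sub0r.
  have d3 := @is_derive1_comp R (fun y => y `^ (1 - q)) (fun s => r - s) s _ _ d1 d2.
  rewrite /F; have d4 : is_derive s 1 ((fun y : R => y `^ (1 - q)) \o (fun s => r - s)) (((1 - q) * (r - s) `^ (1 - q - 1)) *: (- 1 : R)) := d3.
  rewrite (_ : (fun s => _) = (fun s => - (1 - q)^-1 * ((fun y : R => y `^ (1 - q)) \o (fun s => r - s)) s)); last by apply/funext => y; rewrite mulNr mulrC.
  apply: is_derive_eq; rewrite distrC gtr0_norm//.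
  rewrite (_ : 1 - q - 1 = - q); last by ring.
  rewrite /GRing.scale/= mulrN1 mulrNN mulrA mulVf ?gt_eqF//; ring.
have -> : (`[(r - T)%R, r[%classic : set (measurableTypeR R)) = \bigcup_n `[r - T, b_ n]%classic.
  apply/seteqP; split => s.
    rewrite /= in_itv/= => /andP[sT rs].
    have sr : 0 < (r - s) / T by rewrite divr_gt0// subr_gt0.
    have [n _ hn] : \forall n \near \oo, n.+1%:R^-1 < (r - s) / T.
      have /cvgr0Pnorm_lt /(_ _ sr) := @cvg_harmonic R.
      by apply: filterS => m; apply: le_lt_trans; exact: ler_norm.
    exists n => //; rewrite /= in_itv/= sT /b_ lerBrDr -lerBrDl -ler_pdivlMl// mulrC.
    by have /ltW := hn n.+1 (leqnSn n).
  move=> [n _]; rewrite /= !in_itv/= => /andP[-> h1].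
  by apply: le_lt_trans h1 _; rewrite /b_ gtrBl mulr_gt0.
apply: (@ge0_integral_exhaust _ F) => //.
- by move=> n; rewrite /b_ ltrD2l ltrN2 -[ltRHS]mulr1 ltr_pM2l.
- by move=> n; rewrite /b_ lerD2l lerN2 ler_pM2l// lef_pV2 ?posrE// ler_nat.
- move=> n s /andP[_ h]; apply: dF; apply: (le_lt_trans h).
  by rewrite /b_ gtrBl mulr_gt0.
- move=> n s /andP[_ h].
  have rs : 0 < r - s by rewrite subr_gt0; apply: (le_lt_trans h); rewrite /b_ gtrBl mulr_gt0.
  apply: (@continuous_comp _ _ _ (fun s : R => `|s - r|) (fun y : R => y `^ (- q))).
    by apply: cvg_norm; apply: cvgB; [exact: cvg_id|exact: cvg_cst].
  apply/differentiable_continuous/derivable1_diffP.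
  rewrite distrC gtr0_norm//.
  by have [] := is_derive1_powR (- q) rs.
- exact: measurable_norm_powR.
- move=> n; rewrite /F (_ : r - (r - T) = T); last by ring.
  by rewrite opprK addrC gerBl divr_ge0 ?powR_ge0// ltW.
Qed.

Lemma integral_norm_powR (q r T : R) : 0 <= q < 1 -> 0 < T -> 0 <= r <= T ->
  (\int[leb]_(s in `[0%R, T]) (`|s - r| `^ (- q))%:E <= (2 * (T `^ (1 - q) / (1 - q)))%:E)%E.
Proof.
move=> hq T0 /andP[r0 rT].
pose A : set (measurableTypeR R) := `[(r - T)%R, r[%classic.
pose B : set (measurableTypeR R) := `]r, (r + T)%R]%classic.
pose C : set (measurableTypeR R) := [set r].
have mA : measurable A by exact: measurable_itv.
have mB : measurable B by exact: measurable_itv.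
have mC : measurable C by exact: measurable_set1.
have mf D : measurable_fun D (fun s : R => (`|s - r| `^ (- q))%:E).
  by apply: measurable_funTS; apply/measurable_EFinP; exact: measurable_norm_powR.
have f0 s : (0 <= (`|s - r| `^ (- q))%:E)%E by rewrite lee_fin powR_ge0.
apply: (@le_trans _ _ (\int[leb]_(s in (A `|` B) `|` C) (`|s - r| `^ (- q))%:E)%E).
  apply: ge0_subset_integral => //.
  - by apply: measurableU; [exact: measurableU|exact: mC].
  - exact: mf.
  move=> s; rewrite /= in_itv/= => /andP[s0 sT].
  have [sr|sr|->] := ltgtP s r; last by right.
  - by left; left; rewrite /A/= in_itv/= sr andbT; lra.
  - by left; right; rewrite /B/= in_itv/= sr/=; lra.
have mAB : measurable (A `|` B) by exact: measurableU.
rewrite ge0_integral_setU//; last 2 first.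
- exact: mf.
- apply/disj_setPS => s [AB]; rewrite /C/= => sr; move: AB; rewrite sr => -[];
    by rewrite /A /B/= in_itv/= ltxx ?andbF.
rewrite [X in (_ + X)%E](_ : _ = 0%E) ?adde0; last first.
  by rewrite integral_set1.
rewrite ge0_integral_setU//; last 2 first.
- exact: mf.
- by apply/disj_setPS => s []; rewrite /A /B/=; rewrite !in_itv/= => /andP[h1 h2] /andP[h3 h4]; lra.
rewrite (_ : 2 * _ = T `^ (1 - q) / (1 - q) + T `^ (1 - q) / (1 - q)); last by rewrite mulr_natl mulr2n.
rewrite EFinD; apply: leeD; [exact: integral_norm_powR_left|exact: integral_norm_powR_right].
Qed.

Lemma integrable_norm_powR_prod (q h T : R) : 0 <= q < 1 -> 0 <= h < 1 -> 0 < T ->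
  integrableR (leb \x leb)%E (fun z : R * R => (`|z.1| `^ (- q) + `|z.2| `^ (- q)) *
    `|z.2 - z.1| `^ (- h) * (\1_`[0, T]%classic z.1 * \1_`[0, T]%classic z.2)).
Proof.
move=> hq hh T0.
pose I : set (measurableTypeR R) := `[0, T]%classic.
have mI : measurable I by exact: measurable_itv.
have m1 : measurable_fun setT (fun z : measurableTypeR R * measurableTypeR R => `|z.1| `^ (- q)).
  have := measurable_norm_powR 0 (- q).
  under eq_fun do rewrite subr0.
  exact: measurable_fst_comp.
have m2 : measurable_fun setT (fun z : measurableTypeR R * measurableTypeR R => `|z.2| `^ (- q)).
  have := measurable_norm_powR 0 (- q).
  under eq_fun do rewrite subr0.
  exact: measurable_snd_comp.
have m3 : measurable_fun setT (fun z : measurableTypeR R * measurableTypeR R => `|z.2 - z.1| `^ (- h)).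
  apply: (measurableT_comp (f := fun y : R => y `^ (- h))); first exact: measurable_powR.
  apply: measurableT_comp => //; apply: measurable_funB; [exact: measurable_snd|exact: measurable_fst].
have m4 : measurable_fun setT (fun z : measurableTypeR R * measurableTypeR R => \1_I z.1 : R).
  by apply: measurable_fst_comp; exact: measurable_indic.
have m5 : measurable_fun setT (fun z : measurableTypeR R * measurableTypeR R => \1_I z.2 : R).
  by apply: measurable_snd_comp; exact: measurable_indic.
have ind01 (s : R) : 0 <= (\1_I s : R) <= 1.
  by rewrite indicE; case: (_ \in _); rewrite ?lexx ?ler01.
have c0 (a : R) : 0 <= a < 1 -> 0 <= 2 * (T `^ (1 - a) / (1 - a)).
  by move=> /andP[a0 a1]; rewrite mulr_ge0// divr_ge0 ?powR_ge0// subr_ge0 ltW.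
have inner (a r : R) : 0 <= a < 1 ->
    (\int[leb]_s (`| `|s - r| `^ (- a) * (\1_I r * \1_I s)|)%:E <= (2 * (T `^ (1 - a) / (1 - a)) * \1_I r)%:E)%E.
  move=> ha; rewrite indicE; have [|rI] := boolP (r \in I); last first.
    rewrite /= mulr0 [leLHS](_ : _ = 0%E)//; apply: integral0_eq => s _.
    by rewrite mul0r mulr0 normr0.
  rewrite inE /I/= in_itv/= => rI; rewrite mulr1.
  apply: le_trans (integral_norm_powR ha T0 rI).
  rewrite [leRHS]integral_mkcond; apply: ge0_le_integral => //.
  - apply/measurable_EFinP; apply: measurableT_comp => //; apply: measurable_funM.
      exact: measurable_norm_powR.
    by apply: measurable_funM => //; exact: measurable_indic.
  - apply/(measurable_restrictT _ mI).
    apply: measurable_funTS; apply/measurable_EFinP; exact: measurable_norm_powR.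
  move=> s _; rewrite patchE indicE -/I; case: (s \in I) => /=.
    by rewrite !mulr1 ger0_norm// powR_ge0.
  by rewrite !mulr0 normr0.
have outer (a b : R) : 0 <= a < 1 -> 0 <= b < 1 ->
    (\int[leb]_r (`|r| `^ (- a) * (2 * (T `^ (1 - b) / (1 - b)) * \1_I r))%:E < +oo)%E.
  move=> ha hb; set c := 2 * _.
  have c0' : 0 <= c := c0 _ hb.
  have mI0 : measurable_fun setT (fun r : R => `|r| `^ (- a) * \1_I r).
    apply: measurable_funM; last exact: measurable_indic.
    by have := measurable_norm_powR 0 (- a); under eq_fun do rewrite subr0.
  have I0 r : 0 <= `|r| `^ (- a) * \1_I r by rewrite mulr_ge0 ?powR_ge0//; case/andP: (ind01 r).
  rewrite (_ : (fun r => _) = (fun r => (c%:E * (`|r| `^ (- a) * \1_I r)%:E)%E)); last first.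
    by apply/funext => r; rewrite -EFinM; congr EFin; ring.
  rewrite ge0_integralZl//; last exact/measurable_EFinP.
  apply: lte_mul_pinfty => //; apply: (@le_lt_trans _ _ (2 * (T `^ (1 - a) / (1 - a)) * (\1_I (0 : R) : R))%:E); last by rewrite ltry.
  apply: le_trans (inner a 0 ha).
  rewrite le_eqVlt; apply/orP; left; apply/eqP; apply: eq_integral => r _; congr EFin.
  have in0 : (0 : measurableTypeR R) \in I by apply/mem_set; rewrite /I/= in_itv/= lexx ltW.
  by rewrite subr0 [\1_I 0]indicE in0 mul1r [RHS]ger0_norm.
(* The term singular at z.1 = 0 is integrated first in z.2, where the factor |z.2 - z.1|^(-h) has an
   integral bounded uniformly in z.1; [f2] is treated in the opposite order. *)
pose f1 (z : measurableTypeR R * measurableTypeR R) := `|z.1| `^ (- q) * (`|z.2 - z.1| `^ (- h) * (\1_I z.1 * \1_I z.2)).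
pose f2 (z : measurableTypeR R * measurableTypeR R) := `|z.2| `^ (- q) * (`|z.2 - z.1| `^ (- h) * (\1_I z.1 * \1_I z.2)).
have i1 : integrableR (leb \x leb)%E f1.
  have mf1 : measurable_fun setT (EFin \o f1).
    by apply/measurable_EFinP; apply: measurable_funM => //; apply: measurable_funM => //; exact: measurable_funM.
  apply/(integrable12ltyP leb leb mf1) => /=.
  apply: le_lt_trans (outer q h hq hh).
  have mabs : measurable_fun setT (fun z => `|(f1 z)%:E|%E) by exact: measurableT_comp.
  apply: ge0_le_integral => //.
  - by move=> r _; exact: integral_ge0.
  - exact: (@measurable_fun_fubini_tonelli_F _ _ _ _ _ leb (fun z => `|(f1 z)%:E|%E)).
  - apply/measurable_EFinP; apply: measurable_funM.
      by have := measurable_norm_powR 0 (- q); under eq_fun do rewrite subr0.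
    by apply: measurable_funM => //; exact: measurable_indic.
  move=> r _; rewrite EFinM.
  rewrite (_ : (fun y => _) = (fun y => (`|r| `^ (- q))%:E * (`| `|y - r| `^ (- h) * (\1_I r * \1_I y)|)%:E)%E); last first.
    by apply/funext => y; rewrite /f1/= -EFinM normrM (ger0_norm (powR_ge0 _ _)).
  rewrite ge0_integralZl//.
  - by apply: lee_wpmul2l; [rewrite lee_fin powR_ge0|exact: inner].
  - apply/measurable_EFinP; apply: measurableT_comp => //; apply: measurable_funM.
      exact: measurable_norm_powR.
    by apply: measurable_funM => //; exact: measurable_indic.
have i2 : integrableR (leb \x leb)%E f2.
  have mf2 : measurable_fun setT (EFin \o f2).
    by apply/measurable_EFinP; apply: measurable_funM => //; apply: measurable_funM => //; exact: measurable_funM.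
  apply/(integrable21ltyP leb leb mf2) => /=.
  apply: le_lt_trans (outer q h hq hh).
  have mabs : measurable_fun setT (fun z => `|(f2 z)%:E|%E) by exact: measurableT_comp.
  apply: ge0_le_integral => //.
  - by move=> r _; exact: integral_ge0.
  - exact: (@measurable_fun_fubini_tonelli_G _ _ _ _ _ leb (fun z => `|(f2 z)%:E|%E)).
  - apply/measurable_EFinP; apply: measurable_funM.
      by have := measurable_norm_powR 0 (- q); under eq_fun do rewrite subr0.
    by apply: measurable_funM => //; exact: measurable_indic.
  move=> r _; rewrite EFinM.
  rewrite (_ : (fun y => _) = (fun y => (`|r| `^ (- q))%:E * (`| `|y - r| `^ (- h) * (\1_I r * \1_I y)|)%:E)%E); last first.
    apply/funext => y; rewrite /f2/= -EFinM normrM (ger0_norm (powR_ge0 _ _)).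
    by rewrite (distrC r) (mulrC (\1_I y)).
  rewrite ge0_integralZl//.
  - by apply: lee_wpmul2l; [rewrite lee_fin powR_ge0|exact: inner].
  - apply/measurable_EFinP; apply: measurableT_comp => //; apply: measurable_funM.
      exact: measurable_norm_powR.
    by apply: measurable_funM => //; exact: measurable_indic.
have := integrableRD i1 i2.
rewrite (_ : (fun z => _) = (fun z => (`|z.1| `^ (- q) + `|z.2| `^ (- q)) *
    `|z.2 - z.1| `^ (- h) * (\1_`[0, T]%classic z.1 * \1_`[0, T]%classic z.2)))//.
by apply/funext => z; rewrite /f1 /f2 -!mulrDl mulrA.
Qed.

End singular_integrals.

(** The continuous functions y / (y^2 + 1 / (n + 1)) converge to the inverse everywhere, including
    at 0, where the inverse is 0 by convention. *)
Lemma measurable_invR {R : realType} : measurable_fun setT (fun y : R => y^-1).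
Proof.
apply: (@measurable_fun_cvg _ _ _ _ (fun n (y : R) => y * (y ^+ 2 + n.+1%:R^-1)^-1)) => //.
- move=> n; apply: continuous_measurable_fun => y.
  have e0 : 0 < y ^+ 2 + n.+1%:R^-1 by rewrite ltr_wpDl ?sqr_ge0// invr_gt0.
  apply: cvgM; first exact: cvg_id.
  apply: cvgV; first by rewrite gt_eqF.
  by apply: cvgD; [exact: exprn_continuous|exact: cvg_cst].
- move=> y _; have [->|y0] := eqVneq y 0.
    by under eq_fun do rewrite mul0r; rewrite invr0; exact: cvg_cst.
  rewrite [X in _ --> X](_ : _ = y * (y ^+ 2 + 0)^-1); last by rewrite addr0 expr2 invfM mulrA divff// mul1r.
  apply: cvgMr; apply: cvgV; first by rewrite addr0 sqrf_eq0.
  by apply: cvgD; [exact: cvg_cst|exact: cvg_harmonic].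
Qed.

(** * Lower bound on the determinant and integrable majorant *)

Section covariance_determinant.
Context {R : realType} {Hu K T : R}.
Hypotheses (hH : 0 < Hu < 1) (hK : 0 < K <= 1) (hHK : 1 <= 2 * Hu * K) (hT : 0 < T).
Local Notation cov := (bif_cov Hu K).
Local Notation p := (2 * Hu * K).
Local Notation h := (Hu * K).
Local Notation leb := (@lebesgue_measure R).
Local Notation weight := (@weight R Hu K).

Definition cov_det (s r : R) : R := s `^ p * r `^ p - cov s r ^+ 2.

Lemma cov_detC s r : cov_det s r = cov_det r s.
Proof. by rewrite /cov_det (bif_covC s r) (mulrC (s `^ p)). Qed.

Lemma cov_det_lower s r : 0 < r -> r < s ->
  Num.sqrt (@det_const R Hu K) * (r `^ ((h + 1) / 2) * s `^ ((h - 1) / 2) * (s - r) `^ h) <= Num.sqrt (cov_det s r).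
Proof.
move=> r0 rs; have s0 := lt_trans r0 rs; have sr : 0 < s - r by rewrite subr_gt0.
have c0 := ltW (@det_const_gt0 R Hu K hH hK).
have sq (y a : R) : (y `^ (a / 2)) ^+ 2 = y `^ a.
  by rewrite -powR_mulrn ?powR_ge0// -powRrM divfK.
set L := r `^ _ * _ * _.
have L0 : 0 <= L by rewrite !mulr_ge0 ?powR_ge0.
rewrite -[L]ger0_norm// -sqrtr_sqr -sqrtrM// ler_wsqrtr//.
apply: le_trans (le_trans (bif_cov_det hH hK r0 rs) _); last first.
  by rewrite cov_detC /cov_det.
have ph : p / 2 = h by field.
rewrite /L !exprMn (sq r (h + 1)) (sq s (h - 1)) -ph (sq (s - r) p) ph.
have E1 : r `^ (h + 1) = r `^ h * r by rewrite powRD ?powRr1 ?(ltW r0)// (gt_eqF r0) implybT.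
have E2 : s `^ (h - 1) = s `^ h / s by rewrite powRB ?powRr1 ?(ltW s0)// (gt_eqF s0) implybT.
have E3 : (r * s) `^ h = r `^ h * s `^ h by rewrite powRM ?ltW.
rewrite E1 E2 E3.
have alg (c a b dd u v : R) : c * (a * u * (b / v) * dd) <= c * (a * b) * dd * (u / v).
  by rewrite (_ : c * (a * u * (b / v) * dd) = c * (a * b) * dd * (u / v))//; ring.
exact: alg.
Qed.

Lemma cov_det_gt0 s r : 0 < s -> 0 < r -> s != r -> 0 < cov_det s r.
Proof.
wlog rs : s r / r <= s.
  move=> H s0 r0 sr; have [h1|/ltW h1] := leP r s; first exact: H.
  by rewrite cov_detC; apply: H => //; rewrite eq_sym.
move=> s0 r0 sr; have {}rs : r < s by rewrite lt_neqAle eq_sym sr.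
have sr0 : 0 < s - r by rewrite subr_gt0.
rewrite -sqrtr_gt0; apply: lt_le_trans (cov_det_lower r0 rs).
by rewrite !mulr_gt0 ?powR_gt0// sqrtr_gt0 det_const_gt0.
Qed.

(** The weights contribute (2HK)^2, the lower bound on the determinant its constant, and the power
    of T bounds what is left of the power of the larger time. *)
Definition sing_const : R := p ^+ 2 / Num.sqrt (@det_const R Hu K) * T `^ ((3 * h - 1) / 2).

Lemma sing_const_ge0 : 0 <= sing_const.
Proof. by rewrite mulr_ge0 ?powR_ge0// mulr_ge0 ?sqr_ge0// invr_ge0 sqrtr_ge0. Qed.

(** With h = HK and r < s, dividing the weights s^(2h - 1) r^(2h - 1) by the bound [cov_det_lower]
    leaves s^((3h - 1)/2), which is bounded, and r^(-(3 - 3h)/2) (s - r)^(-h). Writing both times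
    symmetrically removes the need to know which is smaller. Where the determinant is 0, the inverse
    is 0 by convention. *)
Lemma weight_det_le s r : 0 <= s <= T -> 0 <= r <= T ->
  p * s `^ (p - 1) * (p * r `^ (p - 1)) * (Num.sqrt (cov_det s r))^-1 <=
  sing_const * ((`|s| `^ (- ((3 - 3 * h) / 2)) + `|r| `^ (- ((3 - 3 * h) / 2))) * `|r - s| `^ (- h)).
Proof.
wlog rs : s r / r <= s.
  move=> H hs hr; have [h1|/ltW h1] := leP r s; first exact: H.
  have := H r s h1 hr hs; rewrite cov_detC distrC (addrC (`|r| `^ _)).
  by congr (_ <= _); rewrite (mulrC (p * r `^ _)).
move=> /andP[s0 sT] /andP[r0 rT].
have rhs0 : 0 <= sing_const * ((`|s| `^ (- ((3 - 3 * h) / 2)) + `|r| `^ (- ((3 - 3 * h) / 2))) * `|r - s| `^ (- h)).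
  by rewrite mulr_ge0 ?sing_const_ge0// mulr_ge0 ?powR_ge0// addr_ge0 ?powR_ge0.
have p0 : 0 < p by exact: lt_le_trans hHK.
have deg : cov_det s r = 0 -> p * s `^ (p - 1) * (p * r `^ (p - 1)) * (Num.sqrt (cov_det s r))^-1 <=
  sing_const * ((`|s| `^ (- ((3 - 3 * h) / 2)) + `|r| `^ (- ((3 - 3 * h) / 2))) * `|r - s| `^ (- h)).
  by move=> ->; rewrite sqrtr0 invr0 mulr0.
move: r0; rewrite le_eqVlt => /predU1P[r0|r0].
  apply: deg; rewrite /cov_det -r0 bif_cov0// powR0 ?gt_eqF// mulr0 expr0n/=.
  by rewrite subr0.
move: rs; rewrite le_eqVlt => /predU1P[rs|rs].
  by apply: deg; rewrite /cov_det rs (bif_cov_diag hK hHK)// -expr2 subrr.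
have {}s0 := lt_trans r0 rs; have sr : 0 < s - r by rewrite subr_gt0.
have low := cov_det_lower r0 rs.
have c0 := @det_const_gt0 R Hu K hH hK.
set L := _ * (_ * _ * _) in low.
have L0 : 0 < L by rewrite !mulr_gt0 ?powR_gt0// sqrtr_gt0.
apply: (@le_trans _ _ (p * s `^ (p - 1) * (p * r `^ (p - 1)) * L^-1)).
  have w0 (y : R) : 0 <= p * y `^ (p - 1) by apply: mulr_ge0; [exact: ltW|exact: powR_ge0].
  rewrite ler_wpM2l//; first exact: mulr_ge0.
  by rewrite lef_pV2// posrE// (lt_le_trans L0).
have rn0 : r != 0 by exact: lt0r_neq0.
have sn0 : s != 0 by exact: lt0r_neq0.
have E1 : s `^ (p - 1) = s `^ ((3 * h - 1) / 2) * s `^ ((h - 1) / 2).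
  by rewrite -powRD ?sn0 ?implybT//; congr (_ `^ _); field.
have E2 : r `^ (p - 1) = r `^ (- ((3 - 3 * h) / 2)) * r `^ ((h + 1) / 2).
  by rewrite -powRD ?rn0 ?implybT//; congr (_ `^ _); field.
rewrite E1 E2 /L (gtr0_norm s0) (gtr0_norm r0) distrC (gtr0_norm sr).
rewrite (powRN (s - r)).
have y1 : 0 < s `^ ((h - 1) / 2) by rewrite powR_gt0.
have y2 : 0 < r `^ ((h + 1) / 2) by rewrite powR_gt0.
have y3 : 0 < (s - r) `^ h by rewrite powR_gt0.
have y4 : 0 < Num.sqrt (@det_const R Hu K) by rewrite sqrtr_gt0.
have T3 : s `^ ((3 * h - 1) / 2) <= T `^ ((3 * h - 1) / 2).
  rewrite ge0_ler_powR ?nnegrE ?(ltW s0) ?(ltW hT)// divr_ge0// subr_ge0.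
  move: hHK; lra.
have y5 := powR_ge0 s ((3 * h - 1) / 2).
have y6 := powR_ge0 r (- ((3 - 3 * h) / 2)).
have y7 := powR_ge0 s (- ((3 - 3 * h) / 2)).
have alg (a b c dd t u v v' z : R) : 0 < a -> 0 < b -> 0 < c -> 0 < dd -> 0 <= t -> t <= u ->
    0 <= v -> 0 <= v' ->
    z * (t * a) * (z * (v * b)) * (dd * (b * a * c))^-1 <= z ^+ 2 / dd * u * ((v' + v) * c^-1).
  move=> a0 b0 c0' d0 t0 tu v0 v'0.
  rewrite (_ : z * (t * a) * (z * (v * b)) * (dd * (b * a * c))^-1 = z ^+ 2 / dd * t * (v * c^-1)); last first.
    by field; rewrite !lt0r_neq0.
  apply: ler_pM.
  - by rewrite mulr_ge0// mulr_ge0 ?sqr_ge0// invr_ge0 ltW.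
  - by rewrite mulr_ge0// invr_ge0 ltW.
  - by rewrite ler_wpM2l// mulr_ge0 ?sqr_ge0// invr_ge0 ltW.
  - by rewrite ler_wpM2r ?invr_ge0 ?(ltW c0')// lerDr.
exact: alg.
Qed.

Definition kernel_bound eta s r : R :=
  (2 * pi)^-1 * ((Num.sqrt (cov_det s r))^-1 - (Num.sqrt (cov_det s r + eta * r `^ p))^-1).

Lemma kernel_bound_le eta s r : 0 <= eta -> 0 < cov_det s r ->
  0 <= kernel_bound eta s r <= (Num.sqrt (cov_det s r))^-1.
Proof.
move=> eta0 D0.
have ev : 0 <= eta * r `^ p by rewrite mulr_ge0// powR_ge0.
have S0 : 0 < Num.sqrt (cov_det s r) by rewrite sqrtr_gt0.
have S1 : 0 < Num.sqrt (cov_det s r + eta * r `^ p) by rewrite sqrtr_gt0 ltr_wpDr.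
have le1 : (Num.sqrt (cov_det s r + eta * r `^ p))^-1 <= (Num.sqrt (cov_det s r))^-1.
  by rewrite lef_pV2 ?posrE// ler_wsqrtr// lerDl.
have pi1 : (2 * pi)^-1 <= 1 :> R.
  by rewrite invf_le1 ?mulr_gt0 ?pi_gt0//; have := pi_ge2 R; lra.
rewrite /kernel_bound mulr_ge0 ?subr_ge0 ?invr_ge0 ?mulr_ge0 ?pi_ge0//=.
rewrite -[leRHS]mul1r; apply: ler_pM => //.
- by rewrite invr_ge0 mulr_ge0 ?pi_ge0.
- by rewrite subr_ge0.
- by rewrite gerBl invr_ge0 ltW.
Qed.

Lemma kernel_bound_cvg (s r : R) (eta : nat -> R) : 0 < cov_det s r -> eta n @[n --> \oo] --> 0 ->
  kernel_bound (eta n) s r @[n --> \oo] --> 0.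
Proof.
move=> D0 eta0; rewrite /kernel_bound.
rewrite [X in _ --> X](_ : _ = (2 * pi)^-1 * ((Num.sqrt (cov_det s r))^-1 - (Num.sqrt (cov_det s r + 0 * r `^ p))^-1)); last first.
  by rewrite mul0r addr0 subrr mulr0.
apply: cvgMr; apply: cvgB; first exact: cvg_cst.
apply: cvgV; first by rewrite mul0r addr0 gt_eqF// sqrtr_gt0.
apply: (@continuous_cvg_seq _ _ (@Num.sqrt R)); first exact: sqrt_continuous.
by apply: cvgD; [exact: cvg_cst|exact: cvgMl].
Qed.

Lemma measurable_cov_det : measurable_fun setT
  (fun z : measurableTypeR R * measurableTypeR R => cov_det z.1 z.2).
Proof.
have mp (q : R) : measurable_fun setT (fun y : R => y `^ q) by exact: measurable_powR.
have m1 q : measurable_fun setT (fun z : measurableTypeR R * measurableTypeR R => z.1 `^ q).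
  by have := mp q; exact: measurable_fst_comp.
have m2 q : measurable_fun setT (fun z : measurableTypeR R * measurableTypeR R => z.2 `^ q).
  by have := mp q; exact: measurable_snd_comp.
apply: measurable_funB; first exact: measurable_funM.
apply: measurable_funX; apply: measurable_funM => //; apply: measurable_funB.
  apply: (measurableT_comp (f := fun y : R => y `^ K)) => //.
  exact: measurable_funD.
apply: (measurableT_comp (f := fun y : R => y `^ p)) => //.
apply: measurableT_comp => //.
by apply: measurable_funB; [exact: measurable_fst|exact: measurable_snd].
Qed.

Definition det_pos : set (measurableTypeR R * measurableTypeR R) := [set z | 0 < cov_det z.1 z.2].

Lemma measurable_det_pos : measurable det_pos.
Proof.
rewrite (_ : det_pos = setT `&` (fun z : measurableTypeR R * measurableTypeR R => cov_det z.1 z.2) @^-1` `]0, +oo[%classic).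
  by apply: measurable_cov_det => //; exact: measurable_itv.
by rewrite setTI; apply/seteqP; split => z; rewrite /det_pos/= in_itv/= andbT.
Qed.

Lemma measurable_kernel_bound eta : measurable_fun setT
  (fun z : measurableTypeR R * measurableTypeR R => kernel_bound eta z.1 z.2).
Proof.
have msV : measurable_fun setT (fun y : R => (Num.sqrt y)^-1).
  apply: (measurableT_comp (f := fun y : R => y^-1)); first exact: measurable_invR.
  exact: continuous_measurable_fun (@sqrt_continuous R).
have mp : measurable_fun setT (fun y : R => y `^ p) by exact: measurable_powR.
apply: measurable_funM => //; apply: measurable_funB.
  by apply: (measurableT_comp msV); exact: measurable_cov_det.
apply: (measurableT_comp msV); apply: measurable_funD; first exact: measurable_cov_det.
by apply: measurable_funM => //; have := mp; exact: measurable_snd_comp.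
Qed.

(** The indicator discards the points with nonpositive determinant; inside the square where the
    weights live these lie on the axes and the diagonal, a null set. *)
Definition weighted_bound t eta (z : measurableTypeR R * measurableTypeR R) : R :=
  weight t z.1 * weight t z.2 * (kernel_bound eta z.1 z.2 * \1_det_pos z).

Lemma measurable_weighted_bound t eta : measurable_fun setT (weighted_bound t eta).
Proof.
apply: measurable_funM.
  apply: measurable_funM; [apply: measurable_fst_comp|apply: measurable_snd_comp]; exact: measurable_weight.
apply: measurable_funM; first exact: measurable_kernel_bound.
by apply: measurable_indic; exact: measurable_det_pos.
Qed.

Lemma weighted_bound_le t : 0 <= t <= T ->
  exists2 g : R * R -> R, integrableR (leb \x leb)%E g &
    forall eta z, 0 <= eta -> 0 <= weighted_bound t eta z <= g z.
Proof.
move=> /andP[t0 tT].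
(* From h >= 1 / 2 the exponent (3 - 3h) / 2 is at most 3 / 4, and h < 1; so both singularities are
   integrable. *)
have h01 : 2^-1 <= h < 1.
  case/andP: hH => H0 H1; case/andP: hK => K0 K1; apply/andP; split; first by move: hHK; lra.
  by apply: le_lt_trans H1; rewrite -[leRHS]mulr1 ler_wpM2l// ltW.
have [h0 h1] := andP h01.
have iG := @integrable_norm_powR_prod R ((3 - 3 * h) / 2) h T _ _ hT.
exists (fun z : R * R => sing_const * ((`|z.1| `^ (- ((3 - 3 * h) / 2)) + `|z.2| `^ (- ((3 - 3 * h) / 2))) *
    `|z.2 - z.1| `^ (- h)) * (\1_`[0, T]%classic z.1 * \1_`[0, T]%classic z.2)).
  under eq_fun do rewrite -mulrA.
  by apply: integrableRZ; apply: iG; apply/andP; split; lra.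
move=> eta [s r] eta0; rewrite /weighted_bound /=.
have w0 (y : R) : 0 <= weight t y by exact: weight_ge0.
have i0 (y : R) : 0 <= (\1_`[0, T]%classic y : R) by rewrite indicE.
have rhs0 : 0 <= sing_const * ((`|s| `^ (- ((3 - 3 * h) / 2)) + `|r| `^ (- ((3 - 3 * h) / 2))) *
    `|r - s| `^ (- h)) * (\1_`[0, T]%classic s * \1_`[0, T]%classic r).
  apply: mulr_ge0; last exact: mulr_ge0.
  apply: mulr_ge0; first exact: sing_const_ge0.
  by apply: mulr_ge0; [apply: addr_ge0|]; exact: powR_ge0.
have [D0|D0] := ltP 0 (cov_det s r); last first.
  rewrite [\1_det_pos _]indicE (_ : _ \in det_pos = false); last first.
    by apply/negbTE/negP; rewrite inE /det_pos/= ltNge D0.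
  rewrite !mulr0 lexx/=; exact: rhs0.
have /andP[k0 k1] := kernel_bound_le eta0 D0.
have zD : ((s, r) : measurableTypeR R * measurableTypeR R) \in det_pos by apply/mem_set.
rewrite [\1_det_pos _]indicE zD mulr1.
have ww : 0 <= weight t s * weight t r by exact: mulr_ge0.
apply/andP; split; first exact: mulr_ge0.
apply: (@le_trans _ _ (weight t s * weight t r * (Num.sqrt (cov_det s r))^-1)).
  exact: ler_wpM2l.
have itv0 (y : R) : y \in `[0, t] -> y \in `[0, T].
  by rewrite !in_itv/= => /andP[-> yt]; exact: le_trans tT.
rewrite /weight ![\1_`[0, t]%classic _]indicE !mem_setE.
have [sI|sI] := boolP (s \in `[0, t]); last first.
  rewrite mulr0 !mul0r; exact: rhs0.
have [rI|rI] := boolP (r \in `[0, t]); last first.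
  rewrite !mulr0 mul0r; exact: rhs0.
rewrite !indicE !mem_setE (itv0 _ sI) (itv0 _ rI) !mulr1.
have := itv0 _ sI; have := itv0 _ rI; rewrite !in_itv/= => hr hs.
exact: weight_det_le.
Qed.

Lemma weighted_bound_cvg t (eta : nat -> R) : 0 <= t <= T -> (forall n, 0 <= eta n) ->
  eta n @[n --> \oo] --> 0 ->
  \int[(leb \x leb)%E]_z weighted_bound t (eta n) z @[n --> \oo] --> 0.
Proof.
move=> tT eta0 eta_cvg; have [g ig gb] := weighted_bound_le tT.
rewrite [X in _ --> X](_ : _ = \int[(leb \x leb)%E]_z 0); last by rewrite Rintegral_cst// mul0r.
apply: (@Rintegral_dominated_cvg _ _ _ (leb \x leb)%E (fun n => weighted_bound t (eta n)) (fun=> 0) g).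
- by move=> n; exact: measurable_weighted_bound.
- move=> z; rewrite /weighted_bound -(mulr0 (weight t z.1 * weight t z.2)); apply: cvgMr.
  rewrite indicE; have [zD|_] := boolP (z \in det_pos); last first.
    by under eq_fun do rewrite mulr0; exact: cvg_cst.
  under eq_fun do rewrite mulr1.
  by apply: kernel_bound_cvg => //; rewrite inE in zD.
- exact: ig.
- by move=> n z; have /andP[h0 h1] := gb _ z (eta0 n); rewrite ger0_norm.
Qed.

End covariance_determinant.

(** * Second moments of Gaussian kernels *)

Section gauss_kernel_fourier.
Context {R : realType}.
Local Notation leb := (@lebesgue_measure R).

Lemma gauss_kernel_gaussf (eps v : R) :
  gauss_kernel eps v = (Num.sqrt (2 * pi * eps))^-1 * gaussf (2 * eps)^-1 v.
Proof. by rewrite /gauss_kernel /gaussf; congr (_ * expR _); rewrite mulNr mulrC. Qed.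

Lemma gauss_kernel_ge0 (eps v : R) : 0 <= gauss_kernel eps v.
Proof. by rewrite mulr_ge0 ?invr_ge0 ?sqrtr_ge0// expR_ge0. Qed.

Lemma gauss_kernel_le (eps v : R) : 0 < eps -> gauss_kernel eps v <= (Num.sqrt (2 * pi * eps))^-1.
Proof.
move=> e0; rewrite gauss_kernel_gaussf ler_piMr ?invr_ge0 ?sqrtr_ge0// gaussf_le1//.
by rewrite invr_ge0 mulr_ge0// ltW.
Qed.

Lemma continuous_gauss_kernel (eps : R) : continuous (gauss_kernel eps).
Proof.
rewrite (_ : gauss_kernel eps = fun v => (Num.sqrt (2 * pi * eps))^-1 * gaussf (2 * eps)^-1 v).
  by move=> v; apply: cvgMr; exact: continuous_gaussf.
by apply/funext => v; exact: gauss_kernel_gaussf.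
Qed.

(** The Gaussian cosine transform read backwards. It replaces the kernel by cosines, whose
    expectations are known without any joint density. *)
Lemma gauss_kernel_fourier (eps v : R) : 0 < eps ->
  gauss_kernel eps v = (2 * pi)^-1 * \int[leb]_x (gaussf (eps / 2) x * cos (v * x)).
Proof.
move=> e0; have p0 := pi_gt0 R.
have -> : \int[leb]_x (gaussf (eps / 2) x * cos (v * x)) =
    Num.sqrt (pi / (eps / 2)) * gaussf (4 * (eps / 2))^-1 v.
  have h := @integral_gaussf_cos R 0 (eps / 2) v; rewrite cos0 mul1r in h.
  rewrite -h ?divr_gt0//.
  by apply: eq_Rintegral => y _; rewrite addr0.
have -> : 4 * (eps / 2) = 2 * eps by field.
rewrite gauss_kernel_gaussf mulrA; congr (_ * _).
have alg (y z : R) : y != 0 -> z != 0 -> y / (z / 2) = (2 * y) ^+ 2 / (2 * y * z).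
  by move=> y0 z0; field; rewrite ?y0 ?z0.
have -> := alg pi eps (lt0r_neq0 p0) (lt0r_neq0 e0).
have pp : 0 < 2 * pi :> R by rewrite mulr_gt0.
rewrite [Num.sqrt (_ ^+ 2 / _)]sqrtrM ?sqr_ge0// sqrtr_sqr (gtr0_norm pp) mulKf ?gt_eqF// sqrtrV//.
by rewrite mulr_ge0 ?(ltW pp)// ltW.
Qed.

Lemma gaussf_monotone (a b x : R) : a <= b -> gaussf b x <= gaussf a x.
Proof. by move=> ab; rewrite ler_expR lerN2 ler_wpM2r ?sqr_ge0. Qed.

Lemma gaussfM (a b x : R) : gaussf a x * gaussf b x = gaussf (a + b) x.
Proof. by rewrite /gaussf -expRD; congr expR; ring. Qed.

End gauss_kernel_fourier.

Section kernel_covariance.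
Context {R : realType} {d : measure_display} {Omega : measurableType d}
  {P : probability Omega R} {Hu K T : R}.
Hypotheses (hH : 0 < Hu < 1) (hK : 0 < K <= 1) (hHK : 1 <= 2 * Hu * K) (hT : 0 < T).
Context {B : R -> {RV P >-> R}}.
Hypothesis hB : is_bifBm Hu K T B.
Context {V : completeNormedModType R} {ip : {dot V for idfun}} {e : R -> V}.
Hypothesis hV : is_completion Hu K T ip e.
Local Notation cov := (bif_cov Hu K).
Local Notation p := (2 * Hu * K).
Local Notation leb := (@lebesgue_measure R).
Context (s r x eps eps' eta : R).
Hypotheses (hs : 0 <= s <= T) (hr : 0 <= r <= T) (r0 : 0 < r) (D0 : 0 < @cov_det R Hu K s r).
Hypotheses (he : 0 < eps <= eta) (he' : 0 < eps' <= eta).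
Local Notation v := (r `^ p).
Local Notation D := (@cov_det R Hu K s r).

Let g y := gauss_kernel eps y - gauss_kernel eps' y.
Let a xi := gaussf (eps / 2) xi - gaussf (eps' / 2) xi.
Let A xi := gaussf (eps / 2) xi + gaussf (eps' / 2) xi.

Let e0 : 0 < eps. Proof. by case/andP: he. Qed.
Let e0' : 0 < eps'. Proof. by case/andP: he'. Qed.
Let eta0 : 0 < eta. Proof. by case/andP: he => h1 h2; exact: lt_le_trans h2. Qed.
Let v0 : 0 < v. Proof. exact: powR_gt0. Qed.

Let iA : integrableR leb A.
Proof. by apply: integrableRD; apply: integrable_gaussf; rewrite divr_gt0. Qed.

Let ma : measurable_fun setT a.
Proof. by apply: measurable_funB; exact: measurable_gaussf. Qed.

Let aA xi : `|a xi| <= A xi.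
Proof.
by apply: (le_trans (ler_normB _ _)); rewrite !ger0_norm// ltW// gaussf_gt0.
Qed.

(** For variances in ]0, eta] both Gaussians lie between [gaussf (eta / 2)] and 1, so their
    difference is at most the width of that range. *)
Let a_le xi : `|a xi| <= 1 - gaussf (eta / 2) xi.
Proof.
have bnd q : 0 < q <= eta -> gaussf (eta / 2) xi <= gaussf (q / 2) xi <= 1.
  move=> /andP[q0 q1]; rewrite gaussf_le1 ?divr_ge0 ?(ltW q0)// andbT.
  by apply: gaussf_monotone; rewrite ler_wpM2r.
have := bnd _ he; have := bnd _ he'; rewrite /a ler_norml.
by move=> /andP[h1 h2] /andP[h3 h4]; apply/andP; split; lra.
Qed.

Let a_le1 xi : `|a xi| <= 1.
Proof. by apply: (le_trans (a_le xi)); rewrite gerBl ltW// gaussf_gt0. Qed.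

Let mcos1 (y : R) : measurable_fun setT (fun xi : R => cos (y * xi)).
Proof.
apply: measurableT_comp; first exact: continuous_measurable_fun (@continuous_cos R).
exact: measurable_funM.
Qed.

Let ga y : g y = (2 * pi)^-1 * \int[leb]_xi (a xi * cos (y * xi)).
Proof.
rewrite /g !gauss_kernel_fourier// -mulrBr -RintegralB//.
- by congr (_ * _); apply: eq_Rintegral => xi _; rewrite /a mulrBl.
- have := @integrable_gaussf_cos R 0 (eps / 2) y; under eq_fun do rewrite addr0.
  by apply; rewrite divr_gt0.
- have := @integrable_gaussf_cos R 0 (eps' / 2) y; under eq_fun do rewrite addr0.
  by apply; rewrite divr_gt0.
Qed.

Let Mg := (Num.sqrt (2 * pi * eps))^-1 + (Num.sqrt (2 * pi * eps'))^-1.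

Let g_le y : `|g y| <= Mg.
Proof.
apply: (le_trans (ler_normB _ _)); rewrite !ger0_norm ?gauss_kernel_ge0//.
by apply: lerD; exact: gauss_kernel_le.
Qed.

Let cg : continuous g.
Proof. by move=> y; apply: cvgB; exact: continuous_gauss_kernel. Qed.

Let X y w := B y w - x.

Let mX y : measurable_fun setT (X y).
Proof. exact: measurable_funB. Qed.

Let mcosX y xi : measurable_fun setT (fun w => cos (X y w * xi)).
Proof.
apply: measurableT_comp; first exact: continuous_measurable_fun (@continuous_cos R).
exact: measurable_funM.
Qed.

Let mcosX2 y : measurable_fun (@setT (Omega * measurableTypeR R)) (fun z => cos (X y z.1 * z.2)).
Proof.
apply: measurableT_comp; first exact: continuous_measurable_fun (@continuous_cos R).
apply: measurable_funM; last exact: measurable_snd.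
by apply: measurable_fst_comp; exact: mX.
Qed.

Let mgX y : measurable_fun setT (fun w => g (X y w)).
Proof. by apply: measurableT_comp; [exact: continuous_measurable_fun|exact: mX]. Qed.

Let swap_measurable y (H : Omega -> R) M : measurable_fun setT H -> (forall w, `|H w| <= M) ->
  measurable_fun setT (fun xi => a xi * \int[P]_w (cos (X y w * xi) * H w)).
Proof.
move=> mH HM; apply: measurable_funM => //.
(* Only measurability is extracted, so the measure on the frequencies is free; a probability makes
   the constant bound integrable. *)
apply: (@measurable_Rintegral1 _ _ _ _ _ (uniform_law hT) P
  (fun z : measurableTypeR R * Omega => cos (X y z.2 * z.1) * H z.2) (fun=> 1) (fun=> M)).
- apply: measurable_funM; last exact: (measurable_snd_comp mH).
  apply: measurableT_comp; first exact: continuous_measurable_fun (@continuous_cos R).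
  by apply: measurable_funM; [apply: measurable_snd_comp; exact: mX|exact: measurable_fst].
- by apply: (@integrableR_bounded _ _ _ _ _ 1) => // xi; rewrite normr1.
- by apply: (@integrableR_bounded _ _ _ _ _ M) => // w; rewrite ger0_norm// (le_trans _ (HM w)).
- by move=> xi w; rewrite normrM; apply: ler_pM => //; exact: cos_max.
Qed.

(* Fourier inversion of the factor g (X y). *)
Let swap y (H : Omega -> R) M : measurable_fun setT H -> (forall w, `|H w| <= M) ->
  \int[P]_w (g (X y w) * H w) =
  (2 * pi)^-1 * \int[leb]_xi (a xi * \int[P]_w (cos (X y w * xi) * H w)).
Proof.
move=> mH HM.
have iH : integrableR P H by exact: (@integrableR_bounded _ _ _ _ _ M).
have icH xi : integrableR P (fun w => cos (X y w * xi) * H w).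
  apply: (@integrableR_bounded _ _ _ _ _ (1 * M)); first exact: measurable_funM.
  by move=> w; rewrite normrM; apply: ler_pM => //; exact: cos_max.
have := @Rintegral_fubini _ _ _ _ _ P leb
  (fun z : Omega * measurableTypeR R => a z.2 * cos (X y z.1 * z.2) * H z.1) (fun=> M) A _ _ iA _.
rewrite /= => fub.
rewrite (_ : (fun xi => _) = fun xi => \int[P]_w (a xi * cos (X y w * xi) * H w)); last first.
  by apply/funext => xi; rewrite -RintegralZl//; apply: eq_Rintegral => w _; rewrite mulrA.
rewrite -fub.
- have E w : \int[leb]_xi (a xi * cos (X y w * xi) * H w) = 2 * pi * (g (X y w) * H w).
    rewrite RintegralZr//; last first.
      apply: (integrableR_dominated _ iA); first by apply: measurable_funM; [exact: ma|exact: mcos1].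
      by move=> xi; rewrite normrM -[leRHS]mulr1; apply: ler_pM => //; exact: cos_max.
    by rewrite ga mulrA mulVKf ?gt_eqF// mulr_gt0// pi_gt0.
  under [in RHS]eq_Rintegral do rewrite E.
  rewrite RintegralZl// ?mulKf ?gt_eqF ?mulr_gt0 ?pi_gt0//.
  apply: (@integrableR_bounded _ _ _ _ _ (Mg * M)); first exact: measurable_funM.
  by move=> w; rewrite normrM; apply: ler_pM.
- apply: measurable_funM; last exact: (measurable_fst_comp mH).
  by apply: measurable_funM; [exact: (measurable_snd_comp ma)|exact: mcosX2].
- by apply: (@integrableR_bounded _ _ _ _ _ M) => // w; rewrite ger0_norm// (le_trans _ (HM w)).
- move=> w xi; rewrite normrM normrM mulrC; apply: ler_pM => //.
  rewrite -[leRHS]mulr1; apply: ler_pM => //; exact: cos_max.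
Qed.

(** The variance of xi B_s + zeta B_r. *)
Let var xi zeta := s `^ p * xi ^+ 2 + 2 * cov s r * xi * zeta + v * zeta ^+ 2.

Let cos_le xi zeta th : `|\int[P]_w cos (xi * B s w + zeta * B r w + th)| <= expR (- (var xi zeta / 2)).
Proof.
have isoB y : 0 <= y <= T -> isonormal T B e (e y) (B y).
  by move=> hy; apply: isonormal_bifBm; rewrite in_itv.
have iso := isonormal_linear xi zeta (isoB s hs) (isoB r hr).
rewrite (isonormal_cos hB hV th iso) normrM (ger0_norm (expR_ge0 _)).
rewrite -[leRHS]mul1r; apply: ler_pM => //; first exact: cos_max.
rewrite ler_expR lerN2 /var ler_wpM2r//.
rewrite !(ipDl, ipDr, ipZl, ipZr) !(completion_ip hV) ?in_itv//= !(bif_cov_diag hK hHK)//; last 2 first.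
- by case/andP: hr.
- by case/andP: hs.
rewrite (bif_covC r s) le_eqVlt; apply/orP; left; apply/eqP; ring.
Qed.

(** Completing the square in zeta; the remaining rate D / (2 v) in xi is half the conditional
    variance of B_s given B_r. *)
Let var_square xi zeta : expR (- (var xi zeta / 2)) =
  gaussf (v / 2) (zeta - (- (xi * cov s r / v))) * gaussf (D / (2 * v)) xi.
Proof.
rewrite /gaussf -expRD; congr expR; rewrite /var /cov_det.
move: (s `^ p) v v0 (cov s r) => u v1 v1gt c; field; exact: lt0r_neq0.
Qed.

Let var_integral xi sg : sg ^+ 2 = 1 -> integrableR leb (fun zeta => expR (- (var xi (sg * zeta) / 2))) /\
  \int[leb]_zeta expR (- (var xi (sg * zeta) / 2)) = Num.sqrt (pi / (v / 2)) * gaussf (D / (2 * v)) xi.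
Proof.
move=> sg2.
have E zeta : expR (- (var xi (sg * zeta) / 2)) =
    gaussf (D / (2 * v)) xi * gaussf (v / 2) (zeta - (- (sg * xi * cov s r / v))).
  rewrite var_square mulrC; congr (_ * expR (- (_ * _))).
  rewrite (_ : sg * zeta - - (xi * cov s r / v) = sg * (zeta - - (sg * xi * cov s r / v))).
    by rewrite exprMn sg2 mul1r.
  rewrite mulrBr mulrN; congr (_ - - _).
  by rewrite !mulrA -expr2 sg2 mul1r.
have v2 : 0 < v / 2 by rewrite divr_gt0.
have [i1 i2] := integral_gaussf_center (- (sg * xi * cov s r / v)) v2.
split; first by under eq_fun do rewrite E; exact: integrableRZ.
under eq_Rintegral do rewrite E.
by rewrite RintegralZl// i2 mulrC.
Qed.

(** Fourier inversion of the factor at time r. The product of cosines splits into cosines of a sum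
    and of a difference, whence the two signs in [var_integral]. The amplitude [a] is bounded by 1
    here; its smallness is exploited in xi only. *)
Let inner_le xi : `|\int[P]_w (cos (X s w * xi) * g (X r w))| <=
  (2 * pi)^-1 * (Num.sqrt (pi / (v / 2)) * gaussf (D / (2 * v)) xi).
Proof.
have pp : 0 <= (2 * pi)^-1 :> R by rewrite invr_ge0 mulr_ge0// pi_ge0.
under eq_Rintegral do rewrite mulrC.
rewrite (@swap r _ 1) => [|//|w]; last exact: cos_max.
rewrite normrM (ger0_norm pp) ler_wpM2l//.
have [ip1 Ip] := @var_integral xi 1 (expr1n _ _).
have [im1 Im] := @var_integral xi (-1) (etrans (sqrrN 1) (expr1n _ 2)).
pose E zeta := 2^-1 * (expR (- (var xi (1 * zeta) / 2)) + expR (- (var xi (-1 * zeta) / 2))).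
have iE : integrableR leb E by apply: integrableRZ; exact: integrableRD.
have IE : \int[leb]_zeta E zeta = Num.sqrt (pi / (v / 2)) * gaussf (D / (2 * v)) xi.
  rewrite RintegralZl//; last exact: integrableRD.
  rewrite RintegralD// Ip Im; by field.
rewrite -IE; apply: Rintegral_bound => //.
  by apply: (@swap_measurable r _ 1) => // w; exact: cos_max.
move=> zeta; rewrite normrM -[leRHS]mul1r; apply: ler_pM => //.
rewrite (_ : \int[P]_w _ = 2^-1 * (\int[P]_w cos (xi * B s w + 1 * zeta * B r w - (xi * x + zeta * x)) +
   \int[P]_w cos (xi * B s w + -1 * zeta * B r w + (zeta * x - xi * x)))); last first.
  have icos b c : integrableR P (fun w => cos (xi * B s w + b * B r w + c)).
    apply: (@integrableR_bounded _ _ _ _ _ 1) => [|w]; last exact: cos_max.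
    apply: measurableT_comp; first exact: continuous_measurable_fun (@continuous_cos R).
    by apply: measurable_funD => //; apply: measurable_funD; apply: measurable_funM.
  rewrite -RintegralD// -RintegralZl//; last exact: integrableRD.
  apply: eq_Rintegral => w _; rewrite mulrC cosM_sum mulrC; congr (_ * (cos _ + cos _)); rewrite /X; ring.
rewrite /E normrM ger0_norm// ler_wpM2l// (le_trans (ler_normD _ _))// lerD//; exact: cos_le.
Qed.

(** In xi the amplitude is at most 1 - exp(- eta xi^2 / 2), so the bound is the difference of two
    Gaussian integrals, of rates D / (2 v) and D / (2 v) + eta / 2. Up to a common factor they are
    D^(-1/2) and (D + eta v)^(-1/2). *)
Lemma kernel_covariance_le :
  `|\int[P]_w (g (B s w - x) * g (B r w - x))| <= @kernel_bound R Hu K eta s r.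
Proof.
have pp : 0 <= (2 * pi)^-1 :> R by rewrite invr_ge0 mulr_ge0// pi_ge0.
have pi0 := pi_gt0 R.
rewrite (@swap s (fun w => g (X r w)) Mg)// normrM (ger0_norm pp) /kernel_bound ler_wpM2l//.
pose c := (2 * pi)^-1 * Num.sqrt (pi / (v / 2)).
have c0 : 0 <= c by rewrite mulr_ge0 ?sqrtr_ge0.
have b1 : 0 < D / (2 * v) by rewrite divr_gt0// mulr_gt0.
have b2 : 0 < D / (2 * v) + eta / 2 by rewrite addr_gt0// divr_gt0.
have [i1 i2] := (integrable_gaussf b1, integrable_gaussf b2).
have iE : integrableR leb (fun xi => c * (gaussf (D / (2 * v)) xi - gaussf (D / (2 * v) + eta / 2) xi)).
  by apply: integrableRZ; exact: integrableRB.
apply: (@le_trans _ _ (\int[leb]_xi (c * (gaussf (D / (2 * v)) xi - gaussf (D / (2 * v) + eta / 2) xi)))).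
  apply: Rintegral_bound => //.
    by apply: (@swap_measurable s _ Mg).
  move=> xi; rewrite normrM.
  apply: (@le_trans _ _ ((1 - gaussf (eta / 2) xi) * (c * gaussf (D / (2 * v)) xi))).
    by apply: ler_pM => //; rewrite /c -mulrA; exact: inner_le.
  by rewrite mulrCA mulrBl mul1r gaussfM addrC [eta / 2 + _]addrC addrC.
rewrite RintegralZl//; last exact: integrableRB.
rewrite RintegralB// !integral_gaussf// mulrBr.
have S (b : R) : 0 < b -> Num.sqrt (pi / (v / 2)) * Num.sqrt (pi / b) = 2 * pi * (Num.sqrt (2 * v * b))^-1.
  move=> b0; rewrite -sqrtrM ?divr_ge0 ?(ltW pi0) ?(ltW v0)//.
  rewrite (_ : pi / (v / 2) * (pi / b) = (2 * pi) ^+ 2 * (2 * v * b)^-1); last first.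
    by move: v v0 => y y0; field; rewrite !gt_eqF.
  rewrite sqrtrM ?sqr_ge0// sqrtr_sqr ger0_norm ?mulr_ge0 ?(ltW pi0)// sqrtrV// mulr_ge0 ?(ltW b0)//.
  by rewrite mulr_ge0// ltW.
have E b : 0 < b -> c * Num.sqrt (pi / b) = (Num.sqrt (2 * v * b))^-1.
  by move=> b0; rewrite /c -mulrA S// mulKf// gt_eqF// mulr_gt0.
rewrite !E//.
have -> : 2 * v * (D / (2 * v)) = D by rewrite mulrC divfK// gt_eqF// mulr_gt0.
have -> : 2 * v * (D / (2 * v) + eta / 2) = D + eta * v; last by [].
move: D v v0 => y z z0; field; exact: lt0r_neq0.
Qed.

End kernel_covariance.

(** * The local time *)

Lemma Rintegral_eq_off2 {R : realType} (f g : R -> R) (a b : R) :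
  measurable_fun setT f -> measurable_fun setT g ->
  (forall r, r != a -> r != b -> f r = g r) ->
  \int[@lebesgue_measure R]_r f r = \int[@lebesgue_measure R]_r g r.
Proof.
move=> mf mg fg; rewrite /Rintegral; congr fine.
apply: ae_eq_integral => //; [exact/measurable_EFinP|exact/measurable_EFinP|].
exists ([set a] `|` [set b]); split.
- by apply: measurableU; exact: measurable_set1.
- by apply: countable_lebesgue_measure0; apply: finite_set_countable; rewrite finite_setU.
- move=> r /= h; apply: contrapT => ab; apply: h => _; congr EFin.
  by apply: fg; apply/eqP => E; apply: ab; [left|right].
Qed.

Lemma Rintegral_prob_cst {R : realType} {d : measure_display} {T : measurableType d}
  (P : probability T R) (c : R) : \int[P]_w c = c.
Proof.
rewrite (@Rintegral_cst _ _ _ P setT measurableT c).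
rewrite [X in fine X](_ : _ = 1%E) ?mulr1//; exact: probability_setT.
Qed.

Section L2_limit.
Context {R : realType} {d : measure_display} {Omega : measurableType d} {P : probability Omega R}.

(* Completeness of L^2, with a limit that is a measurable functional of the
   sequence, hence measurable for any sigma-algebra making the sequence
   measurable. *)
Lemma cauchy_L2_limit (X : R -> Omega -> R) (eta rho : nat -> R) :
  (forall n, 0 < eta n) -> (forall m n, (m <= n)%N -> eta n <= eta m) ->
  (forall a, 0 < a -> sqint P (X a)) -> rho n @[n --> \oo] --> 0 ->
  (forall n a b, 0 < a <= eta n -> 0 < b <= eta n -> \int[P]_w (X a w - X b w) ^+ 2 <= rho n) ->
  exists phi : nat -> nat, let L w := fine (limn_esup (fun k => (X (eta (phi k)) w)%:E)) in
    sqint P L /\ forall n a, 0 < a <= eta n -> \int[P]_w (X a w - L w) ^+ 2 <= rho n.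
Proof.
move=> eta0 eta_mono sX rho0 hrho.
have hN k : exists N, forall j, (N <= j)%N -> rho j <= (2^-1 ^+ k) ^+ 2.
  have e0 : 0 < (2^-1 ^+ k) ^+ 2 :> R by rewrite !exprn_gt0.
  have [N _ hN] : \forall j \near \oo, rho j <= (2^-1 ^+ k) ^+ 2.
    move/cvgr0Pnorm_le : rho0 => /(_ _ e0); apply: filterS => j; apply: le_trans; exact: ler_norm.
  by exists N => j; exact: hN.
pose N k := sval (cid (hN k)).
have NP k : forall j, (N k <= j)%N -> rho j <= (2^-1 ^+ k) ^+ 2 := svalP (cid (hN k)).
(* The partial sums of N make phi nondecreasing and at least N k; the extra k makes it at least k,
   so that late terms fall below any given eta n. *)
pose phi k := (\sum_(i < k.+1) N i + k)%N.
have phiN k : (N k <= phi k)%N.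
  by rewrite /phi big_ord_recr/= addnAC; rewrite leq_addl.
have phik k : (k <= phi k)%N by rewrite /phi leq_addl.
have phiS k : (phi k <= phi k.+1)%N.
  by rewrite /phi [X in (_ <= X + _)%N]big_ord_recr/= addnS -addnA (addnC (N _)) addnA leqW// leq_addr.
exists phi => L.
pose Y k w := X (eta (phi k)) w.
have mX a : 0 < a -> measurable_fun setT (X a) by move=> a0; have [] := sX a a0.
have mY k : measurable_fun setT (Y k) by exact: mX.
pose Dl k w := `|Y k.+1 w - Y k w|.
have mD k : measurable_fun setT (Dl k) by apply: measurableT_comp => //; exact: measurable_funB.
have sD k : sqint P (fun w => Y k.+1 w - Y k w) by exact: (sqintB (sX _ (eta0 _)) (sX _ (eta0 _))).
have iD k : integrableR P (Dl k) by apply: integrableR_norm; exact: sqint_integrable.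
have intD k : \int[P]_w Dl k w <= 2^-1 ^+ k.
  apply: (le_trans (Rintegral_norm_le_sqrt (sD k))).
  have e0 : 0 <= 2^-1 ^+ k :> R by rewrite exprn_ge0.
  rewrite -[leRHS]ger0_norm// -sqrtr_sqr ler_wsqrtr//.
  apply: (le_trans (hrho (phi k) _ _ _ _)).
  - by rewrite eta0 eta_mono.
  - by rewrite eta0 lexx.
  - exact: NP.
(* The increments have L^1 norms at most 2^-k, so the series of their absolute values has finite
   expectation and converges almost everywhere. *)
have aeD : \forall w \ae P, cvgn (series (fun k => Dl k w)).
  pose S w : \bar R := (\sum_(0 <= k <oo) (Dl k w)%:E)%E.
  have iS : P.-integrable setT S.
    apply/integrableP; split.
      by apply: ge0_emeasurable_sum => [k w _ _|k _]; [rewrite lee_fin; exact: normr_ge0|apply/measurable_EFinP; exact: mD].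
    rewrite (_ : (\int[P]_w `|S w| = \int[P]_w S w)%E); last first.
      by apply: eq_integral => w _; rewrite gee0_abs//; apply: nneseries_ge0 => k _ _; rewrite lee_fin; exact: normr_ge0.
    rewrite integral_nneseries//; [|by move=> k; apply/measurable_EFinP; exact: mD|by move=> k w _; rewrite lee_fin; exact: normr_ge0].
    apply: (@le_lt_trans _ _ (\sum_(0 <= k <oo) (2^-1 ^+ k)%:E)%E).
      apply: lee_nneseries => [k _ _|k _].
        by apply: integral_ge0 => w _; rewrite lee_fin; exact: normr_ge0.
      by rewrite -EFin_Rintegral// lee_fin.
    apply: (@le_lt_trans _ _ 2%:E); last by rewrite ltry.
    apply: lime_le; first by apply: is_cvg_nneseries => k _ _; rewrite lee_fin exprn_ge0.
    apply: nearW => n; rewrite sumEFin lee_fin big_mkord.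
    rewrite (_ : \sum_(k < n) 2^-1 ^+ k = 2 - 2 * 2^-1 ^+ n); first by rewrite gerBl mulr_ge0// exprn_ge0.
    elim: n => [|n IH]; first by rewrite big_ord0 expr0 mulr1 subrr.
    by rewrite big_ord_recr/= IH exprS; move: (_ ^+ n) => y; field.
  have := integrable_ae measurableT iS; apply: filterS => w /(_ I) fS.
  apply: nnseries_is_cvg; first by move=> k; exact: normr_ge0.
  by have := fS; rewrite fin_numE => /andP[_]; rewrite -ltey.
have aeY : \forall w \ae P, Y k w @[k --> \oo] --> L w.
  apply: filterS aeD => w cD.
  have cS : cvgn (series (fun k => Y k.+1 w - Y k w)) by exact: normed_cvg.
  have [l hl] : exists l : R, Y k w @[k --> \oo] --> l.
    exists (limn (series (fun k => Y k.+1 w - Y k w)) + Y 0%N w).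
    rewrite (_ : (fun k => Y k w) = (fun k => series (fun k => Y k.+1 w - Y k w) k + Y 0%N w)).
      by apply: cvgD; [exact: cS|exact: cvg_cst].
    by apply/funext => k; rewrite /series/= telescope_sumr// subrK.
  have lE : (fun k => (Y k w)%:E) @ \oo --> l%:E by apply/fine_cvgP; split; [exact: nearW|exact: hl].
  by rewrite /L (cvg_limn_einf_sup lE).2.
have mL : measurable_fun setT L.
  apply: measurableT_comp; first exact: fine_measurable.
  by apply: measurable_fun_limn_esup => k; apply/measurable_EFinP; exact: mX.
(* Fatou along the almost sure limit keeps the bound rho n, for every parameter in ]0, eta n] and
   not only for those of the sequence. *)
have fat n a : 0 < a <= eta n -> (\int[P]_w ((X a w - L w) ^+ 2)%:E <= (rho n)%:E)%E.
  move=> ha; have a0 : 0 < a by case/andP: ha.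
  have mf k : measurable_fun setT (fun w => (X a w - Y k w) ^+ 2).
    by apply: measurable_funX; apply: measurable_funB => //; exact: mX.
  have mfE k : measurable_fun setT (fun w => ((X a w - Y k w) ^+ 2)%:E) by exact/measurable_EFinP.
  have F := @fatou _ _ R P setT measurableT (fun k w => ((X a w - Y k w) ^+ 2)%:E) mfE.
  have {}F := F (fun _ _ _ => sqr_ge0 _).
  apply: (@le_trans _ _ (\int[P]_w limn_einf (fun k => ((X a w - Y k w) ^+ 2)%:E))%E).
    rewrite le_eqVlt; apply/orP; left; apply/eqP; apply: ae_eq_integral => //.
    - by apply/measurable_EFinP; apply: measurable_funX; apply: measurable_funB => //; exact: mX.
    - have mopp : measurable_fun setT (-%E : \bar R -> \bar R) by exact: oppe_measurable.
      have mfN k : measurable_fun setT (fun w => (- ((X a w - Y k w) ^+ 2)%:E)%E).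
        exact: (measurableT_comp mopp (mfE k)).
      exact: (measurableT_comp mopp (measurable_fun_limn_esup mfN)).
    apply: filterS aeY => w cY _.
    have c1 : ((X a w - Y k w) ^+ 2)%:E @[k --> \oo] --> ((X a w - L w) ^+ 2)%:E.
      apply/fine_cvgP; split; first exact: nearW.
      apply: (continuous_cvg_seq (h := fun x : R => x ^+ 2)); first exact: exprn_continuous.
      by apply: cvgB; [exact: cvg_cst|exact: cY].
    by rewrite (cvg_limn_einf_sup c1).1.
  apply: (le_trans F); rewrite limn_einf_lim; apply: lime_le; first exact: is_cvg_einfs.
  exists n => // k /= nk.
  apply: (@le_trans _ _ (\int[P]_w ((X a w - Y k w) ^+ 2)%:E)%E).
    by apply: ereal_inf_lbound; exists k => /=.
  have sk : integrableR P (fun w => (X a w - Y k w) ^+ 2) by have [] := sqintB (sX a a0) (sX _ (eta0 (phi k))).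
  rewrite -EFin_Rintegral// lee_fin; apply: hrho => //.
  by rewrite eta0 eta_mono// (leq_trans nk).
have sXL n a : 0 < a <= eta n -> sqint P (fun w => X a w - L w).
  move=> ha; have h := fat _ _ ha; have a0 : 0 < a by case/andP: ha.
  have mXL : measurable_fun setT (fun w => X a w - L w) by apply: measurable_funB => //; exact: mX.
  split=> //; apply/integrableP; split.
    by apply/measurable_EFinP; exact: measurable_funX.
  apply: le_lt_trans (ltry (rho n)); apply: le_trans h.
  rewrite le_eqVlt; apply/orP; left; apply/eqP; apply: eq_integral => w _.
  by rewrite /= ger0_norm ?sqr_ge0.
split.
  have h0 : 0 < eta 0%N <= eta 0%N by rewrite eta0 lexx.
  have := sqintB (sX _ (eta0 0%N)) (sXL 0%N _ h0).
  by rewrite (_ : (fun w => _) = L)//; apply/funext => w; ring.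
move=> n a ha; rewrite -lee_fin EFin_Rintegral; first exact: fat.
by have [] := sXL n a ha.
Qed.

End L2_limit.

Section local_time.
Context {R : realType} {d : measure_display} {Omega : measurableType d}
  {P : probability Omega R} {Hu K T : R}.
Hypotheses (hH : 0 < Hu < 1) (hK : 0 < K <= 1) (hHK : 1 <= 2 * Hu * K) (hT : 0 < T).
Context {B : R -> {RV P >-> R}}.
Hypothesis hB : is_bifBm Hu K T B.
Context {V : completeNormedModType R} {ip : {dot V for idfun}} {e : R -> V}.
Hypothesis hV : is_completion Hu K T ip e.
Local Notation leb := (@lebesgue_measure R).
Local Notation weight := (@weight R Hu K).
Context (t x : R).
Hypothesis ht : 0 <= t <= T.
Let path s w : R := B (clamp T s) w - x.
Local Notation alt eps := (approx_local_time Hu K B t x eps).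

Let T0 : 0 <= T. Proof. exact: ltW. Qed.

Let continuous_path w : continuous (path^~ w).
Proof.
have h1 : {within `[0, T], continuous (fun s => (B s w : R))} := @bifBm_continuous _ _ _ _ _ _ _ _ hB w.
have h2 := continuous_comp_clamp T0 h1.
by move=> s; exact: (cvgB (h2 s) (cvg_cst x)).
Qed.

Lemma approx_local_timeE eps w : alt eps w = \int[leb]_s (gauss_kernel eps (path s w) * weight t s).
Proof.
have cqp : continuous (fun s => gauss_kernel eps (path s w)).
  move=> s; apply: (@continuous_comp _ _ _ (path^~ w) (gauss_kernel eps)); first exact: continuous_path.
  exact: continuous_gauss_kernel.
rewrite -(Rintegral_weight hHK t cqp) /approx_local_time; congr (_ * _).
apply: eq_Rintegral => s; rewrite inE/= in_itv/= => /andP[s0 st].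
by rewrite /path clamp_id// s0 (le_trans st)//; case/andP: ht.
Qed.

(** The generators of [process_sigma], named so that [g_sigma_algebraType] can equip Omega with this
    smaller sigma-algebra. *)
Definition process_events : set (set Omega) := [set E | exists2 s, s \in `[0, T] &
  exists2 A : set R, measurable A & E = B s @^-1` A].

Lemma process_sigma_measurable A : process_sigma T B A -> measurable A.
Proof.
apply: smallest_sub; first exact: sigma_algebra_measurable.
move=> E [s _ [A' mA' ->]].
have mBs : measurable_fun setT (B s) by [].
by have := mBs measurableT A' mA'; rewrite setTI.
Qed.

Lemma measurable_approx_local_time eps : 0 < eps ->
  measurable_fun [set: g_sigma_algebraType process_events] (alt eps).
Proof.
move=> eps0.
pose O := g_sigma_algebraType process_events.
have mp s : measurable_fun [set: O] (path s).
  apply: measurable_funB => //.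
  move=> _ A mA; rewrite setTI; apply: sub_sigma_algebra.
  by exists (clamp T s); [rewrite in_itv/=; exact: clamp_itv|exists A].
have mj : measurable_fun (@setT (measurableTypeR R * O)) (fun z => path z.1 z.2).
  exact: measurable_fun_joint.
have sw := @measurable_swap _ _ O (measurableTypeR R).
rewrite (_ : alt eps = fun w : O => \int[leb]_s (gauss_kernel eps (path s w) * weight t s)); last first.
  by apply/funext => w; exact: approx_local_timeE.
(* [P] is a measure for the original sigma-algebra of Omega; on the smaller one a Dirac mass stands
   in, since only measurability in w is wanted. *)
apply: (@measurable_Rintegral1 _ _ _ _ _ (\d_ (point : O))%E leb
  (fun z : O * measurableTypeR R => gauss_kernel eps (path z.2 z.1) * weight t z.2)
  (fun=> (Num.sqrt (2 * pi * eps))^-1) (weight t)).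
- apply: measurable_funM; last by have := @measurable_weight R Hu K t; exact: measurable_snd_comp.
  apply: measurableT_comp; first exact: continuous_measurable_fun (@continuous_gauss_kernel _ eps).
  exact: (measurableT_comp mj sw).
- by apply: (@integrableR_bounded _ _ _ _ _ (Num.sqrt (2 * pi * eps))^-1) => // w; rewrite ger0_norm// invr_ge0 sqrtr_ge0.
- exact: integrable_weight.
- move=> w s /=; rewrite normrM (ger0_norm (weight_ge0 _ _ _))// ger0_norm ?gauss_kernel_ge0//.
  by rewrite ler_wpM2r ?weight_ge0// gauss_kernel_le.
Qed.

Lemma measurable_process_events (f : Omega -> R) :
  measurable_fun [set: g_sigma_algebraType process_events] f ->
  measurable_fun setT f /\ forall A : set R, measurable A -> process_sigma T B (f @^-1` A).
Proof.
move=> mf.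
have h (A : set R) : measurable A -> process_sigma T B (f @^-1` A).
  by move=> mA; have := mf measurableT A mA; rewrite setTI.
split; last exact: h.
by move=> _ A mA; rewrite setTI; apply: process_sigma_measurable; exact: h.
Qed.

Lemma approx_local_time_bounded eps : 0 < eps -> exists M, forall w, `|alt eps w| <= M.
Proof.
move=> eps0; exists ((Num.sqrt (2 * pi * eps))^-1 * \int[leb]_s weight t s) => w.
have iw : integrableR leb (weight t) by exact: integrable_weight.
rewrite approx_local_timeE -RintegralZl//.
apply: Rintegral_bound.
- apply: measurable_funM; last exact: measurable_weight.
  apply: measurableT_comp; first exact: continuous_measurable_fun (@continuous_gauss_kernel _ eps).
  exact: continuous_measurable_fun (@continuous_path w).
- exact: integrableRZ.
- move=> s; rewrite normrM (ger0_norm (weight_ge0 _ _ _))// ger0_norm ?gauss_kernel_ge0//.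
  by rewrite ler_wpM2r ?weight_ge0// gauss_kernel_le.
Qed.

Lemma sqint_approx_local_time eps : 0 < eps -> sqint P (alt eps).
Proof.
move=> eps0; have [M hM] := approx_local_time_bounded eps0.
apply: (@sqint_bounded _ _ _ P _ M) => //.
exact: (measurable_process_events (measurable_approx_local_time eps0)).1.
Qed.

(** The square of the difference is a double time integral; Fubini moves the expectation inside,
    where it becomes the kernel covariance that [kernel_covariance_le] controls. *)
Lemma approx_local_time_cauchy eps eps' eta : 0 < eps <= eta -> 0 < eps' <= eta ->
  \int[P]_w (alt eps w - alt eps' w) ^+ 2 <=
  \int[(leb \x leb)%E]_z @weighted_bound R Hu K t eta z.
Proof.
move=> he he'.
have eps0 : 0 < eps by case/andP: he.
have eps0' : 0 < eps' by case/andP: he'.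
have eta0 : 0 <= eta by case/andP: he => h1 h2; rewrite ltW// (lt_le_trans h1).
pose g y := gauss_kernel eps y - gauss_kernel eps' y.
pose Mg : R := (Num.sqrt (2 * pi * eps))^-1 + (Num.sqrt (2 * pi * eps'))^-1.
have gM y : `|g y| <= Mg.
  apply: (le_trans (ler_normB _ _)); rewrite !ger0_norm ?gauss_kernel_ge0//.
  by apply: lerD; exact: gauss_kernel_le.
have Mg0 : 0 <= Mg := le_trans (normr_ge0 _) (gM 0).
have mg : measurable_fun setT g.
  by apply: measurable_funB; exact: continuous_measurable_fun (@continuous_gauss_kernel _ _).
have iw : integrableR leb (weight t) by exact: integrable_weight.
have w0 s : 0 <= weight t s by exact: weight_ge0.
have mw : measurable_fun setT (weight t) by exact: measurable_weight.
have mp s : measurable_fun setT (path s) by apply: measurable_funB.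
have mj : measurable_fun (@setT (measurableTypeR R * Omega)) (fun z => path z.1 z.2).
  exact: measurable_fun_joint.
have mgp w : measurable_fun setT (fun s => g (path s w)).
  by apply: measurableT_comp => //; exact: continuous_measurable_fun (@continuous_path w).
have mgj : measurable_fun (@setT (measurableTypeR R * Omega)) (fun z => g (path z.1 z.2)).
  exact: measurableT_comp.
have igw w : integrableR leb (fun s => g (path s w) * weight t s).
  apply: (integrableR_dominated _ (integrableRZ Mg iw)); first by apply: measurable_funM; [exact: mgp|exact: mw].
  by move=> s; rewrite normrM (ger0_norm (w0 s)) ler_wpM2r.
have E1 w : alt eps w - alt eps' w = \int[leb]_s (g (path s w) * weight t s).
  have igk q : 0 < q -> integrableR leb (fun s => gauss_kernel q (path s w) * weight t s).
    move=> q0; apply: (integrableR_dominated _ (integrableRZ (Num.sqrt (2 * pi * q))^-1 iw)).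
      apply: measurable_funM => //; apply: measurableT_comp.
        exact: continuous_measurable_fun (@continuous_gauss_kernel _ _).
      exact: continuous_measurable_fun (@continuous_path w).
    move=> s; rewrite normrM (ger0_norm (w0 s)) ger0_norm ?gauss_kernel_ge0//.
    by rewrite ler_wpM2r// gauss_kernel_le.
  rewrite !approx_local_timeE -RintegralB//; [|exact: igk|exact: igk].
  by apply: eq_Rintegral => s _; rewrite /g mulrBl.
pose lebleb := sigma_finite_prod leb leb.
pose W (z : measurableTypeR R * measurableTypeR R) := weight t z.1 * weight t z.2.
have W0 z : 0 <= W z by exact: mulr_ge0.
have mW : measurable_fun setT W.
  apply: measurable_funM; have := mw; [exact: measurable_fst_comp|exact: measurable_snd_comp].
have iW : integrableR lebleb W by exact: integrableR_prod.
have Wout s r : ~~ ((0 <= s <= t) && (0 <= r <= t)) -> W (s, r) = 0.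
  rewrite /W /weight/= !indicE !mem_setE !in_itv/= negb_and => /orP[] /negbTE ->.
    by rewrite mulr0 mul0r.
  by rewrite !mulr0.
pose F (z : Omega * (measurableTypeR R * measurableTypeR R)) :=
  W z.2 * (g (path z.2.1 z.1) * g (path z.2.2 z.1)).
have F_le w z : `|F (w, z)| <= Mg ^+ 2 * W z.
  rewrite /F normrM (ger0_norm (W0 _)) mulrC ler_wpM2r// normrM expr2.
  by apply: ler_pM.
have mF : measurable_fun setT F.
  apply: measurable_funM; first by have := mW; exact: measurable_snd_comp.
  have m1 : measurable_fun setT (fun z : Omega * (measurableTypeR R * measurableTypeR R) => (z.2.1, z.1)).
    apply: measurable_fun_pair; last exact: measurable_fst.
    by apply: (measurableT_comp measurable_fst); exact: measurable_snd.
  have m2 : measurable_fun setT (fun z : Omega * (measurableTypeR R * measurableTypeR R) => (z.2.2, z.1)).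
    apply: measurable_fun_pair; last exact: measurable_fst.
    by apply: (measurableT_comp measurable_snd); exact: measurable_snd.
  by apply: measurable_funM; [exact: (measurableT_comp mgj m1)|exact: (measurableT_comp mgj m2)].
have mFw w : measurable_fun setT (fun z => F (w, z)) by exact: (measurableT_comp mF (measurable_pair1 w)).
have E2 w : (alt eps w - alt eps' w) ^+ 2 = \int[lebleb]_z F (w, z).
  rewrite E1 expr2; set I := \int[leb]_s _.
  rewrite (@Rintegral_prod _ _ _ _ _ leb leb (fun z => F (w, z)) (fun s => Mg ^+ 2 * weight t s) (weight t)) //.
  - rewrite -[X in _ * X]/I -RintegralZr//.
    apply: eq_Rintegral => s _; rewrite /I -RintegralZl//.
    by apply: eq_Rintegral => r _; rewrite /F /W/=; ring.
  - exact: integrableRZ.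
  - by move=> s r; rewrite -mulrA; exact: F_le.
pose Cv (z : measurableTypeR R * measurableTypeR R) := \int[P]_w (g (path z.1 w) * g (path z.2 w)).
have igg z : integrableR P (fun w => g (path z.1 w) * g (path z.2 w)).
  apply: (@integrableR_bounded _ _ _ _ _ (Mg * Mg)).
    by apply: measurable_funM; apply: measurableT_comp.
  by move=> w; rewrite normrM; apply: ler_pM.
have E3 : \int[P]_w (alt eps w - alt eps' w) ^+ 2 = \int[lebleb]_z (W z * Cv z).
  under eq_Rintegral do rewrite E2.
  rewrite (@Rintegral_fubini _ _ _ _ _ P lebleb F (fun=> Mg ^+ 2) W) //.
  - by apply: eq_Rintegral => z _; rewrite /F /Cv /= RintegralZl.
  - by apply: (@integrableR_bounded _ _ _ _ _ (Mg ^+ 2)) => // w; rewrite ger0_norm ?sqr_ge0.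
have mCv : measurable_fun setT Cv.
  (* A finite measure on the pairs of times, again a Dirac mass, makes the constant bound
     integrable. *)
  apply: (@measurable_Rintegral1 _ _ _ _ _ (\d_ (point : measurableTypeR R * measurableTypeR R))%E P
    (fun z : (measurableTypeR R * measurableTypeR R) * Omega => g (path z.1.1 z.2) * g (path z.1.2 z.2))
    (fun=> Mg) (fun=> Mg)).
  - have m1 : measurable_fun setT (fun z : (measurableTypeR R * measurableTypeR R) * Omega => (z.1.1, z.2)).
      apply: measurable_fun_pair; last exact: measurable_snd.
      by apply: (measurableT_comp measurable_fst); exact: measurable_fst.
    have m2 : measurable_fun setT (fun z : (measurableTypeR R * measurableTypeR R) * Omega => (z.1.2, z.2)).
      apply: measurable_fun_pair; last exact: measurable_snd.
      by apply: (measurableT_comp measurable_snd); exact: measurable_fst.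
    by apply: measurable_funM; [exact: (measurableT_comp mgj m1)|exact: (measurableT_comp mgj m2)].
  - by apply: (@integrableR_bounded _ _ _ _ _ Mg) => // z; rewrite ger0_norm.
  - by apply: (@integrableR_bounded _ _ _ _ _ Mg) => // w; rewrite ger0_norm.
  - by move=> z w; rewrite normrM; apply: ler_pM.
have CvM z : `|Cv z| <= Mg ^+ 2.
  have i1 : integrableR P (fun=> Mg ^+ 2).
    by apply: (@integrableR_bounded _ _ _ _ _ (Mg ^+ 2)) => // w; rewrite ger0_norm ?sqr_ge0.
  have h1 w : `|g (path z.1 w) * g (path z.2 w)| <= Mg ^+ 2.
    by rewrite normrM expr2; apply: ler_pM.
  apply: (le_trans (Rintegral_bound (integrableR_measurable (igg z)) i1 h1)).
  by rewrite Rintegral_prob_cst.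
have mH : measurable_fun setT (fun z => W z * Cv z) by exact: measurable_funM.
pose H1 z := W z * Cv z * \1_(@det_pos R Hu K) z.
have mH1 : measurable_fun setT H1.
  by apply: measurable_funM => //; apply: measurable_indic; exact: measurable_det_pos.
have H_le s r : `|W (s, r) * Cv (s, r)| <= Mg ^+ 2 * weight t s * weight t r.
  by rewrite normrM (ger0_norm (W0 _)) mulrC -mulrA ler_wpM2r.
have H1_le s r : `|H1 (s, r)| <= Mg ^+ 2 * weight t s * weight t r.
  rewrite /H1 normrM -[leRHS]mulr1; apply: ler_pM => //.
  by rewrite indicE; case: (_ \in _); rewrite ?normr1 ?normr0.
(* For fixed s in ]0, t] the determinant is positive in the square except at r = 0 and r = s, two
   points that [Rintegral_eq_off2] ignores; outside the square the weights vanish. *)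
have E4 : \int[lebleb]_z (W z * Cv z) = \int[lebleb]_z H1 z.
  have iM : integrableR leb (fun s => Mg ^+ 2 * weight t s) by exact: integrableRZ.
  rewrite (@Rintegral_prod _ _ _ _ _ leb leb _ _ _ mH iM iw H_le).
  rewrite (@Rintegral_prod _ _ _ _ _ leb leb _ _ _ mH1 iM iw H1_le).
  apply: (@Rintegral_eq_off2 _ _ _ 0 0).
  - exact: (@measurable_Rintegral1 _ _ _ _ _ leb leb _ _ _ mH iM iw H_le).
  - exact: (@measurable_Rintegral1 _ _ _ _ _ leb leb _ _ _ mH1 iM iw H1_le).
  move=> s s0 _; apply: (@Rintegral_eq_off2 _ _ _ 0 s).
  - exact: (measurableT_comp mH (measurable_pair1 s)).
  - exact: (measurableT_comp mH1 (measurable_pair1 s)).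
  move=> r rn0 rs; rewrite /H1.
  have [/andP[/andP[s1 _] /andP[r1 _]]|/Wout ->] := boolP ((0 <= s <= t) && (0 <= r <= t)); last first.
    by rewrite !mul0r.
  rewrite indicE (_ : (s, r) \in _ = true) ?mulr1//; apply/mem_set.
  rewrite /det_pos/=; apply: (cov_det_gt0 hH hK); rewrite ?lt_neqAle ?s1 ?r1 ?andbT 1?eq_sym//.
rewrite E3 E4.
have [h ih hb] := weighted_bound_le hH hK hHK hT ht.
apply: (le_trans (ler_norm _)); apply: Rintegral_bound => //.
- apply: (integrableR_dominated _ ih); first exact: measurable_weighted_bound.
  by move=> z; have /andP[h1 h2] := hb _ z eta0; rewrite ger0_norm.
- move=> [s r]; rewrite /weighted_bound /H1.
  have [/andP[hs hr]|/Wout E] := boolP ((0 <= s <= t) && (0 <= r <= t)); last first.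
    by rewrite E !mul0r normr0 -[X in _ <= X * _]/(W (s, r)) E mul0r.
  rewrite -mulrA normrM (ger0_norm (W0 _)) ler_wpM2l//.
  rewrite indicE; have [zD|_] := boolP (_ \in _); last by rewrite !mulr0 normr0.
  rewrite !mulr1; move: zD; rewrite inE /det_pos/= => D0.
  have tT : t <= T by case/andP: ht.
  have sub y : 0 <= y <= t -> 0 <= y <= T by move=> /andP[-> yt]; exact: le_trans tT.
  rewrite /Cv /path/= !clamp_id ?sub//.
  apply: (kernel_covariance_le hK hHK hT hB hV) => //; [exact: sub|exact: sub|].
  rewrite lt_neqAle; case/andP: hr => -> _; rewrite andbT; apply/eqP => r0.
  move: D0; rewrite -r0 /cov_det bif_cov0 ?powR0 ?mulr0 ?expr0n/= ?subrr ?ltxx//.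
    by rewrite gt_eqF// (lt_le_trans _ hHK).
  by case/andP: hs.
Qed.

End local_time.

(** * The Tanaka formula *)

Section tanaka.
Context {R : realType} {d : measure_display} {Omega : measurableType d}
  {P : probability Omega R} {Hu K T : R}.
Hypotheses (hH : 0 < Hu < 1) (hK : 0 < K <= 1) (hHK : 1 <= 2 * Hu * K) (hT : 0 < T).
Context {B : R -> {RV P >-> R}}.
Hypothesis hB : is_bifBm Hu K T B.
Context {V : completeNormedModType R} {ip : {dot V for idfun}} {e : R -> V}.
Hypothesis hV : is_completion Hu K T ip e.
Local Notation C := (@cov_const R Hu K T).
Local Notation leb := (@lebesgue_measure R).
Context (t x : R).
Hypothesis ht : 0 <= t <= T.
Let path s w : R := B (clamp T s) w - x.
Local Notation alt eps := (approx_local_time Hu K B t x eps).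
Local Notation events := (@process_events _ _ _ P T B).

Let T0 : 0 <= T. Proof. exact: ltW. Qed.

Let continuous_path w : continuous (path^~ w).
Proof.
have h1 : {within `[0, T], continuous (fun s => (B s w : R))} := @bifBm_continuous _ _ _ _ _ _ _ _ hB w.
have h2 := continuous_comp_clamp T0 h1.
by move=> s; exact: (cvgB (h2 s) (cvg_cst x)).
Qed.

(** The variance of [mollifier n], so that the same sequence serves the mollified absolute value and
    the local time. *)
Let eta n : R := (2 * n.+1%:R)^-1.

Let eta_gt0 n : 0 < eta n. Proof. by rewrite invr_gt0 mulr_gt0. Qed.

Let eta_mono m n : (m <= n)%N -> eta n <= eta m.
Proof. by move=> mn; rewrite lef_pV2 ?posrE ?mulr_gt0// ler_pM2l// ler_nat. Qed.

Let rho n := \int[(leb \x leb)%E]_z @weighted_bound R Hu K t (eta n) z.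

Let rho_cvg : rho n @[n --> \oo] --> 0.
Proof.
apply: (weighted_bound_cvg hH hK hHK hT ht) => [n|]; first exact: ltW.
rewrite (_ : eta = fun n => 2^-1 * n.+1%:R^-1); last by apply/funext => n; rewrite /eta invfM.
by rewrite -[X in _ --> X](mulr0 2^-1); apply: cvgMr; exact: cvg_harmonic.
Qed.

(** The Cauchy bound holds for all parameters below [eta n], so the limit along the sequence is the
    limit as the parameter tends to 0 from the right. The upper limit defining L keeps it measurable
    for the sigma-algebra of the process. *)
Lemma local_time_exists : exists L : Omega -> R,
  [/\ is_local_time Hu K B t x L, measurable_fun [set: g_sigma_algebraType events] L, sqint P L &
    \int[P]_w (alt (eta n) w - L w) ^+ 2 @[n --> \oo] --> 0].
Proof.
have hcau n a b : 0 < a <= eta n -> 0 < b <= eta n ->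
    \int[P]_w (alt a w - alt b w) ^+ 2 <= rho n.
  by move=> ha hb; exact: (approx_local_time_cauchy hH hK hHK hT hB hV _ ht ha hb).
have sal a : 0 < a -> sqint P (alt a).
  by move=> a0; exact: (sqint_approx_local_time hHK hT hB _ ht a0).
have [phi] := @cauchy_L2_limit R d Omega P (fun a => alt a) eta rho eta_gt0 eta_mono sal rho_cvg hcau.
set L := fun w => _; move=> [sL hL]; exists L; split => //.
- split; first exact: sqint_Lfun.
  have E a : 0 < a -> L2_dist P (alt a) L = (Num.sqrt (\int[P]_w (alt a w - L w) ^+ 2))%:E.
    by move=> a0; apply: Lnorm2E; exact: (sqintB (sal a a0) sL).
  have pos : \forall a \near (0 : R)^'+, 0 < a by exact: nbhs_right_gt.
  apply/fine_cvgP; split; first by apply: filterS pos => a a0; rewrite E.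
  apply/cvgr0Pnorm_le => c c0.
  have c20 : 0 < c ^+ 2 by rewrite exprn_gt0.
  have [n _ hn] : \forall n \near \oo, `|rho n| <= c ^+ 2 by move/cvgr0Pnorm_le : rho_cvg => /(_ _ c20).
  have small : \forall a \near (0 : R)^'+, a <= eta n by exact: nbhs_right_le.
  apply: filterS2 pos small => a a0 an.
  rewrite /= E//= ger0_norm ?sqrtr_ge0// -[leRHS](ger0_norm (ltW c0)) -sqrtr_sqr ler_wsqrtr//.
  apply: le_trans (hn n (leqnn n)); apply: le_trans (ler_norm _); apply: hL.
  by rewrite a0.
- have mk k : measurable_fun [set: g_sigma_algebraType events] (fun w => (alt (eta (phi k)) w)%:E).
    by apply/measurable_EFinP; exact: (measurable_approx_local_time hHK hT hB x ht).
  apply: measurableT_comp (measurable_fun_limn_esup mk).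
  exact: fine_measurable.
- apply/cvgr0Pnorm_le => c c0.
  move/cvgr0Pnorm_le : rho_cvg => /(_ _ c0); apply: filterS => n; apply: le_trans.
  rewrite ger0_norm; last by apply: Rintegral_ge0 => w _; exact: sqr_ge0.
  by apply: le_trans (ler_norm _); apply: hL; rewrite eta_gt0 lexx.
Qed.

Let CT0 : 0 <= 9 * (C * T).
Proof. by rewrite mulr_ge0// mulr_ge0 ?cov_const_ge0. Qed.

(** The vectors are chosen path by path; they are measurable in w nevertheless, as limits of grid
    sums with measurable coefficients and fixed vectors. *)
Lemma sign_vectors : exists u_ : nat -> Omega -> V, exists2 u : Omega -> V,
  (forall w, L2_element T e (fun s => Num.sg (B s w - x) * \1_`]0, t]%classic s) (u w)) &
  [/\ forall n w, grid_sum e t N (path_coef t (mollified_sg n) (path^~ w) N) @[N --> \oo] --> u_ n w,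
    forall w, u_ n w @[n --> \oo] --> u w,
    (forall n w, `|u_ n w| ^+ 2 <= 9 * (C * T)) /\ (forall w, `|u w| ^+ 2 <= 9 * (C * T)),
    (forall n, ball_measurable (u_ n)) & ball_measurable u].
Proof.
have H w := sign_path_cvg hH hK hHK hT hV ht (@continuous_path w).
pose u_ n w : V := sval (cid (H w)) n.
have H2 w : exists2 u : V, L2_element T e (fun s => Num.sg (path s w) * \1_`]0, t]%classic s) u &
    [/\ forall n, grid_sum e t N (path_coef t (mollified_sg n) (path^~ w) N) @[N --> \oo] --> u_ n w,
        u_ n w @[n --> \oo] --> u, forall n, `|u_ n w| ^+ 2 <= 9 * (C * T) & `|u| ^+ 2 <= 9 * (C * T)].
  exact: svalP (cid (H w)).
pose u w : V := s2val (cid2 (H2 w)).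
have uL w := s2valP (cid2 (H2 w)).
have uP w := s2valP' (cid2 (H2 w)).
exists u_, u.
  move=> w; have := uL w; rewrite -/(u w); congr (L2_element _ _ _ _).
  apply/funext => s; rewrite indicE mem_setE in_itv/=.
  have [/andP[s0 st]|_] := boolP (0 < s <= t); last by rewrite !mulr0.
  by rewrite /path clamp_id// (ltW s0) (le_trans st)//; case/andP: ht.
have cvu n w : grid_sum e t N (path_coef t (mollified_sg n) (path^~ w) N) @[N --> \oo] --> u_ n w.
  by have [] := uP w.
have cvuu w : u_ n w @[n --> \oo] --> u w by have [] := uP w.
have mu n : ball_measurable (u_ n).
  apply: (ball_measurable_cvg _ (cvu n)) => N.
  apply: (ball_measurable_sum hV) => k.
  have mS s : measurable_fun setT (fun w => mollified_sg n (path s w)).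
    apply: measurableT_comp; last by apply: measurable_funB.
    apply: continuous_measurable_fun => y; apply/differentiable_continuous/derivable1_diffP.
    by have [] := is_derive_mollified_sg n y.
  by apply: measurable_funM => //; exact: measurable_funD.
split => //.
- by split => [n w|w]; have [] := uP w.
- exact: (ball_measurable_cvg mu cvuu).
Qed.

(** Polarization expresses the inner product through the squared distances of [ball_measurable]. *)
Lemma measurable_ip (u : Omega -> V) (v : V) : ball_measurable u ->
  measurable_fun setT (fun w => ip v (u w)).
Proof.
move=> mu.
rewrite (_ : (fun w => _) = fun w => 2^-1 * (`|u w - 0| ^+ 2 + `|v| ^+ 2 - `|u w - v| ^+ 2)).
  apply: measurable_funM => //; apply: measurable_funB; last exact: mu.
  by apply: measurable_funD => //; exact: mu.
apply/funext => w; rewrite !(norm_sqr (completion_norm hV)) subr0 ipBl !ipBr (ipC ip (u w) v).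
by field.
Qed.

Let path_t w : path t w = B t w - x.
Proof. by rewrite /path clamp_id. Qed.

Let path_0 w : path 0 w = - x.
Proof. by rewrite /path clamp_id ?lexx// (bifBm_0 hB) sub0r. Qed.

Let sqint_path : sqint P (path t).
Proof.
have tI : t \in `[0, T] by rewrite in_itv.
have [sB _] := bifBm_sqint hB tI.
have sx : sqint P (fun=> x) by apply: (@sqint_bounded _ _ _ P _ `|x|).
by rewrite (funext path_t); exact: sqintB.
Qed.

(** [weak_ito] with the mollification removed: dominated convergence handles the sign vectors, by
    their uniform norm bound, and the absolute values; Cauchy-Schwarz handles the local time, which
    converges in L^2 only. *)
Lemma tanaka_duality (u_ : nat -> Omega -> V) (u : Omega -> V) (L : Omega -> R) n
    (h : 'I_n -> V) (X : 'I_n -> Omega -> R) (g : 'rV[R]_n -> R) (M M' : R) :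
  (forall m w, grid_sum e t N (path_coef t (mollified_sg m) (path^~ w) N) @[N --> \oo] --> u_ m w) ->
  (forall w, u_ m w @[m --> \oo] --> u w) -> (forall m w, `|u_ m w| ^+ 2 <= 9 * (C * T)) ->
  (forall m, ball_measurable (u_ m)) -> sqint P L -> \int[P]_w (alt (eta m) w - L w) ^+ 2 @[m --> \oo] --> 0 ->
  (forall i, isonormal T B e (h i) (X i)) -> continuous g ->
  (forall y i, derivable g y (delta_mx 0 i)) -> (forall i, continuous (partial i g)) ->
  (forall y, `|g y| <= M) -> (forall i y, `|partial i g y| <= M') ->
  \int[P]_w \sum_i partial i g (\row_i X i w) * ip (h i) (u w) =
  \int[P]_w (g (\row_i X i w) * (`|B t w - x| - `|x| - L w)).
Proof.
move=> cvu cvuu ub mu_ sL cL hX cg dg cdg gM dgM.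
pose G w := g (\row_i X i w); pose dG i w := partial i g (\row_i X i w).
have mX i : measurable_fun setT (X i) by have [] := isonormal_sqint hB hV (hX i).
have mG : measurable_fun setT G by exact: measurable_continuous_row.
have mdG i : measurable_fun setT (dG i) by exact: measurable_continuous_row.
have M0 : 0 <= M := le_trans (normr_ge0 _) (gM 0).
have sG : sqint P G by apply: (@sqint_bounded _ _ _ P _ M) => // w; exact: gM.
have sal m : sqint P (alt (eta m)) by exact: (sqint_approx_local_time hHK hT hB _ ht).
have ito m := weak_ito hH hK hHK hT hB hV hX cg dg cdg gM dgM ht (cvu m).
have c1 : \int[P]_w \sum_i dG i w * ip (h i) (u_ m w) @[m --> \oo] -->
    \int[P]_w \sum_i dG i w * ip (h i) (u w).
  apply: (@Rintegral_dominated_cvg _ _ _ _ _ _ (fun=> \sum_i M' * (`|h i| * Num.sqrt (9 * (C * T))))).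
  - move=> m; apply: measurable_sum => i; apply: measurable_funM => //.
    exact: measurable_ip.
  - move=> w; apply: cvgR_sum => i; apply: cvgMr.
    rewrite ipC; under eq_fun do rewrite ipC.
    by apply: (cvg_ipl (completion_norm hV)); exact: cvuu.
  - apply: (@integrableR_bounded _ _ _ _ _ (`|\sum_i M' * (`|h i| * Num.sqrt (9 * (C * T)))|)) => //.
  - move=> m w; apply: (le_trans (ler_norm_sum _ _ _)); apply: ler_sum => i _.
    rewrite normrM; apply: ler_pM => //; first exact: dgM.
    apply: (le_trans (ip_norm_le (completion_norm hV) _ _)); rewrite ler_wpM2l//.
    by rewrite -[leLHS]ger0_norm// -sqrtr_sqr ler_wsqrtr.
have c2 : \int[P]_w (G w * (mollified_norm m (path t w) - mollified_norm m (path 0 w))) @[m --> \oo] -->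
    \int[P]_w (G w * (`|path t w| - `|path 0 w|)).
  apply: (@Rintegral_dominated_cvg _ _ _ _ _ _ (fun w => M * (`|path t w| + (1 + (`|x| + 1))))).
  - move=> m; have mf s : measurable_fun setT (fun w => mollified_norm m (path s w)).
      apply: measurableT_comp; last by apply: measurable_funB.
      apply: continuous_measurable_fun => y; apply/differentiable_continuous/derivable1_diffP.
      by have [] := is_derive_mollified_norm m y.
    by apply: measurable_funM => //; exact: measurable_funB.
  - by move=> w; apply: cvgMr; apply: cvgB; exact: mollified_norm_cvg.
  - apply: integrableRZ; apply: integrableRD.
      by apply: integrableR_norm; apply: sqint_integrable; exact: sqint_path.
    by apply: (@integrableR_bounded _ _ _ _ _ (1 + (`|x| + 1))) => // w; rewrite ger0_norm// !addr_ge0.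
  - move=> m w; rewrite normrM; apply: ler_pM => //; first exact: gM.
    apply: (le_trans (ler_normB _ _)); rewrite addrA.
    apply: lerD; first exact: mollified_norm_le.
    by apply: (le_trans (mollified_norm_le _ _)); rewrite path_0 normrN.
have c3 : \int[P]_w (G w * alt (eta m) w) @[m --> \oo] --> \int[P]_w (G w * L w).
  have sD m : sqint P (fun w => alt (eta m) w - L w) by exact: sqintB.
  have bnd m : `|\int[P]_w (G w * L w) - \int[P]_w (G w * alt (eta m) w)| <=
      Num.sqrt (\int[P]_w G w ^+ 2) * Num.sqrt (\int[P]_w (alt (eta m) w - L w) ^+ 2).
    rewrite distrC -RintegralB//; [|exact: sqint_mul|exact: sqint_mul].
    under eq_Rintegral do rewrite -mulrBr.
    exact: Rintegral_cauchy.
  apply/cvgrPdist_le => c c0.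
  have z : Num.sqrt (\int[P]_w G w ^+ 2) * Num.sqrt (\int[P]_w (alt (eta m) w - L w) ^+ 2) @[m --> \oo] --> (0 : R).
    rewrite -[X in _ --> X](mulr0 (Num.sqrt (\int[P]_w G w ^+ 2))); apply: cvgMr.
    rewrite -(sqrtr0 R); apply: (@continuous_cvg_seq _ _ (@Num.sqrt R)); first exact: sqrt_continuous.
    exact: cL.
  move/cvgr0Pnorm_le : z => /(_ _ c0); apply: filterS => m hm.
  by apply: (le_trans (bnd m)); apply: le_trans hm; exact: ler_norm.
have E : \int[P]_w \sum_i dG i w * ip (h i) (u w) =
    \int[P]_w (G w * (`|path t w| - `|path 0 w|)) - \int[P]_w (G w * L w).
  have c4 := cvgB c2 c3.
  apply: (cvg_unique _ c1); first exact: Rhausdorff.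
  rewrite (_ : (fun m => _) = (fun m => \int[P]_w (G w * (mollified_norm m (path t w) - mollified_norm m (path 0 w))) -
    \int[P]_w (G w * alt (eta m) w))); first exact: c4.
  by apply/funext => m; exact: ito.
rewrite E -RintegralB//.
- apply: eq_Rintegral => w _; rewrite path_t path_0 normrN -/(G w).
  by rewrite -mulrBr.
- apply: sqint_mul => //; apply: sqintB.
    split; first by apply: measurableT_comp => //; have [] := sqint_path.
    by under eq_fun do rewrite real_normK ?num_real//; have [] := sqint_path.
  apply: (@sqint_bounded _ _ _ P _ `|x|) => [|w]; last by rewrite path_0 normrN normr_id.
  rewrite (_ : (fun w => _) = fun=> `|x|)//; apply/funext => w; by rewrite path_0 normrN.
- exact: sqint_mul.
Qed.

End tanaka.

Local Notation sfun F := (@sf_fun _ _ _ _ _ _ _ _ F).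
Local Notation sdir F := (@sf_dir _ _ _ _ _ _ _ _ F).
Local Notation srv F := (@sf_rv _ _ _ _ _ _ _ _ F).

Theorem theorem2 (R : realType) (d : measure_display)
    (Omega : measurableType d) (P : probability Omega R)
    (Hu K T : R) (hH : 0 < Hu < 1) (hK : 0 < K <= 1) (hHK : 1 <= 2 * Hu * K)
    (hT : 0 < T)
    (B : R -> {RV P >-> R}) (hB : is_bifBm Hu K T B)
    (V : completeNormedModType R) (ip : {dot V for idfun}) (e : R -> V)
    (hV : is_completion Hu K T ip e)
    (t x : R) (ht : t \in `[0, T]) :
  exists delta L : Omega -> R,
    [/\ skorohod_integral T B ip e t (fun s w => Num.sg (B s w - x)) delta,
        is_local_time Hu K B t x L &
        {ae P, forall w, `|B t w - x| = `|x| + delta w + L w}].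
Proof.
have ht' : 0 <= t <= T by move: ht; rewrite in_itv.
have [L [lL mL sL cL]] := local_time_exists hH hK hHK hT hB hV x ht'.
have [u_ [u uE [cvu cvuu [ub_ ub] mu_ mu]]] := sign_vectors hH hK hHK hT hB hV x ht'.
(* With this choice the identity holds for every w; the work lies in showing that [delta] is the
   divergence. *)
pose delta w := `|B t w - x| - `|x| - L w.
have [sB _] := bifBm_sqint hB ht.
have sBx : sqint P (fun w => `|B t w - x|).
  have sx : sqint P (fun=> x) by apply: (@sqint_bounded _ _ _ P _ `|x|).
  have [m1 i1] := sqintB sB sx.
  split; first exact: measurableT_comp.
  by under eq_fun do rewrite real_normK ?num_real//.
have sdelta : sqint P delta.
  apply: sqintB => //; apply: sqintB => //.
  by apply: (@sqint_bounded _ _ _ P _ `|x|) => // w; rewrite normr_id.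
have sm (F : smooth_functional T B e) : smooth_bounded (sfun F) by exact: sf_smooth.
have sw (F : smooth_functional T B e) i : wiener_integral T B e (sdir F i) (srv F i).
  exact: sf_wiener.
have hX (F : smooth_functional T B e) i : isonormal T B e (sdir F i) (srv F i).
  exact: (wiener_integral_isonormal (sw F i)).
have cg (F : smooth_functional T B e) : continuous (sfun F) by have [] := sm F [::].
have dg (F : smooth_functional T B e) y i : derivable (sfun F) y (delta_mx 0 i).
  by have [_ h _] := sm F [::]; exact: h.
have cdg (F : smooth_functional T B e) i : continuous (partial i (sfun F)).
  by have [] := sm F [:: i].
have gM (F : smooth_functional T B e) : exists M, forall y, `|sfun F y| <= M.
  by have [] := sm F [::].
have dgM (F : smooth_functional T B e) : exists M', forall i y, `|partial i (sfun F) y| <= M'.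
  have h i : exists M, forall y, `|partial i (sfun F) y| <= M by have [] := sm F [:: i].
  exists (\sum_i `|sval (cid (h i))|) => i y.
  apply: (le_trans (svalP (cid (h i)) y)); rewrite (bigD1 i)//=.
  by apply: (le_trans (ler_norm _)); rewrite lerDl sumr_ge0.
have mX (F : smooth_functional T B e) i : measurable_fun setT (srv F i) by [].
have sF (F : smooth_functional T B e) : sqint P (sf_val F).
  have [M hM] := gM F; apply: (@sqint_bounded _ _ _ P _ M) => [|w]; last exact: hM.
  exact: measurable_continuous_row.
have ipE (F : smooth_functional T B e) w : ip (malliavin F w) (u w) =
    \sum_i partial i (sfun F) (\row_i srv F i w) * ip (sdir F i) (u w).
  by rewrite /malliavin ip_suml; apply: eq_bigr => i _; rewrite ipZl.
have dual (F : smooth_functional T B e) :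
    \int[P]_w ip (malliavin F w) (u w) = \int[P]_w (sf_val F w * delta w).
  have [[M hM] [M' hM']] := (gM F, dgM F).
  under eq_Rintegral do rewrite ipE.
  exact: (tanaka_duality hH hK hHK hT hB hV ht' cvu cvuu ub_ mu_ sL cL (hX F) (cg F) (dg F) (cdg F) hM hM').
have iip (F : smooth_functional T B e) : integrableR P (fun w => ip (malliavin F w) (u w)).
  have [M' hM'] := dgM F; under eq_fun do rewrite ipE.
  apply: integrableR_sum => i.
  apply: (@integrableR_bounded _ _ _ _ _ (M' * (`|sdir F i| * Num.sqrt (9 * (@cov_const R Hu K T * T))))).
    apply: measurable_funM; last exact: (measurable_ip hV _ mu).
    exact: (measurable_continuous_row (cdg F i) (mX F)).
  move=> w; rewrite normrM; apply: ler_pM => //.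
  apply: (le_trans (ip_norm_le (completion_norm hV) _ _)); rewrite ler_wpM2l//.
  by rewrite -[leLHS]ger0_norm// -sqrtr_sqr ler_wsqrtr.
have Edual (F : smooth_functional T B e) :
    ('E_P[fun w => ip (malliavin F w) (u w)] = (\int[P]_w (sf_val F w * delta w))%:E)%E.
  by rewrite unlock -dual EFin_Rintegral.
exists delta, L; split => //; last first.
  by apply: aeW => w; rewrite /delta; ring.
exists u => //; split.
- split.
    split; first exact: (ball_measurable_open hH hK hHK hT hV mu).
    have mu2 : measurable_fun setT (fun w => `|u w| ^+ 2).
      by have := mu 0; under eq_fun do rewrite subr0.
    have iu : integrableR P (fun w => `|u w| ^+ 2).
      by apply: (@integrableR_bounded _ _ _ _ _ (9 * (@cov_const R Hu K T * T))) => // w; rewrite ger0_norm ?sqr_ge0.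
    exact: (integrable_lty measurableT iu).
  (* The duality relation and Cauchy-Schwarz give the domain condition with the L^2 norm of [delta]
     as constant. *)
  exists (Num.sqrt (\int[P]_w delta w ^+ 2)) => F.
  rewrite Edual (Lnorm2E (sF F)) -EFinM lee_fin mulrC.
  exact: Rintegral_cauchy.
- apply: (measurable_process_events (f := delta) _).2.
  have mBt : measurable_fun [set: g_sigma_algebraType (@process_events _ _ _ P T B)] (B t).
    move=> _ A mA; rewrite setTI; apply: sub_sigma_algebra.
    by exists t => //; exists A.
  apply: measurable_funB => //; apply: measurable_funB => //.
  by apply: measurableT_comp => //; exact: measurable_funB.
- exact: sqint_Lfun.
- by move=> F; rewrite Edual unlock EFin_Rintegral//; exact: sqint_mul.
Qed.
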